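(* Let $l$ be any prime number. There exist injective maps $\Theta_3: \textup{Iso}_{L\textup{-series}}(\check{G}_{K}[l], \check{G}_{K'}[l]) \to \textup{Iso}_{\mathcal{P}}(\check{G}_{K}[l], \check{G}_{K'}[l])$, $\Theta_2: \textup{Iso}_{\mathcal{P}}(\check{G}_{K}[l], \check{G}_{K'}[l]) \to \textup{Iso}_{L\textup{-series}}(\check{G}_{K}[l], \check{G}_{K'}[l])$, $\Theta_1: \textup{Iso}_{\mathcal{P}}(\check{G}_{K}[l], \check{G}_{K'}[l]) \to \textup{Iso}^\delta_{\mathcal{P}}(\check{G}_{K}[l], \check{G}_{K'}[l])$, $\Theta_4: \textup{Iso}(K, K') \to \textup{Iso}_{\mathcal{P}}(\check{G}_{K}[l], \check{G}_{K'}[l])$ and $\Theta_5: \textup{Iso}^\delta_{\mathcal{P}}(\check{G}_{K}[l], \check{G}_{K'}[l]) \to \textup{Iso}(K, K')$ such that $\Theta_2$ and $\Theta_3$ are mutual inverses, and $\Theta_1 \circ \Theta_4$ and $\Theta_5$ are mutual inverses. As a result, the sets of isomorphisms are all in bijection.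
   Context: $K, K'$ are number fields. $\check{G}_{K}[l]$ is the subgroup of the group of Dirichlet characters (continuous homomorphisms $G_K \to \mathbb{C}^\times$) generated by characters of order $l$; for a prime $\mathfrak p$, $\chi(\mathfrak p)$ is the value at Frobenius if $\mathfrak p$ is unramified in $K_\chi/K$ and $0$ otherwise. $\textup{Iso}(K,K')$ is the set of field isomorphisms. $\textup{Iso}_{L\textup{-series}}(\check{G}_{K}[l], \check{G}_{K'}[l])$ is the set of isomorphisms $\psi: \check{G}_{K}[l] \xrightarrow{\sim} \check{G}_{K'}[l]$ with $L(\chi,s)=L(\psi(\chi),s)$ for all $\chi$. $\textup{Iso}_{\mathcal{P}}(\check{G}_{K}[l], \check{G}_{K'}[l])$ is the set of isomorphisms $\psi$ for which there is a norm-preserving bijection $\phi:\mathcal P_K\to\mathcal P_{K'}$ of primes with $\chi(\mathfrak p)=\psi(\chi)(\phi(\mathfrak p))$ for all $\chi\in\check{G}_{K}[l]$, $\mathfrak p\in\mathcal P_K$. $\textup{Iso}^\delta_{\mathcal{P}}(\check{G}_{K}[l], \check{G}_{K'}[l])$ is the set of isomorphisms $\psi$ for which there is a set $\mathcal S\subseteq\mathcal P_K$ of Dirichlet density one and an injective norm-preserving map $\phi:\mathcal S\to\mathcal P_{K'}$ with $\chi(\mathfrak p)=\psi(\chi)(\phi(\mathfrak p))$ for all $\mathfrak p\in\mathcal S$, $\chi\in\check{G}_{K}[l]$. *)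

(* Defs.v *)
From HB Require Import structures.
From mathcomp Require Import all_boot all_order all_algebra all_field.
From mathcomp Require Import finmap complex ring.
From mathcomp Require Import all_classical all_reals all_analysis.

Set Implicit Arguments.
Unset Strict Implicit.
Unset Printing Implicit Defensive.

Import Order.TTheory GRing.Theory Num.Theory.
Import numFieldNormedType.Exports.

Local Open Scope classical_set_scope.
Local Open Scope ring_scope.

(* Rings of integers and their prime ideals are attached to a subfield L of an
   ambient field F, so that one definition serves both for a number field
   (L = setT) and for the intermediate fields of an algebraic closure. *)
Definition int_ring (F : fieldType) (L : set F) : set F :=
  [set x | L x /\ integralOver (intr : int -> F) x].

Definition is_ideal (F : fieldType) (L I : set F) : Prop :=
  [/\ I `<=` int_ring L, I 0, (forall x y, I x -> I y -> I (x + y)) &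
      (forall a x, int_ring L a -> I x -> I (a * x))].

Definition is_prime (F : fieldType) (L P : set F) : Prop :=
  [/\ is_ideal L P, ~ P 1, (exists2 x, P x & x != 0) &
      (forall x y, int_ring L x -> int_ring L y -> P (x * y) -> P x \/ P y)].

Definition ideal_mul (F : fieldType) (I J : set F) : set F :=
  [set x | exists n (a b : 'I_n -> F),
    (forall i, I (a i) /\ J (b i)) /\ x = \sum_(i < n) a i * b i].

Definition ideal_exp (F : fieldType) (L I : set F) (n : nat) : set F :=
  iter n (ideal_mul I) (int_ring L).

Definition primes_of (K : fieldType) : set (set K) :=
  [set P | is_prime setT P].
Arguments primes_of K : clear implicits.

(* The cardinality of the set of cosets x + P with x integral. *)
Definition prime_norm (K : fieldType) (P : primes_of K) : nat :=
  #|` fset_set [set [set x + y | y in val P] | x in int_ring [set: K]]|.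

Record alg_closure (K : fieldType) := AlgClosure {
  ac_field :> closedFieldType;
  ac_emb : {rmorphism K -> ac_field};
  ac_alg : forall x : ac_field, algebraicOver ac_emb x }.

Record absgal (K : fieldType) (Kbar : alg_closure K) := AbsGal {
  gal_fun :> {rmorphism Kbar -> Kbar};
  gal_bij : bijective gal_fun;
  gal_fix : forall x : K, gal_fun (ac_emb Kbar x) = ac_emb Kbar x }.

Section AbsGalGroup.
Context (K : fieldType) (Kbar : alg_closure K).
Implicit Types s t u : absgal Kbar.

Lemma absgal_eq s t : s =1 t -> s = t.
Proof.
case: s t => [[f cf] bf ff] [[g cg] bg fg] /= /funext efg.
case: g / efg cg bg fg => cg bg fg.
have ec : cf = cg.
  case: cf cg {bf ff bg fg} => [[a] [b]] [[a'] [b']].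
  by rewrite (Prop_irrelevance a a') (Prop_irrelevance b b').
case: cg / ec bg fg => bg fg.
by congr AbsGal; exact: Prop_irrelevance.
Qed.

HB.instance Definition _ := gen_eqMixin (absgal Kbar).
HB.instance Definition _ := gen_choiceMixin (absgal Kbar).

Definition absgal_one : absgal Kbar :=
  @AbsGal K Kbar idfun (Bijective (fun=> erefl) (fun=> erefl)) (fun=> erefl).

Lemma absgal_mul_fix s t x : (s \o t) (ac_emb Kbar x) = ac_emb Kbar x.
Proof. by rewrite /= !gal_fix. Qed.

Definition absgal_mul s t : absgal Kbar :=
  @AbsGal K Kbar (s \o t) (bij_comp (gal_bij s) (gal_bij t))
    (absgal_mul_fix s t).

Definition absgal_invf s (y : Kbar) : Kbar := xget 0 [set x | s x = y].

Lemma absgal_invfK s : cancel (absgal_invf s) s.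
Proof.
move=> y; rewrite /absgal_invf; case: xgetP => [x _ //|].
by have [g _ gK] := gal_bij s => /(_ (g y)) []; rewrite /= gK.
Qed.

Lemma absgal_funK s : cancel s (absgal_invf s).
Proof. by move=> x; apply: (bij_inj (gal_bij s)); rewrite absgal_invfK. Qed.

HB.instance Definition _ s := GRing.isZmodMorphism.Build Kbar Kbar
  (absgal_invf s) (can2_zmod_morphism (absgal_funK s) (absgal_invfK s)).
HB.instance Definition _ s := GRing.isMonoidMorphism.Build Kbar Kbar
  (absgal_invf s) (can2_monoid_morphism (absgal_funK s) (absgal_invfK s)).

Lemma absgal_inv_fix s x : absgal_invf s (ac_emb Kbar x) = ac_emb Kbar x.
Proof. by rewrite -[in LHS](gal_fix s) absgal_funK. Qed.

Definition absgal_inv s : absgal Kbar :=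
  @AbsGal K Kbar (absgal_invf s)
    (Bijective (absgal_invfK s) (absgal_funK s)) (absgal_inv_fix s).

Lemma absgal_mulA : associative absgal_mul.
Proof. by move=> s t u; apply: absgal_eq. Qed.
Lemma absgal_mul1g : left_id absgal_one absgal_mul.
Proof. by move=> s; apply: absgal_eq. Qed.
Lemma absgal_mulg1 : right_id absgal_one absgal_mul.
Proof. by move=> s; apply: absgal_eq. Qed.
Lemma absgal_mulVg : left_inverse absgal_one absgal_inv absgal_mul.
Proof. by move=> s; apply: absgal_eq; exact: absgal_funK. Qed.
Lemma absgal_mulgV : right_inverse absgal_one absgal_inv absgal_mul.
Proof. by move=> s; apply: absgal_eq; exact: absgal_invfK. Qed.

HB.instance Definition _ := isGroup.Build (absgal Kbar)
  absgal_mulA absgal_mul1g absgal_mulg1 absgal_mulVg absgal_mulgV.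

End AbsGalGroup.

(* Continuity is for the Krull topology on the Galois group: the sets of all t
   agreeing with s on a finite subset of Kbar form a neighbourhood basis of s. *)
Record dirichlet_char (R : realType) (K : fieldType) (Kbar : alg_closure K) :=
  DirichletChar {
  dc_fun :> absgal Kbar -> R[i];
  dc_neq0 : forall s, dc_fun s != 0;
  dc_mulM : forall s t, dc_fun (s * t)%g = dc_fun s * dc_fun t;
  dc_cont : forall (s : absgal Kbar) (e : R[i]), 0 < e ->
    exists S : seq Kbar, forall t : absgal Kbar,
      {in S, t =1 s} -> `|dc_fun t - dc_fun s| < e }.

Lemma mulf_cont (F : numFieldType) (a b e : F) : 0 < e ->
  exists2 d, 0 < d & forall x y, `|x - a| < d -> `|y - b| < d ->
    `|x * y - a * b| < e.
Proof.
move=> e0; pose c := 1 + `|a| + `|b|.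
have c0 : 0 < c by rewrite /c -addrA ltr_pwDl // addr_ge0.
have ec0 : 0 < e + c by rewrite addr_gt0.
have d1 : e / (e + c) < 1 by rewrite ltr_pdivrMr // mul1r ltrDl.
have dc : e / (e + c) * c < e.
  by rewrite mulrAC ltr_pdivrMr // ltr_pM2l // ltrDr.
exists (e / (e + c)) => [|x y]; first by rewrite divr_gt0.
move: (e / (e + c)) dc d1 => d dc d1 xd yd.
have -> : x * y - a * b = (x - a) * (y - b) + a * (y - b) + (x - a) * b.
  by ring.
apply: le_lt_trans dc; rewrite /c [leRHS]mulrDr.
apply: le_trans (ler_normD _ _) _; apply: lerD; last first.
  by rewrite normrM ler_wpM2r // ltW.
rewrite [leRHS]mulrDr mulr1; apply: le_trans (ler_normD _ _) _; apply: lerD.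
  rewrite normrM -[leRHS]mulr1; apply: ler_pM => //; first exact: ltW.
  by apply/ltW/(lt_trans yd).
by rewrite normrM mulrC ler_wpM2r // ltW.
Qed.

Section DirichletCharGroup.
Context (R : realType) (K : fieldType) (Kbar : alg_closure K).
Local Notation dchar := (dirichlet_char R Kbar).
Implicit Types x y z : dchar.

Lemma dchar_eq x y : x =1 y -> x = y.
Proof.
case: x y => [f a b c] [g a' b' c'] /= /funext efg.
by case: g / efg a' b' c' => a' b' c'; congr DirichletChar;
  exact: Prop_irrelevance.
Qed.

HB.instance Definition _ := gen_eqMixin dchar.
HB.instance Definition _ := gen_choiceMixin dchar.

Lemma dchar1 x : x 1%g = 1.
Proof.
by apply: (mulfI (dc_neq0 x 1%g)); rewrite mulr1 -dc_mulM mul1g.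
Qed.

Lemma dcharV x s : x s^-1%g = (x s)^-1.
Proof.
by apply: (mulfI (dc_neq0 x s)); rewrite -dc_mulM mulgV dchar1 divff ?dc_neq0.
Qed.

Lemma dchar_one_mulM (s t : absgal Kbar) : (1 : R[i]) = 1 * 1.
Proof. by rewrite mulr1. Qed.

Lemma dchar_one_cont (s : absgal Kbar) (e : R[i]) : 0 < e ->
  exists S : seq Kbar, forall t : absgal Kbar,
    {in S, t =1 s} -> `|(1 : R[i]) - 1| < e.
Proof. by move=> e0; exists [::] => t _; rewrite subrr normr0. Qed.

Definition dchar_one : dchar :=
  @DirichletChar R K Kbar (fun=> 1) (fun=> oner_neq0 _)
    dchar_one_mulM dchar_one_cont.

Lemma dchar_mul_neq0 x y s : x s * y s != 0.
Proof. by rewrite mulf_neq0 ?dc_neq0. Qed.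

Lemma dchar_mul_mulM x y s t :
  x (s * t)%g * y (s * t)%g = x s * y s * (x t * y t).
Proof. by rewrite !dc_mulM mulrACA. Qed.

Lemma dchar_mul_cont x y (s : absgal Kbar) (e : R[i]) : 0 < e ->
  exists S : seq Kbar, forall t : absgal Kbar,
    {in S, t =1 s} -> `|x t * y t - x s * y s| < e.
Proof.
move=> e0; have [d d0 dP] := mulf_cont (x s) (y s) e0.
have [S1 HS1] := dc_cont x s d0; have [S2 HS2] := dc_cont y s d0.
exists (S1 ++ S2) => t tS; apply: dP.
- by apply: HS1 => u uS; apply: tS; rewrite mem_cat uS.
- by apply: HS2 => u uS; apply: tS; rewrite mem_cat uS orbT.
Qed.

Definition dchar_mul x y : dchar :=
  @DirichletChar R K Kbar (fun s => x s * y s) (dchar_mul_neq0 x y)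
    (dchar_mul_mulM x y) (dchar_mul_cont x y).

Lemma dchar_inv_neq0 x s : (x s)^-1 != 0.
Proof. by rewrite invr_neq0 ?dc_neq0. Qed.

Lemma dchar_inv_mulM x s t : (x (s * t)%g)^-1 = (x s)^-1 * (x t)^-1.
Proof. by rewrite dc_mulM invfM. Qed.

Lemma dchar_inv_cont x (s : absgal Kbar) (e : R[i]) : 0 < e ->
  exists S : seq Kbar, forall t : absgal Kbar,
    {in S, t =1 s} -> `|(x t)^-1 - (x s)^-1| < e.
Proof.
move=> e0; have [S HS] := dc_cont x s^-1%g e0.
exists (map (s^-1)%g S) => t tS; rewrite -!dcharV.
apply: HS => u uS; have /tS := map_f (s^-1)%g uS.
rewrite [in RHS]/= absgal_invfK => tu.
by rewrite -[in LHS]tu; exact: absgal_funK.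
Qed.

Definition dchar_inv x : dchar :=
  @DirichletChar R K Kbar (fun s => (x s)^-1) (dchar_inv_neq0 x)
    (dchar_inv_mulM x) (dchar_inv_cont x).

Lemma dchar_mulA : associative dchar_mul.
Proof. by move=> x y z; apply: dchar_eq => s /=; rewrite mulrA. Qed.
Lemma dchar_mul1g : left_id dchar_one dchar_mul.
Proof. by move=> x; apply: dchar_eq => s /=; rewrite mul1r. Qed.
Lemma dchar_mulg1 : right_id dchar_one dchar_mul.
Proof. by move=> x; apply: dchar_eq => s /=; rewrite mulr1. Qed.
Lemma dchar_mulVg : left_inverse dchar_one dchar_inv dchar_mul.
Proof. by move=> x; apply: dchar_eq => s /=; rewrite mulVf ?dc_neq0. Qed.
Lemma dchar_mulgV : right_inverse dchar_one dchar_inv dchar_mul.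
Proof. by move=> x; apply: dchar_eq => s /=; rewrite mulfV ?dc_neq0. Qed.

HB.instance Definition _ := isGroup.Build dchar
  dchar_mulA dchar_mul1g dchar_mulg1 dchar_mulVg dchar_mulgV.

End DirichletCharGroup.

Definition has_order (G : groupType) (x : G) (n : nat) : Prop :=
  [/\ (0 < n)%N, (x ^+ n)%g = 1%g &
      forall m, (0 < m < n)%N -> (x ^+ m)%g <> 1%g].

Definition is_subgroup (G : groupType) (H : set G) : Prop :=
  H 1%g /\ forall x y, H x -> H y -> H (x / y)%g.

Definition lchar_pred (R : realType) (K : fieldType) (Kbar : alg_closure K)
    (l : nat) : {pred dirichlet_char R Kbar} :=
  fun x => `[< smallest (@is_subgroup (dirichlet_char R Kbar))
                 [set y | has_order y l] x >].
Arguments lchar_pred R {K} Kbar l.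

Record lchar (R : realType) (K : fieldType) (Kbar : alg_closure K) (l : nat) :=
  LChar { lchar_val :> dirichlet_char R Kbar;
          lcharP : lchar_val \in lchar_pred R Kbar l }.

Section LCharGroup.
Context (R : realType) (K : fieldType) (Kbar : alg_closure K) (l : nat).
Local Notation P := (lchar_pred R Kbar l).

Lemma lchar_pred1 : 1%g \in P.
Proof. by apply/asboolP => H [[]]. Qed.

Lemma lchar_predF x y : x \in P -> y \in P -> (x / y)%g \in P.
Proof.
move=> /asboolP Px /asboolP Py; apply/asboolP => H HP.
by case: (HP) => -[_ HF] _; apply: HF; [exact: Px | exact: Py].
Qed.

Lemma lchar_predV : invg_closed P.
Proof. by move=> x /(lchar_predF lchar_pred1); rewrite div1g. Qed.

Lemma lchar_predM : mulg_closed P.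
Proof.
by move=> x y Px /lchar_predV Py; have := lchar_predF Px Py; rewrite invgK.
Qed.

HB.instance Definition _ := isMulClosed.Build _ P lchar_predM.
HB.instance Definition _ := isMul1Closed.Build _ P lchar_pred1.
HB.instance Definition _ := isInvClosed.Build _ P lchar_predV.

HB.instance Definition _ := [isSub for @lchar_val R K Kbar l].
HB.instance Definition _ := [Choice of lchar R Kbar l by <:].
HB.instance Definition _ :=
  SubChoice_isSubGroup.Build _ _ (lchar R Kbar l)
    (conj lchar_pred1 lchar_predF).
End LCharGroup.

Section CharValues.
Context (R : realType) (K : fieldType) (Kbar : alg_closure K).
Implicit Types (x : dirichlet_char R Kbar) (p : primes_of K) (L Q : set Kbar).

(* The fixed field of the kernel of x. *)
Definition char_field x : set Kbar :=
  [set z | forall s : absgal Kbar, x s = 1 -> s z = z].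

Definition lies_above L p Q : Prop :=
  is_prime L Q /\ ac_emb Kbar @^-1` Q = val p.

(* e is the exponent of Q in the factorization of p O_L. *)
Definition ramification_index L p Q (e : nat) : Prop :=
  forall n, ideal_mul (ac_emb Kbar @` val p) (int_ring L)
              `<=` ideal_exp L Q n <-> (n <= e)%N.

Definition unramified L p : Prop :=
  forall Q, lies_above L p Q -> ramification_index L p Q 1.

(* s restricts on L to the Frobenius automorphism of some prime above p. *)
Definition is_frobenius L p (s : absgal Kbar) : Prop :=
  exists2 Q, lies_above L p Q &
    forall z, int_ring L z -> Q (s z - z ^+ prime_norm p).

(* When p is unramified in the abelian extension char_field x of K, any two
   choices of s differ by an element of the kernel of x. *)
Definition char_at x p : R[i] :=
  if `[< unramified (char_field x) p >]
  then x (xget 1%g [set s | is_frobenius (char_field x) p s])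
  else 0.

End CharValues.

(* n ^ (- s) = exp (- s * ln n). *)
Definition nat_cpow_opp (R : realType) (n : nat) (s : R[i]) : R[i] :=
  let z := - s * (ln n%:R)%:C%C in
  (expR (complex.Re z))%:C%C * (cos (complex.Im z) +i* sin (complex.Im z))%C.

(* The Euler product, ordered by the norms of the primes; it converges
   absolutely for 1 < Re s. *)
Definition Lseries (R : realType) (K : fieldType) (Kbar : alg_closure K)
    (x : dirichlet_char R Kbar) (s : R[i]) : R[i]^o :=
  lim ((fun n : nat => \big[*%R/1]_(p \in [set p : primes_of K |
                                             (prime_norm p <= n)%N])
          (1 - char_at x p * nat_cpow_opp (prime_norm p) s)^-1 : R[i]^o)
       @ \oo).

Definition prime_zeta (R : realType) (K : fieldType) (S : set (primes_of K))
    (s : R) : R :=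
  fine (\esum_(p in S) ((prime_norm p)%:R `^ (- s))%:E)%E.

Definition dirichlet_density (R : realType) (K : fieldType)
    (S : set (primes_of K)) (d : R) : Prop :=
  prime_zeta S s / prime_zeta [set: primes_of K] s @[s --> 1^'+] --> d.

Definition field_iso (K K' : fieldType) : Type :=
  {f : {rmorphism K -> K'} | bijective f}.

Record lchar_iso (R : realType) (K K' : fieldType) (Kbar : alg_closure K)
    (Kbar' : alg_closure K') (l : nat) := LCharIso {
  lci_fun :> {multiplicative lchar R Kbar l -> lchar R Kbar' l};
  lci_bij : bijective lci_fun }.

Section Isos.
Context (R : realType) (K K' : fieldType).
Context (Kbar : alg_closure K) (Kbar' : alg_closure K') (l : nat).

Definition iso_Lseries : Type :=
  {psi : lchar_iso R Kbar Kbar' l |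
    forall (x : lchar R Kbar l) (s : R[i]), 1 < complex.Re s ->
      Lseries x s = Lseries (psi x) s}.

Definition iso_primes : Type :=
  {psi : lchar_iso R Kbar Kbar' l |
    exists phi : primes_of K -> primes_of K',
      [/\ bijective phi, (forall p, prime_norm (phi p) = prime_norm p) &
          forall (x : lchar R Kbar l) p,
            char_at x p = char_at (psi x) (phi p)]}.

Definition iso_primes_density : Type :=
  {psi : lchar_iso R Kbar Kbar' l |
    exists (S : set (primes_of K)) (phi : S -> primes_of K'),
      [/\ dirichlet_density S (1 : R), injective phi,
          (forall p : S, prime_norm (phi p) = prime_norm (val p)) &
          forall (p : S) (x : lchar R Kbar l),
            char_at x (val p) = char_at (psi x) (phi p)]}.

End Isos.

(* Main.v *)
Require Import Defs.
From HB Require Import structures.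
From mathcomp Require Import all_boot all_order all_algebra all_field.
From mathcomp Require Import finmap complex ring lra zify.
From mathcomp Require Import all_classical all_reals all_analysis.

Set Implicit Arguments.
Unset Strict Implicit.
Unset Printing Implicit Defensive.

Import Order.TTheory GRing.Theory Num.Theory.
Import numFieldNormedType.Exports.

Local Open Scope classical_set_scope.
Local Open Scope ring_scope.

(* Every element of the three sets of isomorphisms psi is shown to come from a
   field isomorphism, without Chebotarev's theorem or Dedekind theory.

   All fields are placed in one algebraic closure of Q, with Galois group GG,
   and primes are replaced by places, i.e. prime ideals of the ring of all
   algebraic integers.  For an algebraic integer t with conjugate polynomial f,
   counting elements of Z[t] by their norms gives
   sum_p #(roots of f mod p) p^-s = ln (1/(s-1)) + O(1)  as s -> 1+.

   Equality of L-series at integers s >= 3 gives, by uniqueness of Dirichlet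
   coefficients, sum_(N P = p) x(P) = sum_(N P' = p) (psi x)(P'), hence by
   orthogonality every prime P of degree 1 has, for a given finite set Z of
   characters, a partner P' with x(P) = (psi x)(P') for x in Z, as is the case
   by assumption for the density isomorphisms.  For g in GG / G_K' let
   V_g = G_K /\ g G_K' g^-1 and let U_g(Z) be the h in V_g with
   x(h) = (psi x)(g^-1 h g) for x in Z.  The Frobenius of P lies in some U_g(Z),
   so the asymptotics give 1 <= sum_g 1/[V_g : U_g(Z)].  Hence some index stays
   bounded as Z grows.  Characters obtained from Kummer theory and the transfer
   show that then G_K = g G_K' g^-1 and that g is unique; all other indices
   being unbounded, [V_g : U_g(Z)] = 1 for this g, so psi is induced by g.

   Conversely a field isomorphism preserves x(P) at every P because the value of
   x at a Frobenius element is well defined when P is unramified. *)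

(** * Extension of embeddings to algebraic closures *)

(** A pair (p, r) with p | f(r) is a prime of degree one of Z[t], and a finite set of pairs is a
    squarefree ideal. A pigeonhole puts a small element into every such ideal and bounds their
    number from above; a sieve for elements of squarefree norm bounds it from below. Bounds up to
    constant factors suffice, since the logarithm of the Euler product turns them into O(1). The
    index [V_g : U_g(Z)] enters because U_g(Z) is normal in V_g: a prime whose Frobenius lies in
    U_g(Z) gives that many roots modulo p of the conjugate polynomial of a generator of its fixed
    field. Characters must separate elements inside arbitrarily small open subgroups. They come from
    an element c - t whose norm is divisible exactly once by a prime q: the valuation at q keeps the
    relevant l-th roots out of Q(t). The value x(P) refers to an arbitrarily chosen Frobenius
    element. At large primes of degree one a discriminant settles the choice; at the other
    unramified primes, those above l included, an element acting trivially modulo a place must be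
    shown to fix the field of x. *)

Lemma Zorn_above (T : Type) (P : set (set T)) (A0 : set T) : P A0 ->
  (forall F : set (set T), F `<=` P -> F !=set0 -> total_on F subset ->
    P (\bigcup_(X in F) X)) ->
  exists A, [/\ P A, A0 `<=` A & forall B, A `<=` B -> P B -> B `<=` A].
Proof.
move=> PA0 Pch; pose P' A := A = set0 \/ (A0 `<=` A /\ P A).
(* [Zorn_bigcup] also asks about the empty chain, whose union is empty, so [P'] admits [set0].
   Should [set0] come out maximal, then [A0] is itself empty and serves. *)
have [|A [P'A Amax]] := @Zorn_bigcup T P'.
  move=> F FP Ftot; pose F' := F `&` [set A | A0 `<=` A /\ P A].
  have [[X F'X]|F'0] := pselect (F' !=set0); last first.
    left; rewrite -subset0 => x [X FX Xx].
    case: (FP _ FX) => [X0|X1]; first by rewrite X0 in Xx.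
    by apply: F'0; exists X.
  have -> : \bigcup_(X in F) X = \bigcup_(X in F') X.
    apply/seteqP; split=> x [Y FY Yx]; last by exists Y => //; case: FY.
    exists Y => //; split=> //; case: (FP _ FY) => // Y0.
    by rewrite Y0 in Yx.
  right; split; first by move=> x A0x; exists X => //; exact: F'X.2.1.
  apply: Pch; [by move=> Y [_ []]|by exists X|].
  by move=> Y Z [FY _] [FZ _]; exact: Ftot.
have Amax' B : A `<=` B -> P' B -> B `<=` A.
  move=> AB P'B; have [//|nBA] := pselect (B `<=` A).
  exfalso; exact: (Amax B _ P'B).
case: P'A => [A_0|[A0A PA]]; last first.
  exists A; split=> // B AB PB; apply: Amax' => //; right; split=> //.
  exact: subset_trans AB.
have A0A : A0 `<=` A.
  by apply: Amax'; [rewrite A_0; exact: sub0set|right; split].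
exists A0; split=> // B A0B PB; apply: (@subset_trans _ A); last by rewrite A_0.
apply: Amax'; first (by rewrite A_0); by right; split.
Qed.

Section SubFieldType.
Context (E : fieldType) (D : {pred E}) (closedD : divring_closed D).

(** The closure proof is an argument so that the algebraic structure can be inferred from the
    predicate alone. *)
Definition divring_pred (_ : divring_closed D) : {pred E} := D.
Local Notation D' := (divring_pred closedD).
HB.instance Definition _ := GRing.isDivringClosed.Build E D' closedD.

Record dsub := DSub { dval : E; dvalP : dval \in D' }.
HB.instance Definition _ := [isSub for dval].
HB.instance Definition _ := [Choice of dsub by <:].
HB.instance Definition _ := [SubChoice_isSubIntegralDomain of dsub by <:].
HB.instance Definition _ := [SubIntegralDomain_isSubField of dsub by <:].
End SubFieldType.

(** Take an annihilating polynomial of least size: the remainder of another annihilator modulo it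
    would be smaller. *)
Lemma ann_poly (F : fieldType) (E : fieldType) (i : {rmorphism F -> E}) x :
  algebraicOver i x ->
  exists m : {poly F}, [/\ m != 0, irreducible_poly m &
    forall P, root (map_poly i P) x = (m %| P)%R].
Proof.
move=> ax; pose Q n := `[< exists p : {poly F},
  [/\ p != 0, root (map_poly i p) x & size p = n] >].
have exQ : exists n, Q n by case: ax => p p0 rp; exists (size p); apply/asboolP; exists p.
case: (ex_minnP exQ) => n /asboolP [m [m0 rm sm]] nmin.
have mP P : root (map_poly i P) x = (m %| P).
  apply/idP/idP => [rP|/dvdpP [q ->]]; last first.
    by rewrite rmorphM /= rootM rm orbT.
  rewrite /dvdp; apply/negPn/negP => r0.
  have : Q (size (P %% m)).
    apply/asboolP; exists (P %% m); split=> //.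
    have := rP; rewrite {1}(divp_eq P m) rmorphD rmorphM /= !rootE !hornerE.
    by rewrite (eqP rm) mulr0 add0r.
  by move/nmin; rewrite -sm leqNgt ltn_modp m0.
exists m; split=> //; split.
  rewrite ltnNge; apply/negP => /size1_polyC mc.
  move: rm; rewrite mc map_polyC rootE hornerC fmorph_eq0 => /eqP c0.
  by rewrite mc c0 polyC0 eqxx in m0.
move=> q sq qm; rewrite /eqp qm /=; have /dvdpP [r mE] := qm.
have : root (map_poly i m) x by [].
rewrite mE rmorphM /= rootM => /orP [|]; rewrite mP -mE => //.
have q0 : q != 0 by apply: contra_neq m0 => q0; rewrite mE q0 mulr0.
have r0 : r != 0 by apply: contra_neq m0 => r0; rewrite mE r0 mul0r.
move=> /dvdp_leq -/(_ r0); rewrite mE size_mul //.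
have : (0 < size q)%N by rewrite size_poly_gt0.
case: (size q) sq => [//|[//|k]] _ _; rewrite addnS /=.
by rewrite addnS ltnNge leq_addr.
Qed.

Section Graphs.
Context (E1 : fieldType) (E2 : closedFieldType).
Implicit Types (G : set (E1 * E2)).

(** The graph of a homomorphism from a subfield of [E1]; the last clause, applied to differences,
    makes it single-valued. With graphs the upper bound of a chain in Zorn's lemma is a plain
    union. *)
Definition field_graph G : Prop :=
  [/\ G (1, 1),
      (forall a b c d, G (a, b) -> G (c, d) -> G (a - c, b - d)),
      (forall a b c d, G (a, b) -> G (c, d) -> G (a * c, b * d)),
      (forall a b, G (a, b) -> G (a^-1, b^-1)) &
      (forall b, G (0, b) -> b = 0)].

Lemma field_graph_fun G a b c : field_graph G -> G (a, b) -> G (a, c) -> b = c.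
Proof.
move=> [_ GB _ _ G0] Gb Gc; apply/eqP; rewrite -subr_eq0; apply/eqP/G0.
by rewrite -(subrr a); exact: GB.
Qed.

Section Adjoin.
Context (F : fieldType) (i1 : {rmorphism F -> E1}) (i2 : {rmorphism F -> E2}).

(** The isomorphism F(x) -> F(y) sending x to y, written on fractions. It is well defined as soon as
    x and y are roots of the same polynomials over F. *)
Definition adjoin_graph x y : set (E1 * E2) := [set u | exists P Q : {poly F},
  ~~ root (map_poly i1 Q) x /\
  u = ((map_poly i1 P).[x] / (map_poly i1 Q).[x],
       (map_poly i2 P).[y] / (map_poly i2 Q).[y])].

Lemma adjoin_graphP x y :
  (forall P, root (map_poly i1 P) x = root (map_poly i2 P) y) ->
  [/\ field_graph (adjoin_graph x y), adjoin_graph x y (x, y) &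
      forall a, adjoin_graph x y (i1 a, i2 a)].
Proof.
move=> rxy; have r1 : ~~ root (map_poly i1 1) x.
  by rewrite rmorph1 rootE hornerE oner_eq0.
have GP P : adjoin_graph x y ((map_poly i1 P).[x], (map_poly i2 P).[y]).
  by exists P, 1; split=> //; rewrite !rmorph1 !hornerE !divr1.
split; first split.
- by have := GP 1; rewrite !rmorph1 !hornerE.
- move=> _ _ _ _ [P [Q [rQ [-> ->]]]] [P' [Q' [rQ' [-> ->]]]].
  exists (P * Q' - P' * Q), (Q * Q'); rewrite !rmorphB !rmorphM /= !hornerE.
  rewrite rootM negb_or rQ rQ'; split=> //.
  move: (rQ) (rQ'); rewrite !rxy !rootE => h1 h2.
  rewrite !rootE in rQ rQ'.
  by congr (_, _); field; rewrite ?rQ ?rQ' ?h1 ?h2.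
- move=> _ _ _ _ [P [Q [rQ [-> ->]]]] [P' [Q' [rQ' [-> ->]]]].
  exists (P * P'), (Q * Q'); rewrite !rmorphM /= !hornerM.
  rewrite rootM negb_or rQ rQ'; split=> //.
  by congr (_, _); rewrite invfM mulrACA.
- move=> _ _ [P [Q [rQ [-> ->]]]]; have [rP|rP] := boolP (root (map_poly i1 P) x).
    exists 0, 1; split=> //; rewrite !rmorph1 !rmorph0 !hornerE ?mul0r.
    move: (rP); rewrite rxy; move/eqP: rP => -> /eqP ->.
    by rewrite ?mul0r ?invr0 ?mul0r.
  by exists Q, P; rewrite !invf_div.
- move=> b [P [Q [rQ [/esym/eqP P0 ->]]]].
  move: P0; rewrite mulf_eq0 invr_eq0 -!rootE (negPf rQ) orbF rxy => /eqP ->.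
  by rewrite mul0r.
- by have := GP 'X; rewrite !map_polyX !hornerE.
- by move=> a; have := GP a%:P; rewrite !map_polyC !hornerE.
Qed.
End Adjoin.

(** The domain of [G] becomes a field type; the minimal polynomial of x over it is carried to [E2],
    where it has a root y. By irreducibility x and y are roots of the same polynomials. *)
Lemma field_graph_ext G x : field_graph G ->
  (forall (D : {pred E1}) (hD : divring_closed D), (forall a b, G (a, b) -> a \in D) ->
     algebraicOver (val : dsub hD -> E1) x) ->
  exists G', [/\ field_graph G', G `<=` G' & exists y, G' (x, y)].
Proof.
move=> gG; case: (gG) => G1 GB GM GV G0 xalg.
pose D : {pred E1} := fun a => `[< exists b, G (a, b) >].
have DP a : reflect (exists b, G (a, b)) (a \in D) by exact: asboolP.
have hD : divring_closed D.
  split; first by apply/DP; exists 1.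
  - by move=> a c /DP [b ab] /DP [d cd]; apply/DP; exists (b - d); exact: GB.
  - move=> a c /DP [b ab] /DP [d cd]; apply/DP; exists (b * d^-1).
    by apply: GM => //; exact: GV.
pose F := dsub hD; pose i1 : F -> E1 := val.
have exi2 (a : F) : exists b, G (val a, b) by have /DP := dvalP a.
have [i2 i2P] := boolp.choice exi2.
have i2u a b : G (val a, b) -> i2 a = b by apply: field_graph_fun.
have i2B : zmod_morphism i2.
  by move=> a b; apply: i2u; apply: GB; exact: i2P.
have i2M : monoid_morphism i2.
  split; first exact: i2u.
  by move=> a b; apply: i2u; apply: GM; exact: i2P.
pose i2mB := GRing.isZmodMorphism.Build _ _ i2 i2B.
pose i2mM := GRing.isMonoidMorphism.Build _ _ i2 i2M.
pose i2r : {rmorphism F -> E2} := HB.pack i2 i2mB i2mM.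
have GD a b : G (a, b) -> a \in D by move=> Gab; apply/DP; exists b.
have [m [m0 irm mP]] := ann_poly (xalg D hD GD).
have [y ry] : exists y, root (map_poly i2r m) y.
  apply/closed_rootP; rewrite size_map_poly neq_ltn; apply/orP; right.
  by case: irm.
have rxy P : root (map_poly (val : {rmorphism F -> E1}) P) x = root (map_poly i2r P) y.
  rewrite mP; apply/idP/idP => [/dvdpP [q ->]|rP].
    by rewrite rmorphM /= rootM ry orbT.
  apply/negPn/negP => nmP.
  have : coprimep m P by rewrite irreducible_poly_coprime.
  move/(@Bezout_eq1_coprimepP _ m P) => [[u v] /= uv].
  have /(congr1 (fun p => (map_poly i2r p).[y])) := uv.
  rewrite rmorphD !rmorphM rmorph1 /= !hornerE (eqP ry) (eqP rP) !mulr0 addr0.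
  by move/eqP; rewrite eq_sym oner_eq0.
have [gA Axy Ab] := adjoin_graphP rxy.
exists (adjoin_graph (val : {rmorphism F -> E1}) i2r x y); split=> //; last by exists y.
move=> [a b] Gab; pose a' : F := @DSub _ _ hD _ (GD _ _ Gab).
by have := Ab a'; rewrite /= (i2u a' b).
Qed.

Lemma field_graph_total (F : fieldType) (i1 : {rmorphism F -> E1}) G :
  (forall x, algebraicOver i1 x) -> field_graph G ->
  (forall a, exists b, G (i1 a, b)) ->
  exists f : {rmorphism E1 -> E2}, forall a b, G (a, b) -> f a = b.
Proof.
move=> alg gG Gi.
have [|G' [gG' GG' Gmax]] := @Zorn_above _ field_graph G gG.
  move=> Fs FP [X0 FX0] Ftot.
  have two X Y : Fs X -> Fs Y -> exists Z, [/\ Fs Z, X `<=` Z & Y `<=` Z].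
    by move=> FX FY; have [XY|YX] := Ftot _ _ FX FY; [exists Y; split|exists X; split].
  split.
  - by exists X0 => //; case: (FP _ FX0).
  - move=> a b c d [X FX Xab] [Y FY Ycd]; have [Z [FZ XZ YZ]] := two X Y FX FY.
    by exists Z => //; case: (FP _ FZ) => _ ZB _ _ _; apply: ZB; [exact: XZ|exact: YZ].
  - move=> a b c d [X FX Xab] [Y FY Ycd]; have [Z [FZ XZ YZ]] := two X Y FX FY.
    by exists Z => //; case: (FP _ FZ) => _ _ ZM _ _; apply: ZM; [exact: XZ|exact: YZ].
  - by move=> a b [X FX Xab]; exists X => //; case: (FP _ FX) => _ _ _ XV _; apply: XV.
  - by move=> b [X FX X0b]; case: (FP _ FX) => _ _ _ _; apply.
have tot x : exists y, G' (x, y).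
  have [|G2 [gG2 G'G2 [y G2xy]]] := @field_graph_ext G' x gG'; last first.
    by exists y; exact: (Gmax G2).
  move=> D hD GD; have iD a : i1 a \in D.
    by have [b Gab] := Gi a; apply: (GD _ b); exact: GG'.
  have [p p0 rp] := alg x.
  pose q := map_poly (fun a => @DSub _ _ hD _ (iD a)) p.
  have qE : map_poly (val : dsub hD -> E1) q = map_poly i1 p.
    apply/polyP => k; rewrite coef_map /= coef_map_id0 ?coef_map //.
    by apply: val_inj; rewrite /= rmorph0.
  exists q; last by rewrite qE.
  by rewrite -(map_poly_eq0 (val : {rmorphism dsub hD -> E1})) qE map_poly_eq0.
have [f fP] := boolp.choice tot.
have fu a b : G' (a, b) -> f a = b by apply: field_graph_fun.
case: gG' => G1 GB GM GV G0.
have fB : zmod_morphism f by move=> a b; apply: fu; exact: GB.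
have fM : monoid_morphism f.
  by split; [exact: fu|move=> a b; apply: fu; exact: GM].
pose fmB := GRing.isZmodMorphism.Build _ _ f fB.
pose fmM := GRing.isMonoidMorphism.Build _ _ f fM.
pose fr : {rmorphism E1 -> E2} := HB.pack f fmB fmM.
exists fr => a b Gab; exact: fu (GG' _ Gab).
Qed.
End Graphs.

Lemma closure_hom (F E1 : fieldType) (E2 : closedFieldType)
    (i1 : {rmorphism F -> E1}) (i2 : {rmorphism F -> E2}) :
  (forall x, algebraicOver i1 x) ->
  exists f : {rmorphism E1 -> E2}, forall a, f (i1 a) = i2 a.
Proof.
move=> alg.
(* Adjoining 0 adjoins nothing: the graph obtained is that of [i1 a] to [i2 a]. *)
have rxy P : root (map_poly i1 P) (i1 0) = root (map_poly i2 P) (i2 0).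
  by rewrite !rootE !horner_map !fmorph_eq0.
have [gA _ Ai] := adjoin_graphP rxy.
have [|f fP] := field_graph_total alg gA; first by move=> a; exists (i2 a).
by exists f => a; apply: fP.
Qed.

Lemma closure_hom_adjoin (F E1 : fieldType) (E2 : closedFieldType)
    (i1 : {rmorphism F -> E1}) (i2 : {rmorphism F -> E2}) x y :
  (forall x, algebraicOver i1 x) ->
  (forall P, root (map_poly i1 P) x = root (map_poly i2 P) y) ->
  exists f : {rmorphism E1 -> E2}, (forall a, f (i1 a) = i2 a) /\ f x = y.
Proof.
move=> alg rxy; have [gA Axy Ai] := adjoin_graphP rxy.
have [|f fP] := field_graph_total alg gA; first by move=> a; exists (i2 a).
by exists f; split=> [a|]; apply: fP.
Qed.

(** A polynomial over F already splits in [E1], and f carries its roots there to all its roots in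
    [E2]. *)
Lemma closure_hom_bij (F : fieldType) (E1 E2 : closedFieldType)
    (i1 : {rmorphism F -> E1}) (i2 : {rmorphism F -> E2})
    (f : {rmorphism E1 -> E2}) :
  (forall a, f (i1 a) = i2 a) -> (forall y, algebraicOver i2 y) -> bijective f.
Proof.
move=> fi alg; have surj y : exists x, f x = y.
  have [p p0 rp] := alg y.
  have [s sE] := closed_field_poly_normal (map_poly i1 p).
  have : root (map_poly f (map_poly i1 p)) y.
    by rewrite -map_poly_comp (eq_map_poly (g := i2)).
  rewrite sE map_polyZ rmorph_prod /= rootZ; last first.
    by rewrite fmorph_eq0 lead_coef_eq0 map_poly_eq0.
  rewrite rootE horner_prod prodf_seq_eq0 => /hasP [z zs].
  rewrite /= rmorphB /= map_polyX map_polyC hornerXsubC subr_eq0 => /eqP ->.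
  by exists z.
have [g gP] := boolp.choice surj.
by exists g => // x; apply: (fmorph_inj f); rewrite gP.
Qed.

(** * Algebraic integers and the Galois group of Q *)

Lemma aint_rmorph (E E' : fieldType) (f : {rmorphism E -> E'}) x :
  integralOver (intr : int -> E) x -> integralOver (intr : int -> E') (f x).
Proof.
move=> [p pm rp]; exists p => //.
have -> : map_poly (intr : int -> E') p = map_poly f (map_poly intr p).
  by rewrite -map_poly_comp; apply: eq_map_poly => k /=; rewrite rmorph_int.
by rewrite rootE horner_map (eqP rp) rmorph0.
Qed.

Lemma integral_rat_int (E : fieldType) (f : {rmorphism rat -> E}) (q : rat) :
  integralOver (intr : int -> E) (f q) -> exists m : int, q = m%:~R.
Proof.
move=> [p pm rp].
have rq : root (map_poly (intr : int -> rat) p) q.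
  rewrite -(fmorph_root f) -map_poly_comp.
  by rewrite (eq_map_poly (g := intr)) // => k /=; rewrite rmorph_int.
have aq : (ratr q : algC) \in Aint.
  apply: (@root_monic_Aint (map_poly (intr : int -> algC) p)).
  - move: rq; rewrite -(fmorph_root (ratr : {rmorphism rat -> algC})) -map_poly_comp.
    by rewrite (eq_map_poly (g := intr)) // => k /=; rewrite rmorph_int.
  - by rewrite monic_map.
  - by apply/polyOverP => k; rewrite coef_map /=; exact: intr_int.
have : (ratr q : algC) \in Num.int by apply: Cint_rat_Aint => //; exact: Crat_rat.
move/intrP => [m mE]; exists m; move/eqP: mE.
by rewrite -(ratr_int _ m) (inj_eq (fmorph_inj _)) => /eqP.
Qed.

(** Every root of the minimal polynomial of x is a Galois conjugate, hence equal to x. In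
    characteristic 0 a multiple root would also be a root of the nonzero derivative, so the degree
    is 1. *)
Lemma gal_fixed (K : fieldType) (Kb : alg_closure K) (x : Kb) :
  [pchar K] =i pred0 -> (forall g : absgal Kb, g x = x) ->
  exists a, x = ac_emb Kb a.
Proof.
move=> pK fx; set e := ac_emb Kb; have [m [m0 irm mP]] := ann_poly (ac_alg x).
have [s sE] := closed_field_poly_normal (map_poly e m).
have rm : root (map_poly e m) x by rewrite mP.
have l0 : lead_coef (map_poly e m) != 0 by rewrite lead_coef_eq0 map_poly_eq0.
have sx y : y \in s -> y = x.
  move=> ys; have ry : root (map_poly e m) y.
    by rewrite sE rootZ // root_prod_XsubC.
  have [P|f [fe fxy]] := @closure_hom_adjoin _ _ _ e e x y (@ac_alg _ Kb).
    rewrite mP; apply/idP/idP => [/dvdpP [q ->]|rP].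
      by rewrite rmorphM /= rootM ry orbT.
    apply/negPn/negP => nmP.
    have : coprimep m P by rewrite irreducible_poly_coprime.
    move/(@Bezout_eq1_coprimepP _ m P) => [[u v] /= uv].
    have /(congr1 (fun p => (map_poly e p).[y])) := uv.
    rewrite rmorphD !rmorphM rmorph1 /= !hornerE (eqP ry) (eqP rP) !mulr0 addr0.
    by move/eqP; rewrite eq_sym oner_eq0.
  have bf := closure_hom_bij fe (@ac_alg _ Kb).
  by rewrite -fxy; have := fx (AbsGal bf fe).
have sN : s = nseq (size s) x.
  by apply/all_pred1P/allP => y /sx ->; rewrite /= eqxx.
have sm : size m = (size s).+1.
  have := congr1 (fun p : {poly Kb} => size p) sE.
  by rewrite size_map_poly size_scale // size_prod_XsubC.
case: (ltnP 1 (size s)) => s1; last first.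
  have m1 : m`_1 != 0.
    have : lead_coef m != 0 by rewrite lead_coef_eq0.
    rewrite lead_coefE sm /=; case: irm; rewrite sm => + _.
    by case: (size s) s1 => [|[|]].
  exists (- m`_0 / m`_1).
  have : (map_poly e m).[x] = 0 by exact/eqP.
  have sm2 : size m = 2%N.
    by move: sm s1; case: irm => + _; case: (size s) (size m) => [|[|?]] [|[|[|?]]].
  rewrite horner_coef size_map_poly sm2 big_ord_recl big_ord1 /= !coef_map /=.
  rewrite expr0 mulr1 expr1 => /eqP; rewrite addr_eq0 => /eqP E.
  rewrite rmorphM rmorphN /= fmorphV E opprK mulrAC divff ?mul1r //.
  by rewrite fmorph_eq0.
have dm0 : m^`() != 0.
  have c0 : (m^`())`_(size s).-1 != 0.
    rewrite coef_deriv prednK ?(ltnW s1) //.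
    have : lead_coef m != 0 by rewrite lead_coef_eq0.
    rewrite lead_coefE sm /= => ml; rewrite -mulr_natr mulf_neq0 //.
    by move/pcharf0P: pK => ->; rewrite -lt0n (ltnW s1).
  by apply: contraNneq c0 => ->; rewrite coef0.
have : root (map_poly e m^`()) x.
  rewrite -deriv_map sE sN big_nseq iter_mulr_1 rootE derivZ hornerZ deriv_exp.
  rewrite hornerMn hornerM horner_exp hornerXsubC subrr expr0n.
  have -> : ((size s).-1 == 0)%N = false.
    by apply/negbTE; rewrite -lt0n -subn1 subn_gt0.
  by rewrite mulr0 mul0rn mulr0.
rewrite mP => /dvdp_leq -/(_ dm0).
by rewrite leqNgt lt_size_deriv.
Qed.

Section GaloisIntegers.
Context (Qb : alg_closure rat).
Local Notation Om := (ac_field Qb).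
Local Notation gal := (absgal Qb).
Implicit Types (g h : gal) (x y z t : Om).

Definition aint x : Prop := integralOver (intr : int -> Om) x.

Lemma emb_int (m : int) : ac_emb Qb m%:~R = m%:~R.
Proof. by rewrite rmorph_int. Qed.

Lemma intr_eq0Q (m : int) : ((m%:~R : Om) == 0) = (m == 0).
Proof. by rewrite -emb_int fmorph_eq0 intr_eq0. Qed.

Lemma intr_injQ : injective (intr : int -> Om).
Proof.
by move=> m n /eqP; rewrite -subr_eq0 -rmorphB /= intr_eq0Q subr_eq0 => /eqP.
Qed.

Lemma natr_eq0Q (m : nat) : ((m%:R : Om) == 0) = (m == 0)%N.
Proof. by rewrite pmulrn intr_eq0Q. Qed.

Lemma aint1 : aint 1. Proof. exact: (integral1 (intr : {rmorphism int -> Om})). Qed.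
Lemma aintD x y : aint x -> aint y -> aint (x + y). Proof. exact: integral_add. Qed.
Lemma aintB x y : aint x -> aint y -> aint (x - y). Proof. exact: integral_sub. Qed.
Lemma aintN x : aint x -> aint (- x). Proof. exact: integral_opp. Qed.
Lemma aintM x y : aint x -> aint y -> aint (x * y). Proof. exact: integral_mul. Qed.
Lemma aint_int (m : int) : aint m%:~R. Proof. exact: (integral_id (intr : {rmorphism int -> Om})). Qed.
Lemma aint0 : aint 0. Proof. by have := aint_int 0; rewrite mulr0z. Qed.
Lemma aint_nat (m : nat) : aint m%:R. Proof. exact: (integral_nat (intr : {rmorphism int -> Om})). Qed.
Lemma aintX x n : aint x -> aint (x ^+ n).
Proof.
move=> ax; elim: n => [|n IH]; first by rewrite expr0; exact: aint1.
by rewrite exprS; exact: aintM.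
Qed.
Lemma aint_sum I (r : seq I) (P : pred I) (F : I -> Om) :
  (forall i, P i -> aint (F i)) -> aint (\sum_(i <- r | P i) F i).
Proof. by move=> aF; elim/big_ind: _ => //; [exact: aint0|exact: aintD]. Qed.
Lemma aint_prod I (r : seq I) (P : pred I) (F : I -> Om) :
  (forall i, P i -> aint (F i)) -> aint (\prod_(i <- r | P i) F i).
Proof. by move=> aF; elim/big_ind: _ => //; [exact: aint1|exact: aintM]. Qed.
Lemma aint_gal g x : aint x -> aint (g x). Proof. exact: aint_rmorph. Qed.

Lemma aint_horner (P : {poly int}) x : aint x -> aint (map_poly intr P).[x].
Proof.
move=> ax; rewrite horner_coef; apply: aint_sum => i _.
by rewrite coef_map; apply: aintM; [exact: aint_int|exact: aintX].
Qed.

Definition aint_poly (P : {poly Om}) := forall i, aint P`_i.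

Lemma aint_polyM P Q : aint_poly P -> aint_poly Q -> aint_poly (P * Q).
Proof.
by move=> aP aQ i; rewrite coefM; apply: aint_sum => j _; exact: aintM.
Qed.
Lemma aint_poly_XsubC x : aint x -> aint_poly ('X - x%:P).
Proof.
move=> ax i; rewrite coefB coefX coefC; apply: aintB; first exact: aint_nat.
by case: eqP => // _; exact: aint0.
Qed.
Lemma aint_poly_prod I (r : seq I) (P : pred I) (F : I -> {poly Om}) :
  (forall i, P i -> aint_poly (F i)) -> aint_poly (\prod_(i <- r | P i) F i).
Proof.
move=> aF; elim/big_ind: _ => //; last exact: aint_polyM.
by move=> i; rewrite coef1; exact: aint_nat.
Qed.

(** If a is the leading coefficient of an integer polynomial of degree n + 1 that kills x, its
    product with a^n is a monic polynomial in a x. *)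
Lemma alg_multiple x : exists2 m : int, m != 0 & aint (m%:~R * x).
Proof.
have [p p0 rp] := ac_alg x; have [q [a a0 qE]] := rat_poly_scale p.
have q0 : q != 0.
  by apply: contra_neq p0 => q0; rewrite qE q0 rmorph0 scaler0.
have rq : root (map_poly intr q) x.
  move: rp; rewrite qE linearZ /= -map_poly_comp /= rootZ; last first.
    by rewrite fmorph_eq0 invr_eq0 intr_eq0.
  by rewrite (eq_map_poly (g := intr)) // => k /=; rewrite emb_int.
exists (lead_coef q); first by rewrite lead_coef_eq0.
have sq : (0 < size q)%N by rewrite size_poly_gt0.
have n0 : (size q).-1.+1 = size q by rewrite prednK.
case: (posnP (size q).-1) => [s1|s1].
  have /size_poly1P [c c0 qc] : size q == 1%N by rewrite -n0 s1.
  by move: rq; rewrite qc map_polyC rootE hornerC intr_eq0Q (negPf c0).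
pose n := (size q).-1.-1; have nE : size q = n.+2 by rewrite /n prednK.
pose r : {poly Om} := \poly_(i < n.+2)
  (if i == n.+1 then 1 else (q`_i)%:~R * (lead_coef q)%:~R ^+ (n - i)).
have sr : size r = n.+2 by rewrite size_poly_eq // eqxx oner_eq0.
apply: (@integral_root_monic _ _ _ _ r).
- by rewrite monicE lead_coefE sr coef_poly ltnSn eqxx.
- rewrite rootE horner_coef sr big_ord_recr /= coef_poly ltnSn eqxx mul1r.
  move: rq; rewrite rootE horner_coef size_map_poly_id0 ?intr_eq0Q ?lead_coef_eq0 //.
  rewrite nE big_ord_recr /= => /eqP.
  move/(congr1 (fun u => u * (lead_coef q)%:~R ^+ n)); rewrite mul0r mulrDl => E.
  apply/eqP; rewrite -[RHS]E mulr_suml; congr (_ + _); last first.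
    by rewrite coef_map /= lead_coefE nE /= exprMn exprS mulrAC.
  apply: eq_bigr => i _; rewrite coef_poly ltnS ltnW // coef_map /=.
  have -> : (i == n.+1 :> nat) = false by apply/negbTE; rewrite neq_ltn ltn_ord.
  rewrite exprMn -!mulrA; congr (_ * _); rewrite mulrA -exprD.
  by rewrite subnK -1?ltnS // mulrC.
- move=> c /(nthP 0) [i _ <-]; rewrite coef_poly; case: ifP => _; last exact: aint0.
  case: ifP => _; first exact: aint1.
  by apply: aintM; [exact: aint_int|exact/aintX/aint_int].
Qed.

Lemma pchar_rat0 : [pchar rat] =i pred0. Proof. exact: pchar_num. Qed.

Lemma gal_fixed_aint x : aint x -> (forall g, g x = x) ->
  exists m : int, x = m%:~R.
Proof.
move=> ax /(gal_fixed pchar_rat0) [q xE]; rewrite xE in ax *.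
by have [m ->] := integral_rat_int ax; exists m; rewrite rmorph_int.
Qed.

Lemma gal_fixed_poly (P : {poly Om}) : aint_poly P ->
  (forall g, map_poly g P = P) -> exists Pz : {poly int}, P = map_poly intr Pz.
Proof.
move=> aP fP; have cP i : exists m : int, P`_i = m%:~R.
  apply: gal_fixed_aint => // g.
  by have /(congr1 (fun p : {poly Om} => p`_i)) := fP g; rewrite coef_map.
have [c cE] := boolp.choice cP.
exists (\poly_(i < size P) c i); apply/polyP => i.
rewrite coef_map coef_poly /=; case: ltnP => // si.
by rewrite nth_default.
Qed.

Lemma orbit_finite x : finite_set [set g x | g in [set: gal]].
Proof.
have [p p0 rp] := ac_alg x.
have [s sE] := closed_field_poly_normal (map_poly (ac_emb Qb) p).
apply: (@sub_finite_set _ _ [set` s]); last exact: finite_seq.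
move=> _ [g _ <-] /=.
have : root (map_poly (ac_emb Qb) p) (g x).
  have -> : map_poly (ac_emb Qb) p = map_poly g (map_poly (ac_emb Qb) p).
    by rewrite -map_poly_comp; apply: eq_map_poly => a /=; rewrite gal_fix.
  by rewrite fmorph_root.
by rewrite sE rootZ ?lead_coef_eq0 ?map_poly_eq0 // root_prod_XsubC.
Qed.

Definition orb x : seq Om := enum_fset (fset_set [set g x | g in [set: gal]]).

Lemma orbP x y : reflect (exists g, g x = y) (y \in orb x).
Proof.
apply: (iffP idP) => [|[g <-]].
  by rewrite /orb in_fset_set ?inE; [case=> g _ <-; exists g|exact: orbit_finite].
by rewrite /orb in_fset_set ?inE; [exists g|exact: orbit_finite].
Qed.

Lemma orb_uniq x : uniq (orb x). Proof. exact: fset_uniq. Qed.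
Lemma orb_self x : x \in orb x. Proof. by apply/orbP; exists 1%g. Qed.
Lemma orb_gal x g y : y \in orb x -> g y \in orb x.
Proof. by move=> /orbP [h <-]; apply/orbP; exists (g * h)%g. Qed.
Lemma orb_perm x g : perm_eq [seq g y | y <- orb x] (orb x).
Proof.
apply: uniq_perm; [|exact: orb_uniq|].
  by rewrite map_inj_uniq ?orb_uniq //; exact: fmorph_inj.
move=> y; apply/idP/idP => [/mapP [z zx ->]|/orbP [h <-]]; first exact: orb_gal.
apply/mapP; exists ((g^-1 * h)%g x); first by apply/orbP; exists (g^-1 * h)%g.
by rewrite /= absgal_invfK.
Qed.

Definition orbpoly x : {poly Om} := \prod_(y <- orb x) ('X - y%:P).

Lemma orbpoly_gal x g : map_poly g (orbpoly x) = orbpoly x.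
Proof.
rewrite rmorph_prod /= /orbpoly -[RHS](perm_big _ (orb_perm x g)) big_map.
by apply: eq_bigr => y _; rewrite rmorphB /= map_polyX map_polyC.
Qed.

Lemma aint_orb x y : aint x -> y \in orb x -> aint y.
Proof. by move=> ax /orbP [g <-]; exact: aint_gal. Qed.

Lemma orbpoly_int x : aint x -> exists P : {poly int}, orbpoly x = map_poly intr P.
Proof.
move=> ax; apply: gal_fixed_poly; last exact: orbpoly_gal.
rewrite /orbpoly big_seq; apply: aint_poly_prod => y yx.
exact/aint_poly_XsubC/(aint_orb ax).
Qed.

Lemma gal_mulE g h x : (g * h)%g x = g (h x). Proof. by []. Qed.
Lemma gal_invK g x : (g^-1)%g (g x) = x. Proof. exact: absgal_funK. Qed.
Lemma gal_Kinv g x : g ((g^-1)%g x) = x. Proof. exact: absgal_invfK. Qed.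

(** By Galois theory this says that x lies in Q(t); the field itself is never formed. *)
Definition sfix t x : Prop := forall g, g t = t -> g x = x.

Lemma sfix_coord t x : sfix t x -> exists c : Om -> Om, forall g, c (g t) = g x.
Proof.
move=> fx; pose c y := xget 0 [set z | exists2 g : gal, g t = y & g x = z].
exists c => g; rewrite /c; case: xgetP => [z _ [h hg <-]|/(_ (g x))[]]; last by exists g.
rewrite -[RHS](gal_Kinv h); congr (h _); apply/esym.
rewrite -[LHS]/((h^-1 * g)%g x); apply: fx.
by rewrite gal_mulE -hg gal_invK.
Qed.

(** At a conjugate y this is f'(y), where f is the conjugate polynomial of t; [orb_disc] is
    therefore the discriminant of f up to sign. *)
Definition orb_diff t y : Om := \prod_(z <- orb t | z != y) (y - z).
Definition orb_disc t : Om := \prod_(y <- orb t) orb_diff t y.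

Lemma orb_diff_gal t g y : g (orb_diff t y) = orb_diff t (g y).
Proof.
rewrite /orb_diff rmorph_prod -[RHS](perm_big _ (orb_perm t g)) big_map /=.
by apply: eq_big => z; [rewrite (inj_eq (fmorph_inj g))|rewrite rmorphB].
Qed.

Lemma aint_orb_diff t y : aint t -> aint y -> aint (orb_diff t y).
Proof.
move=> at_ ay; rewrite /orb_diff big_seq_cond; apply: aint_prod => z /andP [zt _].
exact/aintB/(aint_orb at_).
Qed.

Lemma orb_disc_int t : aint t -> exists2 D : int, orb_disc t = D%:~R & D != 0.
Proof.
move=> at_; have [||D DE] := @gal_fixed_aint (orb_disc t).
- rewrite /orb_disc big_seq; apply: aint_prod => y yt.
  exact/aint_orb_diff/(aint_orb at_).
- move=> g; rewrite /orb_disc rmorph_prod -[RHS](perm_big _ (orb_perm t g)) big_map.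
  by apply: eq_bigr => y _; rewrite /= orb_diff_gal.
exists D => //; rewrite -(intr_eq0Q D) -DE prodf_seq_neq0.
apply/allP => y _ /=; rewrite /orb_diff prodf_seq_neq0; apply/allP => z _ /=.
by apply/implyP => zy; rewrite subr_eq0 eq_sym.
Qed.

(* Lagrange interpolation on the conjugates: the interpolating polynomial is
   Galois invariant, hence has integer coefficients. *)
Lemma interp_int t x : aint t -> aint x -> sfix t x ->
  exists P : {poly int},
    [/\ (size P <= size (orb t))%N, (map_poly intr P).[t] = x * orb_diff t t &
        forall (Q : set Om), Q 0 -> (forall a b, Q a -> Q b -> Q (a + b)) ->
          (forall a b, aint a -> Q b -> Q (a * b)) ->
          (forall g, Q (g x)) -> forall i, Q (P`_i)%:~R].
Proof.
move=> at_ ax fx; have [c cP] := sfix_coord fx.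
pose L : {poly Om} := \sum_(y <- orb t) c y *: \prod_(z <- orb t | z != y) ('X - z%:P).
have aprod y : aint_poly (\prod_(z <- orb t | z != y) ('X - z%:P)).
  rewrite big_seq_cond; apply: aint_poly_prod => z /andP [zt _].
  exact/aint_poly_XsubC/(aint_orb at_).
have [||P PE] := @gal_fixed_poly L.
- move=> i; rewrite /L coef_sum big_seq; apply: aint_sum => y /orbP [g <-].
  by rewrite coefZ cP; apply: aintM; [exact: aint_gal|exact: aprod].
- move=> g; rewrite /L rmorph_sum /= -[RHS](perm_big _ (orb_perm t g)) big_map /=.
  rewrite big_seq [RHS]big_seq; apply: eq_bigr => y /orbP [h hE].
  rewrite map_polyZ /=.
  congr (_ *: _); first by rewrite -hE cP -gal_mulE cP.
  rewrite rmorph_prod /= -[RHS](perm_big _ (orb_perm t g)) big_map /=.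
  apply: eq_big => z; first by rewrite (inj_eq (fmorph_inj g)).
  by rewrite rmorphB /= map_polyX map_polyC.
exists P; split.
- rewrite -(size_map_inj_poly intr_injQ) ?mulr0z // -PE.
  apply: (leq_trans (size_sum _ _ _)); apply/bigmax_leqP_seq => y yt _.
  apply: (leq_trans (size_scale_leq _ _)).
  rewrite -big_filter size_prod_XsubC size_filter.
  rewrite -(count_predC (pred1 y) (orb t)) -addn1 addnC leq_add2r.
  by rewrite -has_count; apply/hasP; exists y => //=.
- rewrite -PE /L horner_sum (bigD1_seq t) ?orb_self ?orb_uniq //= [X in _ + X]big_seq_cond
    [X in _ + X]big1 ?addr0.
    rewrite hornerZ horner_prod; have := cP 1%g; rewrite /= => ->.
    by congr (_ * _); apply: eq_bigr => z _; rewrite hornerXsubC.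
  move=> y /andP [yt ny]; rewrite hornerZ horner_prod.
  apply/eqP; rewrite mulf_eq0 prodf_seq_eq0; apply/orP; right.
  apply/hasP; exists t; first exact: orb_self.
  by rewrite /= eq_sym ny hornerXsubC subrr eqxx.
- move=> Q Q0 QD QM Qx i; rewrite -[_%:~R]/(intr _) -coef_map -PE /L coef_sum.
  rewrite big_seq; elim/big_ind: _ => // y /orbP [g <-].
  by rewrite coefZ cP mulrC; apply: QM; [exact: aprod|exact: Qx].
Qed.

End GaloisIntegers.

(** * Places *)

Section Places.
Context (Qb : alg_closure rat).
Local Notation Om := (ac_field Qb).
Local Notation gal := (absgal Qb).
Implicit Types (g h : gal) (x y z t : Om).

Lemma gal_horner g (P : {poly int}) x :
  g (map_poly intr P).[x] = (map_poly intr P).[g x].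
Proof.
rewrite -horner_map -map_poly_comp; congr (_.[_]); apply: eq_map_poly => k /=.
by rewrite rmorph_int.
Qed.

(** Interpolation yields x f'(t). The product w of the f'(y) over the other conjugates y is integral
    and lies in Q(t), so interpolating w x yields x times the discriminant. *)
Lemma interp_disc t x (D : int) : aint t -> aint x -> sfix t x ->
  orb_disc t = D%:~R ->
  exists P : {poly int},
    [/\ (size P <= size (orb t))%N, (map_poly intr P).[t] = D%:~R * x &
        forall (Q : set Om), Q 0 -> (forall a b, Q a -> Q b -> Q (a + b)) ->
          (forall a b, aint a -> Q b -> Q (a * b)) ->
          (forall g, Q (g x)) -> forall i, Q (P`_i)%:~R].
Proof.
move=> at_ ax fx DE.
pose w := \prod_(y <- orb t | y != t) orb_diff t y.
have aw : aint w.
  rewrite /w big_seq_cond; apply: aint_prod => y /andP [yt _].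
  exact/aint_orb_diff/(aint_orb at_).
have fw : sfix t w.
  move=> g gt; rewrite /w rmorph_prod -[RHS](perm_big _ (orb_perm t g)) big_map /=.
  by apply: eq_big => y; [rewrite -{2}gt (inj_eq (fmorph_inj g))|rewrite orb_diff_gal].
have [||P [sP Pt PQ]] := @interp_int _ t (w * x) at_.
- exact: aintM.
- by move=> g gt; rewrite rmorphM /= fw // fx.
exists P; split=> //.
  rewrite Pt -DE /orb_disc (bigD1_seq t) ?orb_self ?orb_uniq //= -/w.
  by rewrite mulrC mulrA.
move=> Q Q0 QD QM Qx; apply: PQ => // g.
by rewrite rmorphM; apply: QM => //; exact: aint_gal.
Qed.

Definition place (p : nat) (Q : set Om) : Prop := is_prime [set: Om] Q /\ Q p%:R.

Section Place.
Context (p : nat) (Q : set Om) (plQ : place p Q) (p_pr : prime p).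

Lemma pl_aint x : Q x -> aint x.
Proof. by case: plQ => -[[QO _ _ _] _ _ _] _ /QO []. Qed.
Lemma pl0 : Q 0. Proof. by case: plQ => -[[]]. Qed.
Lemma pl1 : ~ Q 1. Proof. by case: plQ => -[]. Qed.
Lemma plp : Q p%:R. Proof. by case: plQ. Qed.
Lemma plD x y : Q x -> Q y -> Q (x + y).
Proof. by case: plQ => -[[_ _ QD _] _ _ _] _; exact: QD. Qed.
Lemma plM x y : aint x -> Q y -> Q (x * y).
Proof. by move=> ax; case: plQ => -[[_ _ _ QM] _ _ _] _; exact: QM. Qed.
Lemma plMr x y : aint x -> Q y -> Q (y * x).
Proof. by rewrite mulrC; exact: plM. Qed.
Lemma plN x : Q x -> Q (- x).
Proof. by rewrite -mulN1r; apply: plM; apply: aintN; exact: aint1. Qed.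
Lemma plB x y : Q x -> Q y -> Q (x - y).
Proof. by move=> Qx Qy; apply: plD => //; exact: plN. Qed.
Lemma pl_prime x y : aint x -> aint y -> Q (x * y) -> Q x \/ Q y.
Proof. by move=> ax ay; case: plQ => -[_ _ _ Qp] _; apply: Qp. Qed.
Lemma pl_sum I (r : seq I) (P : pred I) (F : I -> Om) :
  (forall i, P i -> Q (F i)) -> Q (\sum_(i <- r | P i) F i).
Proof. by move=> QF; elim/big_ind: _ => //; [exact: pl0|exact: plD]. Qed.
Lemma pl_prod (I : eqType) (r : seq I) (P : pred I) (F : I -> Om) :
  (forall i, i \in r -> P i -> aint (F i)) -> Q (\prod_(i <- r | P i) F i) ->
  exists2 i, i \in r & P i /\ Q (F i).
Proof.
elim: r => [|i r IH] aF; first by rewrite big_nil => /pl1.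
have ar j : j \in r -> P j -> aint (F j) by move=> jr; apply: aF; rewrite inE jr orbT.
have stepr : Q (\prod_(j <- r | P j) F j) -> exists2 j, j \in i :: r & P j /\ Q (F j).
  by move=> /(IH ar) [j jr Hj]; exists j => //; rewrite inE jr orbT.
rewrite big_cons; case: ifP => // Pi /pl_prime [||Qi|//].
- by apply: aF => //; rewrite mem_head.
- by rewrite big_seq_cond; apply: aint_prod => j /andP [jr Pj]; exact: ar.
- by exists i => //; rewrite mem_head.
Qed.

Lemma pl_prod_mem (I : eqType) (r : seq I) (P : pred I) (F : I -> Om) i :
  (forall i, i \in r -> P i -> aint (F i)) -> i \in r -> P i -> Q (F i) ->
  Q (\prod_(i <- r | P i) F i).
Proof.
move=> aF ir Pi Qi; rewrite (big_rem i) //= Pi; apply: plMr => //.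
rewrite big_seq_cond; apply: aint_prod => j /andP [/mem_rem jr Pj].
exact: aF.
Qed.

Lemma pl_int (m : int) : Q m%:~R <-> (p %| m)%Z.
Proof.
split=> [Qm|/dvdzP [k ->]]; last first.
  by rewrite intrM; apply: plM; [exact: aint_int|exact: plp].
apply/negPn/negP => npm; apply: pl1.
have : coprimez p m by rewrite /coprimez /gcdz /= eqz_nat -/(coprime _ _) prime_coprime.
move=> /coprimezP [[u v] /= uv].
have /(congr1 (fun k : int => k%:~R : Om)) := uv.
rewrite intrD !intrM -[1%:~R]/1 => <-.
by apply: plD; apply: plM => //; [exact: aint_int|exact: plp|exact: aint_int].
Qed.

Lemma pl_exp x n : aint x -> Q (x ^+ n) -> Q x.
Proof.
move=> ax; elim: n => [|n IH]; first by rewrite expr0 => /pl1.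
by rewrite exprS => /pl_prime [||//|/IH]; [|exact: aintX|].
Qed.

Lemma pl_sep t (D : int) y z : aint t -> orb_disc t = D%:~R -> ~~ (p %| D)%Z ->
  y \in orb t -> z \in orb t -> Q (y - z) -> y = z.
Proof.
move=> at_ DE pD yt zt Qyz; apply/eqP/negPn/negP => yz; move/negP: pD; apply.
apply/pl_int; rewrite -DE /orb_disc (bigD1_seq y) ?orb_uniq //=.
apply: plMr.
  rewrite big_seq_cond; apply: aint_prod => u /andP [ut _].
  exact/aint_orb_diff/(aint_orb at_).
apply: (@pl_prod_mem _ _ _ _ z) => //; last by rewrite eq_sym.
by move=> u ut _; apply: aintB; exact: (aint_orb at_).
Qed.

Lemma aint_divp (D : int) x y : ~~ (p %| D)%Z -> aint x -> aint y ->
  D%:~R * x = p%:R * y -> exists2 z, aint z & x = p%:R * z.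
Proof.
move=> pD ax ay E.
have : coprimez p D by rewrite /coprimez /gcdz /= eqz_nat -/(coprime _ _) prime_coprime.
move=> /coprimezP [[u v] /= uv].
have /(congr1 (fun k : int => k%:~R : Om)) := uv.
rewrite intrD !intrM -[1%:~R]/1 -pmulrn => E1.
exists (u%:~R * x + v%:~R * y).
  by apply: aintD; apply: aintM => //; exact: aint_int.
transitivity ((u%:~R * p%:R + v%:~R * D%:~R) * x); first by rewrite E1 mul1r.
by rewrite mulrDl -[v%:~R * _ * x]mulrA E; ring.
Qed.

(** The primes above p in Q(t) intersect in the multiples of p when p does not divide the
    discriminant: the integer coefficients that express D x in powers of t lie in Q, so p divides
    them, and D is then cancelled. *)
Lemma pl_red t (D : int) x : aint t -> orb_disc t = D%:~R -> ~~ (p %| D)%Z ->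
  aint x -> sfix t x -> (forall g, Q (g x)) -> exists2 z, aint z & x = p%:R * z.
Proof.
move=> at_ DE pD ax fx Qx.
have [P [_ Pt PQ]] := interp_disc at_ ax fx DE.
have dP i : (p %| P`_i)%Z.
  by apply/pl_int; apply: PQ => //; [exact: pl0|exact: plD|exact: plM].
apply: (@aint_divp D x (map_poly intr (\poly_(i < size P) (P`_i %/ p)%Z)).[t]) => //.
  exact: aint_horner.
rewrite -Pt -hornerZ; congr (_.[_]); apply/polyP => i.
rewrite coefZ !coef_map coef_poly /=; case: ltnP => si; last first.
  by rewrite nth_default // mulr0.
by rewrite pmulrn -intrM mulrC divzK.
Qed.

(** Modulo p the conjugate polynomial of x is X^j h with h(0) prime to p. A conjugate outside Q must
    then be a root of h modulo Q. *)
Lemma unit_poly x : aint x -> exists h : {poly int}, ~~ (p %| h`_0)%Z /\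
  forall g, ~ Q (g x) -> Q (map_poly intr h).[g x].
Proof.
move=> ax; have [P PE] := orbpoly_int ax.
have lP : lead_coef P = 1.
  apply: (@intr_injQ Qb); rewrite -lead_coef_map_inj //; last exact: intr_injQ.
  by rewrite -PE; apply/eqP; exact: monic_prod_XsubC.
have ex : exists j, ~~ (p %| P`_j)%Z.
  exists (size P).-1; rewrite -lead_coefE lP.
  by rewrite dvdzE /= dvdn1 neq_ltn prime_gt1 // orbT.
case: (ex_minnP ex) => j pj jmin; exists (drop_poly j P).
rewrite coef_drop_poly add0n; split=> // g nQ.
have ag := aint_gal g ax.
have r0 : (map_poly intr P).[g x] = 0.
  apply/eqP; rewrite -rootE -PE root_prod_XsubC; apply/orbP; by exists g.
have := r0; rewrite -{1}[P](poly_take_drop j) rmorphD rmorphM /= hornerD hornerM.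
rewrite map_polyXn hornerXn => /eqP; rewrite addr_eq0 => /eqP E.
have Qt : Q (map_poly intr (take_poly j P)).[g x].
  rewrite horner_coef; apply: pl_sum => i _; apply: plMr; first exact: aintX.
  rewrite coef_map coef_take_poly /=; case: ltnP => ij; last by rewrite mulr0z; exact: pl0.
  by apply/pl_int/negPn/negP => /jmin; rewrite leqNgt ij.
have : Q ((map_poly intr (drop_poly j P)).[g x] * g x ^+ j).
  by rewrite -[_ * _]opprK -E; exact: plN.
move/pl_prime => [||//|/pl_exp]; [exact: aint_horner|exact: aintX|].
by move=> /(_ ag).
Qed.

(* Comparable contractions of places to the fixed field of the stabilizer of t
   are equal. *)
Lemma pl_incomparable t g : aint t ->
  (forall u, aint u -> sfix t u -> Q (g u) -> Q u) ->
  forall u, sfix t u -> Q u -> Q (g u).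
Proof.
move=> at_ Hg u fu Qu; have [//|nQ] := pselect (Q (g u)); exfalso.
have au := pl_aint Qu.
have [h [h0 hP]] := unit_poly au.
have := hP g nQ; rewrite -gal_horner.
move=> Qgh; have : Q (map_poly intr h).[u].
  apply: Hg => //; first exact: aint_horner.
  by move=> s st; rewrite gal_horner fu.
have -> : h = drop_poly 1 h * 'X + (h`_0)%:P.
  rewrite -[LHS](poly_take_drop 1) addrC; congr (_ + _).
  by apply/polyP => -[|i]; rewrite coef_take_poly coefC.
rewrite rmorphD rmorphM /= map_polyX map_polyC hornerD hornerM hornerX hornerC => Qh.
move/negP: h0; apply; apply/pl_int.
rewrite -[_%:~R](addKr ((map_poly intr (drop_poly 1 h)).[u] * u)).
by apply: plD => //; apply: plN; apply: plM => //; exact: aint_horner.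
Qed.

(** Prime avoidance. A conjugate g t is bad if some u outside Q has g u in Q; y is the product of
    one such u for each bad conjugate. For the other g the contraction of g^-1 Q lies in that of Q,
    hence equals it by [pl_incomparable]. *)
Lemma pl_avoid t : aint t -> exists y, [/\ aint y, sfix t y, ~ Q y &
    forall x, sfix t x -> Q x -> forall g, Q (g (y * x))].
Proof.
move=> at_.
pose bad s := exists u : Om, exists g, [/\ g t = s, aint u, sfix t u, Q (g u) & ~ Q u].
have exu s : exists v : Om, bad s -> exists g,
    [/\ g t = s, aint v, sfix t v, Q (g v) & ~ Q v].
  have [[v bs]|nb] := pselect (bad s); first by exists v.
  by exists 0.
have [u uP] := boolp.choice exu.
pose y := \prod_(s <- orb t | `[< bad s >]) u s.
have au s : bad s -> aint (u s) by move=> /uP [g []].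
have ay : aint y by apply: aint_prod => s /asboolP /au.
have fy : sfix t y.
  move=> g gt; rewrite /y rmorph_prod; apply: eq_bigr => s /asboolP /uP [h [_ _ fu _ _]].
  exact: fu.
exists y; split=> //.
  by move=> /pl_prod [s _ /asboolP /au //|s _ [/asboolP /uP [g [_ _ _ _]]]].
move=> x fx Qx g; rewrite rmorphM /=; have [bg|nbg] := pselect (bad (g t)).
  apply: plMr; first exact/aint_gal/pl_aint.
  rewrite /y rmorph_prod; apply: (@pl_prod_mem _ _ _ _ (g t)).
  - by move=> s _ /asboolP /au; exact: aint_gal.
  - by apply/orbP; exists g.
  - exact/asboolP.
  - have [h [hg _ fu Qu _]] := uP _ bg; have -> // : g (u (g t)) = h (u (g t)).
    rewrite -[LHS](gal_Kinv h); congr (h _); rewrite -gal_mulE; apply: fu.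
    by rewrite gal_mulE -hg gal_invK.
apply: plM; first exact: aint_gal.
apply: (pl_incomparable at_) => // v av fv Qgv.
by have [//|nQ] := pselect (Q v); exfalso; apply: nbg; exists v, g.
Qed.

(* Places over p not dividing the discriminant are unramified. *)
Lemma pl_unr t (D : int) : aint t -> orb_disc t = D%:~R -> ~~ (p %| D)%Z ->
  exists y, [/\ aint y, sfix t y, ~ Q y &
    forall x, sfix t x -> Q x -> exists2 z, aint z & y * x = p%:R * z].
Proof.
move=> at_ DE pD; have [y [ay fy nQy yP]] := pl_avoid at_.
exists y; split=> // x fx Qx; apply: (pl_red at_ DE pD).
- by apply: aintM => //; exact: pl_aint.
- by move=> g gt; rewrite rmorphM /= fy // fx.
- exact: yP.
Qed.

(** Divisibility of an integer by a power of p can be tested at a single place, up to a factor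
    outside Q. *)
Lemma pl_symb x y (N : int) k : aint y -> ~ Q y -> aint x ->
  y * N%:~R = p%:R ^+ k * x -> (Posz (p ^ k)%N %| N)%Z.
Proof.
move=> ay nQy ax; elim: k N x ax => [|k IH] N x ax E; first by rewrite expn0 dvd1z.
have /pl_int/dvdzP [N' NE] : Q N%:~R.
  have /pl_prime : Q (y * N%:~R).
    by rewrite E exprS -mulrA; apply: plMr; [apply: aintM=> //; exact/aintX/aint_nat|exact: plp].
  by move=> [||//|//]; [|exact: aint_int].
rewrite NE expnSr PoszM dvdz_mul2r; last by rewrite eqz_nat -lt0n prime_gt0.
apply: (IH N' x) => //.
have p0 : p%:R != 0 :> Om by rewrite natr_eq0Q -lt0n prime_gt0.
apply: (mulIf p0); move: E; rewrite NE intrM -pmulrn mulrA => ->.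
by rewrite exprS; ring.
Qed.

Lemma bin_div (a b : Om) : aint a -> aint b ->
  exists2 z, aint z & (a + b) ^+ p = a ^+ p + b ^+ p + p%:R * z.
Proof.
move=> aa ab; rewrite exprDn.
have p0 := prime_gt0 p_pr.
rewrite big_ord_recl /= bin0 subn0 expr0 mulr1 mulr1n.
have [q pE] : exists q, p = q.+1 by exists p.-1; rewrite prednK.
pose F i := a ^+ (p - i.+1) * b ^+ i.+1 *+ ('C(p, i.+1) %/ p).
exists (\sum_(i < q) F i).
  apply: aint_sum => i _; rewrite /F -mulr_natr; apply: aintM; last exact: aint_nat.
  by apply: aintM; exact: aintX.
rewrite pE; under eq_bigr do rewrite /bump /= add1n.
rewrite big_ord_recr /= binn subnn expr0 mul1r mulr1n -pE.
rewrite -addrA [b ^+ p + _]addrC; congr (_ + (_ + _)).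
rewrite mulr_sumr; apply: eq_bigr => i _.
rewrite /F mulr_natl -mulrnA divnK // prime_dvd_bin //.
by rewrite pE !ltnS ltn_ord.
Qed.

Lemma frob_int (m : int) : Q (m%:~R ^+ p - m%:~R).
Proof.
have nat_case (n : nat) : Q (n%:R ^+ p - n%:R).
  elim: n => [|n IH].
    by rewrite mulr0n expr0n gtn_eqF ?prime_gt0 // subrr; exact: pl0.
  rewrite -natr1; have [z az ->] := bin_div (aint_nat Qb n) (@aint1 Qb).
  rewrite expr1n opprD addrACA addrA.
  rewrite [X in Q X](_ : _ = (n%:R ^+ p - n%:R) + p%:R * z); last by ring.
  by apply: plD => //; apply: plMr => //; exact: plp.
have p0 : (p%:Z != 0) by rewrite eqz_nat -lt0n prime_gt0.
pose n := `|(m %% p)%Z|%N; pose c : Om := (m %/ p)%Z%:~R * p%:R.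
have ac : aint c by apply: aintM; [exact: aint_int|exact: aint_nat].
have Qc : Q c by apply: plM; [exact: aint_int|exact: plp].
have -> : m%:~R = n%:R + c :> Om.
  rewrite {1}(divz_eq m p) addrC intrD intrM; congr (_ + _).
  by rewrite pmulrn /n gez0_abs ?modz_ge0.
have [z az ->] := bin_div (aint_nat Qb n) ac.
rewrite [X in Q X](_ : _ = (n%:R ^+ p - n%:R) + (c ^+ p - c) + p%:R * z); last by ring.
apply: plD; last by apply: plMr => //; exact: plp.
apply: plD => //; apply: plB => //.
by rewrite -(prednK (prime_gt0 p_pr)) exprS; apply: plMr => //; exact: aintX.
Qed.

Lemma frob_poly (P : {poly int}) x : aint x ->
  Q ((map_poly intr P).[x] ^+ p - (map_poly intr P).[x ^+ p]).
Proof.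
move=> ax; elim/poly_ind: P => [|P c IH].
  by rewrite rmorph0 !horner0 expr0n gtn_eqF ?prime_gt0 // subrr; exact: pl0.
rewrite rmorphD rmorphM /= map_polyX map_polyC !hornerD !hornerM !hornerX !hornerC.
have aP := aint_horner P ax.
have [z az ->] := bin_div (aintM aP ax) (aint_int Qb c).
rewrite exprMn; set u := _.[x]; set v := _.[x ^+ p].
rewrite [X in Q X](_ : _ = (u ^+ p - v) * x ^+ p + (c%:~R ^+ p - c%:~R) + p%:R * z); last by rewrite /=; ring.
apply: plD; last by apply: plMr => //; exact: plp.
by apply: plD; [apply: plMr; [exact: aintX|exact: IH]|exact: frob_int].
Qed.

(** Since f(t^p) is congruent to f(t)^p = 0 modulo Q, the power t^p is a root of the conjugate
    polynomial modulo Q, hence congruent to a conjugate of t. *)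
Lemma pl_frob t : aint t -> exists g, Q (g t - t ^+ p).
Proof.
move=> at_; have [P PE] := orbpoly_int at_.
have : Q (orbpoly t).[t ^+ p].
  have := frob_poly P at_; rewrite -PE.
  have -> : (orbpoly t).[t] = 0 by apply/eqP; rewrite -rootE root_prod_XsubC orb_self.
  rewrite expr0n gtn_eqF ?prime_gt0 // sub0r => /plN; by rewrite opprK.
rewrite /orbpoly horner_prod => /pl_prod [y yt _|y /orbP [g <-] [_]].
  by rewrite hornerXsubC; apply: aintB; [exact: aintX|exact: (aint_orb at_)].
by rewrite hornerXsubC => /plN; rewrite opprB; exists g.
Qed.

(** The congruence at t passes to integer polynomials in t, hence to D z, and D is invertible modulo
    Q. *)
Lemma pl_frob_ext t (D : int) g z : aint t -> orb_disc t = D%:~R ->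
  ~~ (p %| D)%Z -> Q (g t - t ^+ p) -> aint z -> sfix t z -> Q (g z - z ^+ p).
Proof.
move=> at_ DE pD Qg az fz; have [P [_ Pt _]] := interp_disc at_ az fz DE.
have Qmod x y : aint x -> aint y -> Q (x - y) ->
    Q ((map_poly intr P).[x] - (map_poly intr P).[y]).
  move=> ax ay Qxy; elim/poly_ind: P {Pt} => [|P c IH].
    by rewrite rmorph0 !horner0 subrr; exact: pl0.
  rewrite rmorphD rmorphM /= map_polyX map_polyC !hornerD !hornerM !hornerX !hornerC.
  set u := _.[x] in IH *; set v := _.[y] in IH *.
  rewrite [X in Q X](_ : _ = (u - v) * x + v * (x - y)); last by ring.
  by apply: plD; [exact: plMr|apply: plM => //; exact: aint_horner].
have H1 := frob_poly P at_; rewrite Pt in H1.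
have H2 := Qmod _ _ (aint_gal g at_) (aintX p at_) Qg.
rewrite -gal_horner Pt rmorphM rmorph_int in H2.
have H3 := frob_int D.
have : Q (D%:~R * (g z - z ^+ p)).
  rewrite [X in Q X](_ : _ = (D%:~R * g z - (map_poly intr P).[t ^+ p]) -
    ((D%:~R * z) ^+ p - (map_poly intr P).[t ^+ p]) +
    (D%:~R ^+ p - D%:~R) * z ^+ p); last by rewrite exprMn; ring.
  by apply: plD; [exact: plB|apply: plMr => //; exact: aintX].
move/pl_prime => [||/pl_int H|//]; [exact: aint_int| |by rewrite H in pD].
by apply: aintB; [exact: aint_gal|exact: aintX].
Qed.

Definition pl_poly (P : {poly Om}) := forall i, Q P`_i.

(** Gauss's lemma modulo Q: consider the lowest coefficients outside Q of both factors. *)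
Lemma pl_polyM P1 P2 : aint_poly P1 -> aint_poly P2 -> pl_poly (P1 * P2) ->
  pl_poly P1 \/ pl_poly P2.
Proof.
move=> a1 a2 Q12; have [|n1] := pselect (pl_poly P1); first by left.
have [|n2] := pselect (pl_poly P2); first by right.
exfalso; have ex (P : {poly Om}) : ~ pl_poly P -> exists i, ~~ `[< Q P`_i >].
  by move=> /existsNP [i ni]; exists i; apply/asboolP.
have [i1 /asboolP ni1 min1] := ex_minnP (ex _ n1).
have [i2 /asboolP ni2 min2] := ex_minnP (ex _ n2).
have lt1 i : (i < i1)%N -> Q P1`_i.
  by move=> ii; apply/asboolP/negPn/negP => /min1; rewrite leqNgt ii.
have lt2 i : (i < i2)%N -> Q P2`_i.
  by move=> ii; apply/asboolP/negPn/negP => /min2; rewrite leqNgt ii.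
have := Q12 (i1 + i2)%N; rewrite coefM.
have i12 : (i1 < (i1 + i2).+1)%N by rewrite ltnS leq_addr.
rewrite (bigD1 (Ordinal i12)) //= addKn => H.
have : Q (P1`_i1 * P2`_i2).
  rewrite -[_ * _](addrK (\sum_(i < (i1 + i2).+1 | i != Ordinal i12) P1`_i * P2`_(i1 + i2 - i))).
  apply: plB => //; apply: pl_sum => i; rewrite -val_eqE /= neq_ltn => /orP [ii|ii].
    by apply: plMr; [exact: a2|exact: lt1].
  apply: plM; first exact: a1.
  by apply: lt2; move: ii (ltn_ord i); clear; lia.
by move/pl_prime => [||//|//]; [exact: a1|exact: a2].
Qed.

Lemma pl_poly_prod (I : eqType) (r : seq I) (P : pred I) (F : I -> {poly Om}) :
  (forall i, i \in r -> P i -> aint_poly (F i)) ->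
  pl_poly (\prod_(i <- r | P i) F i) ->
  exists2 i, i \in r & P i /\ pl_poly (F i).
Proof.
elim: r => [|i r IH] aF.
  by rewrite big_nil => /(_ 0%N); rewrite coef1 => /pl1.
have ar j : j \in r -> P j -> aint_poly (F j) by move=> jr; apply: aF; rewrite inE jr orbT.
have stepr : pl_poly (\prod_(j <- r | P j) F j) ->
    exists2 j, j \in i :: r & P j /\ pl_poly (F j).
  by move=> /(IH ar) [j jr Hj]; exists j => //; rewrite inE jr orbT.
rewrite big_cons; case: ifP => // Pi /pl_polyM [||Qi|//].
- by apply: aF => //; rewrite mem_head.
- by rewrite big_seq_cond; apply: aint_poly_prod => j /andP [jr Pj]; exact: ar.
- by exists i => //; rewrite mem_head.
Qed.

(* Transitivity of the Galois action on the primes above a given prime: the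
   norm of a polynomial with coefficients in Q1 has coefficients in Q. *)
Lemma pl_trans t (H : set gal) (Q1 : set Om) : aint t -> H 1%g ->
  (forall g h, H g -> H h -> H (g * h)%g) -> (forall g, H g -> H (g^-1)%g) ->
  (forall g, g t = t -> H g) ->
  (forall x, Q1 x -> aint x /\ sfix t x) -> Q1 0 ->
  (forall x y, Q1 x -> Q1 y -> Q1 (x + y)) ->
  (forall x y, aint x -> sfix t x -> Q1 y -> Q1 (x * y)) ->
  (forall x, Q1 x -> (forall h, H h -> h x = x) -> Q x) ->
  exists2 h, H h & forall z, Q1 z -> Q (h z).
Proof.
move=> at_ H1 HM HV Hst Q1a Q10 Q1D Q1M Q1Q.
have [//|nex] := pselect (exists2 h, H h & forall z, Q1 z -> Q (h z)).
exfalso; have bad h : H h -> exists z, Q1 z /\ ~ Q (h z).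
  by move=> Hh; apply: contrapT => nz; apply: nex; exists h => // z Qz;
    apply: contrapT => nQ; apply: nz; exists z.
pose ot := [seq y <- orb t | `[< exists2 h, H h & h t = y >]].
have otP y : reflect (exists2 h, H h & h t = y) (y \in ot).
  rewrite mem_filter; apply: (iffP andP) => [[/asboolP //]|[h Hh <-]].
  by split; [apply/asboolP; exists h|apply/orbP; exists h].
have exz y : exists z, Q1 z /\ (forall h, H h -> h t = y -> ~ Q (h z)).
  have [[h Hh hy]|ny] := pselect (exists2 h, H h & h t = y); last first.
    by exists 0; split=> // h Hh hy; case: ny; exists h.
  have [z [Qz nQ]] := bad h Hh; exists z; split=> // h' Hh' hy'.
  have -> // : h' z = h z.
  rewrite -[LHS](gal_Kinv h); congr (h _); rewrite -gal_mulE; apply: (Q1a _ Qz).2.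
  by rewrite gal_mulE hy' -hy gal_invK.
have [z zP] := boolp.choice exz.
pose Z : {poly Om} := \poly_(i < size ot) z (nth 0 ot i).
have Q1Z i : Q1 Z`_i by rewrite coef_poly; case: ifP => // _; exact: (zP _).1.
have exc y : exists P : {poly Om}, forall h, h t = y -> P = map_poly h Z.
  have [[h hy]|ny] := pselect (exists h, h t = y); last by exists 0 => h hy; case: ny; exists h.
  exists (map_poly h Z) => h' hy'; apply/polyP => i; rewrite !coef_map /=.
  rewrite -[LHS](gal_Kinv h'); congr ((h' : {rmorphism Om -> Om}) _); rewrite -gal_mulE.
  by apply: (Q1a _ (Q1Z i)).2; rewrite gal_mulE hy -hy' gal_invK.
have [c cP] := boolp.choice exc.
pose N := \prod_(y <- ot) c y.
have uot : uniq ot by rewrite filter_uniq // orb_uniq.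
have tot : t \in ot by apply/otP; exists 1%g.
have permH h : H h -> perm_eq [seq h y | y <- ot] ot.
  move=> Hh; apply: uniq_perm => //; first by rewrite map_inj_uniq //; exact: fmorph_inj.
  move=> y; apply/idP/idP => [/mapP [u /otP [k Hk <-] ->]|/otP [k Hk <-]].
    by apply/otP; exists (h * k)%g => //; exact: HM.
  apply/mapP; exists ((h^-1 * k)%g t); last by rewrite gal_mulE gal_Kinv.
  by apply/otP; exists (h^-1 * k)%g => //; apply: HM => //; exact: HV.
have cH h y : y \in ot -> map_poly h (c y) = c (h y).
  move=> /otP [k Hk ky]; rewrite (cP _ k ky) (cP _ (h * k)%g); last by rewrite gal_mulE ky.
  by apply/polyP => i; rewrite !coef_map.
have ac y : y \in ot -> aint_poly (c y).
  move=> /otP [k Hk ky] i; rewrite (cP _ k ky) coef_map; apply: aint_gal.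
  exact: (Q1a _ (Q1Z i)).1.
have NH h : H h -> map_poly h N = N.
  move=> Hh; rewrite /N rmorph_prod -[RHS](perm_big _ (permH h Hh)) big_map.
  by rewrite big_seq [RHS]big_seq; apply: eq_bigr => y yt; rewrite /= cH.
have QN : pl_poly N.
  move=> i; apply: Q1Q; last first.
    move=> h Hh; have /(congr1 (fun P : {poly Om} => P`_i)) := NH h Hh.
    by rewrite coef_map.
  rewrite /N (bigD1_seq t) //= mulrC coefM.
  have cT : c t = Z by rewrite (cP t 1%g) //; apply/polyP => k; rewrite coef_map.
  have Q1sum I (r : seq I) (F : I -> Om) : (forall j, Q1 (F j)) -> Q1 (\sum_(j <- r) F j).
    by move=> QF; elim/big_ind: _.
  apply: Q1sum => j; apply: Q1M; last by rewrite cT; exact: Q1Z.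
  - move: (j : nat) => k; rewrite big_seq_cond; apply: aint_poly_prod.
    by move=> y /andP [yt _]; exact: ac.
  - move=> g gt; have Hg := Hst g gt.
    have gW : map_poly g (\prod_(y <- ot | y != t) c y) = \prod_(y <- ot | y != t) c y.
      rewrite rmorph_prod -[RHS](perm_big _ (permH g Hg)) big_map /=.
      rewrite big_seq_cond [RHS]big_seq_cond; apply: eq_big => y.
        by rewrite -{2}gt (inj_eq (fmorph_inj g)).
      by move=> /andP [yt _]; rewrite cH.
    by have /(congr1 (fun P : {poly Om} => P`_j)) := gW; rewrite coef_map.
have [y yt [_ Qy]] := pl_poly_prod (fun y yt _ => ac y yt) QN.
have /otP [h Hh hy] := yt.
apply: ((zP y).2 h Hh hy).
have := Qy (index y ot); rewrite (cP y h hy) coef_map coef_poly index_mem yt.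
by rewrite nth_index.
Qed.

End Place.

(** An ideal maximal among those that contain p and avoid 1. The search starts from the multiples of
    p, which avoid 1 because 1/p is not integral. *)
Lemma place_exists p : prime p -> exists Q : set Om, place p Q.
Proof.
move=> p_pr.
pose P (I : set Om) := [/\ is_ideal [set: Om] I, I p%:R & ~ I 1].
pose I0 : set Om := [set x | exists2 z, aint z & x = p%:R * z].
have PI0 : P I0.
  split; [split| |].
  - by move=> _ [z az ->]; split=> //; apply: aintM => //; exact: aint_nat.
  - by exists 0; [exact: aint0|rewrite mulr0].
  - by move=> _ _ [z az ->] [z' az' ->]; exists (z + z'); [exact: aintD|rewrite mulrDr].
  - move=> a _ [_ aa] [z az ->]; exists (a * z); last by ring.
    exact: aintM.
  - by exists 1; [exact: aint1|rewrite mulr1].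
  - move=> [z az /esym pz]; have p0 : p%:R != 0 :> Om by rewrite natr_eq0Q -lt0n prime_gt0.
    have zE : z = ac_emb Qb (p%:R^-1).
      by rewrite fmorphV rmorph_nat; apply: (mulfI p0); rewrite pz divff.
    rewrite zE in az; have [m mE] := integral_rat_int az.
    have : p%:R * (m%:~R : rat) = 1.
      by rewrite -mE divff // pnatr_eq0 -lt0n prime_gt0.
    rewrite -[p%:R]/((p%:Z)%:~R) -intrM => /eqP; rewrite -[1]/(1%:~R) eqr_int => /eqP.
    move/(congr1 absz); rewrite abszM /= => /eqP; rewrite muln_eq1 => /andP [/eqP p1 _].
    by rewrite p1 in p_pr.
have [Fs FP [X0 FX0] tot|I [PI _ Imax]] := @Zorn_above _ P I0 PI0.
  have two X Y : Fs X -> Fs Y -> exists Z, [/\ Fs Z, X `<=` Z & Y `<=` Z].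
    by move=> FX FY; have [XY|YX] := tot _ _ FX FY; [exists Y; split|exists X; split].
  split; [split| |].
  - by move=> x [X FX Xx]; have [[XO _ _ _] _ _] := FP _ FX; exact: XO.
  - by exists X0 => //; have [[_ ? _ _] _ _] := FP _ FX0.
  - move=> x y [X FX Xx] [Y FY Yy]; have [Z [FZ XZ YZ]] := two X Y FX FY.
    by exists Z => //; have [[_ _ ZD _] _ _] := FP _ FZ; apply: ZD; [exact: XZ|exact: YZ].
  - by move=> a x aa [X FX Xx]; exists X => //; have [[_ _ _ XM] _ _] := FP _ FX; exact: XM.
  - by exists X0 => //; have [_ ? _] := FP _ FX0.
  - by move=> [X FX X1]; have [_ _] := FP _ FX; apply.
case: PI => Iid Ip I1; exists I; split=> //; split=> //.
  by exists p%:R => //; rewrite natr_eq0Q -lt0n prime_gt0.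
case: (Iid) => IO I00 ID IM.
move=> x y ox oy Ixy; have [|nIx] := pselect (I x); [by left|right].
pose J : set Om := [set u | exists i z, [/\ I i, aint z & u = i + z * x]].
have IJ : I `<=` J.
  by move=> i Ii; exists i, 0; split=> //; [exact: aint0|rewrite mul0r addr0].
have Jx : J x by exists 0, 1; split=> //; [exact: aint1|rewrite mul1r add0r].
have [[i [z [Ii az E]]]|nJ1] := pselect (J 1).
  rewrite -[y]mul1r E mulrDl; apply: ID; first by rewrite mulrC; exact: IM.
  by rewrite -mulrA; apply: IM.
exfalso; apply: nIx; apply: (Imax J) => //; split=> //; last exact: IJ.
split.
- by move=> _ [i [z [Ii az ->]]]; split=> //; apply: aintD; [exact: (IO _ Ii).2|
    apply: aintM => //; exact: ox.2].
- exact: IJ.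
- move=> _ _ [i [z [Ii az ->]]] [i' [z' [Ii' az' ->]]]; exists (i + i'), (z + z').
  by split; [exact: ID|exact: aintD|ring].
- move=> a _ [_ aa] [i [z [Ii az ->]]]; exists (a * i), (a * z).
  by split; [exact: IM|exact: aintM|ring].
Qed.

Lemma nat_notin (s : seq Om) : exists c : nat, c%:R \notin s.
Proof.
apply: contrapT => nex; have all_in c : (c%:R : Om) \in s.
  by apply/negPn/negP => nc; apply: nex; exists c.
have /uniq_leq_size : uniq [seq (c%:R : Om) | c <- iota 0 (size s).+1].
  rewrite map_inj_uniq ?iota_uniq // => a b /eqP.
  by rewrite !pmulrn => /eqP /intr_injQ [].
move=> /(_ s); rewrite size_map size_iota ltnn => H.
by apply/notF/H => y /mapP [c _ ->].
Qed.

Lemma prim_elem (S : seq Om) : exists t, [/\ aint t,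
  (forall x, x \in S -> sfix t x) &
  forall g, (forall x, x \in S -> g x = x) -> g t = t].
Proof.
elim: S => [|x S [t [at_ tS tg]]].
  by exists 0; split=> //; [exact: aint0|move=> g _; rewrite rmorph0].
have [m m0 amx] := alg_multiple x; pose x' := m%:~R * x.
have m0' : m%:~R != 0 :> Om by rewrite intr_eq0Q.
have x'x g : g x' = x' -> g x = x.
  by rewrite /x' rmorphM /= rmorph_int => /(mulfI m0').
(* The excluded quotients are the only values of c for which some g could fix t + c x' and move
   x'. *)
have [c cn] := nat_notin [seq (y - t) / (x' - z) | y <- orb t, z <- orb x'].
exists (t + c%:R * x'); split.
- by apply: aintD => //; apply: aintM => //; exact: aint_nat.
- have key g : g (t + c%:R * x') = t + c%:R * x' -> g x' = x' /\ g t = t.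
    rewrite rmorphD rmorphM /= rmorph_nat => E.
    have [gx|gx] := eqVneq (g x') x'; first by split=> //; move: E; rewrite gx => /addIr.
    exfalso; move/negP: cn; apply; apply/allpairsP; exists (g t, g x') => /=.
    split; [by apply/orbP; exists g|by apply/orbP; exists g|].
    have d0 : x' - g x' != 0 by rewrite subr_eq0 eq_sym.
    apply: (mulIf d0); rewrite divfK //.
    have -> : c%:R * (x' - g x') = (t + c%:R * x') - t - c%:R * g x' by ring.
    by rewrite -E; ring.
  move=> y; rewrite inE => /orP [/eqP -> g /key [/x'x]//|yS g /key [_ gt]].
  exact: (tS y yS).
- move=> g gS; rewrite rmorphD rmorphM /= rmorph_nat tg; last first.
    by move=> y yS; apply: gS; rewrite inE yS orbT.
  by rewrite /x' rmorphM /= rmorph_int gS // mem_head.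
Qed.

(** The coefficients of the product of the X - y over the U-orbit of t generate the fixed field of
    U: an element fixing them sends t into this orbit, so it lies in U times the stabilizer of t. *)
Lemma prim_subgroup t (U : set gal) : U 1%g ->
  (forall g h, U g -> U h -> U (g * h)%g) -> (forall g, U g -> U (g^-1)%g) ->
  (forall g, g t = t -> U g) ->
  exists2 e, aint e & forall g, g e = e <-> U g.
Proof.
move=> U1 UM UV Ut.
pose ot := [seq y <- orb t | `[< exists2 h, U h & h t = y >]].
have otP y : reflect (exists2 h, U h & h t = y) (y \in ot).
  rewrite mem_filter; apply: (iffP andP) => [[/asboolP //]|[h Hh <-]].
  by split; [apply/asboolP; exists h|apply/orbP; exists h].
have uot : uniq ot by rewrite filter_uniq // orb_uniq.
pose P : {poly Om} := \prod_(y <- ot) ('X - y%:P).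
have gP g : map_poly g P = \prod_(y <- [seq g y | y <- ot]) ('X - y%:P).
  rewrite big_map rmorph_prod; apply: eq_bigr => y _.
  by rewrite rmorphB /= map_polyX map_polyC.
have [e [ae eS eg]] := prim_elem P.
exists e => // g; split=> [ge|Ug].
  have gPP : map_poly g P = P.
    apply/polyP => i; rewrite coef_map /=.
    have [si|si] := ltnP i (size P); last by rewrite nth_default // rmorph0.
    by apply: (eS P`_i) => //; exact: mem_nth.
  have : root P (g t).
    by rewrite -gPP gP root_prod_XsubC map_f //; apply/otP; exists 1%g.
  rewrite root_prod_XsubC => /otP [h Uh hg].
  have -> : g = (h * (h^-1 * g))%g by rewrite mulgA mulgV mul1g.
  by apply: UM => //; apply: Ut; rewrite gal_mulE -hg gal_invK.
apply: eg => x /(nthP 0) [i _ <-].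
have gPP : map_poly g P = P.
  rewrite gP; apply: perm_big; apply: uniq_perm => //.
    by rewrite map_inj_uniq //; exact: fmorph_inj.
  move=> y; apply/idP/idP => [/mapP [u /otP [k Hk <-] ->]|/otP [k Hk <-]].
    by apply/otP; exists (g * k)%g => //; exact: UM.
  apply/mapP; exists ((g^-1 * k)%g t); last by rewrite gal_mulE gal_Kinv.
  by apply/otP; exists (g^-1 * k)%g => //; apply: UM => //; exact: UV.
by have /(congr1 (fun q : {poly Om} => q`_i)) := gPP; rewrite coef_map.
Qed.

End Places.

(** * Norms and counting *)

Section OrbitNorm.
Context (Qb : alg_closure rat).
Local Notation Om := (ac_field Qb).
Local Notation gal := (absgal Qb).
Implicit Types (g h : gal) (x y z : Om).
Local Notation ev P y := (map_poly (intr : int -> Om) P).[y].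

Lemma orb_conj t y : y \in orb t -> perm_eq (orb y) (orb t).
Proof.
move=> /orbP [g <-]; apply: uniq_perm; rewrite ?orb_uniq // => z.
apply/orbP/orbP => [[h <-]|[h <-]]; first by exists (h * g)%g.
by exists (h * g^-1)%g; rewrite gal_mulE gal_invK.
Qed.

Lemma orb_disc_conj t y : y \in orb t -> orb_disc y = orb_disc t.
Proof.
move=> yt; have pe := orb_conj yt; rewrite /orb_disc (perm_big _ pe) /=.
by apply: eq_bigr => z _; rewrite /orb_diff (perm_big _ pe).
Qed.

Lemma ev_gal_orb t y z (P : {poly int}) : y \in orb t -> z \in orb t ->
  exists g, g y = z /\ forall P : {poly int}, g (ev P y) = ev P z.
Proof.
move=> /orbP [g <-] /orbP [h <-]; exists (h * g^-1)%g.
by rewrite gal_mulE gal_invK; split=> // Q; rewrite gal_horner gal_mulE gal_invK.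
Qed.

Section Norm.
Context (t : Om) (at_ : aint t).
Local Notation n := (size (orb t)).

Definition nrm (P : {poly int}) : int :=
  xget 0 [set N : int | \prod_(y <- orb t) ev P y = N%:~R].

Lemma orb_gt0 : (0 < n)%N.
Proof. by have := orb_self t; case: (orb t). Qed.

Lemma nrmE P : (nrm P)%:~R = \prod_(y <- orb t) ev P y.
Proof.
rewrite /nrm; case: xgetP => [N _ /= -> //|].
have [||N NE] := @gal_fixed_aint Qb (\prod_(y <- orb t) ev P y).
- rewrite big_seq; apply: aint_prod => y yt; apply: aint_horner.
  exact: aint_orb yt.
- move=> g; rewrite rmorph_prod -[RHS](perm_big _ (orb_perm t g)) big_map.
  by apply: eq_bigr => y _; rewrite /= gal_horner.
by move/(_ N); rewrite /= NE.
Qed.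

Lemma ev_orb_eq0 P y z : y \in orb t -> z \in orb t -> ev P y = 0 -> ev P z = 0.
Proof.
move=> yt zt; have [g [_ gP]] := ev_gal_orb 0 yt zt.
by rewrite -(gP P) => ->; rewrite rmorph0.
Qed.

Lemma nrm_neq0 (P : {poly int}) : P != 0 -> (size P <= n)%N -> nrm P != 0.
Proof.
move=> P0 sP; rewrite -(intr_eq0Q Qb) nrmE prodf_seq_neq0; apply/allP => y yt /=.
apply/negP => /eqP Py.
have mP0 : map_poly intr P != 0 :> {poly Om}.
  by rewrite map_poly_eq0_id0 ?intr_eq0Q ?lead_coef_eq0.
have := max_poly_roots mP0 _ (orb_uniq t).
rewrite size_map_inj_poly ?mulr0z //; last exact: intr_injQ.
rewrite ltnNge sP => -/(_ _)/notF; apply; apply/allP => z zt.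
by rewrite rootE; apply/eqP; apply: ev_orb_eq0 Py.
Qed.

Lemma nrm1 : nrm 1 = 1.
Proof.
apply: (@intr_injQ Qb); rewrite nrmE big1 // => y _.
by rewrite rmorph1 hornerC.
Qed.

Lemma nrm_mod (m : nat) (P P' : {poly int}) :
  (forall i, (m %| P`_i - P'`_i)%Z) -> (m %| nrm P - nrm P')%Z.
Proof.
move=> mP; have [m0|m_gt0] := posnP m.
  have -> : P = P'; last by rewrite subrr.
  by apply/polyP => i; have := mP i; rewrite m0 dvd0z subr_eq0 => /eqP.
pose q : {poly int} := \poly_(i < maxn (size P) (size P')) ((P`_i - P'`_i) %/ m)%Z.
have PE : P = P' + m%:Z *: q.
  apply/polyP => i; rewrite coefD coefZ coef_poly; case: ltnP => ii.
    by rewrite mulrC divzK // addrC subrK.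
  by rewrite mulr0 addr0 !nth_default //; move: ii; rewrite geq_max => /andP [].
have dec (s : seq Om) : {subset s <= orb t} -> exists2 z, aint z &
    \prod_(y <- s) ev P y - \prod_(y <- s) ev P' y = m%:R * z.
  elim: s => [|y s IH] sub.
    by exists 0; [exact: aint0|rewrite !big_nil subrr mulr0].
  have [|z az zE] := IH; first by move=> u us; apply: sub; rewrite inE us orbT.
  have ay : aint y by apply: (aint_orb at_); apply: sub; rewrite mem_head.
  rewrite !big_cons; exists (ev q y * \prod_(y <- s) ev P y + ev P' y * z).
    apply: aintD; apply: aintM => //; try exact: aint_horner.
    rewrite big_seq; apply: aint_prod => u us; apply: aint_horner.
    by apply: (aint_orb at_); apply: sub; rewrite inE us orbT.
  have -> : ev P y = ev P' y + m%:R * ev q y.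
    by rewrite {1}PE rmorphD /= map_polyZ hornerD hornerZ.
  rewrite mulrDr [m%:R * (ev P' y * z)]mulrCA -zE; ring.
have [z az zE] := dec _ (fun y yt => yt).
rewrite -!nrmE -intrB in zE.
have m0 : m%:R != 0 :> Om by rewrite natr_eq0Q -lt0n.
have [k zk] : exists k : int, z = k%:~R.
  apply: gal_fixed_aint => // g; apply: (mulfI m0).
  by rewrite -[in RHS]zE -(rmorph_int g) zE rmorphM /= rmorph_nat.
apply/dvdzP; exists k; apply: (@intr_injQ Qb).
by rewrite zE zk intrM mulrC.
Qed.

Lemma nrm_ub : exists2 C0 : nat, (0 < C0)%N & forall (H : nat) (P : {poly int}),
  (size P <= n)%N -> (forall i, (absz (P`_i)%R <= H)%N) -> (absz (nrm P) <= C0 * H ^ n)%N.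
Proof.
have [e eE] := closure_hom (ratr : {rmorphism rat -> algC}) (@ac_alg _ Qb).
pose B : algC := 1 + \sum_(y <- orb t) \sum_(i < n) `|e y| ^+ i.
have sum_ge0 y : 0 <= \sum_(i < n) `|e y| ^+ i.
  by apply: sumr_ge0 => i _; rewrite exprn_ge0.
have B1 : 1 <= B.
  by rewrite /B lerDl; apply: sumr_ge0.
have BP y : y \in orb t -> \sum_(i < n) `|e y| ^+ i <= B.
  move=> yt; rewrite /B (bigD1_seq y) ?orb_uniq //= addrCA lerDl.
  by rewrite addr_ge0 // sumr_ge0.
exists (Num.bound (B ^+ n)).
  have B0 := exprn_ge0 n (le_trans ler01 B1).
  rewrite lt0n; apply/eqP => b0; have := archi_boundP B0; rewrite b0 => H.
  by have := le_lt_trans B0 H; rewrite ltxx.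
move=> H P sP PH.
have key : (`|nrm P|%N%:R : algC) <= B ^+ n * H%:R ^+ n.
  have -> : (`|nrm P|%N%:R : algC) = `|e (nrm P)%:~R|.
    by rewrite rmorph_int -intr_norm -abszE.
  rewrite nrmE rmorph_prod normr_prod -exprMn.
  have -> : (B * H%:R) ^+ n = \prod_(y <- orb t) (B * H%:R).
    by rewrite big_const_seq count_predT iter_mulr_1.
  rewrite big_seq [leRHS]big_seq; apply: ler_prod => y yt; rewrite normr_ge0 /=.
  rewrite (@horner_coef_wide _ n) ?(leq_trans (size_poly _ _)) //.
  rewrite rmorph_sum /=; apply: (le_trans (ler_norm_sum _ _ _)).
  apply: (@le_trans _ _ ((\sum_(i < n) `|e y| ^+ i) * H%:R)); last first.
    by rewrite ler_wpM2r ?BP.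
  rewrite mulr_suml; apply: ler_sum => i _.
  rewrite rmorphM rmorphXn normrM normrX /= mulrC ler_wpM2l ?exprn_ge0 //.
  by rewrite coef_map /= rmorph_int -intr_norm -[H%:R]/((H%:Z)%:~R) ler_int -abszE lez_nat.
rewrite -(ler_nat algC); apply: (le_trans key); rewrite natrM natrX ler_wpM2r ?exprn_ge0 //.
by apply/ltW/archi_boundP; rewrite exprn_ge0 // (le_trans ler01 B1).
Qed.

(** A constant coefficient of at least [ka * E] dominates the other terms at every conjugate, so
    each factor of the norm has absolute value at least E. *)
Lemma nrm_lb : exists2 ka : nat, (0 < ka)%N & forall (E : nat) (P : {poly int}),
  (size P <= n)%N -> (forall i, (0 < i)%N -> (absz (P`_i)%R <= E)%N) ->
  (ka * E)%:Z <= P`_0 -> (E ^ n <= absz (nrm P))%N.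
Proof.
have [e eE] := closure_hom (ratr : {rmorphism rat -> algC}) (@ac_alg _ Qb).
pose B : algC := 1 + \sum_(y <- orb t) \sum_(i < n) `|e y| ^+ i.
have sum_ge0 y : 0 <= \sum_(i < n) `|e y| ^+ i.
  by apply: sumr_ge0 => i _; rewrite exprn_ge0.
have B1 : 1 <= B.
  by rewrite /B lerDl; apply: sumr_ge0.
have BP y : y \in orb t -> \sum_(i < n) `|e y| ^+ i <= B.
  move=> yt; rewrite /B (bigD1_seq y) ?orb_uniq //= addrCA lerDl.
  by rewrite addr_ge0 // sumr_ge0.
have B0 := le_trans ler01 B1.
exists (Num.bound B).
  rewrite lt0n; apply/eqP => b0; have := archi_boundP B0; rewrite b0 => H.
  by have := le_lt_trans B0 H; rewrite ltxx.
move=> E P sP PE P0; rewrite -(ler_nat algC).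
have -> : (`|nrm P|%N%:R : algC) = `|e (nrm P)%:~R|.
  by rewrite rmorph_int -intr_norm -abszE.
rewrite nrmE rmorph_prod normr_prod natrX.
have -> : (E%:R : algC) ^+ n = \prod_(y <- orb t) E%:R.
  by rewrite big_const_seq count_predT iter_mulr_1.
rewrite big_seq [leRHS]big_seq; apply: ler_prod => y yt; rewrite ler0n /=.
rewrite (@horner_coef_wide _ n) ?(leq_trans (size_poly _ _)) //.
have n0 := orb_gt0; move: BP sP; case: n n0 => // k _ BP sP.
rewrite big_ord_recl /= expr0 mulr1 rmorphD /=.
set S := \sum_(i < k) _.
have Sle : `|e S| <= (B - 1) * E%:R.
  rewrite /S rmorph_sum; apply: (le_trans (ler_norm_sum _ _ _)).
  apply: (@le_trans _ _ ((\sum_(i < k) `|e y| ^+ i.+1) * E%:R)); last first.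
    rewrite ler_wpM2r // lerBrDl; have := BP y yt; rewrite big_ord_recl expr0.
    by under eq_bigr do rewrite lift0.
  rewrite mulr_suml; apply: ler_sum => i _.
  rewrite rmorphM rmorphXn normrM normrX /= mulrC ler_wpM2l ?exprn_ge0 //.
  rewrite coef_map /= rmorph_int -intr_norm -[E%:R]/((E%:Z)%:~R) ler_int -abszE lez_nat.
  exact: PE.
apply: (le_trans _ (lerB_normD _ _)); rewrite lerBrDr.
apply: (@le_trans _ _ (B * E%:R)).
  by rewrite -[X in X + _]mul1r; apply: (le_trans (lerD (lexx _) Sle)); rewrite -mulrDl addrC subrK.
rewrite coef_map /= rmorph_int -intr_norm.
apply: (@le_trans _ _ ((Num.bound B)%:R * E%:R)).
  by rewrite ler_wpM2r // ltW // archi_boundP.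
rewrite -natrM -[X in X <= _]/((_%:Z)%:~R) ler_int.
by apply: (le_trans P0); exact: ler_norm.
Qed.

Context (D : int) (DE : orb_disc t = D%:~R) (fz : {poly int})
  (fzE : orbpoly t = map_poly intr fz).

Section AtPrime.
Context (p : nat) (Q : set Om) (plQ : place p Q) (p_pr : prime p)
  (pD : ~~ (p %| D)%Z).

Lemma ev_cong (P : {poly int}) x y : aint x -> aint y -> Q (x - y) ->
  Q (ev P x - ev P y).
Proof.
move=> ax ay Qxy; elim/poly_ind: P => [|P c IH].
  by rewrite rmorph0 !horner0 subrr; exact: (pl0 plQ).
rewrite rmorphD rmorphM /= map_polyX map_polyC !hornerD !hornerM !hornerX !hornerC.
set u := _.[x] in IH *; set v := _.[y] in IH *.
rewrite [X in Q X](_ : _ = (u - v) * x + v * (x - y)); last by ring.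
apply: (plD plQ); first exact: (plMr plQ).
by apply: (plM plQ) => //; exact: aint_horner.
Qed.

Lemma ev_nat (P : {poly int}) (r : nat) : ev P r%:R = (P.[r%:Z])%:~R.
Proof. by rewrite pmulrn horner_map. Qed.

Lemma orbpoly_nat (r : nat) : \prod_(y <- orb t) (r%:R - y) = (fz.[r%:Z])%:~R.
Proof.
rewrite -ev_nat -fzE horner_prod; apply: eq_bigr => y _.
by rewrite hornerXsubC.
Qed.

Lemma root_place (r : nat) : (p %| fz.[r%:Z])%Z ->
  exists2 y, y \in orb t & Q (r%:R - y).
Proof.
move=> /(pl_int plQ p_pr); rewrite -orbpoly_nat => /(pl_prod plQ) [y yt _|y yt [_ Qy]].
  by apply: aintB; [exact: aint_nat|exact: (aint_orb at_)].
by exists y.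
Qed.

Lemma unr_orb y : y \in orb t ->
  exists u, [/\ aint u, ~ Q u & forall P : {poly int}, Q (ev P y) ->
    exists2 z, aint z & u * ev P y = p%:R * z].
Proof.
move=> yt; have ay := aint_orb at_ yt.
have [|u [au _ nQu uP]] := pl_unr plQ p_pr ay _ pD; first by rewrite (orb_disc_conj yt).
exists u; split=> // P QP; apply: uP => //.
by move=> g gy; rewrite gal_horner gy.
Qed.

Let inQ (P : {poly int}) y := `[< Q (ev P y) >].

(** Because p does not divide the discriminant, every value lying in Q becomes a multiple of p after
    multiplication by an element outside Q. *)
Lemma prod_count (P : {poly int}) (s : seq Om) : {subset s <= orb t} ->
  exists u z, [/\ aint u, aint z, ~ Q u &
    u * \prod_(y <- s) ev P y = p%:R ^+ (count (inQ P) s) * z].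
Proof.
elim: s => [|y s IH] sub.
  exists 1, 1; rewrite big_nil /=; split; [exact: aint1|exact: aint1|exact: (pl1 plQ)|].
  by rewrite expr0.
have [|u [z [au az nQu uz]]] := IH; first by move=> v vs; apply: sub; rewrite inE vs orbT.
have yt : y \in orb t by apply: sub; rewrite mem_head.
have ay := aint_orb at_ yt; rewrite big_cons /= /inQ; case: asboolP => Qy.
  have [v [av nQv vP]] := unr_orb yt; have [w aw wE] := vP _ Qy.
  exists (u * v), (z * w); split; [exact: aintM|exact: aintM| |].
    by move=> /(pl_prime plQ) [].
  transitivity ((u * \prod_(j <- s) ev P j) * (v * ev P y)); first by ring.
  by rewrite uz wE exprS; ring.
exists u, (z * ev P y); split=> //; first by apply: aintM => //; exact: aint_horner.
by rewrite mulrCA uz add0n; ring.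
Qed.

Lemma nrm_count (P : {poly int}) :
  (Posz (p ^ count (inQ P) (orb t))%N %| nrm P)%Z.
Proof.
have [u [z [au az nQu uz]]] := @prod_count P _ (fun y yt => yt).
by apply: (pl_symb plQ p_pr au nQu az); rewrite nrmE.
Qed.

(** Each root r of f modulo p is congruent modulo Q to a conjugate y of t, and distinct r give
    distinct y. If p also divides P(r), then P(y) lies in Q and contributes a factor p to the
    norm. *)
Lemma nrm_roots (P : {poly int}) (A : {set 'I_p}) :
  (forall r, r \in A -> (p %| fz.[(r : nat)%:Z])%Z && (p %| P.[(r : nat)%:Z])%Z) ->
  (Posz (p ^ #|A|)%N %| nrm P)%Z.
Proof.
move=> AP; apply: dvdz_trans (nrm_count P); rewrite dvdzE /= dvdn_exp2l //.
have exy (r : 'I_p) : exists y, r \in A -> y \in orb t /\ Q ((r : nat)%:R - y).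
  have [/AP /andP [/root_place [y yt Qy] _]|] := boolP (r \in A); first by exists y.
  by exists 0.
have [yy yyP] := boolp.choice exy.
have inj : {in A &, injective yy}.
  move=> r r' rA rA' E; have [_ Q1] := yyP _ rA; have [_ Q2] := yyP _ rA'.
  have := plB plQ Q1 Q2; rewrite E opprB addrA subrK !pmulrn -intrB => /(pl_int plQ p_pr).
  move=> dv; apply/val_inj.
  have : ((r : nat)%:Z == (r' : nat)%:Z %[mod p])%Z by rewrite eqz_mod_dvd.
  by rewrite !modz_nat eqz_nat !modn_small ?ltn_ord // => /eqP.
rewrite cardE -(size_map yy) -size_filter; apply: uniq_leq_size.
  by rewrite map_inj_in_uniq ?enum_uniq // => r r'; rewrite !mem_enum; exact: inj.
move=> y /mapP [r]; rewrite mem_enum => rA ->; have [yt Qy] := yyP _ rA.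
rewrite mem_filter yt andbT; apply/asboolP.
have /andP [_ /(pl_int plQ p_pr)] := AP _ rA; rewrite -ev_nat => QP.
rewrite -[ev P (yy r)](subKr (ev P (r : nat)%:R)); apply: (plB plQ) => //.
by apply: ev_cong => //; [exact: aint_nat|exact: (aint_orb at_)].
Qed.

(** The product of the X - r over all residues r is congruent to X^p - X modulo p, so a solution of
    the latter modulo Q is congruent to some r. *)
Lemma frob_fix_root y : y \in orb t -> Q (y ^+ p - y) ->
  exists2 r : 'I_p, (p %| fz.[(r : nat)%:Z])%Z & Q ((r : nat)%:R - y).
Proof.
move=> yt Qy; have ay := aint_orb at_ yt.
pose G : {poly int} := \prod_(r < p) ('X - ((r : nat)%:Z)%:P).
have GE i : (p %| (G - ('X^p - 'X))`_i)%Z.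
  have FpE : map_poly (intr : int -> 'F_p) (G - ('X^p - 'X)) = 0.
    rewrite !rmorphB /= map_polyXn map_polyX rmorph_prod /=.
    have -> : 'X^p - 'X = \prod_(x : 'F_p) ('X - x%:P) :> {poly 'F_p}.
      by rewrite -finField_genPoly card_Fp.
    apply/eqP; rewrite subr_eq0; apply/eqP.
    rewrite (reindex (fun r : 'I_p => (r : nat)%:R : 'F_p)) /=.
      by apply: eq_bigr => r _; rewrite rmorphB /= map_polyX map_polyC.
    have FpK : cancel (fun x : 'F_p => inord (x : nat) : 'I_(p.-1.+1)) (fun r => (r : nat)%:R).
      move=> x; rewrite inordK ?natr_Zp // prednK ?prime_gt0 //.
      by have := ltn_ord x; rewrite [X in (_ < X)%N -> _]Fp_cast.
    exists (fun x : 'F_p => Ordinal (etrans (congr1 (fun m => (x < m)%N) (esym (Fp_cast p_pr))) (ltn_ord x))).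
      by move=> r _; apply: val_inj; rewrite /= val_Fp_nat // modn_small.
    by move=> x _; rewrite /= natr_Zp.
  have /(congr1 (fun q : {poly 'F_p} => q`_i)) := FpE.
  rewrite coef_map coef0 /=; move: (_`_i) => c; clear -p_pr => c0.
  have : ((c %% p)%Z%:~R : 'F_p) = 0.
    move: c0; rewrite {1}(divz_eq c p) intrD intrM -[p%:~R]/(p%:R).
    by rewrite (pcharf0 (pchar_Fp p_pr)) mulr0 add0r.
  rewrite -(gez0_abs (modz_ge0 c _)); last by rewrite eqz_nat -lt0n prime_gt0.
  rewrite -pmulrn => /eqP; rewrite -(dvdn_pcharf (pchar_Fp p_pr)) => /dvdnP [k kE].
  have lt : (`|(c %% p)%Z| < p)%N.
    by rewrite -ltz_nat gez0_abs ?modz_ge0 ?ltz_pmod ?ltz_nat ?prime_gt0 // eqz_nat -lt0n prime_gt0.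
  have k0 : k = 0%N by case: k kE lt => // k ->; rewrite mulSn ltnNge leq_addr.
  by apply/dvdz_mod0P/eqP; rewrite -absz_eq0 kE k0.
have : Q (ev G y).
  have -> : ev G y = ev (G - ('X^p - 'X)) y + (y ^+ p - y).
    by rewrite !rmorphB /= map_polyXn map_polyX !(hornerD, hornerN) hornerXn hornerX subrK.
  apply: (plD plQ) => //; rewrite horner_coef; apply: (pl_sum plQ) => i _.
  apply: (plMr plQ); first exact: aintX.
  by rewrite coef_map; apply/(pl_int plQ p_pr).
rewrite rmorph_prod /= horner_prod => /(pl_prod plQ) [r _ _|r _ [_]].
  rewrite rmorphB /= map_polyX map_polyC hornerXsubC; apply: aintB => //.
  exact: aint_int.
rewrite rmorphB /= map_polyX map_polyC hornerXsubC => /(plN plQ); rewrite opprB => Qr.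
exists r => //; apply/(pl_int plQ p_pr); rewrite -orbpoly_nat.
apply: (@pl_prod_mem _ _ _ plQ _ _ _ _ y) => // z zt _.
by apply: aintB; [exact: aint_nat|exact: (aint_orb at_)].
Qed.

Lemma count2_sq (P : {poly int}) y y' : y \in orb t -> y' \in orb t -> y != y' ->
  Q (ev P y) -> Q (ev P y') -> (Posz (p ^ 2)%N %| nrm P)%Z.
Proof.
move=> yt yt' yy' Qy Qy'; apply: dvdz_trans (nrm_count P).
rewrite dvdzE /= dvdn_exp2l // -size_filter -[2%N]/(size [:: y; y']).
apply: uniq_leq_size; first by rewrite /= inE yy'.
move=> z; rewrite !inE mem_filter => /orP [/eqP ->|/eqP ->]; rewrite ?yt ?yt' andbT;
  exact/asboolP.
Qed.

(** Let P(y) lie in Q. A Frobenius g for y also gives P(g y) in Q, and two such conjugates would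
    force p^2 into the norm; hence g y = y, so y is congruent to its p-th power and thus to an
    integer modulo Q. *)
Lemma nrm_prime_root (P : {poly int}) : (p %| nrm P)%Z ->
  ~~ (Posz (p ^ 2)%N %| nrm P)%Z ->
  exists2 r : 'I_p, (p %| fz.[(r : nat)%:Z])%Z & (p %| P.[(r : nat)%:Z])%Z.
Proof.
move=> /(pl_int plQ p_pr) + nsq; rewrite nrmE => /(pl_prod plQ) [y yt _|y yt [_ Qy]].
  exact/aint_horner/(aint_orb at_).
have ay := aint_orb at_ yt.
have [g Qg] := pl_frob plQ p_pr ay.
have Qgy : Q (ev P (g y)).
  rewrite -[ev P (g y)](subrK (ev P (y ^+ p))); apply: (plD plQ).
    by apply: ev_cong => //; [exact: aint_gal|exact: aintX].
  rewrite -[ev P (y ^+ p)](subKr (ev P y ^+ p)); apply: (plB plQ); last exact: frob_poly.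
  rewrite -(prednK (prime_gt0 p_pr)) exprS; apply: (plMr plQ) => //.
  exact/aintX/aint_horner.
have gyy : g y = y.
  apply/eqP/negPn/negP => gy; move/negP: nsq; apply.
  by apply: (@count2_sq P (g y) y) => //; exact: orb_gal.
have [|r dr Qr] := frob_fix_root yt.
  by rewrite -opprB; apply: (plN plQ); rewrite -{1}gyy.
exists r => //; apply/(pl_int plQ p_pr); rewrite -ev_nat.
rewrite -[ev P _](subrK (ev P y)); apply: (plD plQ) => //.
by apply: ev_cong => //; exact: aint_nat.
Qed.

(* Finitely many sublattices of Z[t] cover the elements whose norm is divisible
   by the square of p. *)
Definition sqlat y y' (P : {poly int}) : Prop :=
  if y == y' then exists u z, [/\ aint u, aint z, ~ Q u & u * ev P y = p%:R ^+ 2 * z]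
  else Q (ev P y) /\ Q (ev P y').

(** If only one conjugate y has P(y) in Q, the product of the other conjugate values is outside Q
    and serves as u. *)
Lemma sqlat_cover (P : {poly int}) : (Posz (p ^ 2)%N %| nrm P)%Z ->
  exists y y', [/\ y \in orb t, y' \in orb t & sqlat y y' P].
Proof.
move=> sq; have /(pl_int plQ p_pr) : (p %| nrm P)%Z.
  by apply: dvdz_trans sq; rewrite dvdzE /= dvdn_exp.
rewrite nrmE => /(pl_prod plQ) [y yt _|y yt [_ Qy]].
  exact/aint_horner/(aint_orb at_).
have [[y' [yt' yy' Qy']]|nex] := pselect (exists y', [/\ y' \in orb t, y != y' & Q (ev P y')]).
  by exists y, y'; rewrite /sqlat (negPf yy').
exists y, y; split=> //; rewrite /sqlat eqxx.
have [k NE] := dvdzP sq.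
exists (\prod_(z <- orb t | z != y) ev P z), k%:~R; split.
- rewrite big_seq_cond; apply: aint_prod => z /andP [zt _].
  exact/aint_horner/(aint_orb at_).
- exact: aint_int.
- move=> /(pl_prod plQ) [z zt _|z zt [zy Qz]].
    exact/aint_horner/(aint_orb at_).
  by apply: nex; exists z; rewrite eq_sym.
- rewrite mulrC -(bigD1_seq y (F := fun z => ev P z)) ?orb_uniq //= -nrmE NE intrM.
  by rewrite -natrX mulrC.
Qed.

Lemma sqlat_nrm y y' P : y \in orb t -> y' \in orb t -> sqlat y y' P ->
  (Posz (p ^ 2)%N %| nrm P)%Z.
Proof.
rewrite /sqlat => yt yt'; case: eqVneq => [_ [u [z [au az nQu uz]]]|yy' [Qy Qy']]; last first.
  exact: (@count2_sq P y y').
apply: (pl_symb plQ p_pr au nQu (x := z * \prod_(v <- orb t | v != y) ev P v)).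
  apply: aintM => //; rewrite big_seq_cond; apply: aint_prod => v /andP [vt _].
  exact/aint_horner/(aint_orb at_).
by rewrite nrmE (bigD1_seq y) ?orb_uniq //= mulrA uz mulrA.
Qed.

Lemma sqlatB y y' P P' : y \in orb t -> y' \in orb t ->
  sqlat y y' P -> sqlat y y' P' -> sqlat y y' (P - P').
Proof.
rewrite /sqlat => yt yt'; case: eqP => [_|_]; last first.
  by move=> [a b] [c d]; rewrite !rmorphB /= !hornerD !hornerN; split; exact: (plB plQ).
move=> [u [z [au az nQu uz]]] [u' [z' [au' az' nQu' uz']]].
exists (u * u'), (u' * z - u * z'); split.
- exact: aintM.
- by apply: aintB; exact: aintM.
- by move=> /(pl_prime plQ) [].
- rewrite rmorphB /= hornerD hornerN.
  transitivity (u' * (u * ev P y) - u * (u' * ev P' y)); first by ring.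
  by rewrite uz uz'; ring.
Qed.

Lemma sqlatZ y y' P (d : nat) : y \in orb t -> y' \in orb t -> ~~ (p %| d)%N ->
  sqlat y y' (d%:Z *: P) -> sqlat y y' P.
Proof.
rewrite /sqlat => yt yt' pd.
have nQd : ~ Q d%:R.
  by rewrite pmulrn => /(pl_int plQ p_pr); rewrite dvdzE /= (negPf pd).
have ea v : ev (d%:Z *: P) v = d%:R * ev P v by rewrite map_polyZ hornerZ.
rewrite !ea; case: eqP => [_|_].
  move=> [u [z [au az nQu uz]]]; exists (u * d%:R), z; split=> //.
  - by apply: aintM => //; exact: aint_nat.
  - by move=> /(pl_prime plQ) [||//|//] //; exact: aint_nat.
  - by rewrite -mulrA uz.
move=> [Q1 Q2]; split.
  move: Q1 => /(pl_prime plQ) [||//|//]; [exact: aint_nat|].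
  exact/aint_horner/(aint_orb at_).
move: Q2 => /(pl_prime plQ) [||//|//]; [exact: aint_nat|].
exact/aint_horner/(aint_orb at_).
Qed.

End AtPrime.
End Norm.
End OrbitNorm.

(** * Counting squarefree products of primes of degree one in Z[t] *)

Section Counting.
Local Close Scope classical_set_scope.
Context (Qb : alg_closure rat).
Local Notation Om := (ac_field Qb).
Context (t : Om) (at_ : aint t) (D : int) (DE : orb_disc t = D%:~R) (D_neq0 : D != 0)
  (fz : {poly int}) (fzE : orbpoly t = map_poly intr fz).
Local Notation n := (size (orb t)).
Local Notation nrm := (nrm t).
Local Notation vp v := (rVpoly (v : 'rV[int]_n)).

Lemma vp_coef_le (v : 'rV[int]_n) H : (forall i, (absz (v ord0 i) <= H)%N) ->
  forall k, (absz ((vp v)`_k)%R <= H)%N.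
Proof. by move=> vH k; rewrite coef_rVpoly; case: insub => [i|] //=. Qed.

Definition dvec E (c c' : {ffun 'I_n -> 'I_E}) : 'rV[int]_n :=
  \row_i ((c i : nat)%:Z - (c' i : nat)%:Z).

Lemma dvec_neq0 E (c c' : {ffun 'I_n -> 'I_E}) : c != c' -> vp (dvec c c') != 0.
Proof.
apply: contra_neq => d0; apply/ffunP => i; apply/val_inj.
have := congr1 (fun p : {poly int} => p`_i) d0; rewrite /= coef_rVpoly_ord coef0 mxE.
by move/eqP; rewrite subr_eq0 eqz_nat => /eqP.
Qed.

Lemma nrm_dvec_neq0 E (c c' : {ffun 'I_n -> 'I_E}) : c != c' -> nrm (vp (dvec c c')) != 0.
Proof. by move=> cc'; apply: nrm_neq0 => //; [exact: dvec_neq0|exact: size_poly]. Qed.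

Section Packing.
Context (C0 : nat) (C0_gt0 : (0 < C0)%N)
  (C0P : forall (H : nat) (P : {poly int}), (size P <= n)%N ->
    (forall i, (absz (P`_i)%R <= H)%N) -> (absz (nrm P) <= C0 * H ^ n)%N).

(** Let w be the largest side with C0 w^n < m. Two vectors in one cube of side w differ by an
    element of norm below m, so each cube contains at most one member of X; there are at most (E/w +
    1)^n cubes. *)
Lemma packing (E m : nat) (X : {set {ffun 'I_n -> 'I_E}}) : (0 < m)%N ->
  (forall c c', c \in X -> c' \in X -> c != c' -> (m <= absz (nrm (vp (dvec c c'))))%N) ->
  (#|X| * m <= 3 ^ n * (C0 * E ^ n + m))%N.
Proof.
move=> m0 Xm; have n0 := orb_gt0 t.
have exw : exists w, (C0 * w ^ n < m)%N by exists 0%N; rewrite exp0n // muln0.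
have wb w : (C0 * w ^ n < m)%N -> (w <= m)%N.
  move=> h; apply: leq_trans (ltnW h); apply: leq_trans (leq_pmull _ C0_gt0).
  case: w {h} => // w; rewrite -{1}[w.+1]expn1 leq_pexp2l //.
case: (ex_maxnP exw wb) => w wP wmax.
have wS : (m <= C0 * w.+1 ^ n)%N by rewrite leqNgt; apply/negP => /wmax; rewrite ltnn.
have [w0|w0] := posnP w.
  rewrite w0 exp1n muln1 in wS.
  have : (#|X| <= E ^ n)%N by rewrite (leq_trans (max_card _)) // card_ffun !card_ord.
  move=> XE; apply: (leq_trans (leq_mul XE wS)).
  by rewrite mulnC -[X in (X <= _)%N]mul1n leq_mul ?expn_gt0 ?leq_addr.
pose f (c : {ffun 'I_n -> 'I_E}) : {ffun 'I_n -> 'I_(E %/ w).+1} :=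
  [ffun i => inord (c i %/ w)].
have fin : {in X &, injective f}.
  move=> c c' cX c'X fE; apply/eqP/negPn/negP => cc'.
  have := Xm c c' cX c'X cc'; rewrite leqNgt => /negP; apply.
  apply: leq_ltn_trans wP; apply: C0P; first exact: size_poly.
  apply: vp_coef_le => i; rewrite mxE.
  have /(congr1 val) := congr1 (fun u : {ffun 'I_n -> 'I_(E %/ w).+1} => u i) fE.
  rewrite !ffunE /= !inordK ?ltnS ?leq_div2r ?(ltnW (ltn_ord _)) // => q.
  have := divn_eq (c i) w; have := divn_eq (c' i) w; rewrite q.
  have := ltn_pmod (c i) w0; have := ltn_pmod (c' i) w0.
  move: (c i %% w)%N (c' i %% w)%N (c' i %/ w * w)%N (nat_of_ord (c i)) (nat_of_ord (c' i)).
  by clear => a b d u v; lia.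
have Xle : (#|X| <= (E %/ w).+1 ^ n)%N.
  by rewrite -(card_in_imset fin) (leq_trans (max_card _)) // card_ffun !card_ord.
have [Ew|wE] := leqP E w.
  apply: (@leq_trans (3 ^ n * m)); last by rewrite leq_mul // leq_addl.
  rewrite leq_mul2r; apply/orP; right; apply: (leq_trans Xle).
  rewrite leq_exp2r // ltnS; apply: (@leq_trans (w %/ w)); first exact: leq_div2r.
  by rewrite divnn w0.
apply: (leq_trans (leq_mul Xle wS)); rewrite mulnCA -expnMn.
apply: (@leq_trans (C0 * (3 * E) ^ n)); last first.
  by rewrite expnMn mulnCA leq_mul // leq_addr.
rewrite leq_mul // leq_exp2r //.
have h1 := leq_trunc_div E w; have h2 : (E %/ w <= E)%N by exact: leq_div.
by move: h1 h2 wE; move: (E %/ w)%N => q; clear; nia.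
Qed.
End Packing.

Section Pairs.
Context (P0 : nat) (P0D : (absz D <= P0)%N).

Lemma P0_ndvd p : (P0 < p)%N -> ~~ (p %| D)%Z.
Proof.
move=> Pp; rewrite dvdzE /= gtnNdvd ?absz_gt0 //.
exact: leq_ltn_trans Pp.
Qed.

(** The pair (p, r) stands for the prime (p, t - r) of degree one of Z[t]. Sets of pairs stand for
    squarefree ideals with norm [pn], and [dset] collects the primes that contain P(t). *)
Definition good Y : {set 'I_Y.+1 * 'I_Y.+1} :=
  [set x : 'I_Y.+1 * 'I_Y.+1 | [&& prime x.1, P0 < x.1, x.2 < x.1 & ((x.1 : nat) %| fz.[(x.2 : nat)%:Z])%Z]%N].

Definition pn Y (a : {set 'I_Y.+1 * 'I_Y.+1}) : nat := \prod_(x in a) (x.1 : nat).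

Definition dset Y (P : {poly int}) : {set 'I_Y.+1 * 'I_Y.+1} :=
  [set x in good Y | ((x.1 : nat) %| P.[(x.2 : nat)%:Z])%Z].

Lemma goodP Y x : x \in good Y -> [/\ prime x.1, (P0 < x.1)%N, (x.2 < x.1)%N &
  ((x.1 : nat) %| fz.[(x.2 : nat)%:Z])%Z].
Proof. by rewrite inE => /and4P []. Qed.

Lemma pn_gt0 Y (a : {set 'I_Y.+1 * 'I_Y.+1}) : a \subset good Y -> (0 < pn a)%N.
Proof.
move=> /fintype.subsetP ag; apply: prodn_cond_gt0 => x /ag /goodP [+ _ _ _].
exact: prime_gt0.
Qed.

Lemma coprime_prod_dvd (I : eqType) (r : seq I) (F : I -> nat) N : uniq r ->
  (forall i j, i \in r -> j \in r -> i != j -> coprime (F i) (F j)) ->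
  (forall i, i \in r -> F i %| N)%N -> (\prod_(i <- r) F i %| N)%N.
Proof.
elim: r => [|i r IH] /=; first by rewrite big_nil dvd1n.
move=> /andP [ir ur] cop dv; rewrite big_cons Gauss_dvd.
  rewrite dv ?mem_head //= IH // => [j k jr kr|j jr].
    by apply: cop; rewrite inE ?jr ?kr orbT.
  by apply: dv; rewrite inE jr orbT.
rewrite big_seq; elim/big_ind: _ => [|u v cu cv|j jr]; first exact: coprimen1.
  by rewrite coprimeMr cu.
apply: cop; rewrite ?mem_head // ?inE ?jr ?orbT //.
by apply: contraNneq ir => ->.
Qed.

(** Primes above different p contribute coprime factors; those above one p are counted by
    [nrm_roots]. *)
Lemma pn_dset_dvd Y P : (pn (dset Y P) %| absz (nrm P))%N.
Proof.
pose A (p : 'I_Y.+1) := [set r : 'I_Y.+1 | (p, r) \in dset Y P].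
have -> : pn (dset Y P) = (\prod_(p <- index_enum 'I_Y.+1) (p : nat) ^ #|A p|)%N.
  rewrite /pn (eq_bigl (fun x => true && (x.2 \in A x.1))); last first.
    by case=> p r; rewrite /A /= [RHS]inE.
  rewrite -(pair_big_dep predT (fun p r => r \in A p) (fun p _ => p : nat)) /=.
  by apply: eq_bigr => p _; rewrite prod_nat_const.
have Apr p : A p != finset.set0 -> prime p /\ (P0 < p)%N.
  by move=> /finset.set0Pn [r]; rewrite !inE => /andP [/and4P [? ? _ _] _].
apply: coprime_prod_dvd; first exact: index_enum_uniq.
  move=> p q _ _ pq; have [->|/Apr [pp _]] := eqVneq (A p) finset.set0.
    by rewrite cards0 expn0 coprime1n.
  have [->|/Apr [qq _]] := eqVneq (A q) finset.set0; first by rewrite cards0 expn0 coprimen1.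
  by rewrite coprimeXl // coprimeXr // prime_coprime // dvdn_prime2.
move=> p _; have [->|/Apr [pp Pp]] := eqVneq (A p) finset.set0.
  by rewrite cards0 expn0 dvd1n.
have [Q plQ] := place_exists Qb pp.
pose B := [set r : 'I_p | (p %| fz.[(r : nat)%:Z])%Z && (p %| P.[(r : nat)%:Z])%Z].
have : (Posz (p ^ #|B|)%N %| nrm P)%Z.
  by apply: (@nrm_roots Qb t at_ D DE fz fzE p Q plQ pp (P0_ndvd Pp)) => r; rewrite inE.
rewrite dvdzE /=; apply: dvdn_trans; rewrite dvdn_exp2l //.
have p0 := prime_gt0 pp.
pose f (r : 'I_Y.+1) : 'I_p := insubd (Ordinal p0) (r : nat).
have Alt r : r \in A p -> (r < p)%N by rewrite !inE => /andP [/and4P []].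
have fE r : r \in A p -> f r = r :> nat.
  by move=> rA; rewrite /f val_insubd Alt.
rewrite -(card_in_imset (f := f) (D := A p)) ?subset_leq_card //.
  apply/fintype.subsetP => _ /imsetP [r rA ->]; rewrite inE fE //.
  by move: rA; rewrite !inE => /andP [/and4P [_ _ _ ->] ->].
by move=> r r' rA rA' E; apply/val_inj; rewrite -[LHS](fE r) // E fE.
Qed.

Lemma pnD Y (a b : {set 'I_Y.+1 * 'I_Y.+1}) : a \subset b ->
  pn b = (pn a * pn (b :\: a))%N.
Proof. by move=> ab; rewrite /pn (big_setID a) /= (finset.setIidPr ab). Qed.

(** The bound is independent of Y: each p occurring in b divides [pn b], so both entries of every
    pair are at most M. *)
Lemma few_small Y M : (#|[set b : {set 'I_Y.+1 * 'I_Y.+1} |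
  (b \subset good Y) && (pn b <= M)]| <= 2 ^ (M.+1 * M.+1))%N.
Proof.
pose f (b : {set 'I_Y.+1 * 'I_Y.+1}) : {set 'I_M.+1 * 'I_M.+1} :=
  [set (inord (x : 'I_Y.+1 * 'I_Y.+1).1, inord x.2) | x in b].
set S := [set b | _].
have small b x : b \in S -> x \in b -> (x.1 <= M)%N /\ (x.2 <= M)%N.
  rewrite inE => /andP [bg bM] xb; have [_ _ x21 _] := goodP (fintype.subsetP bg _ xb).
  have x1M : (x.1 <= M)%N.
    apply: leq_trans bM; apply: dvdn_leq; first exact: pn_gt0.
    by rewrite /pn (bigD1 x) //= dvdn_mulr.
  by split=> //; apply: leq_trans (ltnW x21) x1M.
have fin : {in S &, injective f}.
  have sub b b' : b \in S -> b' \in S -> f b = f b' -> b \subset b'.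
    move=> bS bS' fE; apply/fintype.subsetP => x xb.
    have : (inord x.1, inord x.2) \in f b' by rewrite -fE; apply/imsetP; exists x.
    move=> /imsetP [y yb [e1 e2]].
    have [h1 h2] := small _ _ bS xb; have [h3 h4] := small _ _ bS' yb.
    have -> // : x = y; rewrite [x]surjective_pairing [y]surjective_pairing; congr (_, _).
      by apply/val_inj; have := congr1 val e1; rewrite /= !inordK.
    by apply/val_inj; have := congr1 val e2; rewrite /= !inordK.
  by move=> b b' bS bS' fE; apply/eqP; rewrite finset.eqEsubset !sub.
rewrite -(card_in_imset fin) (leq_trans (max_card _)) //.
by rewrite -cardsT -powersetT card_powerset cardsT card_prod !card_ord.
Qed.

(** Thue's pigeonhole. The box of side H + 1 has more vectors than there are residues modulo a, so a
    contains a nonzero element u with coefficients at most H. Its remaining primes of degree one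
    form a set b of bounded norm, and the pair (u, b) determines a. *)
Lemma upper_count : exists C : nat, forall Y k,
  (#|[set a : {set 'I_Y.+1 * 'I_Y.+1} |
     [&& a \subset good Y, 2 ^ (n * k) <= pn a & pn a < 2 ^ (n * k.+1)]]|
   <= C * 2 ^ (n * k))%N.
Proof.
have [C0 C0_gt0 C0P] := nrm_ub at_.
(* M is C0 H^n divided by the least norm 2^(n k), for H = 2^(k+1). There are 2 H + 1 <= 6 * 2^k
   choices for each coordinate of u, whence the factor 6^n. *)
pose M := (C0 * 2 ^ n)%N; exists (6 ^ n * 2 ^ (M.+1 * M.+1))%N => Y k.
set S := [set a | _]; pose H := (2 ^ k.+1)%N.
have H0 : (0 < H)%N by rewrite expn_gt0.
have HE : (H ^ n = 2 ^ (n * k.+1))%N by rewrite /H -expnM mulnC.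
pose SM := [set b : {set 'I_Y.+1 * 'I_Y.+1} | (b \subset good Y) && (pn b <= M)%N].
pose uvec (u : {ffun 'I_n -> 'I_(H + H).+1}) : 'rV[int]_n := \row_i ((u i : nat)%:Z - H%:Z).
have ex (a : {set 'I_Y.+1 * 'I_Y.+1}) : exists ub : {ffun 'I_n -> 'I_(H + H).+1} * {set 'I_Y.+1 * 'I_Y.+1},
    a \in S -> [/\ ub.2 \in SM & a = dset Y (vp (uvec ub.1)) :\: ub.2].
  have [aS|naS] := boolP (a \in S); last by exists ([ffun=> ord0], finset.set0).
  move: (aS); rewrite inE => /and3P [ag a1 a2].
  pose rho (c : {ffun 'I_n -> 'I_H.+1}) : {ffun 'I_Y.+1 * 'I_Y.+1 -> 'I_Y.+1} :=
    [ffun x => if x \in a then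
       inord (absz ((vp (\row_i (c i : nat)%:Z)).[(x.2 : nat)%:Z] %% (x.1 : nat))%Z) else ord0].
  have Hlt : (pn a < H.+1 ^ n)%N.
    by apply: (leq_trans a2); rewrite -HE leq_exp2r ?orb_gt0.
  pose fam (x : 'I_Y.+1 * 'I_Y.+1) : pred 'I_Y.+1 :=
    fun y => if x \in a then (y < x.1)%N else y == ord0.
  have modlt (m : int) (p : nat) : (0 < p)%N -> (absz (m %% p)%Z < p)%N.
    by move=> p0; rewrite -ltz_nat gez0_abs ?modz_ge0 ?ltz_pmod // eqz_nat -lt0n.
  have rhoin c : rho c \in family fam.
    apply/familyP => x; rewrite ffunE /fam unfold_in /=.
    have [xa|/negPf xa] := boolP (x \in a); rewrite ?xa ?eqxx //.
    have [pr _ _ _] := goodP (fintype.subsetP ag _ xa).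
    by rewrite inordK ?modlt ?prime_gt0 // (leq_trans (modlt _ _ (prime_gt0 pr))) // ltnW.
  have cardfam : #|family fam| = pn a.
    rewrite card_family /image_mem foldrE big_map big_enum /= /pn.
    rewrite [RHS]big_mkcond /=; apply: eq_bigr => x _.
    rewrite /fam; case: ifP => xa; last by rewrite (eq_card (B := pred1 ord0)) ?card1.
    have [pr _ _ _] := goodP (fintype.subsetP ag _ xa).
    have xY : (x.1 <= Y.+1)%N by exact: ltnW.
    have winj : injective (widen_ord xY).
      by move=> u v /(congr1 val) /= uv; apply: val_inj.
    rewrite -[RHS]card_ord -(fintype.card_image winj).
    apply: eq_card => y; apply/idP/idP => [yx|/fintype.imageP [u _ ->]].
      apply/fintype.imageP; exists (Ordinal (yx : (y < x.1)%N)) => //.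
      exact: val_inj.
    by rewrite unfold_in /= ltn_ord.
  have [c [c' [cc' rE]]] : exists c c', c != c' /\ rho c = rho c'.
    apply: contrapT => nex; have inj : injective rho.
      by move=> c c' cE; apply/eqP/negPn/negP => cc'; apply: nex; exists c, c'.
    have := card_codom inj; rewrite card_ffun !card_ord => E.
    have : (#|codom rho| <= #|family fam|)%N.
      by apply/subset_leq_card/fintype.subsetP => _ /codomP [c ->]; exact: rhoin.
    by rewrite E cardfam leqNgt Hlt.
  pose u : {ffun 'I_n -> 'I_(H + H).+1} := [ffun i => inord (c i + H - c' i)].
  have uE : uvec u = dvec c c'.
    apply/rowP => i; rewrite !mxE ffunE inordK.
      by have := ltn_ord (c' i); rewrite ltnS => h; rewrite -subzn ?(leq_trans h) ?leq_addl // PoszD addrAC addrK.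
    by have := ltn_ord (c i); move: (nat_of_ord (c i)) (nat_of_ord (c' i)) => x y; lia.
  pose P := vp (dvec c c').
  have ad : a \subset dset Y P.
    apply/fintype.subsetP => x xa; rewrite inE (fintype.subsetP ag) //=.
    have [pr _ _ _] := goodP (fintype.subsetP ag _ xa).
    have := congr1 (fun r : {ffun _ -> 'I_Y.+1} => nat_of_ord (r x)) rE.
    rewrite /= !ffunE xa !inordK;
      try by rewrite (leq_trans (modlt _ _ (prime_gt0 pr))) // ltnW.
    move=> /eqP; rewrite -eqz_nat !gez0_abs ?modz_ge0 ?eqz_nat -?lt0n ?prime_gt0 //.
    rewrite eqz_mod_dvd /P -hornerN -hornerD.
    rewrite (_ : vp _ - vp _ = vp (dvec c c')) //.
    by rewrite -linearB /=; congr (rVpoly _); apply/rowP => i; rewrite !mxE.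
  have N0 : (0 < absz (nrm P))%N by rewrite absz_gt0 nrm_dvec_neq0.
  have dg : dset Y P :\: a \subset good Y.
    by apply/fintype.subsetP => x; rewrite !inE => /and3P [].
  exists (u, dset Y P :\: a) => _ /=; split; last first.
    by rewrite uE finset.setDDr finset.setDv finset.set0U (finset.setIidPr ad).
  rewrite inE dg /=.
  have le1 : (pn a * pn (dset Y P :\: a) <= C0 * 2 ^ (n * k.+1))%N.
    rewrite -pnD // -HE; apply: leq_trans (dvdn_leq N0 (pn_dset_dvd _ _)) _.
    apply: C0P; first exact: size_poly.
    apply: vp_coef_le => i; rewrite mxE.
    have := ltn_ord (c i); have := ltn_ord (c' i).
    by move: (nat_of_ord (c i)) (nat_of_ord (c' i)); clear => x y; lia.
  rewrite -(leq_pmul2l (expn_gt0 2 (n * k))) /M mulnCA -expnD addnC -mulnS.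
  by apply: leq_trans le1; rewrite leq_mul2r a1 orbT.
have [F FP] := boolp.choice ex.
have Fin : {in S &, injective F}.
  by move=> a a' aS aS' FE; rewrite (FP a aS).2 (FP a' aS').2 FE.
rewrite -(card_in_imset Fin).
apply: (@leq_trans #|finset.setX [set: {ffun 'I_n -> 'I_(H + H).+1}] SM|).
  apply/subset_leq_card/fintype.subsetP => _ /imsetP [a aS ->].
  by rewrite [F a]surjective_pairing finset.in_setX inE (FP a aS).1.
rewrite finset.cardsX cardsT card_ffun !card_ord mulnAC.
apply: leq_mul (few_small _ _).
rewrite [(n * k)%N]mulnC expnM -expnMn leq_exp2r ?orb_gt0 //.
by rewrite /H expnS; have := expn_gt0 2 k; move: (2 ^ k)%N; clear; lia.
Qed.

Lemma dset_sub Y P : dset Y P \subset good Y.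
Proof. by apply/fintype.subsetP => x; rewrite inE => /andP []. Qed.

Lemma pn_sub_dvd Y (a b : {set 'I_Y.+1 * 'I_Y.+1}) : a \subset b -> (pn a %| pn b)%N.
Proof. by move=> ab; rewrite (pnD ab) dvdn_mulr. Qed.

(** The vectors in question fall into n^2 classes, one for each pair of conjugates in [sqlat].
    Within a class all differences have norm divisible by p^2, so [packing] applies with m = p^2. *)
Lemma sq_count C0 (p E d : nat) (X : {set {ffun 'I_n -> 'I_E}})
    (b : {poly int}) : (0 < C0)%N ->
  (forall (H : nat) (P : {poly int}), (size P <= n)%N ->
    (forall i, (absz (P`_i)%R <= H)%N) -> (absz (nrm P) <= C0 * H ^ n)%N) ->
  prime p -> (P0 < p)%N -> ~~ (p %| d)%N ->
  (forall c, c \in X ->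
    (Posz (p ^ 2)%N %| nrm (b + d%:Z *: vp (\row_i (c i : nat)%:Z)))%Z) ->
  (#|X| * p ^ 2 <= n ^ 2 * (3 ^ n * (C0 * E ^ n + p ^ 2)))%N.
Proof.
move=> C0_gt0 C0P p_pr Pp pd Xsq; have [Q plQ] := place_exists Qb p_pr.
have pD := P0_ndvd Pp.
pose B c := b + d%:Z *: vp (\row_i ((c : {ffun 'I_n -> 'I_E}) i : nat)%:Z).
pose L (ij : 'I_n * 'I_n) := [set c in X | `[< sqlat p Q (orb t)`_ij.1 (orb t)`_ij.2 (B c) >]].
have Lle ij : (#|L ij| * p ^ 2 <= 3 ^ n * (C0 * E ^ n + p ^ 2))%N.
  apply: packing => //; first by rewrite expn_gt0 prime_gt0.
  move=> c c'; rewrite !inE => /andP [_ /asboolP Lc] /andP [_ /asboolP Lc'] cc'.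
  have mem1 : (orb t)`_ij.1 \in orb t by rewrite mem_nth.
  have mem2 : (orb t)`_ij.2 \in orb t by rewrite mem_nth.
  have := sqlatB plQ mem1 mem2 Lc Lc'.
  have -> : B c - B c' = d%:Z *: vp (dvec c c').
    rewrite /B opprD addrACA subrr add0r -scalerBr -linearB /=; congr (_ *: rVpoly _).
    by apply/rowP => i; rewrite !mxE.
  move/(sqlatZ at_ plQ p_pr mem1 mem2 pd)/(sqlat_nrm at_ DE plQ p_pr pD mem1 mem2).
  by rewrite dvdzE /=; apply: dvdn_leq; rewrite absz_gt0 nrm_dvec_neq0.
have sub : X \subset \bigcup_ij L ij.
  apply/fintype.subsetP => c cX.
  have [y [y' [yt yt' sl]]] := sqlat_cover at_ plQ p_pr (Xsq c cX).
  have iy : (index y (orb t) < n)%N by rewrite index_mem.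
  have iy' : (index y' (orb t) < n)%N by rewrite index_mem.
  apply/bigcupP; exists (Ordinal iy, Ordinal iy') => //.
  by rewrite inE cX /=; apply/asboolP; rewrite !nth_index.
have : (#|X| <= \sum_ij #|L ij|)%N.
  apply: (leq_trans (subset_leq_card sub)).
  elim/big_ind2: _ => // [|u1 v1 u2 v2 h1 h2]; first by rewrite cards0.
  by apply: (leq_trans (leq_card_setU _ _)); rewrite leq_add.
rewrite -(leq_pmul2r (m := p ^ 2)) ?expn_gt0 ?prime_gt0 // => h.
apply: (leq_trans h); rewrite big_distrl /=.
apply: (leq_trans (leq_sum _ (fun ij _ => Lle ij))).
by rewrite sum_nat_const card_prod card_ord.
Qed.

Lemma squarefree_dvd N M : (0 < N)%N -> (0 < M)%N ->
  (forall p, prime p -> ~~ (p ^ 2 %| N)%N) ->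
  (forall p, prime p -> (p %| N)%N -> (p %| M)%N) -> (N %| M)%N.
Proof.
move=> N0 M0 sq dv; apply/dvdn_partP => // p; rewrite mem_primes => /and3P [pp _ pN].
rewrite p_part; have -> : logn p N = 1%N; last by rewrite expn1 dv.
apply/eqP; rewrite eqn_leq; apply/andP; split; last by rewrite logn_gt0 mem_primes pp N0.
by rewrite leqNgt -pfactor_dvdn // sq.
Qed.

Lemma inv_sq_sum (F : realFieldType) (m k : nat) : (0 < m)%N ->
  \sum_(j < k) ((m + j).+1%:R ^+ 2)^-1 <= (m%:R)^-1 :> F.
Proof.
move=> m0.
have : \sum_(j < k) ((m + j).+1%:R ^+ 2)^-1 <= m%:R^-1 - (m + k)%:R^-1 :> F.
  elim: k => [|k IH]; first by rewrite addn0 big_ord0 subrr.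
  rewrite big_ord_recr /= addnS.
  apply: (le_trans (lerD IH (lexx _))).
  have j0 : (0 < (m + k)%:R :> F) by rewrite ltr0n addn_gt0 m0.
  rewrite -[(m + k).+1%:R]natr1; move: ((m + k)%:R : F) j0 => u u0.
  have u1 : 0 < u + 1 by rewrite addr_gt0.
  have h : ((u + 1) ^+ 2)^-1 <= u^-1 - (u + 1)^-1.
    have -> : u^-1 - (u + 1)^-1 = (u * (u + 1))^-1.
      by field; rewrite !gt_eqF.
    rewrite lef_pV2 ?posrE ?exprn_gt0 ?mulr_gt0 // expr2 ler_wpM2r ?ltW //.
    by rewrite ltrDl.
  by lra.
by move/le_trans; apply; rewrite gerBl invr_ge0.
Qed.

Lemma prime_dvd_fact_leq p m : prime p -> (p %| m`!)%N -> (p <= m)%N.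
Proof.
move=> pp; elim: m => [|m IH]; first by rewrite fact0 dvdn1 => /eqP p1; rewrite p1 in pp.
by rewrite factS Euclid_dvdM // => /orP [/dvdn_leq -> //|/IH /leqW].
Qed.

End Pairs.

(** At least half of the elements of a suitable shifted box have squarefree norm. All primes in such
    a norm come from primes of degree one by [nrm_prime_root], so the element determines a set a
    with [pn a] equal to its norm, and boundedly many elements share one a. *)
Lemma lower_count : exists P0 c1 c2 c3 E0 : nat,
  [/\ (absz D <= P0)%N, (0 < c1)%N, (0 < c2)%N, (0 < c3)%N &
    forall E Y, (E0 <= E)%N -> (c2 * E ^ n <= Y)%N ->
    (E ^ n <= c3 * #|[set a : {set 'I_Y.+1 * 'I_Y.+1} |
       [&& a \subset good P0 Y, c1 * E ^ n <= pn a & pn a <= c2 * E ^ n]]|)%N].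
Proof.
have [C0 C0_gt0 C0P] := nrm_ub at_; have [ka ka_gt0 kaP] := nrm_lb at_.
have n0 := orb_gt0 t.
have [K KE K0] : exists2 K, K = (n ^ 2 * 3 ^ n)%N & (0 < K)%N.
  by exists (n ^ 2 * 3 ^ n)%N; rewrite // muln_gt0 !expn_gt0 n0.
(* The primes p > P0 account for at most K C0 E^n / P0 <= E^n / 4 in the main term of the sieve. *)
pose P0 := maxn (absz D) (4 * K * C0).
have P0D : (absz D <= P0)%N by rewrite leq_maxl.
have P0K : (4 * K * C0 <= P0)%N by rewrite leq_maxr.
have P0_gt0 : (0 < P0)%N by apply: leq_trans P0K; rewrite !muln_gt0 K0 C0_gt0.
(* D0 is the factorial of P0: among primes, not dividing D0 means exceeding P0. *)
have [D0 D0P D0_gt0] : exists2 D0 : nat,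
    (forall p, prime p -> (P0 < p)%N = ~~ (p %| D0)%N) & (0 < D0)%N.
  exists P0`!; last exact: fact_gt0.
  move=> p pp; apply/idP/idP => [Pp|].
    by apply/negP => /(prime_dvd_fact_leq pp); rewrite leqNgt Pp.
  by rewrite ltnNge; apply: contra => pP; rewrite dvdn_fact // prime_gt0.
clearbody P0.
pose c1 := (D0 ^ n)%N; pose c2 := (C0 * ((ka + 2) * D0) ^ n)%N.
pose C4 := (3 ^ n * (C0 + 1))%N.
have c2_gt0 : (0 < c2)%N by rewrite muln_gt0 C0_gt0 expn_gt0 muln_gt0 addn_gt0 D0_gt0 orbT.
(* For E >= E0 the square of 4 K M is at most E^(2n) whenever M^2 <= c2 E^n; this controls the error
   term of the sieve. *)
pose E0 := (16 * K ^ 2 * c2)%N.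
exists P0, c1, c2, (2 * C4)%N, E0; split=> //.
- by rewrite expn_gt0 D0_gt0.
- by rewrite !muln_gt0 expn_gt0 addn1.
move=> E Y EE EY.
have E_gt0 : (0 < E)%N by apply: leq_trans EE; rewrite /E0 2!muln_gt0 expn_gt0 K0 c2_gt0.
pose V c : 'rV[int]_n := \row_i ((c : {ffun 'I_n -> 'I_E}) i : nat)%:Z.
(* The summand 1, with all else divisible by D0, makes the norm congruent to 1 modulo each prime up
   to P0. The large constant term meets the hypothesis of [nrm_lb] and keeps the norm at least (D0
   E)^n. *)
pose b : {poly int} := (1 + D0 * (ka * E))%:Z%:P.
pose B c := b + D0%:Z *: vp (V c).
have Bcoef c k : (B c)`_k = (if k == 0%N then (1 + D0 * (ka * E))%:Z else 0) +
    D0%:Z * (vp (V c))`_k by rewrite coefD coefZ coefC.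
have Vlt c k : 0 <= (vp (V c))`_k <= E%:Z.
  rewrite coef_rVpoly; case: insub => [i|] //=.
  by rewrite mxE; apply/andP; split=> //; rewrite lez_nat ltnW // ltn_ord.
have sB c : (size (B c) <= n)%N.
  apply: (leq_trans (size_polyD _ _)); rewrite geq_max.
  rewrite (leq_trans (size_polyC_leq1 _)) //=.
  exact: (leq_trans (size_scale_leq _ _) (size_poly _ _)).
have Blb c : ((D0 * E) ^ n <= absz (nrm (B c)))%N.
  apply: kaP => // [i i0|]; rewrite Bcoef.
    rewrite gtn_eqF //= add0r abszM /= leq_mul2l; apply/orP; right.
    by have /andP [] := Vlt c i; move: (_`_i); clear => x; lia.
  rewrite eqxx; have /andP [v0 _] := Vlt c 0%N.
  by move: (_`_0) v0; clear => x; nia.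
have Bub c : (absz (nrm (B c)) <= c2 * E ^ n)%N.
  rewrite /c2 -mulnA -expnMn; apply: C0P => // i; rewrite Bcoef.
  have /andP [] := Vlt c i; move: (_`_i) D0_gt0 E_gt0; clear => x.
  by case: eqP => _; nia.
have Bmod c p : prime p -> (p %| absz (nrm (B c)))%N -> (P0 < p)%N.
  move=> pp pN; rewrite D0P //; apply/negP => pD0.
  have : (p %| nrm (B c) - nrm 1)%Z.
    apply: nrm_mod => // i; rewrite Bcoef coef1.
    have -> : (if i == 0%N then (1 + D0 * (ka * E))%:Z else 0) + D0%:Z * (vp (V c))`_i
      - (i == 0%N)%:R = D0%:Z * ((if i == 0%N then (ka * E)%:Z else 0) + (vp (V c))`_i).
      by case: eqP => _; rewrite /= ?PoszD ?PoszM; ring.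
    by rewrite dvdz_mulr // dvdzE.
  rewrite nrm1 // => h.
  have : (p %| nrm (B c) - (nrm (B c) - 1))%Z by rewrite rpredB // dvdzE.
  by rewrite subKr dvdzE /= dvdn1 => /eqP p1; rewrite p1 in pp.
pose Good := [set c | [forall p : 'I_(c2 * E ^ n).+1, prime p ==> ~~ ((p : nat) ^ 2 %| absz (nrm (B c)))%N]].
have GoodP c : c \in Good -> forall p, prime p -> ~~ (p ^ 2 %| absz (nrm (B c)))%N.
  rewrite inE => /forallP h p pp; have [pl|pl] := ltnP p (c2 * E ^ n).+1.
    by have /implyP := h (Ordinal pl); apply.
  have N0 : (0 < absz (nrm (B c)))%N.
    by apply: leq_trans (Blb c); rewrite expn_gt0 muln_gt0 D0_gt0 E_gt0.
  apply/negP => /(dvdn_leq N0); rewrite leqNgt => /negP; apply.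
  apply: leq_ltn_trans (Bub c) _; apply: (leq_trans pl).
  by rewrite -{1}[p]expn1 leq_pexp2l // prime_gt0.
(* A prime whose square divides a norm lies above P0 and is at most M, the integer square root of c2
   E^n. Each p excludes at most K C0 E^n / p^2 + K vectors; the two parts sum to at most E^n / 4
   each. *)
have GoodC : (2 * #|~: Good| <= E ^ n)%N.
  have exM : exists M, (M ^ 2 <= c2 * E ^ n)%N by exists 0%N.
  have Mb M : (M ^ 2 <= c2 * E ^ n)%N -> (M <= c2 * E ^ n)%N.
    by apply: leq_trans; case: M => // M; rewrite -{1}[M.+1]expn1 leq_pexp2l.
  case: (ex_maxnP exM Mb) => M MP Mmax.
  pose k := (M - P0)%N.
  pose Bad p := [set c | prime p && (p ^ 2 %| absz (nrm (B c)))%N].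
  have sub : ~: Good \subset \bigcup_(j < k) Bad (P0 + j).+1.
    apply/fintype.subsetP => c; rewrite !inE negb_forall => /existsP [p].
    rewrite negb_imply negbK => /andP [pp pN].
    have Pp : (P0 < p)%N.
      by apply: (Bmod c) => //; apply: dvdn_trans pN; rewrite dvdn_exp.
    have N0 : (0 < absz (nrm (B c)))%N.
      by apply: leq_trans (Blb c); rewrite expn_gt0 muln_gt0 D0_gt0 E_gt0.
    have pM : (p <= M)%N by apply: Mmax; apply: leq_trans (dvdn_leq N0 pN) (Bub c).
    have jk : (p.-1 - P0 < k)%N by rewrite /k; move: Pp pM; clear; lia.
    have pE : (P0 + (p.-1 - P0)).+1 = p by move: Pp; clear; lia.
    by apply/bigcupP; exists (Ordinal jk) => //; rewrite inE /= pE pp.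
  have le1 : (#|~: Good| <= \sum_(j < k) #|Bad (P0 + j).+1|)%N.
    apply: (leq_trans (subset_leq_card sub)).
    elim/big_ind2: _ => // [|u1 v1 u2 v2 h1 h2]; first by rewrite cards0.
    by apply: (leq_trans (leq_card_setU _ _)); rewrite leq_add.
  have Ble p : (P0 < p)%N -> (#|Bad p|%:R <= (K * C0 * E ^ n)%N%:R * (p%:R ^+ 2)^-1 + K%:R :> rat).
    move=> Pp; have [pp|npp] := boolP (prime p); last first.
      have -> : Bad p = finset.set0 by apply/setP => c; rewrite !inE (negPf npp).
      by rewrite cards0 addr_ge0 // mulr_ge0 // invr_ge0 exprn_ge0.
    have p2 : 0 < (p%:R ^+ 2 : rat) by rewrite exprn_gt0 // ltr0n prime_gt0.
    rewrite -(ler_pM2r p2) mulrDl divfK ?gt_eqF // -natrX -!natrM -natrD ler_nat.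
    have := @sq_count P0 P0D C0 p E D0 (Bad p) b C0_gt0 C0P pp Pp.
    rewrite -D0P // => /(_ Pp) h; apply: (leq_trans (h _)).
      by move=> c; rewrite inE => /andP [_]; rewrite dvdzE.
    by rewrite mulnA -KE mulnDr mulnA.
  have le2 : (#|~: Good|%:R <= (K * C0 * E ^ n)%N%:R * P0%:R^-1 + (k * K)%N%:R :> rat).
    apply: (@le_trans _ _ (\sum_(j < k) #|Bad (P0 + j).+1|)%N%:R); first by rewrite ler_nat.
    rewrite natr_sum.
    apply: (@le_trans _ _ (\sum_(j < k) ((K * C0 * E ^ n)%N%:R * ((P0 + j).+1%:R ^+ 2)^-1 + K%:R))).
      by apply: ler_sum => j _; apply: Ble; rewrite ltnS leq_addr.
    rewrite big_split /= -mulr_sumr sumr_const card_ord -[K%:R *+ k]mulr_natl -natrM.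
    by rewrite lerD2r ler_wpM2l // inv_sq_sum.
  have le3 : ((K * C0 * E ^ n)%N%:R * P0%:R^-1 <= (E ^ n)%N%:R / 4 :> rat).
    rewrite ler_pdivrMr ?ltr0n // mulrAC ler_pdivlMr // -!natrM ler_nat.
    by move: P0K; move: (E ^ n)%N; clear; nia.
  have le4 : ((k * K)%N%:R <= (E ^ n)%N%:R / 4 :> rat).
    rewrite ler_pdivlMr // -natrM ler_nat.
    have kM : (k <= M)%N by exact: leq_subr.
    have EEn : (E <= E ^ n)%N by rewrite -{1}[E]expn1 leq_pexp2l.
    rewrite -(@leq_exp2r _ _ 2) //.
    move: kM EEn MP EE; rewrite /E0; move: (E ^ n)%N => En; clear -c2_gt0.
    rewrite -!mulnn => h1 h2 h3 h4.
    apply: (@leq_trans (16 * (K * K) * (M * M))).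
      by rewrite [leqRHS](_ : _ = M * K * 4 * (M * K * 4))%N; [rewrite leq_mul // leq_mul // leq_mul|lia].
    apply: (@leq_trans (16 * (K * K) * (c2 * En))); first by rewrite leq_mul2l h3 orbT.
    by rewrite mulnA leq_mul2r (leq_trans h4 h2) orbT.
  rewrite -(ler_nat rat) natrM; move: le2 le3 le4.
  by move: (_%:R * _^-1) (#|~: Good|%:R : rat) ((k * K)%:R : rat) ((E ^ n)%:R : rat) => u1 u2 u3 u4; lra.
have Gle : (E ^ n <= 2 * #|Good|)%N.
  have := cardsC Good; rewrite card_ffun !card_ord => h.
  by move: h GoodC; move: #|Good| #|~: Good| (E ^ n)%N; clear; lia.
have pnE c : c \in Good -> pn (dset P0 Y (B c)) = absz (nrm (B c)).
  move=> cG; have N0 : (0 < absz (nrm (B c)))%N.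
    by apply: leq_trans (Blb c); rewrite expn_gt0 muln_gt0 D0_gt0 E_gt0.
  apply/eqP; rewrite eqn_dvd pn_dset_dvd //=; apply: squarefree_dvd => //.
  - exact: pn_gt0 (dset_sub _ _ _).
  - exact: GoodP.
  move=> p pp pN; have Pp := Bmod c p pp pN.
  have [Q plQ] := place_exists Qb pp.
  have [||r r1 r2] := nrm_prime_root at_ DE fzE plQ pp (P0_ndvd P0D Pp) (P := B c).
  - by rewrite dvdzE.
  - by rewrite dvdzE /=; exact: GoodP.
  have pY : (p < Y.+1)%N by rewrite ltnS; apply: leq_trans EY; apply: leq_trans (Bub c); exact: dvdn_leq.
  have rY : (r < Y.+1)%N by apply: ltn_trans pY.
  rewrite /pn (bigD1 (Ordinal pY, Ordinal rY)) /= ?dvdn_mulr //.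
  by rewrite !inE /= pp Pp ltn_ord r1 r2.
set S := [set a | _].
have Sin c : c \in Good -> dset P0 Y (B c) \in S.
  move=> cG; have N0 : (0 < absz (nrm (B c)))%N.
    by apply: leq_trans (Blb c); rewrite expn_gt0 muln_gt0 D0_gt0 E_gt0.
  rewrite inE dset_sub /= pnE // /c1 -expnMn Blb Bub //.
(* Two vectors with the same a differ, up to the factor D0 prime to a, by an element contained in a,
   so the norm of the difference is at least [pn a] >= E^n and [packing] applies. *)
have fib a : (#|[set c in Good | dset P0 Y (B c) == a]| <= C4)%N.
  set X := [set c in Good | _].
  have En0 : (0 < E ^ n)%N by rewrite expn_gt0 E_gt0.
  have := @packing C0 C0_gt0 C0P E (E ^ n) X En0.
  rewrite (_ : C0 * E ^ n + E ^ n = (C0 + 1) * E ^ n)%N; last by rewrite mulnDl mul1n.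
  rewrite mulnA leq_pmul2r //; apply=> c c'.
  rewrite !inE => /andP [cG /eqP ca] /andP [cG' /eqP ca'] cc'.
  have cGm : c \in Good by rewrite inE.
  have le1 : (E ^ n <= pn a)%N.
    rewrite -ca pnE //; apply: leq_trans (Blb c).
    by rewrite leq_exp2r // leq_pmull.
  apply: (leq_trans le1).
  have N0 : (0 < absz (nrm (vp (dvec c c'))))%N by rewrite absz_gt0 nrm_dvec_neq0.
  apply: dvdn_leq => //; apply: dvdn_trans (pn_dset_dvd P0D Y _).
  apply: pn_sub_dvd; apply/fintype.subsetP => x xa.
  have : x \in dset P0 Y (B c) by rewrite ca.
  have : x \in dset P0 Y (B c') by rewrite ca'.
  move=> /finset.setIdP [_ d1] /finset.setIdP [xg d2]; apply/finset.setIdP; split=> //.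
  have [pr Px _ _] := goodP xg.
  have := rpredB d2 d1; rewrite -hornerN -hornerD.
  have -> : B c - B c' = D0%:Z *: vp (dvec c c').
    rewrite /B opprD addrACA subrr add0r -scalerBr -linearB /=; congr (_ *: rVpoly _).
    by apply/rowP => i; rewrite !mxE.
  rewrite hornerZ !dvdzE abszM /= Euclid_dvdM // -[_ || _]/(_ || _).
  by move: Px; rewrite D0P // => /negPf ->.
have : (#|Good| <= C4 * #|S|)%N.
  have -> : #|Good| = (\sum_(a in S) #|[set c in Good | dset P0 Y (B c) == a]|)%N.
    rewrite -sum1_card (partition_big (fun c => dset P0 Y (B c)) (mem S)) //=.
    by apply: eq_bigr => a _; rewrite -sum1_card; apply: eq_bigl => c; rewrite !inE.
  apply: (leq_trans (leq_sum _ (fun a _ => fib a))).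
  by rewrite sum_nat_const mulnC.
by move: Gle; rewrite -mulnA; move: (E ^ n)%N (C4 * #|S|)%N #|Good|; clear; lia.
Qed.
End Counting.

(** * The sum over roots modulo p as s tends to 1 *)

Section ZetaBounds.
Local Close Scope classical_set_scope.
Context (R : realType).

Lemma powR_opp_anti (a b s : R) : 0 < a -> a <= b -> 0 <= s -> b `^ (- s) <= a `^ (- s).
Proof.
move=> a0 ab s0; rewrite !powRN lef_pV2 ?posrE ?powR_gt0 ?(lt_le_trans a0) //.
by apply: ge0_ler_powR => //; rewrite nnegrE ltW // (lt_le_trans a0).
Qed.

Lemma powR_natprod (I : Type) (r : seq I) (P : pred I) (F : I -> nat) (s : R) :
  (\prod_(i <- r | P i) F i)%N%:R `^ s = \prod_(i <- r | P i) (F i)%:R `^ s.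
Proof.
apply: (big_morph (fun m : nat => m%:R `^ s)) => [a b|]; last by rewrite powR1.
by rewrite natrM powRM.
Qed.

Lemma powR_expn (m k : nat) (s : R) : (m ^ k)%N%:R `^ s = (m%:R `^ s) ^+ k.
Proof.
elim: k => [|k IH]; first by rewrite expn0 expr0 powR1.
by rewrite expnS exprS natrM powRM // IH.
Qed.

Lemma expR_quad (w : R) : 0 <= w <= 1 -> expR (w - w ^+ 2) <= 1 + w.
Proof.
move=> /andP [w0 w1].
have h : 0 < 1 - w + w ^+ 2 by nra.
have e1 : 1 - (w - w ^+ 2) <= expR (- (w - w ^+ 2)).
  by apply: le_trans (expR_ge1Dx _); rewrite addrC.
rewrite -[w - w ^+ 2]opprK expRN -[leRHS]invrK lef_pV2 ?posrE ?expR_gt0 //; last first.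
  by rewrite invr_gt0 ltr_pwDl.
apply: le_trans e1; rewrite -[leLHS]mul1r ler_pdivrMr ?ltr_pwDl //; nra.
Qed.

Lemma sum_subsets (I : finType) (A : {set I}) (w : I -> R) :
  \prod_(i in A) (1 + w i) = \sum_(B : {set I} | B \subset A) \prod_(i in B) w i.
Proof.
transitivity (\prod_i ((if i \in A then w i else 0) + 1)).
  rewrite big_mkcond; apply: eq_bigr => i _; case: ifP => _; first by rewrite addrC.
  by rewrite add0r.
rewrite bigA_distr big_mkcond [RHS]big_mkcond; apply: eq_bigr => B _ /=.
have [BA|nBA] := boolP (B \subset A).
  rewrite [RHS]big_mkcond; apply: eq_bigr => i _; case: ifP => // iB.
  by rewrite (fintype.subsetP BA).
have /fintype.subsetPn [i iB iA] := nBA.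
by rewrite (bigD1 i) //= iB (negPf iA) mul0r.
Qed.

Lemma geometric_le (q : R) N : 0 <= q < 1 -> \sum_(k < N) q ^+ k <= (1 - q)^-1.
Proof.
move=> /andP [q0 q1]; have h : 0 < 1 - q by rewrite subr_gt0.
rewrite -[leRHS]mul1r ler_pdivlMr // mulrC.
have -> : (1 - q) * (\sum_(k < N) q ^+ k) = 1 - q ^+ N.
  by rewrite -opprB mulNr -subrX1 opprB.
by rewrite gerBl exprn_ge0.
Qed.

Lemma geometric_eq (q : R) N : (1 - q) * (\sum_(k < N) q ^+ k) = 1 - q ^+ N.
Proof. by rewrite -opprB mulNr -subrX1 opprB. Qed.

Context (Qb : alg_closure rat).
Local Notation Om := (ac_field Qb).
Context (t : Om) (at_ : aint t) (D : int) (DE : orb_disc t = D%:~R) (D_neq0 : D != 0)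
  (fz : {poly int}) (fzE : orbpoly t = map_poly intr fz).
Local Notation n := (size (orb t)).

Definition pzeta P0 Y (s : R) : R :=
  \sum_(x in good fz P0 Y) (x.1 : nat)%:R `^ (- s).

Lemma prod_pn P0 Y (s : R) :
  \prod_(x in good fz P0 Y) (1 + (x.1 : nat)%:R `^ (- s)) =
  \sum_(a : {set 'I_Y.+1 * 'I_Y.+1} | a \subset good fz P0 Y) (pn a)%:R `^ (- s).
Proof. by rewrite sum_subsets; apply: eq_bigr => a _; rewrite powR_natprod. Qed.

(** The ratio q = m^(1-s) governs the geometric series over the scales m^k; these bounds compare 1 -
    q with s - 1 uniformly for 1 < s <= 2. *)
Lemma base_bounds (m : nat) : (1 < m)%N -> exists2 c : R, 0 < c & forall s, 1 < s <= 2 ->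
  [/\ 0 <= m%:R * m%:R `^ (- s) < 1, c * (s - 1) <= 1 - m%:R * m%:R `^ (- s),
      1 - m%:R * m%:R `^ (- s) <= ln m%:R * (s - 1), m%:R^-1 <= m%:R * m%:R `^ (- s) &
      exists N, (m%:R * m%:R `^ (- s)) ^+ N <= 2^-1].
Proof.
move=> m1; have m0 : 0 < m%:R :> R by rewrite ltr0n (ltn_trans _ m1).
have m1R : 1 < m%:R :> R by rewrite ltr1n.
set l := ln m%:R; have l0 : 0 < l by rewrite ln_gt0.
exists (l / (1 + l)); first by rewrite divr_gt0 // addr_gt0.
move=> s /andP [s1 s2].
set u := l * (s - 1); have u0 : 0 < u by rewrite mulr_gt0 // subr_gt0.
have qE : m%:R * m%:R `^ (- s) = expR (- u).
  rewrite /powR gt_eqF // -{1}(lnK (x := m%:R)) ?posrE // -expRD; congr expR.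
  by rewrite /u /l; ring.
rewrite qE; have e0 := expR_gt0 (- u).
have e1 : expR (- u) < 1 by rewrite expR_lt1 oppr_lt0.
split.
- by rewrite ltW.
- have : expR (- u) <= (1 + u)^-1.
    by rewrite expRN lef_pV2 ?posrE ?expR_gt0 ?addr_gt0 // expR_ge1Dx.
  have -> : (1 + u)^-1 = 1 - u / (1 + u) by field; rewrite gt_eqF // addr_gt0.
  have : l / (1 + l) * (s - 1) <= u / (1 + u).
    have -> : l / (1 + l) * (s - 1) = u / (1 + l) by rewrite /u; field; rewrite gt_eqF // addr_gt0.
    rewrite ler_pM2l // lef_pV2 ?posrE ?addr_gt0 // lerD2l /u ger_pMr //.
    by lra.
  by lra.
- have := expR_ge1Dx (- u); rewrite -/u; lra.
- rewrite -[m%:R]lnK ?posrE // -expRN ler_expR lerN2 -/l /u ger_pMr //; lra.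
- exists (Num.bound u^-1); rewrite -expRM_natl.
  have hb : u^-1 < (Num.bound u^-1)%:R by apply: archi_boundP; rewrite invr_ge0 ltW.
  apply: (@le_trans _ _ (expR (- 1))).
    rewrite ler_expR mulrN lerN2 -ler_pdivrMr // div1r; exact: ltW.
  rewrite expRN lef_pV2 ?posrE ?expR_gt0 //.
  by apply: le_trans (expR_ge1Dx 1); lra.
Qed.

(** Expanded into squarefree ideals and grouped by the scale 2^(n k) of their norms, the product is
    dominated through [upper_count] by a geometric series of ratio q. *)
Lemma prod_upper P0 : (absz D <= P0)%N -> exists2 C : R, 0 < C & forall Y s, 1 < s <= 2 ->
  \prod_(x in good fz P0 Y) (1 + (x.1 : nat)%:R `^ (- s)) <= C / (s - 1).
Proof.
move=> P0D; have [C CP] := upper_count at_ DE D_neq0 fzE P0D.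
have n0 := orb_gt0 t; pose m := (2 ^ n)%N.
have m1 : (1 < m)%N by rewrite -(expn0 2) ltn_exp2l.
have [c c0 cP] := base_bounds m1.
exists (C.+1%:R / c); first by rewrite divr_gt0.
move=> Y s s12; have [q01 qc _ _ _] := cP s s12; set q := m%:R * _ in q01 qc.
have /andP [s1 s2] := s12; have s0 : 0 <= s by lra.
rewrite prod_pn.
pose kk (a : {set 'I_Y.+1 * 'I_Y.+1}) := trunc_log m (pn a).
pose Kx := \max_(a : {set 'I_Y.+1 * 'I_Y.+1}) kk a.
have kkP a : (kk a < Kx.+1)%N by rewrite ltnS; exact: leq_bigmax.
rewrite (partition_big (fun a => Ordinal (kkP a)) predT) //=.
apply: (@le_trans _ _ (\sum_(k < Kx.+1) C%:R * q ^+ k)).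
  apply: ler_sum => k _.
  apply: (@le_trans _ _ (\sum_(a : {set 'I_Y.+1 * 'I_Y.+1} |
      [&& a \subset good fz P0 Y, 2 ^ (n * k) <= pn a & pn a < 2 ^ (n * k.+1)]%N)
      (m%:R `^ (- s)) ^+ k)).
    rewrite [leRHS](bigID (fun a => Ordinal (kkP a) == k)) /=.
    have -> : \sum_(i : {set 'I_Y.+1 * 'I_Y.+1} | (i \subset good fz P0 Y) && (Ordinal (kkP i) == k)) (pn i)%:R `^ (- s) =
        \sum_(i : {set 'I_Y.+1 * 'I_Y.+1} | [&& i \subset good fz P0 Y, 2 ^ (n * k) <= pn i & pn i < 2 ^ (n * k.+1)]%N && (Ordinal (kkP i) == k)) (pn i)%:R `^ (- s).
      apply: eq_bigl => a; case: eqP => ka; rewrite ?andbF ?andbT //.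
      have [ag|//] := boolP (a \subset good fz P0 Y).
      have /andP [h1 h2] := trunc_log_bounds m1 (pn_gt0 ag).
      have kE : kk a = k by have := congr1 val ka.
      by rewrite -/(kk a) kE /m -!expnM in h1 h2; rewrite h1 h2.
    apply: ler_wpDr; first by apply: sumr_ge0 => a _; rewrite exprn_ge0 // powR_ge0.
    apply: ler_sum => a /andP [/and3P [ag a1 a2] _].
    rewrite -powR_expn /m -expnM; apply: powR_opp_anti => //.
    by rewrite ler_nat.
  rewrite sumr_const -[_ *+ _]mulr_natl exprMn mulrA ler_wpM2r ?exprn_ge0 ?powR_ge0 //.
  rewrite -natrX -natrM ler_nat /m -expnM.
  by have := CP Y k; rewrite cardsE.
rewrite -mulr_sumr; apply: (@le_trans _ _ (C%:R * (1 - q)^-1)).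
  by rewrite ler_wpM2l // geometric_le.
have cs : 0 < c * (s - 1) by rewrite mulr_gt0 // subr_gt0.
apply: (@le_trans _ _ (C.+1%:R * (c * (s - 1))^-1)); last by rewrite invfM mulrA.
apply: ler_pM => //; first by rewrite invr_ge0; case/andP: q01; lra.
  by rewrite ler_nat.
by rewrite lef_pV2 ?posrE //; apply: lt_le_trans qc.
Qed.

Lemma good_w P0 Y (s : R) x : 1 <= s -> x \in good fz P0 Y ->
  0 <= (x.1 : nat)%:R `^ (- s) <= 2^-1.
Proof.
move=> s1 /goodP [pr _ _ _]; rewrite powR_ge0 /=.
apply: (@le_trans _ _ (2 `^ (- s))).
  by apply: powR_opp_anti; rewrite ?ler_nat ?prime_gt1 //; lra.
rewrite powRN lef_pV2 ?posrE ?powR_gt0 //.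
rewrite -{1}[2]powRr1 //; apply: ler_powR => //; lra.
Qed.

(** The inequality exp(w - w^2) <= 1 + w turns the bound on the product into a bound on the sum of
    the w - w^2. The squares at s are at most the terms at 3/2, and since w <= 1/2 those are at most
    2 (w - w^2); the bound already found, taken at 3/2, is a constant. *)
Lemma pzeta_upper P0 : (absz D <= P0)%N -> exists C : R, forall Y s, 1 < s <= 2 ->
  pzeta P0 Y s <= ln (s - 1)^-1 + C.
Proof.
move=> P0D; have [C C0 CP] := prod_upper P0D.
have key Y s : 1 < s <= 2 ->
    \sum_(x in good fz P0 Y) ((x.1 : nat)%:R `^ (- s) - ((x.1 : nat)%:R `^ (- s)) ^+ 2)
    <= ln (s - 1)^-1 + ln C.
  move=> s12; have /andP [s1 s2] := s12.
  have s10 : 0 < (s - 1)^-1 by rewrite invr_gt0 subr_gt0.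
  rewrite -lnM ?posrE // -ler_expR lnK ?posrE ?mulr_gt0 // mulrC.
  apply: le_trans (CP Y s s12); rewrite expR_sum; apply: ler_prod => x xg.
  rewrite expR_ge0 /= expR_quad //.
  by have /andP [h1 h2] := good_w (ltW s1) xg; rewrite h1; lra.
have h32 : 1 < (3%:R / 2 : R) <= 2 by lra.
exists (ln C + 2 * (ln (3%:R / 2 - 1)^-1 + ln C)) => Y s s12; have /andP [s1 s2] := s12.
have h1 := key Y _ s12; have h2 := key Y _ h32.
have sq : \sum_(x in good fz P0 Y) ((x.1 : nat)%:R `^ (- s)) ^+ 2 <=
    2 * \sum_(x in good fz P0 Y) ((x.1 : nat)%:R `^ (- (3%:R / 2)) -
      ((x.1 : nat)%:R `^ (- (3%:R / 2))) ^+ 2).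
  rewrite mulr_sumr; apply: ler_sum => x xg.
  have h32' : 1 <= (3%:R / 2 : R) by lra.
  have /andP [w0 w1] := good_w h32' xg.
  have le1 : ((x.1 : nat)%:R `^ (- s)) ^+ 2 <= (x.1 : nat)%:R `^ (- (3%:R / 2)) :> R.
    have [pr _ _ _] := goodP xg.
    have x0 : 0 < (x.1 : nat)%:R :> R by rewrite ltr0n prime_gt0.
    rewrite -powR_mulrn ?powR_ge0 // -powRrM; apply: ler_powR; first by rewrite ler1n prime_gt0.
    by lra.
  by move: w0 w1 le1; set w := _ `^ (- (3%:R / 2)) => w0 w1 le1; nra.
move: h1 h2 sq; rewrite /pzeta sumrB; lra.
Qed.

Lemma pzeta_lower : exists (P0 : nat) (C : R), (absz D <= P0)%N /\
  forall s, 1 < s <= 2 -> exists Y, ln (s - 1)^-1 - C <= pzeta P0 Y s.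
Proof.
have [P0 [c1 [c2 [c3 [E0 [P0D c1_0 c2_0 c3_0 LC]]]]]] := lower_count at_ DE D_neq0 fzE.
(* Consecutive scales differ by B^n > c2, so the ranges of norms furnished by [lower_count] at
   different scales are disjoint and no ideal is counted twice. *)
have n0 := orb_gt0 t; pose B := c2.+1; have B1 : (1 < B)%N by rewrite ltnS.
pose m := (B ^ n)%N; have m1 : (1 < m)%N by rewrite -(expn0 B) ltn_exp2l.
have [cb _ mP] := base_bounds m1.
pose c : R := (c3%:R)^-1 * (c2%:R ^+ 2)^-1 * (m%:R^-1) ^+ E0 * 2^-1 / ln m%:R.
have lm : 0 < ln m%:R :> R by rewrite ln_gt0 // ltr1n.
have c0 : 0 < c.
  by rewrite /c !(divr_gt0, mulr_gt0) // ?invr_gt0 ?exprn_gt0 ?invr_gt0 ?ltr0n // (ltn_trans _ m1).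
exists P0, (- ln c); split=> // s s12; have [q01 _ q2 q3 [N qN]] := mP s s12.
set q := m%:R * _ in q01 q2 q3 qN; have /andP [s1 s2] := s12.
have /andP [q0 q1] := q01.
(* N scales with q^N <= 1/2 already carry half of the infinite geometric series. Y exceeds every
   norm that occurs, and the exponents start at E0 so that [lower_count] applies. *)
pose Y := (c2 * m ^ (E0 + N))%N; exists Y.
have s10 : 0 < (s - 1)^-1 by rewrite invr_gt0 subr_gt0.
rewrite opprK -lnM ?posrE // -ler_expR lnK; last by rewrite posrE; exact: mulr_gt0.
apply: (@le_trans _ _ (\prod_(x in good fz P0 Y) (1 + (x.1 : nat)%:R `^ (- s)))); last first.
  rewrite /pzeta expR_sum; apply: ler_prod => x xg.
  by rewrite expR_ge1Dx andbT addr_ge0 // powR_ge0.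
rewrite prod_pn.
pose T (j : nat) (a : {set 'I_Y.+1 * 'I_Y.+1}) :=
  [&& a \subset good fz P0 Y, c1 * (B ^ (E0 + j)) ^ n <= pn a & pn a <= c2 * (B ^ (E0 + j)) ^ n]%N.
have T1 a i j : T i a -> T j a -> i = j.
  have lt i' j' : (i' < j')%N -> T i' a -> T j' a -> False.
    move=> ij /and3P [_ _ h1] /and3P [_ h2 _].
    have := leq_trans h2 h1; rewrite leqNgt => /negP; apply.
    apply: (@leq_trans (c2.+1 * (B ^ (E0 + i')) ^ n)); first by rewrite ltn_mul2r ltnSn expn_gt0 expn_gt0.
    apply: (@leq_trans ((B ^ (E0 + i').+1) ^ n)).
      rewrite expnS expnMn leq_mul2r; apply/orP; right.
      by rewrite -{1}[c2.+1]expn1 leq_pexp2l.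
    apply: (@leq_trans ((B ^ (E0 + j')) ^ n)); last by rewrite leq_pmull.
    by rewrite leq_exp2r // leq_exp2l // -addnS leq_add2l.
  by move=> Ti Tj; case: (ltngtP i j) => // ij; [case: (lt i j)|case: (lt j i)].
apply: (@le_trans _ _ (\sum_(j < N) \sum_(a | T j a) (pn a)%:R `^ (- s))); last first.
  rewrite (exchange_big_dep (fun a : {set 'I_Y.+1 * 'I_Y.+1} => a \subset good fz P0 Y)) /=; last first.
    by move=> j a _ /and3P [].
  apply: ler_sum => a ag; rewrite sumr_const -[leRHS]mulr1n.
  rewrite -[leLHS]mulr_natr -[leRHS]mulr_natr ler_wpM2l ?powR_ge0 // ler_nat.
  by apply/fintype.card_le1_eqP => i j Ti Tj; apply/val_inj; rewrite /= (@T1 a i j Ti Tj).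
have term j : (j < N)%N -> (c3%:R)^-1 * (c2%:R ^+ 2)^-1 * q ^+ (E0 + j) <=
    \sum_(a | T j a) (pn a)%:R `^ (- s).
  move=> jN; set En := ((B ^ (E0 + j)) ^ n)%N.
  have EnE : En = (m ^ (E0 + j))%N by rewrite /En /m -!expnM mulnC.
  apply: (@le_trans _ _ (\sum_(a | T j a) (c2 * En)%N%:R `^ (- s))); last first.
    apply: ler_sum => a /and3P [ag a1 a2]; apply: powR_opp_anti; last by lra.
      by rewrite ltr0n (pn_gt0 ag).
    by rewrite ler_nat.
  rewrite sumr_const -[leRHS]mulr_natl natrM powRM // EnE powR_expn.
  have hc : (m ^ (E0 + j) <= c3 * #|[pred a | T j a]|)%N.
    rewrite -EnE; apply: leq_trans (LC (B ^ (E0 + j))%N Y _ _) _.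
    - by apply: leq_trans (ltnW (ltn_expl _ B1)); rewrite leq_addr.
    - rewrite -/En EnE /Y leq_mul2l; apply/orP; right.
      by rewrite leq_exp2l // leq_add2l ltnW.
    - by rewrite leq_mul2l cardsE leqnn orbT.
  have hcR : c3%:R^-1 * m%:R ^+ (E0 + j) <= #|[pred a | T j a]|%:R :> R.
    by rewrite mulrC ler_pdivrMr ?ltr0n // -natrX -natrM ler_nat mulnC.
  have c2le : (c2%:R ^+ 2)^-1 <= c2%:R `^ (- s) :> R.
    rewrite powRN lef_pV2 ?posrE ?powR_gt0 ?exprn_gt0 ?ltr0n //.
    rewrite -powR_mulrn //; apply: ler_powR => //.
    by rewrite ler1n.
  rewrite /q exprMn.
  have -> : c3%:R^-1 * (c2%:R ^+ 2)^-1 * (m%:R ^+ (E0 + j) * m%:R `^ (- s) ^+ (E0 + j)) =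
    (c3%:R^-1 * m%:R ^+ (E0 + j)) * ((c2%:R ^+ 2)^-1 * m%:R `^ (- s) ^+ (E0 + j)) :> R by ring.
  apply: ler_pM; [by []| |exact: hcR|].
  - by apply: mulr_ge0; rewrite ?invr_ge0 ?exprn_ge0 ?powR_ge0.
  - by rewrite ler_wpM2r // exprn_ge0 // powR_ge0.
apply: (@le_trans _ _ (\sum_(j < N) (c3%:R)^-1 * (c2%:R ^+ 2)^-1 * q ^+ (E0 + j))); last first.
  by apply: ler_sum => j _; exact: term.
under eq_bigr do rewrite exprD mulrA.
rewrite -mulr_sumr.
have geo := geometric_eq q N.
have S0 : 2^-1 <= (1 - q) * \sum_(k < N) q ^+ k by rewrite geo; lra.
have Sge : 2^-1 / (ln m%:R * (s - 1)) <= \sum_(k < N) q ^+ k.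
  rewrite ler_pdivrMr ?mulr_gt0 ?subr_gt0 //; apply: (le_trans S0).
  rewrite mulrC ler_wpM2l // sumr_ge0 // => k _; exact: exprn_ge0.
rewrite /c.
set A := c3%:R^-1 / c2%:R ^+ 2 * m%:R^-1 ^+ E0.
have -> : (s - 1)^-1 * (A / 2 / ln m%:R) = A * (2^-1 / (ln m%:R * (s - 1))).
  by clearbody A; rewrite [(ln m%:R * _)^-1]invfM; ring.
rewrite /A.
apply: ler_pM; [by []| | |exact: Sge].
- by rewrite divr_ge0 // mulr_ge0 ?ltW // subr_gt0.
- apply: ler_wpM2l; first by [].
  by apply: lerXn2r; [rewrite nnegrE invr_ge0|rewrite nnegrE|exact: q3].
Qed.
End ZetaBounds.

(** * Primes of number fields *)

Section NumberField.
Context (K : fieldExtType rat) (Kb : alg_closure K).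

Lemma Qbar_alg (x : Kb) : algebraicOver (ac_emb Kb \o in_alg K : {rmorphism rat -> Kb}) x.
Proof.
have Kalg (a : K) : integralOver (ac_emb Kb \o in_alg K : {rmorphism rat -> Kb}) (ac_emb Kb a).
  have /polyOver1P [q qE] := minPolyOver 1%VS a.
  exists q; first by have := monic_minPoly 1%VS a; rewrite qE map_monic.
  rewrite (map_poly_comp (ac_emb Kb) (in_alg K)) -qE fmorph_root.
  exact: root_minPoly.
apply/integral_algebraic; have [p p0 rp] := ac_alg x.
apply: (@integral_root_monic _ _ _ _ ((lead_coef (map_poly (ac_emb Kb) p))^-1 *: map_poly (ac_emb Kb) p)).
- by rewrite monicE lead_coefZ mulVf // lead_coef_eq0 map_poly_eq0.
- by rewrite rootZ // invr_eq0 lead_coef_eq0 map_poly_eq0.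
- move=> c /(nthP 0) [i _ <-]; rewrite coefZ lead_coef_map coef_map -fmorphV -rmorphM.
  exact: Kalg.
Qed.

(** The same field regarded as an algebraic closure of Q; the Galois group of K becomes the subgroup
    [fixK]. *)
Definition Qbar : alg_closure rat := AlgClosure Qbar_alg.
Local Notation Om := (ac_field Kb).
Local Notation gal := (absgal Qbar).
Local Notation emb := (ac_emb Kb).
Implicit Types (g h : gal) (a b : K) (P : set K) (Q : set Om).

Lemma pcharK0 : [pchar K] =i pred0.
Proof. by move=> p; rewrite pchar_lalg pchar_num. Qed.

Definition fixK g : Prop := forall a, g (emb a) = emb a.

Lemma toQ_fix (s : absgal Kb) (q : rat) : s (ac_emb Qbar q) = ac_emb Qbar q.
Proof. exact: gal_fix. Qed.
Definition toQ (s : absgal Kb) : gal := @AbsGal rat Qbar s (gal_bij s) (toQ_fix s).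
Definition toK g (hg : fixK g) : absgal Kb := @AbsGal K Kb g (gal_bij g) hg.

Lemma K_gen : exists2 e : Om, aint (e : Qbar) & forall g, g e = e <-> fixK g.
Proof.
pose S := [seq emb b | b <- vbasis {:K}].
have [e [ae eS eg]] := @prim_elem Qbar S.
exists e => // g; split=> [ge a|fg]; last first.
  by apply: eg => _ /mapP [b _ ->]; exact: fg.
rewrite (coord_vbasis (memvf a)) rmorph_sum /= [LHS](rmorph_sum g); apply: eq_bigr => i _.
rewrite -mulr_algl !rmorphM /=; congr (_ * _).
  exact: (gal_fix g).
apply: (eS _ _ g ge); apply/mapP; exists (vbasis {:K})`_i => //.
by rewrite mem_nth // size_tuple.
Qed.

Lemma fixK_rel (x : Om) : (forall g, fixK g -> g x = x) -> exists a, x = emb a.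
Proof.
move=> fx; apply: (gal_fixed pcharK0) => s.
by have := fx (toQ s); apply=> a; exact: (gal_fix s).
Qed.

Lemma intK a : int_ring [set: K] a <-> aint (emb a : Qbar).
Proof.
split=> [[_ ia]|[p pm rp]]; first exact: aint_rmorph.
split=> //; exists p => //; rewrite -(fmorph_root emb) -map_poly_comp.
by rewrite (eq_map_poly (g := intr)) // => k /=; rewrite rmorph_int.
Qed.

Lemma emb_intr (m : int) : emb m%:~R = m%:~R. Proof. exact: rmorph_int. Qed.

Section Prime.
Context (P : set K) (PP : is_prime [set: K] P).
Local Notation O := (int_ring [set: K]).

Lemma kp_int a : P a -> O a. Proof. by case: PP => -[PO _ _ _] _ _ _; exact: PO. Qed.
Lemma kp0 : P 0. Proof. by case: PP => -[]. Qed.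
Lemma kp1 : ~ P 1. Proof. by case: PP. Qed.
Lemma kpD a b : P a -> P b -> P (a + b). Proof. by case: PP => -[_ _ PD _] _ _ _; exact: PD. Qed.
Lemma kpM a b : O a -> P b -> P (a * b). Proof. by case: PP => -[_ _ _ PM] _ _ _; exact: PM. Qed.
Lemma kp_prime a b : O a -> O b -> P (a * b) -> P a \/ P b.
Proof. by case: PP => _ _ _; apply. Qed.
Lemma O_int (m : int) : O m%:~R.
Proof. by apply/intK; rewrite emb_intr; exact: aint_int. Qed.
Lemma O_nat (m : nat) : O m%:R. Proof. exact: (O_int m). Qed.
Lemma OD a b : O a -> O b -> O (a + b).
Proof. by rewrite !intK rmorphD; exact: aintD. Qed.
Lemma OB a b : O a -> O b -> O (a - b).
Proof. by rewrite !intK rmorphB; exact: aintB. Qed.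
Lemma OM a b : O a -> O b -> O (a * b).
Proof. by rewrite !intK rmorphM; exact: aintM. Qed.
Lemma OX a k : O a -> O (a ^+ k).
Proof. by rewrite !intK rmorphXn; exact: aintX. Qed.
Lemma O_horner (q : {poly int}) a : O a -> O (map_poly intr q).[a].
Proof.
rewrite !intK => ia; have := aint_horner q ia.
have -> // : (map_poly intr q).[emb a] = emb (map_poly intr q).[a].
rewrite -horner_map -map_poly_comp; congr (_.[_]); apply: eq_map_poly => k /=.
by rewrite rmorph_int.
Qed.
Lemma kpN a : P a -> P (- a).
Proof. by rewrite -mulN1r; apply: kpM; exact: (O_int (-1)). Qed.
Lemma kpB a b : P a -> P b -> P (a - b).
Proof. by move=> Pa Pb; apply: kpD => //; exact: kpN. Qed.

Lemma int_annihil a : O a -> exists q : {poly int},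
  [/\ lead_coef q = 1, (map_poly intr q).[a] = 0 & a != 0 -> q`_0 != 0].
Proof.
move=> /intK ia; have [q qE] := orbpoly_int ia; exists q.
have qa : (map_poly (intr : int -> Om) q).[emb a] = 0.
  by apply/eqP; rewrite -rootE -qE root_prod_XsubC; exact: (@orb_self Qbar).
split.
- apply: (@intr_injQ Qbar); rewrite -lead_coef_map_inj //; last exact: intr_injQ.
  by rewrite -qE; apply/eqP; exact: monic_prod_XsubC.
- apply: (fmorph_inj emb); rewrite rmorph0 -horner_map -map_poly_comp -[RHS]qa.
  by congr (_.[_]); apply: eq_map_poly => k /=; rewrite rmorph_int.
- move=> a0; rewrite -(intr_eq0Q Qbar) -[_%:~R]/(intr _) -coef_map -qE -horner_coef0.
  rewrite horner_prod prodf_seq_neq0; apply/allP => y /orbP [g <-] /=.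
  by rewrite hornerXsubC sub0r oppr_eq0 fmorph_eq0 fmorph_eq0.
Qed.

Lemma poly_drop1 (q : {poly int}) : q = drop_poly 1 q * 'X + (q`_0)%:P.
Proof.
rewrite -[LHS](poly_take_drop 1) addrC; congr (_ + _).
by apply/polyP => -[|i]; rewrite coef_take_poly coefC.
Qed.

Lemma prime_char : exists2 p, prime p & P p%:R.
Proof.
have [x Px x0] : exists2 x, P x & x != 0 by case: PP.
have [q [_ qx q0]] := int_annihil (kp_int Px); have c0 := q0 x0.
have Pc : P (q`_0)%:~R.
  move: qx; rewrite {1}(poly_drop1 q) rmorphD rmorphM /= map_polyX map_polyC.
  rewrite hornerD hornerM hornerX hornerC => /eqP; rewrite addrC addr_eq0 => /eqP ->.
  by apply: kpN; apply: kpM => //; apply: O_horner; exact: kp_int.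
have ex : exists m, (0 < m)%N && `[< P m%:R >].
  exists (absz q`_0); rewrite absz_gt0 c0; apply/asboolP.
  case: (q`_0) Pc => m //; rewrite NegzE intrN => /kpN; by rewrite opprK.
case: (ex_minnP ex) => p /andP [p0 /asboolP Pp] pmin; exists p => //.
have p1 : (1 < p)%N.
  by rewrite ltn_neqAle p0 andbT; apply/eqP => p1; apply: kp1; rewrite -p1 in Pp.
apply/primeP; split=> // d /dvdnP [k pE].
have k0 : (0 < k)%N by move: p0; rewrite pE muln_gt0 => /andP [].
have d0 : (0 < d)%N by move: p0; rewrite pE muln_gt0 => /andP [].
move: Pp; rewrite pE natrM => /kp_prime [||Pk|Pd]; try exact: O_nat.
- have : (p <= k)%N by apply: pmin; rewrite k0; apply/asboolP.
  rewrite pE -{2}[k]muln1 leq_pmul2l // => d1; apply/orP; left.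
  by rewrite eqn_leq d1.
- have : (p <= d)%N by apply: pmin; rewrite d0; apply/asboolP.
  rewrite pE -{2}[d]mul1n leq_pmul2r // => k1; apply/orP; right.
  by have -> : k = 1%N by [apply/eqP; rewrite eqn_leq k1]; rewrite mul1n.
Qed.

Context (p : nat) (p_pr : prime p) (Pp : P p%:R).

Lemma kp_dvd (m : int) : P m%:~R <-> (p %| m)%Z.
Proof.
split=> [Pm|/dvdzP [k ->]]; last by rewrite intrM; apply: kpM; [exact: O_int|].
apply/negPn/negP => npm; apply: kp1.
have : coprimez p m by rewrite /coprimez /gcdz /= eqz_nat -/(coprime _ _) prime_coprime.
move=> /coprimezP [[u v] /= uv].
have /(congr1 (fun k : int => k%:~R : K)) := uv.
rewrite intrD !intrM -[1%:~R]/1 => <-.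
by apply: kpD; apply: kpM => //; exact: O_int.
Qed.

(** [pl_trans] gives g mapping P into Q. For the converse let a be outside P: its annihilating
    polynomial is X^j h modulo p with h(0) prime to p, so h(a) lies in P. If g a were in Q, then so
    would be h(0). *)
Lemma prime_contr Q : place (Qb := Qbar) p Q ->
  exists g, forall a, P a <-> O a /\ Q (g (emb a)).
Proof.
move=> plQ; have [e ae eP] := K_gen.
pose Q1 : set Om := [set emb a | a in P].
have embO x : aint (x : Qbar) -> sfix (Qb := Qbar) e x -> exists2 a, O a & x = emb a.
  move=> ax fx; have [g fg|a xE] := @fixK_rel x; first by apply: fx; apply/eP.
  by exists a => //; apply/intK; rewrite -xE.
have [||||||||||g _ gP] := @pl_trans Qbar p Q plQ e [set: gal] Q1 => //.
- move=> _ [a Pa <-]; split; first by apply/intK; exact: kp_int.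
  by move=> g /eP fg; exact: fg.
- by exists 0; [exact: kp0|exact: rmorph0].
- by move=> _ _ [a Pa <-] [b Pb <-]; exists (a + b); [exact: kpD|exact: rmorphD].
- move=> x _ ax fx [b Pb <-]; have [a Oa ->] := embO x ax fx.
  by exists (a * b); [exact: kpM|exact: rmorphM].
- move=> _ [a Pa <-] fa.
  have [|m mE] := @gal_fixed_aint Qbar (emb a) _ (fun g => fa g I).
    by apply/intK; exact: kp_int.
  rewrite mE; apply/(pl_int plQ p_pr)/kp_dvd.
  by have -> // : m%:~R = a; apply: (fmorph_inj emb); rewrite emb_intr mE.
exists g => a; split=> [Pa|[Oa Qa]].
  by split; [exact: kp_int|apply: gP; exists a].
have [//|nPa] := pselect (P a); exfalso.
have [q [lq qa _]] := int_annihil Oa.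
have ex : exists j, ~~ (p %| q`_j)%Z.
  exists (size q).-1; rewrite -lead_coefE lq.
  by rewrite dvdzE /= dvdn1 neq_ltn prime_gt1 // orbT.
case: (ex_minnP ex) => j pj jmin.
have kpX k : P (a ^+ k) -> False.
  elim: k => [|k IH]; first by rewrite expr0 => /kp1.
  by rewrite exprS => /kp_prime [||//|/IH]; [|exact: OX|].
have Ph : P (map_poly intr (drop_poly j q)).[a].
  have := qa; rewrite -{1}[q](poly_take_drop j) rmorphD rmorphM /= hornerD hornerM.
  rewrite map_polyXn hornerXn => /eqP; rewrite addr_eq0 => /eqP E.
  have Pt : P (map_poly intr (take_poly j q)).[a].
    rewrite horner_coef; elim/big_ind: _ => [||i _]; [exact: kp0|exact: kpD|].
    rewrite mulrC; apply: kpM; first exact: OX.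
    rewrite coef_map coef_take_poly /=; case: ltnP => ij; last by rewrite mulr0z; exact: kp0.
    by apply/kp_dvd/negPn/negP => /jmin; rewrite leqNgt ij.
  have : P ((map_poly intr (drop_poly j q)).[a] * a ^+ j).
    by rewrite -[_ * _]opprK -E; exact: kpN.
  by move/kp_prime => [||//|/kpX //]; [exact: O_horner|exact: OX].
have : Q (g (emb (map_poly intr (drop_poly j q)).[a])) by apply: gP; exists (map_poly intr (drop_poly j q)).[a].
set h := drop_poly j q; rewrite {1}(poly_drop1 h) rmorphD rmorphM /= map_polyX map_polyC.
rewrite hornerD hornerM hornerX hornerC !rmorphD !rmorphM /= emb_intr rmorph_int => Qh.
move/negP: pj; apply; rewrite -[q`_j]/(q`_(0 + j)) -coef_drop_poly -/h.
apply/(pl_int plQ p_pr); rewrite -[_%:~R](addKr (g (emb (map_poly intr (drop_poly 1 h)).[a]) * g (emb a))).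
apply: (plD plQ) => //; apply: (plN plQ); apply: (plM plQ) => //.
apply: (@aint_gal Qbar); apply/intK; exact: O_horner.
Qed.

End Prime.

Lemma contr_prime p Q g : prime p -> place (Qb := Qbar) p Q ->
  is_prime [set: K] [set a | int_ring [set: K] a /\ Q (g (emb a))] /\
  Q (g (emb p%:R)).
Proof.
move=> p_pr plQ; have Qp : Q (g (emb p%:R)) by rewrite !rmorph_nat; exact: (plp plQ).
split=> //; split; first split.
- by move=> a [].
- by split; [exact: (O_int 0)|rewrite !rmorph0; exact: (pl0 plQ)].
- move=> a b [Oa Qa] [Ob Qb']; split; first exact: OD.
  by rewrite !rmorphD; exact: (plD plQ).
- move=> a b Oa [Ob Qb']; split; first exact: OM.
  by rewrite !rmorphM; apply: (plM plQ) => //; apply: (@aint_gal Qbar); exact/intK.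
- by move=> [_]; rewrite !rmorph1; exact: (pl1 plQ).
- exists p%:R; first by split=> //; exact: O_nat.
  by rewrite -(fmorph_eq0 emb) rmorph_nat (natr_eq0Q Qbar) -lt0n prime_gt0.
- move=> a b Oa Ob [_]; rewrite !rmorphM => /(pl_prime plQ) [||Qa|Qb'].
  + by apply: (@aint_gal Qbar); exact/intK.
  + by apply: (@aint_gal Qbar); exact/intK.
  + by left.
  + by right.
Qed.

End NumberField.

(** * Norms of primes and primes of degree one *)

Section PrimeNorms.
Context (K : fieldExtType rat) (Kb : alg_closure K).
Local Notation Om := (ac_field Kb).
Local Notation Qb := (Qbar Kb).
Local Notation gal := (absgal (Qbar Kb)).
Local Notation emb := (ac_emb Kb).
Local Notation O := (int_ring [set: K]).
Implicit Types (g h : gal) (a b : K) (Q : set Om).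

Lemma primes_ofP (P : primes_of K) : is_prime [set: K] (val P).
Proof. by have /set_mem := valP P. Qed.

Definition rchar (P : set K) : nat := xget 0%N [set p | prime p /\ P p%:R].

Lemma rcharP (P : primes_of K) : prime (rchar (val P)) /\ val P (rchar (val P))%:R.
Proof.
rewrite /rchar; case: xgetP => [p _ [] //|].
by have [p pp Pp] := prime_char Kb (primes_ofP P) => /(_ p) [].
Qed.

Lemma rchar_uniq (P : primes_of K) p : prime p -> val P p%:R -> rchar (val P) = p.
Proof.
move=> pp Pp; have [pr Pr] := rcharP P; apply/eqP; rewrite -dvdn_prime2 //.
by have := (kp_dvd Kb (primes_ofP P) pr Pr p).1 Pp; rewrite dvdzE.
Qed.

Lemma cos_eq (P : set K) a b : is_prime [set: K] P ->
  ([set a + y | y in P] = [set b + y | y in P]) <-> P (a - b).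
Proof.
move=> PP; split=> [E|Pab].
  have : [set b + y | y in P] a by rewrite -E; exists 0; [exact: (kp0 PP)|rewrite addr0].
  by move=> [y Py <-]; rewrite addrC addKr.
apply/seteqP; split=> _ [y Py <-].
  by exists (a - b + y); [exact: (kpD PP)|ring].
by exists (y - (a - b)); [exact: (kpB Kb PP)|ring].
Qed.

Section Norm.
Context (P : primes_of K).
Let PP := primes_ofP P.
Let p := rchar (val P).
Let pp : prime p := (rcharP P).1.
Let Pp : val P p%:R := (rcharP P).2.
Let cosets : set (set K) := [set [set x + y | y in val P] | x in O].

(** For a generator e with discriminant D the element D a is a polynomial in e, and its coefficients
    modulo |D| p determine the coset of a. *)
Lemma cosets_finite : finite_set cosets.
Proof.
have [e ae eP] := K_gen Kb; have [D DE D0] := @orb_disc_int Qb e ae.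
set n := size (orb (Qb := Qb) e).
have exA a : exists A : {poly int}, O a ->
    (size A <= n)%N /\ (map_poly intr A).[e] = D%:~R * emb a.
  have [Oa|nO] := pselect (O a); last by exists 0.
  have [||A [sA AE _]] := @interp_disc Qb e (emb a) D ae _ _ DE.
  - exact/intK.
  - by move=> g /eP fg; exact: fg.
  - by exists A.
have [A AP] := boolp.choice exA.
pose M := (absz D * p).-1; have ME : M.+1 = (absz D * p)%N.
  by rewrite prednK // muln_gt0 absz_gt0 D0 prime_gt0.
pose r a : {ffun 'I_n -> 'I_M.+1} := [ffun i : 'I_n => inord (absz ((A a)`_i %% M.+1)%Z)].
pose F v := [set xget 0 [set a | O a /\ r a = v] + y | y in val P].
apply: (@sub_finite_set _ _ (F @` [set` predT])); last first.
  by apply: finite_image; exact: finite_finpred.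
move=> _ [a Oa <-]; exists (r a) => //; rewrite /F.
case: xgetP => [b _ [Ob rE]|/(_ a) []//]; apply/(cos_eq _ _ PP).
have dv i : (M.+1 %| (A b)`_i - (A a)`_i)%Z.
  have [ni|ni] := ltnP i n; last first.
    have [sa _] := AP a Oa; have [sb _] := AP b Ob.
    by rewrite !nth_default ?subrr ?dvdz0 // (leq_trans _ ni).
  have := congr1 (fun f : {ffun 'I_n -> 'I_M.+1} => nat_of_ord (f (Ordinal ni))) rE.
  have modlt (m : int) : (absz (m %% M.+1)%Z < M.+1)%N.
    by rewrite -ltz_nat gez0_abs ?modz_ge0 // ltz_pmod.
  rewrite !ffunE /= !inordK ?modlt // => /eqP.
  by rewrite -eqz_nat !gez0_abs ?modz_ge0 // eqz_mod_dvd.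
pose B : {poly int} := \poly_(i < n) (((A b)`_i - (A a)`_i) %/ M.+1)%Z.
have BE : A b - A a = M.+1%:Z *: B.
  apply/polyP => i; rewrite coefB coefZ coef_poly; case: ltnP => ni.
    by rewrite mulrC divzK.
  have [sa _] := AP a Oa; have [sb _] := AP b Ob.
  by rewrite mulr0 !nth_default ?subrr // (leq_trans _ ni).
have DE' : D%:~R * emb (b - a) = M.+1%:R * (map_poly intr B).[e].
  have := congr1 (fun q : {poly int} => (map_poly (intr : int -> Om) q).[e]) BE.
  rewrite /= rmorphB /= map_polyZ hornerD hornerN hornerZ (AP b Ob).2 (AP a Oa).2.
  by rewrite -mulrBr -rmorphB /= => ->.
have [c Oc cE] : exists2 c, O c & emb c = (map_poly intr B).[e].
  have [g fg|c cE] := @fixK_rel K Kb (map_poly intr B).[e].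
    by rewrite (@gal_horner Qb); congr (_.[_]); exact/eP.
  by exists c => //; apply/(intK Kb); rewrite -cE; exact: (@aint_horner Qb).
have sgnE : (absz D)%:R = (Num.sg D)%:~R * D%:~R :> Om.
  by rewrite -intrM -normrEsg -abszE.
have -> : b - a = ((Num.sg D)%:~R * p%:R) * c.
  apply: (fmorph_inj emb); apply: (mulfI (x := (D%:~R : Om))).
    by rewrite (intr_eq0Q Qb).
  rewrite DE' ME natrM sgnE !rmorphM /= emb_intr rmorph_nat cE; ring.
by rewrite mulrC; apply: (kpM PP) => //; apply: (kpM PP) => //; exact: (O_int Kb).
Qed.

Lemma norm_ge (s : seq K) : (forall a, a \in s -> O a) -> uniq s ->
  (forall a b, a \in s -> b \in s -> val P (a - b) -> a = b) ->
  (size s <= prime_norm P)%N.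
Proof.
move=> sO us sP; rewrite /prime_norm -(size_map (fun x => [set x + y | y in val P])).
apply: uniq_leq_size.
  by rewrite map_inj_in_uniq // => a b sa sb /(cos_eq _ _ PP); exact: sP.
move=> _ /mapP [a sa ->]; rewrite in_fset_set ?inE; last exact: cosets_finite.
by exists a => //; exact: sO.
Qed.

(* The residue field of P is the prime field. *)
Definition dg1 : Prop := forall a, O a -> exists m : nat, val P (a - m%:R).

Lemma nat_mod_p (m : int) : exists2 k : nat, (k < p)%N & val P (m%:~R - k%:R).
Proof.
exists (absz (m %% p)%Z).
  by rewrite -ltz_nat gez0_abs ?modz_ge0 ?ltz_pmod ?ltz_nat ?prime_gt0 // eqz_nat -lt0n prime_gt0.
have -> : (absz (m %% p)%Z)%:R = ((m %% p)%Z)%:~R :> K.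
  by rewrite pmulrn gez0_abs // modz_ge0 // eqz_nat -lt0n prime_gt0.
rewrite -intrB; apply/(kp_dvd Kb PP pp Pp); rewrite {1}(divz_eq m p) addrK.
exact: dvdz_mull.
Qed.

Lemma nat_inj_p (i j : nat) : (i < p)%N -> (j < p)%N -> val P (i%:R - j%:R) -> i = j.
Proof.
move=> ip jp; rewrite !pmulrn -intrB => /(kp_dvd Kb PP pp Pp) dv.
have : (i%:Z == j%:Z %[mod p])%Z by rewrite eqz_mod_dvd.
by rewrite !modz_nat eqz_nat !modn_small // => /eqP.
Qed.

Lemma norm_dg1 : dg1 -> prime_norm P = p.
Proof.
move=> d1; apply/eqP; rewrite eqn_leq; apply/andP; split.
  pose s := [seq [set (m%:R : K) + y | y in val P] | m <- iota 0 p].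
  rewrite -[p](size_iota 0) -(size_map (fun m : nat => [set (m%:R : K) + y | y in val P])).
  apply: uniq_leq_size; first exact: fset_uniq.
  move=> C; rewrite in_fset_set ?inE; last exact: cosets_finite.
  move=> [a Oa <-]; have [m Pm] := d1 a Oa; have [k kp Pk] := nat_mod_p m.
  apply/mapP; exists k; first by rewrite mem_iota.
  apply/(cos_eq _ _ PP); rewrite [_ - _](_ : _ = (a - m%:R) + (m%:R - k%:R)); last by ring.
  exact: (kpD PP).
rewrite -[X in (X <= _)%N](size_iota 0) -(size_map (fun m : nat => m%:R : K)).
have injm : {in iota 0 p &, injective (fun m : nat => m%:R : K)}.
  move=> i j; rewrite !mem_iota /= !add0n => ip jp E.
  by apply: nat_inj_p => //; rewrite E subrr; exact: (kp0 PP).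
apply: norm_ge; first by move=> _ /mapP [m _ ->]; exact: (O_nat Kb).
  by rewrite map_inj_in_uniq // iota_uniq.
move=> _ _ /mapP [i ii ->] /mapP [j jj ->] Pij; congr (_%:R).
by apply: nat_inj_p Pij; move: ii jj; rewrite !mem_iota.
Qed.

(** For x not congruent to an integer, the p^2 elements i + j x with 0 <= i, j < p lie in distinct
    cosets. *)
Lemma norm_ndg1 : ~ dg1 -> (p ^ 2 <= prime_norm P)%N.
Proof.
move=> /existsNP [x /not_implyP [Ox nx]].
have nx' (m : int) : ~ val P (x - m%:~R).
  move=> Pm; have [k _ Pk] := nat_mod_p m; apply: nx; exists k.
  by rewrite [_ - _](_ : _ = (x - m%:~R) + (m%:~R - k%:R)); [exact: (kpD PP)|ring].
have key (i j i' j' : nat) : (i < p)%N -> (j < p)%N -> (i' < p)%N -> (j' < p)%N ->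
    val P ((i%:R + j%:R * x) - (i'%:R + j'%:R * x)) -> i = i' /\ j = j'.
  move=> ip jp ip' jp' Pd; have [jj|jj] := eqVneq j j'.
    by split=> //; apply: nat_inj_p => //; rewrite jj in Pd; move: Pd; congr (val P _); ring.
  exfalso; have : coprimez p (j%:Z - j'%:Z).
    rewrite /coprimez /gcdz /= eqz_nat -/(coprime _ _) prime_coprime //.
    apply/negP => dv; move/eqP: jj; apply; apply: nat_inj_p => //.
    by rewrite !pmulrn -intrB; apply/(kp_dvd Kb PP pp Pp); rewrite dvdzE.
  move=> /coprimezP [[u v] /= uv].
  have /(congr1 (fun k : int => k%:~R : K)) := uv.
  rewrite intrD !intrM intrB -[1%:~R]/1 -!pmulrn => E.
  apply: (nx' (v * (i'%:Z - i%:Z))).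
  have -> : x - (v * (i'%:Z - i%:Z))%:~R = (u%:~R * x) * p%:R +
      v%:~R * ((i%:R + j%:R * x) - (i'%:R + j'%:R * x)).
    rewrite intrM intrB -!pmulrn.
    have -> : x = (u%:~R * p%:R + v%:~R * (j%:R - j'%:R)) * x by rewrite E mul1r.
    rewrite E; have := E; move: (p%:R : K) => pK E'.
    have -> : 1 * x = (u%:~R * pK + v%:~R * (j%:R - j'%:R)) * x by rewrite E' mul1r.
    by rewrite E' mul1r -[X in X - _](mul1r x) -{1}E'; ring.
  apply: (kpD PP); last by apply: (kpM PP) => //; exact: (O_int Kb).
  by apply: (kpM PP) => //; apply: (OM Kb) => //; exact: (O_int Kb).
pose s := [seq (i%:R + j%:R * x : K) | i <- iota 0 p, j <- iota 0 p].
have -> : (p ^ 2 = size s)%N by rewrite size_allpairs !size_iota mulnn.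
have inj (ij ij' : nat * nat) : ij \in [seq (i, j) | i <- iota 0 p, j <- iota 0 p] ->
   ij' \in [seq (i, j) | i <- iota 0 p, j <- iota 0 p] ->
   val P ((ij.1%:R + ij.2%:R * x) - (ij'.1%:R + ij'.2%:R * x)) -> ij = ij'.
  move=> /allpairsP [[i j] /= [ii jj ->]] /allpairsP [[i' j'] /= [ii' jj' ->]] /= Pd.
  rewrite !mem_iota /= !add0n in ii jj ii' jj'.
  by have [-> ->] := key _ _ _ _ ii jj ii' jj' Pd.
have sE : s = [seq (ij.1%:R + ij.2%:R * x : K) | ij <- [seq (i, j) | i <- iota 0 p, j <- iota 0 p]].
  by rewrite /s map_allpairs.
rewrite sE; apply: norm_ge.
- move=> _ /mapP [ij _ ->]; apply: (OD Kb); first exact: (O_nat Kb).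
  by apply: (OM Kb) => //; exact: (O_nat Kb).
- rewrite map_inj_in_uniq.
    by apply: allpairs_uniq; rewrite ?iota_uniq // => -[i j] [i' j'] _ _ [-> ->].
  by move=> ij ij' ii jj E; apply: inj => //; rewrite E subrr; exact: (kp0 PP).
- move=> _ _ /mapP [ij ii ->] /mapP [ij' jj ->] Pd.
  by rewrite (inj ij ij').
Qed.

(** Lagrange's theorem for the residue ring: translation by 1 permutes the cosets, so the sum of the
    representatives and the sum of their translates agree modulo P and differ by the number of
    cosets. *)
Lemma norm_mem : val P (prime_norm P)%:R.
Proof.
pose s : seq (set K) := enum_fset (fset_set cosets).
have sP C : C \in s <-> cosets C.
  by rewrite /s in_fset_set ?inE; [|exact: cosets_finite].
pose rep (C : set K) := xget 0 [set a | O a /\ C = [set a + y | y in val P]].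
have repP C : C \in s -> O (rep C) /\ C = [set rep C + y | y in val P].
  move=> /sP [a Oa aC]; rewrite /rep; case: xgetP => [b _ //|/(_ a) []].
  by split.
pose f C := [set (rep C + 1) + y | y in val P].
have fs C : C \in s -> f C \in s.
  by move=> /repP [Or _]; apply/sP; exists (rep C + 1) => //; apply: (OD Kb) => //; exact: (O_nat Kb 1).
have perm : perm_eq [seq f C | C <- s] s.
  have us : uniq s by exact: fset_uniq.
  have uf : uniq [seq f C | C <- s].
    rewrite map_inj_in_uniq // => C C' sC sC' /(cos_eq _ _ PP) Pd.
    have [_ ->] := repP C sC; have [_ ->] := repP C' sC'; apply/(cos_eq _ _ PP).
    by move: Pd; congr (val P _); ring.
  apply: uniq_perm => //; apply: (uniq_min_size uf _ _).2; last by rewrite size_map.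
  by move=> _ /mapP [C sC ->]; exact: fs.
have E : \sum_(C <- s) (rep C + 1) - \sum_(C <- s) rep (f C) = (prime_norm P)%:R.
  rewrite -[X in _ - X](big_map f predT rep) (perm_big _ perm) /= big_split /=.
  rewrite addrAC subrr add0r big_const_seq count_predT iter_addr_0 /prime_norm.
  by [].
rewrite -E -sumrB big_seq; elim/big_ind: _ => [||C sC]; [exact: (kp0 PP)|exact: (kpD PP)|].
have [_ fE] := repP (f C) (fs C sC).
by apply/(cos_eq _ _ PP); rewrite -fE.
Qed.

Lemma norm_ge_char : (p <= prime_norm P)%N.
Proof.
have [/norm_dg1 -> //|/norm_ndg1] := pselect dg1; apply: leq_trans.
by rewrite -{1}[p]expn1 leq_pexp2l // prime_gt0.
Qed.

Lemma norm_prime_dg1 : prime (prime_norm P) -> prime_norm P = p /\ dg1.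
Proof.
move=> pr; have E := rchar_uniq pr norm_mem; split=> //.
apply: contrapT => /norm_ndg1; rewrite -E -/p; have := prime_gt1 pp.
by rewrite -mulnn; nia.
Qed.
End Norm.
End PrimeNorms.

(** * Sums over the primes of K and Dirichlet density *)

Section PrimeZeta.
Context (R : realType) (K : fieldExtType rat) (Kb : alg_closure K).
Local Notation Om := (ac_field Kb).
Local Notation Qb := (Qbar Kb).
Local Notation gal := (absgal (Qbar Kb)).
Local Notation emb := (ac_emb Kb).
Local Notation O := (int_ring [set: K]).
Local Notation ev P y := (map_poly (intr : int -> Om) P).[y].
Implicit Types (g h : gal) (a b : K) (Q : set Om).

(** Fix a place Q above p. Each prime above p is the contraction of Q along some g and is determined
    by the conjugate g e. *)
Lemma fiber_size (e : Om) (p : nat) (X : seq (primes_of K)) :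
  (forall g, g e = e <-> fixK g) -> prime p -> uniq X ->
  (forall P, P \in X -> rchar (val P) = p) -> (size X <= size (orb (Qb := Qb) e))%N.
Proof.
move=> eP pp uX Xp; have [Q plQ] := place_exists Qb pp.
have ex (P : primes_of K) : exists g, P \in X -> forall a, val P a <-> O a /\ Q (g (emb a)).
  have [PX|] := boolP (P \in X); last by exists 1%g.
  have [pr Pp] := rcharP Kb P; rewrite (Xp P PX) in Pp.
  have [g gP] := prime_contr (primes_ofP P) pp Pp plQ.
  by exists g.
have [gg ggP] := boolp.choice ex.
rewrite -(size_map (fun P => gg P e)); apply: uniq_leq_size; last first.
  by move=> _ /mapP [P PX ->]; apply/orbP; exists (gg P).
rewrite map_inj_in_uniq // => P P' PX PX' E; apply/val_inj/seteqP.
have agree a : gg P (emb a) = gg P' (emb a).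
  rewrite -[LHS](@gal_Kinv Qb (gg P')); congr ((gg P' : {rmorphism Om -> Om}) _).
  rewrite -[LHS]/(((gg P')^-1 * gg P)%g (emb a)).
  have /eP fx : ((gg P')^-1 * gg P)%g e = e.
    by rewrite -[LHS]/((gg P')^-1%g (gg P e)) E; exact: (@gal_invK Qb).
  exact: fx.
by split=> a /(ggP _ _) => [/(_ PX)|/(_ PX')] [Oa Qa]; apply/ggP => //; split=> //;
  rewrite ?agree // -agree.
Qed.

Lemma place_gal (p : nat) Q : place (Qb := Qb) p Q ->
  forall g, place (Qb := Qb) p [set x | Q (g x)].
Proof.
move=> plQ g; split; last by rewrite /= rmorph_nat; exact: (plp plQ).
have ag x : aint (x : Qb) <-> aint (g x : Qb).
  split=> [|ax]; first exact: (@aint_gal Qb).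
  by rewrite -[x](@gal_invK Qb g); exact: (@aint_gal Qb).
split.
- split.
  + by move=> x Qx; split=> //; apply/ag; exact: (pl_aint plQ Qx).
  + by rewrite /= rmorph0; exact: (pl0 plQ).
  + by move=> x y /= Qx Qy; rewrite rmorphD; exact: (plD plQ).
  + move=> a x [_ aa] /= Qx; rewrite rmorphM; apply: (plM plQ) => //; exact: (@aint_gal Qb).
- by rewrite /= rmorph1; exact: (pl1 plQ).
- have [[_ _ [x Qx x0] _] _] := plQ; exists (g^-1%g x).
    by rewrite /= -[g _]/(g (g^-1%g x)) (@gal_Kinv Qb).
  by rewrite fmorph_eq0.
- move=> x y [_ ax] [_ ay] /=; rewrite rmorphM => /(pl_prime plQ) [] //.
  + exact: (@aint_gal Qb).
  + exact: (@aint_gal Qb).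
  + by left.
  + by right.
Qed.

Lemma sum_seq_le (T : finType) (L : seq T) (A : {pred T}) (F : T -> R) : uniq L ->
  {subset L <= A} -> (forall x, 0 <= F x) -> \sum_(x <- L) F x <= \sum_(x in A) F x.
Proof.
move=> uL LA F0; rewrite big_uniq //= [leLHS]big_mkcond [leRHS]big_mkcond.
apply: ler_sum => x _; case: ifP => xL; first by rewrite LA.
by case: ifP.
Qed.

Section Inj.
Context (e : Om) (ae : aint (e : Qb)) (D : int) (DE : orb_disc (e : Qb) = D%:~R)
  (fz : {poly int}) (fzE : orbpoly (e : Qb) = map_poly intr fz) (P0 : nat)
  (P0D : (absz D <= P0)%N) (D0 : D != 0) (eK : forall g, g e = e -> fixK g).

(** If each P in X has k conjugates of e over K that are congruent to integers at a place above P,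
    the k |X| resulting pairs (p, r) are roots of f modulo p. They are distinct, so k times the sum
    over X is a part of [pzeta]. *)
Lemma inj_pairs (k : nat) (X : seq (primes_of K)) : uniq X ->
  (forall P, P \in X ->
    [/\ (P0 < rchar (val P))%N, prime_norm P = rchar (val P) &
     exists Q (s : seq Om), [/\ place (Qb := Qb) (rchar (val P)) Q,
       (forall a, val P a -> Q (emb a)), uniq s, size s = k &
       forall y, y \in s -> (exists2 h, fixK h & y = h e) /\ exists r : nat, Q (r%:R - y)]]) ->
  exists Y, forall s : R, k%:R * \sum_(P <- X) (prime_norm P)%:R `^ (- s) <= pzeta fz P0 Y s.
Proof.
move=> uX HX; pose Y := \max_(P <- X) rchar (val P); exists Y => s.
have ex (P : primes_of K) : exists Qs : set Om * seq Om, P \in X ->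
    [/\ place (Qb := Qb) (rchar (val P)) Qs.1, (forall a, val P a -> Qs.1 (emb a)),
     uniq Qs.2, size Qs.2 = k & forall y, y \in Qs.2 ->
     (exists2 h, fixK h & y = h e) /\ exists r : nat, Qs.1 (r%:R - y)].
  have [PX|] := boolP (P \in X); last by exists (set0, [::]).
  by have [_ _ [Q [l H]]] := HX P PX; exists (Q, l).
have [QQ QQP] := boolp.choice ex.
have exr (Pi : primes_of K * nat) : exists r : nat, Pi.1 \in X -> (Pi.2 < k)%N ->
    (r < rchar (val Pi.1))%N /\ (QQ Pi.1).1 (r%:R - (QQ Pi.1).2`_Pi.2).
  case: Pi => P i /=; have [PX|] := boolP (P \in X); last by exists 0%N.
  have [ik|] := boolP (i < k)%N; last by exists 0%N.
  have [plQ PQ us sk sP] := QQP P PX.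
  have [_ [r Qr]] := sP _ (mem_nth 0 (eq_ind_r (fun m => (i < m)%N) ik sk)).
  have [m mp Pm] := nat_mod_p Kb P r; exists m => _ _; split=> //.
  have := PQ _ Pm; rewrite rmorphB /= rmorph_int rmorph_nat => Qm.
  rewrite [X in (QQ P).1 X](_ : _ = (r%:R - (QQ P).2`_i) - (r%:~R - m%:R)); last by rewrite -pmulrn; ring.
  exact: (plB plQ).
have [rr rrP] := boolp.choice exr.
pose T := [seq (P, i) | P <- X, i <- iota 0 k].
pose x (Pi : primes_of K * nat) : 'I_Y.+1 * 'I_Y.+1 :=
  (inord (rchar (val Pi.1)), inord (rr Pi)).
have Ymax P : P \in X -> (rchar (val P) <= Y)%N.
  by move=> PX; rewrite /Y (big_rem P) //= leq_maxl.
have TP Pi : Pi \in T -> Pi.1 \in X /\ (Pi.2 < k)%N.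
  by move=> /allpairsP [[P i] /= [PX ik ->]]; rewrite mem_iota in ik.
have x1 Pi : Pi \in T -> (x Pi).1 = rchar (val Pi.1) :> nat.
  by move=> /TP [PX _]; rewrite /x /= inordK // ltnS Ymax.
have x2 Pi : Pi \in T -> (x Pi).2 = rr Pi :> nat.
  move=> /TP [PX ik]; have [rlt _] := rrP Pi PX ik.
  by rewrite /x /= inordK // ltnS ltnW // (leq_trans rlt) // Ymax.
have injx : {in T &, injective x}.
  move=> [P i] [P' i'] PT PT' E.
  have [/= PX ik] := TP _ PT; have [/= PX' ik'] := TP _ PT'.
  have [plQ PQ us sk sP] := QQP P PX; have [plQ' PQ' us' sk' sP'] := QQP P' PX'.
  have [/= _ Qr] := rrP (P, i) PX ik; have [/= _ Qr'] := rrP (P', i') PX' ik'.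
  have pE : rchar (val P) = rchar (val P').
    by have := x1 _ PT; rewrite E x1.
  have rE : rr (P, i) = rr (P', i').
    by have := x2 _ PT; rewrite E x2.
  have mi : (QQ P).2`_i \in (QQ P).2 by rewrite mem_nth ?sk.
  have mi' : (QQ P').2`_i' \in (QQ P').2 by rewrite mem_nth ?sk'.
  have [[h fh yE] _] := sP _ mi; have [[h' fh' yE'] _] := sP' _ mi'.
  have pp := (rcharP Kb P).1; have pp' := (rcharP Kb P').1.
  have pD q : (P0 < q)%N -> ~~ (q %| D)%Z.
    by move=> Pq; rewrite dvdzE /= gtnNdvd ?absz_gt0 // (leq_ltn_trans P0D).
  have [P0p _ _] := HX P PX.
  (* The pair (p, r) determines P: D a is A(e) for an integer polynomial A, so for a in P1 the
     residue A(r) vanishes modulo p, and this puts D a, hence a, into the other prime. *)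
  have sub (P1 P2 : primes_of K) Q1 Q2 (h1 h2 : gal) (r : nat) : rchar (val P1) = rchar (val P2) ->
      place (Qb := Qb) (rchar (val P1)) Q1 -> place (Qb := Qb) (rchar (val P2)) Q2 ->
      (P0 < rchar (val P1))%N ->
      (forall a, val P1 a -> Q1 (emb a)) -> (forall a, val P2 a -> Q2 (emb a)) ->
      fixK h1 -> fixK h2 -> Q1 (r%:R - h1 e) -> Q2 (r%:R - h2 e) -> val P1 `<=` val P2.
    move=> pE12 pl1 pl2 Pp1 PQ1 PQ2 f1 f2 Q1r Q2r a P1a.
    have q1 := (rcharP Kb P1).1; have [q2 P2p] := rcharP Kb P2.
    have Oa := kp_int (primes_ofP P1) P1a.
    have [||A [_ AE _]] := @interp_disc Qb e (emb a) D ae _ _ DE.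
    - exact/intK.
    - by move=> g /eK fg; exact: fg.
    have hA (h0 : gal) : fixK h0 -> ev A (h0 e) = D%:~R * emb a.
      by move=> f0; rewrite -(@gal_horner Qb) AE rmorphM /= rmorph_int f0.
    have dv : (rchar (val P1) %| A.[r%:Z])%Z.
      apply/(pl_int pl1 q1); rewrite -(@ev_nat Qb).
      rewrite -[ev A r%:R](subrK (ev A (h1 e))); apply: (plD pl1).
        apply: (ev_cong (Qb := Qb) pl1) => //; first exact: (@aint_nat Qb).
        exact: (@aint_gal Qb).
      by rewrite hA //; apply: (plM pl1); [exact: (@aint_int Qb)|exact: PQ1].
    have : Q2 (D%:~R * emb a).
      rewrite -(hA h2) // -[ev A (h2 e)](subKr (ev A r%:R)); apply: (plB pl2).
        by rewrite (@ev_nat Qb); apply/(pl_int pl2 q2); rewrite -pE12.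
      apply: (ev_cong (Qb := Qb) pl2) => //; first exact: (@aint_nat Qb).
      exact: (@aint_gal Qb).
    move/(pl_prime pl2) => [||/(pl_int pl2 q2) dD|Q2a].
    - exact: (@aint_int Qb).
    - exact/intK.
    - by move/negP: (pD _ Pp1); rewrite pE12.
    have [g gP] := prime_contr (primes_ofP P2) q2 P2p pl2.
    have sub1 b : O b -> Q2 (g (emb b)) -> Q2 (emb b) by move=> Ob Qb'; apply: PQ2; apply/gP.
    apply/gP; split=> //.
    have [th ath thP] := K_gen Kb.
    apply: (@pl_incomparable Qb _ Q2 pl2 q2 th g ath) => //.
    - move=> u au fu; have [g0 f0|b uE] := @fixK_rel K Kb u.
        by apply: fu; exact/thP.
      by rewrite uE; apply: sub1; apply/(intK Kb); rewrite -uE.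
    - by move=> g0 /thP f0; exact: f0.
  have PP' : P = P'.
    apply/val_inj/seteqP; split.
      apply: (@sub P P' (QQ P).1 (QQ P').1 h h' (rr (P, i))) => //; first by rewrite -yE.
      by rewrite rE -yE'.
    apply: (@sub P' P (QQ P').1 (QQ P).1 h' h (rr (P, i))) => //.
    - by rewrite -pE.
    - by rewrite rE -yE'.
    - by rewrite -yE.
  (* For one P, two listed conjugates congruent to the same r modulo the place coincide, since p
     does not divide the discriminant of e. *)
  subst P'; congr (_, _); apply/eqP; rewrite -(nth_uniq 0 _ _ us) ?sk //; apply/eqP.
  apply: (@pl_sep Qb _ _ plQ pp e D _ _ ae DE (pD _ P0p)).
  - by rewrite yE; apply/orbP; exists h.
  - by rewrite yE'; apply/orbP; exists h'.
  rewrite [X in (QQ P).1 X](_ : _ = ((rr (P, i'))%:R - (QQ P).2`_i') - ((rr (P, i))%:R - (QQ P).2`_i)); last first.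
    by rewrite rE; ring.
  exact: (plB plQ).
have uT : uniq T.
  by apply: allpairs_uniq => //; [exact: iota_uniq|move=> [? ?] [? ?] _ _ [-> ->]].
have ux : uniq [seq x Pi | Pi <- T] by rewrite map_inj_in_uniq.
apply: (@le_trans _ _ (\sum_(u <- [seq x Pi | Pi <- T]) (u.1 : nat)%:R `^ (- s))).
  rewrite big_map.
  have -> : \sum_(Pi <- T) ((x Pi).1 : nat)%:R `^ (- s) =
      \sum_(Pi <- T) (prime_norm Pi.1)%:R `^ (- s) :> R.
    rewrite big_seq [RHS]big_seq; apply: eq_bigr => Pi PT.
    by have [PX _] := TP _ PT; have [_ nE _] := HX _ PX; rewrite x1 // nE.
  rewrite /T big_allpairs /= mulr_sumr; apply: ler_sum => P _.
  by rewrite big_const_seq count_predT size_iota iter_addr_0 mulr_natl.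
apply: sum_seq_le; [exact: ux| |by move=> u; exact: powR_ge0].
move=> u /mapP [Pi PT ->].
have [PX ik] := TP _ PT; have [P0p _ _] := HX _ PX; have [rlt Qr] := rrP Pi PX ik.
have [plQ PQ us sk sP] := QQP _ PX.
have pp := (rcharP Kb Pi.1).1.
rewrite finset.inE x1 // x2 // pp P0p rlt /=.
apply/(pl_int plQ pp); rewrite -(orbpoly_nat (Qb := Qb) fzE).
have [[h fh yE] _] := sP _ (mem_nth 0 (eq_ind_r (fun m => (Pi.2 < m)%N) ik sk)).
apply: (@pl_prod_mem Qb _ _ plQ _ _ _ _ ((QQ Pi.1).2`_Pi.2)) => //.
- by move=> z zt _; apply: (@aintB Qb); [exact: (@aint_nat Qb)|exact: (@aint_orb Qb e z ae zt)].
- by rewrite yE; apply/orbP; exists h.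
Qed.
End Inj.

(** There are at most n primes above each p. Those of degree at least two have norm at least p^2,
    and the sum of 1/p^2 over p > P0 is bounded; the p up to P0 contribute at most n each. *)
Lemma rest_bound (P0 : nat) : (0 < P0)%N -> exists2 C : R, 0 <= C & forall (s : R) (X : seq (primes_of K)),
  1 <= s -> uniq X -> (forall P, P \in X -> ~ dg1 P \/ (rchar (val P) <= P0)%N) ->
  \sum_(P <- X) (prime_norm P)%:R `^ (- s) <= C.
Proof.
move=> P00; have [e ae eP] := K_gen Kb; set n := size (orb (Qb := Qb) e).
exists (n%:R * (P0.+1%:R + 1)); first by rewrite mulr_ge0 // addr_ge0.
move=> s X s1 uX HX.
pose c (p : nat) : R := if (p <= P0)%N then 1 else (p%:R ^+ 2)^-1.
have c0 p : 0 <= c p by rewrite /c; case: ifP => // _; rewrite invr_ge0 exprn_ge0.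
have Nc P : P \in X -> (prime_norm P)%:R `^ (- s) <= c (rchar (val P)).
  move=> PX; have [pp Pp] := rcharP Kb P; have Np := norm_ge_char Kb P.
  have N1 : (1 <= prime_norm P)%N by apply: leq_trans Np; exact: prime_gt0.
  have step (m : nat) : (0 < m)%N -> (m <= prime_norm P)%N -> (prime_norm P)%:R `^ (- s) <= m%:R^-1 :> R.
    move=> m0 mN; apply: (@le_trans _ _ (m%:R `^ (- s))).
      by apply: powR_opp_anti; rewrite ?ltr0n ?ler_nat //; lra.
    rewrite powRN lef_pV2 ?posrE ?powR_gt0 ?ltr0n //.
    by rewrite -{1}[m%:R]powRr1 //; apply: ler_powR => //; rewrite ler1n.
  rewrite /c; case: ifP => [_|nP0]; first by have := step 1%N isT N1; rewrite invr1.
  have [nd|] := HX P PX; last by rewrite nP0.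
  by rewrite -natrX; apply: step; [rewrite expn_gt0 prime_gt0|exact: norm_ndg1].
pose B := \max_(P <- X) rchar (val P).
have Bmax P : P \in X -> (rchar (val P) < B.+1)%N.
  by move=> PX; rewrite ltnS /B (big_rem P) //= leq_maxl.
apply: (@le_trans _ _ (\sum_(P <- X) c (rchar (val P)))).
  by rewrite big_seq [leRHS]big_seq; apply: ler_sum.
apply: (@le_trans _ _ (\sum_(p < B.+1) n%:R * c p)).
  rewrite (partition_big (fun P => inord (rchar (val P)) : 'I_B.+1) predT) //=.
  apply: ler_sum => p _.
  pose Xp := [seq P <- X | inord (rchar (val P)) == p].
  have pE P : P \in Xp -> rchar (val P) = p.
    rewrite mem_filter => /andP [/eqP <- PX]; by rewrite inordK // Bmax.
  rewrite -big_filter -/Xp big_seq.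
  rewrite (eq_bigr (fun=> c p)); last by move=> P /pE ->.
  rewrite -big_seq big_const_seq count_predT iter_addr_0 -[c p *+ _]mulr_natl ler_wpM2r // ler_nat.
  case XpE : Xp => [//|P Xp']; rewrite -XpE.
  have PX : P \in Xp by rewrite XpE mem_head.
  apply: (@fiber_size e p) => //; last by rewrite filter_uniq.
  by rewrite -(pE P PX); exact: (rcharP Kb P).1.
rewrite -mulr_sumr ler_wpM2l //.
apply: (@le_trans _ _ (\sum_(p < P0.+1 + B) c p)).
  have le : (B.+1 <= P0.+1 + B)%N by rewrite addSn ltnS leq_addl.
  rewrite (big_ord_widen_cond (P0.+1 + B) xpredT c le) /= [leLHS]big_mkcond.
  by apply: ler_sum => p _; case: ifP.
rewrite big_split_ord /=; apply: lerD.
  rewrite (eq_bigr (fun=> 1)); last by move=> p _; rewrite /c -ltnS ltn_ord.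
  by rewrite sumr_const card_ord.
rewrite (eq_bigr (fun j : 'I_B => ((P0 + j).+1%:R ^+ 2)^-1)); last first.
  by move=> j _; rewrite /c addSn leqNgt ltnS leq_addr.
apply: (le_trans (inv_sq_sum _ _ P00)).
by rewrite invf_le1 ?ltr0n // ler1n.
Qed.

(** This is [inj_pairs] with k = 1 and a generator e of K, which is congruent to an integer at every
    prime of degree one. *)
Lemma zeta_upper : exists C : R, forall (s : R) (X : seq (primes_of K)),
  1 < s <= 2 -> uniq X ->
  \sum_(P <- X) (prime_norm P)%:R `^ (- s) <= ln (s - 1)^-1 + C.
Proof.
have [e ae eP] := K_gen Kb; have [D DE D0] := @orb_disc_int Qb e ae.
have [fz fzE] := @orbpoly_int Qb e ae.
have [C1 C1P] := @pzeta_upper R Qb e ae D DE D0 fz fzE (maxn (absz D) 1) (leq_maxl _ _).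
set P0 := maxn _ _ in C1P; have P0_gt0 : (0 < P0)%N by rewrite leq_maxr.
have [C2 C20 C2P] := rest_bound P0_gt0.
exists (C1 + C2) => s X s12 uX.
pose good1 (P : primes_of K) := `[< dg1 P >] && (P0 < rchar (val P))%N.
rewrite (bigID good1) /= addrA; apply: lerD; last first.
  rewrite -big_filter; apply: C2P; [by case/andP: s12 => /ltW|exact: filter_uniq|].
  move=> P; rewrite mem_filter negb_and -leqNgt => /andP [/orP [/asboolP|] ? _]; by [left|right].
rewrite -big_filter.
have [||||Y YP] := @inj_pairs e ae D DE fz fzE P0 _ D0 _ 1 [seq P <- X | good1 P].
- exact: leq_maxl.
- by move=> g /eP.
- exact: filter_uniq.
- move=> P; rewrite mem_filter => /andP [/andP [/asboolP d1 Pp] _].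
  have [pp PPp] := rcharP Kb P; split=> //; first exact: norm_dg1.
  have [Q plQ] := place_exists Qb pp.
  have [g gP] := prime_contr (primes_ofP P) pp PPp plQ.
  have plg := place_gal plQ g.
  exists [set x | Q (g x)], [:: e]; split=> //.
  + by move=> a /gP [].
  + move=> y; rewrite inE => /eqP ->; split; first by exists 1%g.
    have [a aE] : exists a, e = emb a.
      by apply: fixK_rel => h fh; exact/eP.
    have Oa : O a by apply/(intK Kb); rewrite -aE.
    have [m Pm] := d1 a Oa; exists m.
    have /gP [_] := Pm; rewrite !rmorphB /= !rmorph_nat -aE => /(plN plQ).
    by rewrite opprB rmorphB rmorph_nat.
- move: (YP s); rewrite mul1r => h; apply: (le_trans h).
  exact: C1P.
Qed.

(** A pair (p, r) gives the prime below a place at which a conjugate of e is congruent to r. It has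
    degree one because D a is an integer polynomial in e, and it determines p and r. *)
Lemma zeta_lower : exists (P0 : nat) (C : R), forall s : R, 1 < s <= 2 ->
  exists X : seq (primes_of K), uniq X /\
    ln (s - 1)^-1 - C <= \sum_(P <- X) (prime_norm P)%:R `^ (- s).
Proof.
have [e ae eP] := K_gen Kb; have [D DE D0] := @orb_disc_int Qb e ae.
have [fz fzE] := @orbpoly_int Qb e ae.
have [P0 [C [P0D lowP]]] := @pzeta_lower R Qb e ae D DE D0 fz fzE.
exists P0, C => s s12; have [Y YP] := lowP s s12.
pose pl (p : nat) := xget set0 [set Q | place (Qb := Qb) p Q].
have plP p : prime p -> place (Qb := Qb) p (pl p).
  move=> pp; rewrite /pl; case: xgetP => [//|].
  by have [Q plQ] := place_exists Qb pp => /(_ Q).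
have [a0 a0E] : exists a, e = emb a by apply: fixK_rel => h fh; exact/eP.
have Oa0 : O a0 by apply/(intK Kb); rewrite -a0E.
have xP (x : 'I_Y.+1 * 'I_Y.+1) : x \in good fz P0 Y ->
    [/\ prime x.1, (P0 < x.1)%N, (x.2 < x.1)%N & ((x.1 : nat)%:Z %| fz.[(x.2 : nat)%:Z])%Z].
  by rewrite finset.inE => /and4P.
have ex (x : 'I_Y.+1 * 'I_Y.+1) : exists P : set K, x \in good fz P0 Y ->
    is_prime [set: K] P /\ exists g, [/\ (forall a, P a <-> O a /\ pl x.1 (g (emb a))),
     P (x.1 : nat)%:R & P (a0 - (x.2 : nat)%:R)].
  have [/xP [pp Pp rp dv]|] := boolP (x \in good fz P0 Y); last by exists set0.
  have [y /orbP [g gE] Qr] := root_place (Qb := Qb) ae fzE (plP _ pp) pp dv.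
  have [Pr Pm] := contr_prime g pp (plP _ pp).
  exists [set a | O a /\ pl x.1 (g (emb a))] => _; split=> //; exists g; split=> //.
    by split=> //; exact: (O_nat Kb).
  split; first by apply: (OB Kb) => //; exact: (O_nat Kb).
  by rewrite rmorphB -a0E rmorphB gE !rmorph_nat -opprB; apply: (plN (plP _ pp)).
have [PP PPP] := boolp.choice ex.
have [X XE] : exists X : seq (primes_of K), map val X = map PP (enum (good fz P0 Y)).
  have : {subset enum (good fz P0 Y) <= good fz P0 Y} by move=> x; rewrite mem_enum.
  elim: (enum _) => [|x l IH] sub; first by exists [::].
  have [X XE] := IH (fun y yl => sub y (mem_behead (s := x :: l) yl)).
  have [PPx _] := PPP x (sub x (mem_head _ _)).
  by exists (exist _ (PP x) (mem_set PPx) :: X); rewrite /= XE.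
have charE x (P : primes_of K) : x \in good fz P0 Y -> val P = PP x -> rchar (val P) = x.1.
  move=> xg E; have [pp _ _ _] := xP x xg; have [_ [g [_ Pp _]]] := PPP x xg.
  by apply: (rchar_uniq Kb) => //; rewrite E.
have normE x (P : primes_of K) : x \in good fz P0 Y -> val P = PP x -> prime_norm P = x.1.
  move=> xg E; rewrite -(charE x P xg E); apply: (norm_dg1 Kb) => a Oa.
  have [pp Pp rp dv] := xP x xg; have [PPx [g [gP PPp PPr]]] := PPP x xg; rewrite E.
  have [||A [_ AE _]] := @interp_disc Qb e (emb a) D ae _ _ DE.
  - exact/intK.
  - by move=> g0 /eP fg; exact: fg.
  have AE' : (map_poly intr A).[a0] = D%:~R * a.
    apply: (fmorph_inj emb); rewrite rmorphM /= emb_intr -AE a0E -horner_map /= -map_poly_comp.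
    by congr (_.[_]); apply: eq_map_poly => m /=; exact: emb_intr.
  have [q qE] : exists q : {poly int}, A = q * ('X - (x.2 : nat)%:Z%:P) + (A.[(x.2 : nat)%:Z])%:P.
    have /factor_theorem [q qE] : root (A - (A.[(x.2 : nat)%:Z])%:P) (x.2 : nat)%:Z.
      by rewrite rootE !hornerE subrr.
    by exists q; rewrite -qE subrK.
  have PA : PP x (D%:~R * a - (A.[(x.2 : nat)%:Z])%:~R).
    rewrite -AE' {1}qE rmorphD rmorphM /= rmorphB /= map_polyX !map_polyC /= !hornerE addrK.
    by apply: (kpM PPx) => //; exact: (O_horner Kb).
  have : coprimez x.1 D.
    rewrite coprimezE /= prime_coprime // gtnNdvd ?absz_gt0 //; exact: leq_ltn_trans Pp.
  move=> /coprimezP [[u v] /= uv].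
  have uvK : u%:~R * (x.1 : nat)%:R + v%:~R * D%:~R = 1 :> K.
    by have := congr1 (fun k : int => k%:~R : K) uv; rewrite intrD !intrM.
  have [k _] := nat_mod_p Kb P (v * A.[(x.2 : nat)%:Z]); rewrite E => Pk; exists k.
  have -> : a - k%:R = (u%:~R * a) * (x.1 : nat)%:R + v%:~R * (D%:~R * a - (A.[(x.2 : nat)%:Z])%:~R)
     + ((v * A.[(x.2 : nat)%:Z])%:~R - k%:R).
    have aE : a = (u%:~R * (x.1 : nat)%:R + v%:~R * D%:~R) * a by rewrite uvK mul1r.
    by rewrite intrM {1}aE; ring.
  apply: (kpD PPx) => //; apply: (kpD PPx).
    by apply: (kpM PPx) => //; apply: (OM Kb) => //; exact: (O_int Kb).
  by apply: (kpM PPx) => //; exact: (O_int Kb).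
have injPP : {in enum (good fz P0 Y) &, injective PP}.
  move=> x x'; rewrite !mem_enum => xg xg' E.
  have [PPx [g [gP PPp PPr]]] := PPP x xg; have [_ [g' [_ PPp' PPr']]] := PPP x' xg'.
  pose P : primes_of K := exist _ (PP x) (mem_set PPx).
  have e1 := charE x P xg erefl; have e2 := charE x' P xg' E.
  have [_ _ r1 _] := xP x xg; have [_ _ r2 _] := xP x' xg'.
  have e3 : x.1 = x'.1 :> nat by rewrite -e1 e2.
  have e4 : x.2 = x'.2 :> nat.
    apply: (@nat_inj_p K Kb P); rewrite ?e1 // ?e3 //=.
    rewrite [_ - _](_ : _ = (a0 - (x'.2 : nat)%:R) - (a0 - (x.2 : nat)%:R)); last by ring.
    by apply: (kpB Kb PPx) => //; rewrite E.
  by case: x x' e3 e4 {E xg xg' PPr PPr' PPp' gP P e1 e2 r1 r2 PPx PPp} => [? ?] [? ?] /= /val_inj -> /val_inj ->.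
exists X; split.
  by rewrite -(map_inj_uniq val_inj) XE map_inj_in_uniq // enum_uniq.
apply: (le_trans YP); rewrite /pzeta -big_enum /=.
have : {subset enum (good fz P0 Y) <= good fz P0 Y} by move=> x; rewrite mem_enum.
elim: (enum _) X XE {injPP} => [|x l IH] [|P X] //=; first by rewrite !big_nil.
move=> [PE XE] sub; rewrite !big_cons (normE x P) //; last exact/sub/mem_head.
by rewrite lerD2l; apply: IH => // y yl; apply: sub; rewrite inE yl orbT.
Qed.

Definition zsum (X : seq (primes_of K)) (s : R) : R :=
  \sum_(P <- X) (prime_norm P)%:R `^ (- s).

Local Notation term s := (fun p : primes_of K => ((prime_norm p)%:R `^ (- s))%:E : \bar R).

Lemma zsum_fsets (S : set (primes_of K)) (A : set (primes_of K)) (s : R) : fsets S A ->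
  exists X : seq (primes_of K), [/\ uniq X, (forall P, P \in X -> S P) &
    (\sum_(p \in A) term s p)%E = (zsum X s)%:E].
Proof.
move=> [fA AS]; exists (enum_fset (fset_set A)); split; first exact: fset_uniq.
  by move=> P; rewrite in_fset_set // inE; exact: AS.
by rewrite fsbig_finite //= sumEFin.
Qed.

Lemma esum_zsum (S : set (primes_of K)) (s M : R) :
  (forall X, uniq X -> (forall P, P \in X -> S P) -> zsum X s <= M) ->
  (\esum_(p in S) term s p <= M%:E)%E.
Proof.
move=> H; rewrite /esum; apply: ge_ereal_sup => _ [A AS <-].
by have [X [uX XS ->]] := zsum_fsets s AS; rewrite lee_fin; exact: H.
Qed.

Lemma zsum_esum (S : set (primes_of K)) (s : R) X : uniq X -> (forall P, P \in X -> S P) ->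
  ((zsum X s)%:E <= \esum_(p in S) term s p)%E.
Proof.
move=> uX XS; apply: esum_ge; exists [set` X].
  by split; [exact: finite_seq|move=> P /= /XS].
by rewrite -fsbig_seq //= sumEFin.
Qed.

(** [fine] sends an infinite value to 0; [zeta_upper] excludes this case. *)
Lemma prime_zetaE (S : set (primes_of K)) (s : R) : 1 < s <= 2 ->
  (prime_zeta S s)%:E = (\esum_(p in S) term s p)%E.
Proof.
move=> s12; have [C CP] := zeta_upper.
rewrite /prime_zeta fineK // ge0_fin_numE; last first.
  by apply: esum_ge0 => P _; rewrite lee_fin powR_ge0.
apply: le_lt_trans (ltry (ln (s - 1)^-1 + C)); apply: esum_zsum => X uX _.
exact: CP.
Qed.

Lemma prime_zeta_sup (S : set (primes_of K)) (s : R) : 1 < s <= 2 -> exists X,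
  [/\ uniq X, (forall P, P \in X -> S P) & prime_zeta S s - 1 <= zsum X s].
Proof.
move=> s12; apply: contrapT => H.
have : (\esum_(p in S) term s p <= (prime_zeta S s - 1)%:E)%E.
  apply: esum_zsum => X uX XS; rewrite leNgt; apply/negP => lt; apply: H.
  by exists X; split=> //; exact: ltW.
by rewrite -prime_zetaE // lee_fin lerBDr gerDl ler10.
Qed.

Lemma prime_zeta_lower : exists C : R, forall s, 1 < s <= 2 ->
  ln (s - 1)^-1 - C <= prime_zeta [set: primes_of K] s.
Proof.
have [P0 [C CP]] := zeta_lower; exists C => s s12; have [X [uX XP]] := CP s s12.
apply: (le_trans XP); rewrite -lee_fin prime_zetaE //.
exact: zsum_esum.
Qed.

Lemma ln_inv_near (M : R) : exists2 d : R, 0 < d <= 1 &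
  forall s, 1 < s < 1 + d -> M <= ln (s - 1)^-1.
Proof.
exists (Num.min 1 (expR (- M))).
  by rewrite lt_min ltr01 expR_gt0 ge_min lexx.
move=> s /andP [s1]; rewrite -ltrBlDl lt_min => /andP [_ sM].
have s0 : 0 < s - 1 by rewrite subr_gt0.
by rewrite -[M]expRK ler_ln ?posrE ?expR_gt0 ?invr_gt0 // -[expR M]invrK lef_pV2 ?posrE ?invr_gt0 ?expR_gt0 //
  -expRN ltW.
Qed.

Lemma density_setT : dirichlet_density [set: primes_of K] (1 : R).
Proof.
rewrite /dirichlet_density; have [C CP] := prime_zeta_lower.
have [d /andP [d0 d1] dP] := ln_inv_near (C + 1).
apply: (@cvg_trans _ ((fun=> (1 : R)) @ 1^'+)); last exact: cvg_cst.
apply: near_eq_cvg; near=> s.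
have s1 : 1 < s by near: s; exact: nbhs_right_gt.
have s2 : s < 1 + d by near: s; apply: nbhs_right_lt; rewrite ltrDl.
have s12 : 1 < s <= 2 by rewrite s1 /= ltW // (lt_le_trans s2) //; lra.
rewrite divff // gt_eqF //; apply: lt_le_trans (CP s s12).
by have := dP s; rewrite s1 s2 => /(_ isT); lra.
Unshelve. all: by end_near. Qed.

Lemma density_lower (S : set (primes_of K)) (ep : R) (P0 : nat) : 0 < ep < 1 ->
  (0 < P0)%N ->
  dirichlet_density S (1 : R) -> exists C d : R, [/\ 0 < d, d <= 1 & forall s, 1 < s < 1 + d ->
    exists X, [/\ uniq X, (forall P, P \in X -> [/\ S P, dg1 P & (P0 < rchar (val P))%N]) &
      (1 - ep) * ln (s - 1)^-1 - C <= zsum X s]].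
Proof.
move=> /andP [ep0 ep1] P00 dS; have [C1 C1P] := prime_zeta_lower.
have [C2 C20 C2P] := rest_bound P00.
have [d1 /andP [d10 d11] d1P] := ln_inv_near (C1 + 1).
have /cvgrPdist_lt /(_ ep ep0) := dS; move=> -[d2 /= d20 d2P].
exists ((1 - ep) * C1 + 1 + C2), (Num.min d1 d2); split.
- by rewrite lt_min d10.
- by rewrite ge_min d11.
move=> s /andP [s1]; rewrite -ltrBlDl lt_min => /andP [sd1 sd2].
have s12 : 1 < s <= 2 by rewrite s1 /=; lra.
have Z1 : 1 <= prime_zeta [set: primes_of K] s.
  by apply: le_trans (C1P s s12); have := d1P s; rewrite s1 -ltrBlDl sd1 => /(_ isT); lra.
have q : `|1 - prime_zeta S s / prime_zeta [set: primes_of K] s| < ep.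
  by apply: d2P => //=; rewrite ltr0_norm; lra.
have ZS : (1 - ep) * prime_zeta [set: primes_of K] s <= prime_zeta S s.
  rewrite -ler_pdivlMr; last by lra.
  by move: q; rewrite ltr_norml => /andP [_ ?]; lra.
have [X [uX XS XP]] := prime_zeta_sup S s12.
pose good1 (P : primes_of K) := `[< dg1 P >] && (P0 < rchar (val P))%N.
exists [seq P <- X | good1 P]; split; first exact: filter_uniq.
  by move=> P; rewrite mem_filter => /andP [/andP [/asboolP ? ?] /XS].
have H2 : zsum [seq P <- X | ~~ good1 P] s <= C2.
  apply: C2P; [exact: ltW|exact: filter_uniq|].
  move=> P; rewrite mem_filter negb_and -leqNgt => /andP [/orP [/asboolP|] ? _]; by [left|right].
have H3 : zsum X s = zsum [seq P <- X | good1 P] s + zsum [seq P <- X | ~~ good1 P] s.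
  by rewrite /zsum !big_filter (bigID good1).
have H4 := C1P s s12.
have H5 : (1 - ep) * (ln (s - 1)^-1 - C1) <= (1 - ep) * prime_zeta [set: primes_of K] s.
  by rewrite ler_wpM2l //; lra.
lra.
Qed.

End PrimeZeta.

(** * Values of characters at primes of degree one *)

Section CharAt.
Context (R : realType) (K : fieldExtType rat) (Kb : alg_closure K).
Local Notation Om := (ac_field Kb).
Local Notation Qb := (Qbar Kb).
Local Notation gal := (absgal (Qbar Kb)).
Local Notation emb := (ac_emb Kb).
Local Notation O := (int_ring [set: K]).
Implicit Types (g h : gal) (s : absgal Kb) (a b : K) (Q : set Om)
  (x : dirichlet_char R Kb).

Lemma fixK_toQ s : fixK (toQ s).
Proof. exact: gal_fix. Qed.

Lemma toQ_onto g : fixK g -> exists s, toQ s = g.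
Proof. by move=> fg; exists (toK fg); apply: absgal_eq. Qed.

Lemma toQM s s' : toQ (s * s')%g = (toQ s * toQ s')%g.
Proof. exact: absgal_eq. Qed.

Lemma toQV s : toQ s^-1%g = (toQ s)^-1%g.
Proof. by apply: (mulgI (toQ s)); rewrite -toQM !mulgV; exact: absgal_eq. Qed.

Lemma toQ_inj s s' : toQ s = toQ s' -> s = s'.
Proof. by move=> E; apply: absgal_eq => z; rewrite -[s z]/(toQ s z) E. Qed.

Lemma lchar_root (l : nat) (x : lchar R Kb l) s : x s ^+ l = 1.
Proof.
pose H := [set y : dirichlet_char R Kb | forall s, y s ^+ l = 1].
suff : H x by apply.
have /asboolP := lcharP x; apply; split.
  split=> [s'|y z Hy Hz s'] /=; first by rewrite expr1n.
  by rewrite exprMn exprVn Hy Hz divr1.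
move=> y [_ yl _] s'.
have yk k : (y ^+ k)%g s' = y s' ^+ k.
  by elim: k => [//|k IH]; rewrite expgS exprS -IH.
by rewrite -yk yl.
Qed.

(** The kernel of x is open: it contains the stabilizer of some algebraic integer t. *)
Definition opench x := exists2 t : Om, aint (t : Qb) &
  forall g, g t = t -> exists2 s, toQ s = g & x s = 1.

(** No small subgroups: near 1 all powers of the value x(s) are within distance 1 of 1. If x(s) were
    a nontrivial l-th root of unity, these powers would sum to 0, while the sum of l such numbers,
    one being 1 itself, stays at distance less than l from l. *)
Lemma root_open x (l : nat) : (0 < l)%N -> (forall s, x s ^+ l = 1) -> opench x.
Proof.
move=> l0 xl; have [S SP] := dc_cont x 1%g (ltr01 : 0 < 1 :> R[i]).
have [e ae eP] := K_gen Kb.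
have [t [at_ tS _]] := prim_elem (Qb := Qb) (e :: S).
exists t => // g gt; have fg : fixK g by apply/eP; apply: (tS e) => //; exact: mem_head.
have [s sE] := toQ_onto fg; exists s => //.
have near1 k : `|x s ^+ k - 1| < 1.
  have -> : x s ^+ k = x (s ^+ k)%g.
    by elim: k => [|k IH]; rewrite ?dchar1 // exprS expgS dc_mulM IH.
  have := SP (s ^+ k)%g; rewrite dchar1; apply=> z zS /=.
  elim: k => [//|k IH]; rewrite expgS.
  rewrite -[LHS]/(s ((s ^+ k)%g z)) IH -[s z]/(toQ s z) sE.
  by apply: (tS z) => //; rewrite inE zS orbT.
apply/eqP; apply: contraT => x1.
have S0 : \sum_(k < l) x s ^+ k = 0.
  have := subrX1 (x s) l; rewrite xl subrr => /esym /eqP.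
  by rewrite mulf_eq0 subr_eq0 (negbTE x1) /= => /eqP.
have : `|\sum_(k < l) (x s ^+ k - 1)| < l%:R.
  apply: (le_lt_trans (ler_norm_sum _ _ _)).
  rewrite -[X in _ < X%:R]card_ord -sumr_const.
  case: l l0 {xl S0} => // l _; rewrite !big_ord_recl ltr_leD //.
  by apply: ler_sum => i _; exact: ltW.
by rewrite sumrB S0 sub0r normrN sumr_const card_ord normr_nat ltxx.
Qed.

Lemma char_gen x : opench x -> exists2 t : Om, aint (t : Qb) &
  forall g, g t = t <-> exists2 s, toQ s = g & x s = 1.
Proof.
move=> [t0 at0 t0P].
have [||||t at_ tP] := @prim_subgroup Qb t0 [set g | exists2 s, toQ s = g & x s = 1].
- by exists 1%g; [exact: absgal_eq|exact: dchar1].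
- by move=> g h [s <- xs] [s' <- xs']; exists (s * s')%g; rewrite ?toQM // dc_mulM xs xs' mulr1.
- by move=> g [s <- xs]; exists s^-1%g; rewrite ?toQV // dcharV xs invr1.
- exact: t0P.
- by exists t.
Qed.

Section AtGen.
Context (x : dirichlet_char R Kb) (t : Om) (at_ : aint (t : Qb))
  (tP : forall g, g t = t <-> exists2 s, toQ s = g & x s = 1)
  (D : int) (DE : orb_disc (t : Qb) = D%:~R).
Local Notation L := (char_field x).
Local Notation sfixt z := (sfix (Qb := Qb) t z).

Lemma char_fieldE z : L z <-> sfixt z.
Proof.
split=> [Lz g /tP [s <- /Lz]//|sz s xs].
by apply: (sz (toQ s)); apply/tP; exists s.
Qed.

(** The kernel of x is normal, so the field Q(t) it fixes is stable under the Galois group of K. *)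
Lemma sfix_conj s z : sfixt z -> sfixt (s z).
Proof.
move=> sz g /tP [s' s'E xs'].
have : (s^-1 * s' * s)%g z = z.
  apply: (sz (toQ (s^-1 * s' * s)%g)); apply/tP; exists (s^-1 * s' * s)%g => //.
  by rewrite !dc_mulM xs' mulr1 dcharV mulVf // dc_neq0.
move=> /(congr1 (s : Om -> Om)).
have -> : s ((s^-1 * s' * s)%g z) = s' (s z) by rewrite /=; exact: absgal_invfK.
by rewrite -s'E.
Qed.

Context (P : primes_of K) (d1 : dg1 P).
Local Notation p := (rchar (val P)).
Context (pD : ~~ (p %| D)%Z) (Q : set Om) (plQ : place (Qb := Qb) p Q)
  (PQ : forall a, val P a -> Q (emb a)).
Let pp : prime p := (rcharP Kb P).1.
Let PP := primes_ofP P.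

Lemma Q_contr a : O a -> Q (emb a) -> val P a.
Proof.
move=> Oa Qa; have [m Pm] := d1 Oa.
have Qm : Q (m%:Z%:~R).
  rewrite [m%:Z%:~R](_ : _ = emb a - emb (a - m%:R)); last by rewrite rmorphB /= rmorph_nat; ring.
  by apply: (plB plQ) => //; exact: PQ.
have Pmm : val P (m%:Z)%:~R by apply/(kp_dvd Kb PP pp (rcharP Kb P).2); exact/(pl_int plQ pp).
by rewrite [a](_ : _ = a - m%:R + m%:Z%:~R); [exact: (kpD PP)|rewrite -pmulrn; ring].
Qed.

Lemma above_conj Q1 : lies_above L P Q1 ->
  exists s, forall z, Q1 z -> Q (s z).
Proof.
move=> [[[Q1i Q10 Q1D Q1M] Q11 _ Q1p] Q1P].
have [|||||||||h fh hP] := @pl_trans Qb p Q plQ t [set g | fixK g] Q1 at_.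
- by [].
- by move=> g h fg fh a; rewrite -[LHS]/(g (h (emb a))) fh fg.
- by move=> g fg a; rewrite -{1}(fg a) (@gal_invK Qb).
- by move=> g /tP [s <- _]; exact: fixK_toQ.
- by move=> z /Q1i [/char_fieldE ? ?].
- by [].
- exact: Q1D.
- by move=> y z ay sy; apply: Q1M; split=> //; exact/char_fieldE.
- move=> z Q1z fz; have [a aE] : exists a, z = emb a by exact: fixK_rel.
  by rewrite aE; apply: PQ; rewrite -Q1P /= -aE.
- by have [s sE] := toQ_onto fh; exists s => z /hP; rewrite -sE.
Qed.

(** If p were a sum of products of two elements of a prime above P, then, with y outside Q turning
    every element of the conjugate prime into a multiple of p, the number y^2 p would be a multiple
    of p^2, so y would lie in Q. *)
Lemma char_unramified : unramified L P.
Proof.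
move=> Q1 ab; have [s sP] := above_conj ab.
have [[[Q1i Q10 Q1D Q1M] Q11 _ Q1p] Q1P] := ab.
have expQ n : ideal_exp L Q1 n.+1 `<=` Q1.
  elim: n => [|n IH] z /= [m [a [b [ab' ->]]]].
    elim/big_ind: _ => // i _; have [Qa Ob] := ab' i.
    by rewrite mulrC; exact: Q1M.
  elim/big_ind: _ => // i _; have [Qa Qb'] := ab' i.
  by apply: Q1M; [exact: Q1i|exact: IH].
case=> [|[|n]]; split=> //.
- move=> _ z [m [a [b [ab' ->]]]] /=.
  elim/big_ind: _ => [|u v [Lu au] [Lv av]|i _].
  + by split; [move=> g _; rewrite rmorph0|exact: (@aint0 Qb)].
  + by split; [move=> g xg; rewrite rmorphD Lu // Lv|exact: (@aintD Qb)].
  have [[c Pc cE] [Lb ab1]] := ab' i; rewrite -cE; split.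
    by move=> g xg; rewrite rmorphM /= gal_fix Lb.
  by apply: (@aintM Qb) => //; apply/(intK Kb); exact: (kp_int PP).
- move=> _ z [m [a [b [ab' ->]]]] /=; exists m, a, b; split=> // i.
  by have [[c Pc cE] Ob] := ab' i; split=> //; rewrite -cE; move: Pc; rewrite -Q1P.
move=> sub; exfalso.
have : ideal_exp L Q1 n.+2 p%:R.
  apply: sub; exists 1%N, (fun=> p%:R), (fun=> 1); split; last by rewrite big_ord1 mulr1.
  move=> _; split; first by exists p%:R; [exact: (rcharP Kb P).2|rewrite rmorph_nat].
  by split; [move=> g _; rewrite rmorph1|exact: (@aint1 Qb)].
move=> [m [a [b [ab' pE]]]].
have pO : orb_disc (s t : Qb) = D%:~R.
  by rewrite (@orb_disc_conj Qb t) //; apply/orbP; exists (toQ s).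
have ast : aint (s t : Qb) by exact: (@aint_gal Qb (toQ s)).
have [y [ay sy nQy yP]] := @pl_unr Qb p Q plQ pp (s t) D ast pO pD.
have sfs z : L z -> sfix (Qb := Qb) (s t) (s z).
  move=> /char_fieldE Lz g gE.
  have : ((toQ s)^-1 * g * toQ s)%g z = z.
    by apply: Lz; rewrite !(@gal_mulE Qb) -[toQ s t]/(s t) gE; exact: (@gal_invK Qb (toQ s)).
  rewrite !(@gal_mulE Qb) => /(congr1 (s : Om -> Om)).
  by rewrite -[s (_ _)]/(toQ s _) (@gal_Kinv Qb).
have dvd z : Q1 z -> exists2 w, aint (w : Qb) & y * s z = p%:R * w.
  by move=> Q1z; apply: yP; [apply: sfs; exact: (Q1i z Q1z).1|exact: sP].
have : exists2 w, aint (w : Qb) & y ^+ 2 * \sum_(i < m) s (a i) * s (b i) = p%:R ^+ 2 * w.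
  elim/big_ind: _ => [|u v [w aw uE] [w' aw' vE]|i _].
  - by exists 0; [exact: (@aint0 Qb)|rewrite !mulr0].
  - by exists (w + w'); [exact: (@aintD Qb)|rewrite !mulrDr uE vE].
  have [Qa Qb'] := ab' i; have [w aw wE] := dvd _ Qa.
  have [w' aw' wE'] := dvd _ (expQ _ _ Qb').
  exists (w * w'); first exact: (@aintM Qb).
  by rewrite expr2 mulrACA wE wE'; ring.
have -> : \sum_(i < m) s (a i) * s (b i) = p%:R.
  rewrite -(rmorph_nat (s : {rmorphism Om -> Om})) pE rmorph_sum; apply: eq_bigr => i _.
  by rewrite rmorphM.
move=> [w aw E]; apply: nQy; apply: (@pl_exp Qb _ _ plQ _ 2 ay).
have -> : y ^+ 2 = p%:R * w.
  apply: (mulfI (x := (p%:R : Om))); first by rewrite (natr_eq0Q Qb) -lt0n prime_gt0.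
  by rewrite mulrC E; ring.
by rewrite mulrC; apply: (plM plQ) => //; exact: (plp plQ).
Qed.

Lemma above_prime : (forall a, O a -> Q (emb a) -> val P a) ->
  lies_above L P [set z | sfixt z /\ Q z].
Proof.
move=> contr.
have LO z : int_ring L z -> sfixt z /\ aint (z : Qb).
  by move=> [/char_fieldE ? ?].
split; last first.
  apply/seteqP; split=> a /=.
    by move=> [_ Qa]; apply: contr => //; apply/(intK Kb); exact: (pl_aint plQ Qa).
  move=> Pa; split; last exact: PQ.
  by move=> g /tP [s <- _]; exact: fixK_toQ.
split; first split.
- by move=> z [sz Qz]; split; [exact/char_fieldE|exact: (pl_aint plQ Qz)].
- by split; [move=> g _; rewrite rmorph0|exact: (pl0 plQ)].
- move=> y z [sy Qy] [sz Qz]; split; last exact: (plD plQ).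
  by move=> g gt; rewrite rmorphD sy // sz.
- move=> y z /LO [sy ay] [sz Qz]; split; last exact: (plM plQ).
  by move=> g gt; rewrite rmorphM sy // sz.
- by move=> [_ /(pl1 plQ)].
- exists p%:R; last by rewrite (natr_eq0Q Qb) -lt0n prime_gt0.
  by split; [move=> g _; rewrite rmorph_nat|exact: (plp plQ)].
- by move=> y z /LO [sy ay] /LO [sz az] [_ /(pl_prime plQ) [] // ?]; [left|right].
Qed.

(** The element chosen in [char_at] may belong to another prime above P; a conjugate of it is a
    Frobenius at Q. As p does not divide D, that conjugate agrees with s on t, and x does not see
    conjugation. *)
Lemma char_at_frob s : Q (s t - t ^+ p) -> char_at x P = x s.
Proof.
move=> Qs; have NE := norm_dg1 Kb d1.
rewrite /char_at; case: asboolP => [_|]; last by have := char_unramified.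
case: xgetP => [s' _ [Q1 ab frob]|/(_ s)]; last first.
  case; exists [set z | sfixt z /\ Q z]; first exact: (above_prime Q_contr).
  move=> z [/char_fieldE sz az]; rewrite NE; split; last first.
    exact: (@pl_frob_ext Qb p Q plQ pp t D (toQ s)).
  move=> g gt; rewrite rmorphB rmorphXn /= sz //; congr (_ - _).
  exact: (sfix_conj s sz).
have [h hP] := above_conj ab.
have : Q (h (s' (h^-1%g t) - (h^-1%g t) ^+ prime_norm P)).
  apply/hP/frob; split; last exact: (@aint_gal Qb (toQ h^-1%g)).
  by apply/char_fieldE/sfix_conj => g.
rewrite rmorphB rmorphXn /= -[h (absgal_invf h t)]/(h (h^-1%g t)) NE.
have hK z : h (h^-1%g z) = z by exact: absgal_invfK.
have -> : h (absgal_invf h t) = t by exact: absgal_invfK.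
move=> Q2.
have E : (h * s' * h^-1)%g t = s t.
  apply: (@pl_sep Qb p Q plQ pp t D) => //.
  - by apply/orbP; exists (toQ (h * s' * h^-1)%g).
  - by apply/orbP; exists (toQ s).
  by have := plB plQ Q2 Qs; rewrite opprB addrA subrK.
have : toQ (s^-1 * (h * s' * h^-1))%g t = t.
  by rewrite -[LHS]/(absgal_invf s ((h * s' * h^-1)%g t)) E absgal_funK.
move=> /tP [s1 /toQ_inj ->]; rewrite !dc_mulM !dcharV => E1.
have := dc_neq0 x h => h0; have s0 := dc_neq0 x s.
by apply: (mulfI (x := (x s)^-1)); rewrite ?invr_eq0 // mulVf // -E1; field; rewrite h0.
Qed.
End AtGen.

(** The Frobenius congruence is tested on any T generating a larger field, so that several
    characters can be evaluated at one and the same g. *)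
Lemma char_at_eval x : opench x -> exists (P0 : nat) (t : Om), aint (t : Qb) /\
  forall (T : Om) (D : int), aint (T : Qb) -> sfix (Qb := Qb) T t -> orb_disc (T : Qb) = D%:~R ->
  forall (P : primes_of K) Q g, dg1 P -> (P0 < rchar (val P))%N -> ~~ (rchar (val P) %| D)%Z ->
    place (Qb := Qb) (rchar (val P)) Q -> (forall a, val P a -> Q (emb a)) ->
    Q (g T - T ^+ rchar (val P)) -> exists2 s, toQ s = g & char_at x P = x s.
Proof.
move=> /char_gen [t at_ tP]; have [e ae eP] := K_gen Kb.
have [De DeE De0] := @orb_disc_int Qb e ae; have [Dt DtE Dt0] := @orb_disc_int Qb t at_.
exists (maxn (absz De) (absz Dt)), t; split=> // T D aT Tt DE P Q g d1 Pp pD plQ PQ Qg.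
have pp := (rcharP Kb P).1.
have pDD D0 : D0 != 0 -> (absz D0 < rchar (val P))%N -> ~~ (rchar (val P) %| D0)%Z.
  by move=> D00 lt; rewrite dvdzE /= gtnNdvd ?absz_gt0.
have pDe := pDD _ De0 (leq_ltn_trans (leq_maxl _ _) Pp).
have pDt := pDD _ Dt0 (leq_ltn_trans (leq_maxr _ _) Pp).
have Qt : Q (g t - t ^+ rchar (val P)) by apply: (@pl_frob_ext Qb _ Q plQ pp T D).
have te : sfix (Qb := Qb) t e by move=> h /tP [s <- _]; apply/eP; exact: fixK_toQ.
have Qe : Q (g e - e ^+ rchar (val P)) by apply: (@pl_frob_ext Qb _ Q plQ pp t Dt).
have fg : fixK g.
  apply/eP; apply: (@pl_sep Qb _ Q plQ pp e De) => //.
  - by apply/orbP; exists g.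
  - exact: orb_self.
  have [a aE] : exists a, e = emb a by apply: fixK_rel => h fh; exact/eP.
  have Oa : O a by apply/(intK Kb); rewrite -aE.
  have [m Pm] := d1 a Oa; have Qm : Q (e - m%:R).
    by have := PQ _ Pm; rewrite rmorphB /= rmorph_nat -aE.
  have Qp : Q (e ^+ rchar (val P) - m%:R ^+ rchar (val P)).
    rewrite subrXX; apply: (plMr plQ) => //; apply: (@aint_sum Qb) => i _.
    by apply: (@aintM Qb); apply: (@aintX Qb) => //; exact: (@aint_nat Qb).
  have Qf := frob_int plQ pp m%:Z; rewrite -pmulrn in Qf.
  by have := plB plQ (plD plQ (plD plQ Qe Qp) Qf) Qm; rewrite !subrKA opprB subrKA.
have [s sE] := toQ_onto fg; exists s => //.
by apply: (@char_at_frob x t at_ tP Dt DtE P d1 pDt Q plQ PQ s); rewrite -[s t]/(toQ s t) sE.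
Qed.

End CharAt.

(** * Kummer characters and transfer *)

Section NormalGenerator.
Context (Qb : alg_closure rat).
Local Notation Om := (ac_field Qb).
Local Notation gal := (absgal Qb).
Implicit Types (g h : gal) (x y z t : Om).

(** A generator of the field of all conjugates of a primitive element: Q(t) is then normal. *)
Lemma normal_gen (S : seq Om) : exists t, [/\ aint t, (forall x, x \in S -> sfix t x) &
  forall g, sfix t (g t)].
Proof.
have [t1 [at1 t1S _]] := prim_elem S.
have [t [at_ tS tg]] := prim_elem (orb t1).
exists t; split=> //.
- by move=> x xS k kt; apply: (t1S x xS); apply: (tS t1) => //; exact: orb_self.
move=> g k kt; have : (g^-1 * k * g)%g t = t.
  apply: tg => x xo; rewrite !gal_mulE (tS (g x)) //; first by rewrite gal_invK.
  exact: orb_gal.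
by rewrite !gal_mulE => /(congr1 (g : Om -> Om)); rewrite gal_Kinv.
Qed.

Lemma unity_list (l : nat) : (0 < l)%N -> exists S : seq Om, forall z, z ^+ l = 1 -> z \in S.
Proof.
move=> l0; have [S SE] := closed_field_poly_normal (('X^l - 1) : {poly Om}).
exists S => z zl; have : root ('X^l - 1) z by rewrite rootE !hornerE zl subrr.
by rewrite SE rootZ ?root_prod_XsubC // lead_coef_eq0 -size_poly_eq0 size_XnsubC.
Qed.

Lemma prim_root_exists (l : nat) : prime l -> exists z : Om, l.-primitive_root z.
Proof.
move=> pl; have l1 := prime_gt1 pl; have l0 := prime_gt0 pl.
have l10 : (0 < l.-1)%N by rewrite -ltnS prednK.
(* z is a root of 1 + X + ... + X^(l-1); it differs from 1 because l is nonzero in characteristic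
   0. *)
have [z zE] := @solve_monicpoly Om l.-1 (fun=> -1) l10.
have S0 : \sum_(i < l) z ^+ i = 0.
  rewrite -[l]prednK // big_ord_recr /= zE -big_split /= big1 // => i _.
  by rewrite mulN1r subrr.
have zl : z ^+ l = 1 by apply/eqP; rewrite -subr_eq0 subrX1 S0 mulr0.
have [m mP] := prim_order_exists l0 zl.
have m1 : m != 1%N.
  apply: contraL (l0) => /eqP m1; rewrite m1 in mP.
  have := prim_expr_order mP; rewrite expr1 => z1; move/eqP: S0; rewrite z1.
  by rewrite (eq_bigr (fun=> 1)) => [|i _]; rewrite ?expr1n // sumr_const card_ord natr_eq0Q lt0n negbK.
by move/(prime_nt_dvdP pl m1) => <-; exists z.
Qed.

Lemma aint_root (l : nat) x : (0 < l)%N -> aint (x ^+ l) -> aint x.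
Proof.
move=> l0 ax; apply: (@integral_root_monic _ _ _ _ ('X^l - (x ^+ l)%:P)).
- exact: monicXnsubC.
- by rewrite rootE !hornerE subrr.
- move=> c /(nthP 0) [i _ <-]; rewrite coefB coefXn coefC.
  apply: aintB; first exact: aint_nat.
  by case: ifP => _ //; exact: aint0.
Qed.

Section SimpleValue.
Context (R : realType) (t : Om) (at_ : aint t) (D : int) (DE : orb_disc t = D%:~R)
  (D0 : D != 0) (fz : {poly int}) (fzE : orbpoly t = map_poly intr fz).

(** Since [pzeta] becomes positive near s = 1, the set of pairs (q, r) cannot be empty. *)
Lemma root_exists : exists (q r : nat), [/\ prime q, ~~ (q %| D)%Z & (q %| fz.[r%:Z])%Z].
Proof.
have [P0 [C [P0D lowP]]] := @pzeta_lower R Qb t at_ D DE D0 fz fzE.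
have [d /andP [d0 d1] dP] := ln_inv_near (C + 1).
have s12 : 1 < 1 + d / 2 <= 2 by apply/andP; split; lra.
have [Y YP] := lowP _ s12.
have := dP (1 + d / 2); have -> : 1 < 1 + d / 2 < 1 + d by apply/andP; split; lra.
move=> /(_ isT) dd; have pz : 0 < pzeta fz P0 Y (1 + d / 2) by lra.
have [E|[x]] := set_0Vmem (good fz P0 Y).
  by move: pz; rewrite /pzeta E big_set0 ltxx.
rewrite finset.inE => /and4P [pp P0p _ dv]; exists x.1, x.2; split=> //.
by rewrite dvdzE /= gtnNdvd ?absz_gt0 // (leq_ltn_trans P0D).
Qed.

(** If q^2 divided both f(r) and f(r + q), write these values as (r - y) A and (r + q - y) A', where
    y is the root congruent to r. Eliminating r - y gives A A' in Q, although A and A' are products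
    of differences outside Q. *)
Lemma simple_value : exists (q c : nat), [/\ prime q, ~~ (q %| D)%Z, (q %| fz.[c%:Z])%Z &
  ~~ (Posz (q ^ 2)%N %| fz.[c%:Z])%Z].
Proof.
have [q [r [pp qD dv]]] := root_exists.
have [sq|] := boolP (Posz (q ^ 2)%N %| fz.[r%:Z])%Z; last by exists q, r.
have dvq : (q %| fz.[(r + q)%N%:Z])%Z.
  have [Q plQ] := place_exists Qb pp.
  apply/(pl_int plQ pp); rewrite -(@ev_nat Qb).
  rewrite -[X in Q X](subrK (map_poly intr fz).[r%:R]); apply: (plD plQ).
    apply: (ev_cong (Qb := Qb) plQ) => //; try exact: aint_nat.
    by rewrite natrD addrC addKr; exact: (plp plQ).
  by rewrite (@ev_nat Qb); apply/(pl_int plQ pp).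
exists q, (r + q)%N; split=> //; apply/negP => sq'.
have [Q plQ] := place_exists Qb pp.
have [y yo Qy] := root_place at_ fzE plQ pp dv.
have oth (m : nat) : Q (m%:R - y) -> exists A, [/\ aint A, ~ Q A & (m%:R - y) * A = (fz.[m%:Z])%:~R].
  move=> Qm; exists (\prod_(z <- orb t | z != y) (m%:R - z)); split.
  - rewrite big_seq_cond; apply: aint_prod => z /andP [zo _].
    by apply: aintB; [exact: aint_nat|exact: aint_orb zo].
  - move/(pl_prod plQ) => [|z zo [/eqP zy Qz]].
      by move=> z zo _; apply: aintB; [exact: aint_nat|exact: aint_orb zo].
    apply: zy; apply: (pl_sep plQ pp at_ DE qD) => //.
    by have := plB plQ Qm Qz; rewrite opprB addrC subrKA.
  - by rewrite -(orbpoly_nat fzE) [RHS](big_rem y) //= (rem_filter _ (orb_uniq t)) big_filter.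
have Qy' : Q ((r + q)%N%:R - y).
  by rewrite natrD addrAC; apply: (plD plQ) => //; exact: (plp plQ).
have [A [aA nA AE]] := oth r Qy; have [A' [aA' nA' AE']] := oth _ Qy'.
have /dvdzP [u uE] := sq; have /dvdzP [v vE] := sq'.
have E : A * A' = q%:R * (v%:~R * A - u%:~R * A').
  apply: (mulfI (x := (q%:R : Om))); first by rewrite natr_eq0Q -lt0n prime_gt0.
  have -> : q%:R * (A * A') = ((r + q)%N%:R - y) * A' * A - (r%:R - y) * A * A'.
    by rewrite natrD; ring.
  by rewrite AE AE' uE vE !intrM -!pmulrn natrX; ring.
have : Q (A * A').
  rewrite E; apply: (plMr plQ); last exact: (plp plQ).
  by apply: aintB; apply: aintM => //; exact: aint_int.
by case/(pl_prime plQ).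
Qed.
End SimpleValue.
End NormalGenerator.

Section LCharMember.
Context (R : realType) (K : fieldType) (Kb : alg_closure K) (l : nat) (l_pr : prime l).

Lemma dchar_expg (x : dirichlet_char R Kb) k (s : absgal Kb) : (x ^+ k)%g s = x s ^+ k.
Proof. by elim: k => [//|k IH]; rewrite expgS exprS -IH. Qed.

Lemma root_lchar (x : dirichlet_char R Kb) : (forall s, x s ^+ l = 1) ->
  x \in lchar_pred R Kb l.
Proof.
move=> xl; have [->|x1] := eqVneq x 1%g; first exact: lchar_pred1.
apply/asboolP => H [_]; apply; split; first exact: prime_gt0.
  by apply: dchar_eq => s; rewrite dchar_expg xl.
move=> m /andP [m0 ml] xm; move/eqP: x1; apply; apply: dchar_eq => s.
have xm' : x s ^+ m = 1 by rewrite -dchar_expg xm.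
have : coprime m l by rewrite coprime_sym prime_coprime // gtnNdvd.
move=> /eqP gE; have [u v E _] := egcdnP l m0.
have : x s ^+ (u * m) = x s ^+ (v * l + gcdn m l) by rewrite E.
by rewrite gE exprD mulnC exprM xm' expr1n mulnC exprM xl expr1n mul1r expr1.
Qed.
End LCharMember.

Section Transfer.
Context (R : realType) (K : fieldExtType rat) (Kb : alg_closure K) (l : nat) (l_pr : prime l).
Local Notation Om := (ac_field Kb).
Local Notation Qb := (Qbar Kb).
Local Notation gal := (absgal (Qbar Kb)).
Local Notation emb := (ac_emb Kb).
Implicit Types (g h : gal) (s : absgal Kb) (y z : Om).
Context (t a al : Om) (a0 : a != 0) (alE : al ^+ l = a)
  (ta : sfix (Qb := Qb) t a) (tmu : forall z, z ^+ l = 1 -> sfix (Qb := Qb) t z)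
  (f : {rmorphism Om -> R[i]}).

Lemma al_neq0 : al != 0.
Proof. by move: a0; rewrite -alE expf_eq0 negb_and => /orP []//; rewrite -leqNgt leqn0 => /eqP l0; move: l_pr; rewrite l0. Qed.

Lemma kum_root g : g t = t -> (g al / al) ^+ l = 1.
Proof. by move=> gt; rewrite expr_div_n -rmorphXn /= alE ta // divff. Qed.

(* trf is the Kummer character of a = al ^+ l on the stabilizer of t, composed
   with the transfer from the Galois group of K; f maps roots of unity to R[i]. *)
Definition kap g : R[i] := f (g al / al).

Lemma kapM g g' : g t = t -> g' t = t -> kap (g * g')%g = kap g * kap g'.
Proof.
move=> gt gt'; rewrite /kap -rmorphM; congr (f _).
have : g (g' al / al) = g' al / al by apply: (tmu (kum_root gt')).
rewrite fmorph_div => E; rewrite [(g * g')%g al](_ : _ = g (g' al)) //.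
have gal0 : g al != 0 by rewrite fmorph_eq0 al_neq0.
have -> : g (g' al) = g (g' al) / g al * g al by rewrite divfK.
by rewrite E; ring.
Qed.

Definition Ot : seq Om := [seq y <- orb (Qb := Qb) t | `[< exists s, s t = y >]].

Lemma OtP y : reflect (exists s, s t = y) (y \in Ot).
Proof.
rewrite mem_filter; apply: (iffP andP) => [[/asboolP //]|ex]; split; first exact/asboolP.
by have [s sE] := ex; apply/(@orbP Qb); exists (toQ s).
Qed.

Lemma Ot_uniq : uniq Ot.
Proof. exact/filter_uniq/orb_uniq. Qed.

Lemma Ot_s s y : y \in Ot -> s y \in Ot.
Proof. by move=> /OtP [s' <-]; apply/OtP; exists (s * s')%g. Qed.

Lemma Ot_perm s : perm_eq [seq s y | y <- Ot] Ot.
Proof.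
have u : uniq [seq s y | y <- Ot] by rewrite map_inj_uniq ?Ot_uniq //; exact: fmorph_inj.
apply: uniq_perm => //; first exact: Ot_uniq.
apply: (uniq_min_size u _ _).2; last by rewrite size_map.
by move=> _ /mapP [y yO ->]; exact: Ot_s.
Qed.

Definition rep y : absgal Kb := xget 1%g [set s : absgal Kb | s t = y].

Lemma repP y : y \in Ot -> rep y t = y.
Proof. by move=> /OtP [s sE]; rewrite /rep; case: xgetP => [//|/(_ s)]. Qed.

(** The factor of s at the coset labelled y in the transfer; it lies in the stabilizer of t and
    satisfies the cocycle rule [twM]. *)
Definition tw s y : gal := (toQ (rep (s y))^-1%g * toQ s * toQ (rep y))%g.

Lemma tw_fix s y : y \in Ot -> tw s y t = t.
Proof.
move=> yO; rewrite -[LHS]/(absgal_invf (rep (s y)) (s (rep y t))) repP //.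
by rewrite -{2}(repP (Ot_s s yO)) absgal_funK.
Qed.

Lemma twM s s' y : tw (s * s')%g y = (tw s (s' y) * tw s' y)%g.
Proof.
apply: absgal_eq => z.
rewrite -[RHS]/(absgal_invf (rep (s (s' y))) (s (rep (s' y) (absgal_invf (rep (s' y)) (s' (rep y z)))))).
by rewrite absgal_invfK.
Qed.

Definition trf s : R[i] := \prod_(y <- Ot) kap (tw s y).

Lemma trf_neq0 s : trf s != 0.
Proof.
rewrite /trf prodf_seq_neq0; apply/allP => y _ /=.
by rewrite /kap fmorph_eq0 mulf_neq0 ?invr_neq0 ?fmorph_eq0 ?al_neq0.
Qed.

Lemma trfM s s' : trf (s * s')%g = trf s * trf s'.
Proof.
rewrite /trf -[X in _ = X * _](perm_big _ (Ot_perm s')) big_map -big_split /=.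
rewrite big_seq [RHS]big_seq; apply: eq_bigr => y yO.
by rewrite twM kapM //; apply: tw_fix => //; exact: Ot_s.
Qed.

Lemma trf_cont s (e : R[i]) : 0 < e -> exists S : seq Kb, forall s' : absgal Kb,
    {in S, s' =1 s} -> `|trf s' - trf s| < e.
Proof.
move=> e0; exists (Ot ++ [seq rep y al | y <- Ot]) => s' sS.
suff -> : trf s' = trf s by rewrite subrr normr0.
rewrite /trf big_seq [RHS]big_seq; apply: eq_bigr => y yO.
rewrite /kap -![tw _ y al]/(absgal_invf (rep (_ y)) (_ (rep y al))).
rewrite -![toQ _ _]/(_ (rep y al)) (sS y) ?mem_cat ?yO // (sS (rep y al)) //.
by rewrite mem_cat; apply/orP; right; apply/mapP; exists y.
Qed.

Definition trf_char : dirichlet_char R Kb := DirichletChar trf_neq0 trfM trf_cont.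

Lemma trf_root s : trf s ^+ l = 1.
Proof.
rewrite /trf -prodrXl big_seq big1 // => y yO.
by rewrite /kap -rmorphXn kum_root ?rmorph1 //; exact: tw_fix.
Qed.

End Transfer.

Section Kummer.
Context (R : realType) (K : fieldExtType rat) (Kb : alg_closure K) (l : nat) (l_pr : prime l).
Local Notation Om := (ac_field Kb).
Local Notation Qb := (Qbar Kb).
Local Notation gal := (absgal (Qbar Kb)).
Local Notation emb := (ac_emb Kb).
Implicit Types (g h : gal) (s : absgal Kb) (y z : Om).

(** For h outside the Galois group of K, conjugation by h is visible to characters of order dividing
    l on every open subgroup. Otherwise the transferred Kummer character of a would agree with its
    conjugate by h near 1, and Kummer theory would make a certain product of conjugates of a an l-th
    power in Q(t), against the valuation at q. *)
Lemma kummer_sep (h : gal) (t0 : Om) : ~ fixK h ->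
  exists (x : lchar R Kb l) (s s' : absgal Kb),
    [/\ s t0 = t0, toQ s' = (h^-1 * toQ s * h)%g & x s <> x s'].
Proof.
move=> nh; have l0 := prime_gt0 l_pr; have l1 := prime_gt1 l_pr.
have [e ae eP] := K_gen Kb; have [S SP] := unity_list Qb l0.
have [t [at_ tS tn]] := @normal_gen Qb ([:: t0, e & S]).
have tt0 : sfix (Qb := Qb) t t0 by apply: tS; rewrite mem_head.
have tK g : g t = t -> fixK g by move=> gt; apply/eP; apply: (tS e) => //; rewrite !inE eqxx orbT.
have tmu z : z ^+ l = 1 -> sfix (Qb := Qb) t z.
  by move=> /SP zS; apply: tS; rewrite !inE zS !orbT.
have [D DE D0] := @orb_disc_int Qb t at_; have [fz fzE] := @orbpoly_int Qb t at_.
have [q [c [pq qD qf qf2]]] := @simple_value Qb R t at_ D DE D0 fz fzE.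
have fz0 : fz.[c%:Z] != 0 by apply: contraNneq qf2 => ->; exact: dvdz0.
(* The norm of a is f(c), divisible by q exactly once. So a single conjugate of a lies in a given
   place above q, and there with valuation one. *)
pose a : Om := c%:R - t.
have aa : aint (a : Qb) by apply: (@aintB Qb) => //; exact: (@aint_nat Qb).
have cprod := orbpoly_nat (Qb := Qb) fzE c.
have a0 : a != 0.
  apply: contraNneq fz0 => aE; rewrite -(intr_eq0Q Qb) -cprod.
  by rewrite (big_rem t) ?orb_self //= -/a aE mul0r.
have [al alE] : exists al : Om, al ^+ l = a.
  have [al alE] := @solve_monicpoly Om l (fun i => if i == 0%N then a else 0) l0.
  exists al; rewrite {}alE (bigD1 (Ordinal l0)) //= expr0 mulr1 big1 ?addr0 // => i.
  by rewrite -val_eqE /= => /negbTE ->; rewrite mul0r.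
have sfD g : g t = t -> g a = a by move=> gt; rewrite /a rmorphB rmorph_nat gt.
have [f fP] : exists f : {rmorphism Om -> R[i]}, forall q : rat, f (ac_emb Qb q) = ratr q.
  exact: (@closure_hom rat Om R[i] (ac_emb Qb) (ratr : {rmorphism rat -> R[i]}) (@ac_alg _ Qb)).
pose x0 := trf_char l_pr a0 alE sfD tmu f.
have x0P : x0 \in lchar_pred R Kb l by apply: root_lchar => // s; rewrite [x0 s]/(trf t al f s); exact: (trf_root a0 alE sfD).
pose x := LChar x0P.
apply: contrapT => /forallNP H.
have eq s s' : s t = t -> toQ s' = (h^-1 * toQ s * h)%g -> x s = x s'.
  move=> st sE; apply: contrapT => ne; apply: (H x); exists s, s'; split=> //.
  exact: (tt0 (toQ s)).
have [ze zeP] := @prim_root_exists Qb l l_pr.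
have exk g : exists k : 'I_l, forall u, u ^+ l = 1 -> g u = u ^+ k.
  have : (g ze) ^+ l = 1 by rewrite -rmorphXn /= prim_expr_order // rmorph1.
  move=> /(prim_rootP zeP) [k kE]; exists k => u /(prim_rootP zeP) [i ->].
  by rewrite rmorphXn /= kE -!exprM mulnC.
have [kk kkP] := boolp.choice exk.
have kk1 g : g t = t -> kk g = 1%N :> nat.
  move=> gt; have zl := prim_expr_order zeP.
  have : ze ^+ kk g = ze ^+ 1 by rewrite -kkP // expr1; exact: (tmu ze zl).
  by move/eqP; rewrite (eq_prim_root_expr zeP) !modn_small // => /eqP.
have tfix (g m : gal) : g t = t -> g (m t) = m t by move=> gt; exact: (tn m g gt).
have ma (m : gal) : m a = c%:R - m t by rewrite /a rmorphB rmorph_nat.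
pose u (g m : gal) := g (m al) / m al.
have al0 : al != 0 by exact: (al_neq0 l_pr a0 alE).
have uroot g m : g t = t -> u g m ^+ l = 1.
  move=> gt; rewrite /u expr_div_n -!rmorphXn /= alE ma rmorphB rmorph_nat tfix // divff //.
  by rewrite -ma fmorph_eq0.
have uK (g m : gal) k : g (m al ^+ k) = u g m ^+ k * m al ^+ k.
  by rewrite -exprMn /u divfK ?fmorph_eq0 // rmorphXn.
(* The Kummer character of a conjugated by m is that of m a, raised to the power by which m^-1 acts
   on the l-th roots of unity. *)
have conjE g m : g t = t -> (m^-1 * g * m)%g al / al = u g m ^+ kk m^-1%g.
  move=> gt; rewrite -kkP ?uroot // /u fmorph_div !(@gal_mulE Qb).
  by rewrite [X in _ = _ / X](@gal_invK Qb).
pose Y := Ot t; pose w y := toQ (rep t y).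
have tY : t \in Y by apply/OtP; exists 1%g.
have wt y : y \in Y -> w y t = y by exact: repP.
have trfE s : s t = t -> x s = f (\prod_(y <- Y) u (toQ s) (w y) ^+ kk (w y)^-1%g).
  move=> st; rewrite rmorph_prod [LHS]/(trf t al f s) /trf big_seq [RHS]big_seq.
  apply: eq_bigr => y yY; rewrite /kap; congr (f _); rewrite -conjE //.
  congr (_ / _); have sy : s y = y by have := tfix (toQ s) (w y) st; rewrite wt.
  by rewrite /tw sy toQV.
pose k1 y := nat_of_ord (kk (w y)^-1%g); pose k2 y := nat_of_ord (kk (h * w y)^-1%g).
(* The assumed equality of characters says that each g fixing t multiplies the first product and the
   product of the powers [k2] by the same root of unity, so B is fixed. The exponent l - k2 replaces
   -k2 to keep B integral. *)
pose B : Om := \prod_(y <- Y) (w y al) ^+ k1 y * \prod_(y <- Y) ((h * w y)%g al) ^+ (l - k2 y).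
have tB : sfix (Qb := Qb) t B.
  move=> g gt; have [s sE] := toQ_onto (tK g gt).
  have gt' : (h^-1 * g * h)%g t = t.
    by rewrite !(@gal_mulE Qb) (tfix g h gt) (@gal_invK Qb).
  have [s' sE'] := toQ_onto (tK _ gt').
  have st : s t = t by rewrite -[s t]/(toQ s t) sE.
  have st' : s' t = t by rewrite -[s' t]/(toQ s' t) sE'.
  have := eq s s' st; rewrite sE' sE => /(_ erefl).
  rewrite !trfE // => /(fmorph_inj f); rewrite sE sE'.
  have -> : \prod_(y <- Y) u (h^-1 * g * h)%g (w y) ^+ kk (w y)^-1%g =
      \prod_(y <- Y) u g (h * w y)%g ^+ k2 y.
    apply: eq_bigr => y _; rewrite -conjE // -conjE //; congr (_ / _).
    by rewrite invgM !mulgA.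
  move=> E; rewrite /B rmorphM !rmorph_prod.
  have -> : \prod_(y <- Y) g (w y al ^+ k1 y) =
      \prod_(y <- Y) u g (w y) ^+ k1 y * \prod_(y <- Y) w y al ^+ k1 y.
    by rewrite -big_split; apply: eq_bigr => y _; exact: (uK g (w y)).
  have -> : \prod_(y <- Y) g ((h * w y)%g al ^+ (l - k2 y)) =
      \prod_(y <- Y) u g (h * w y)%g ^+ (l - k2 y) * \prod_(y <- Y) (h * w y)%g al ^+ (l - k2 y).
    by rewrite -big_split; apply: eq_bigr => y _; exact: (uK g (h * w y)%g).
  rewrite E mulrACA -big_split /= big1 ?mul1r // => y _.
  by rewrite -exprD subnKC; [exact: uroot|exact/ltnW/ltn_ord].
have [Q0 plQ0] := place_exists Qb pq.
have [y0 /orbP [g0 g0E] Qy0] := root_place (Qb := Qb) at_ fzE plQ0 pq qf.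
have [Q [plQ Qa]] : exists Q, place (Qb := Qb) q Q /\ Q a.
  exists [set z | Q0 (g0 z)]; split; first exact: place_gal.
  by rewrite /= ma g0E.
have oth y : y \in orb (Qb := Qb) t -> Q (c%:R - y) -> y = t.
  move=> yo Qy; apply: (@pl_sep Qb q Q plQ pq t D) => //; first exact: orb_self.
  by have := plB plQ Qa Qy; rewrite /a opprB addrC subrKA.
have acy y : y \in orb (Qb := Qb) t -> aint (c%:R - y : Qb).
  by move=> yo; apply: (@aintB Qb); [exact: (@aint_nat Qb)|exact: (@aint_orb Qb t y at_ yo)].
have Yo y : y \in Y -> y \in orb (Qb := Qb) t by rewrite mem_filter => /andP [].
have hYo y : y \in Y -> h y \in orb (Qb := Qb) t by move=> /Yo; exact: orb_gal.
pose M1 : Om := \prod_(y <- Y | y != t) (c%:R - y) ^+ k1 y.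
pose M2 : Om := \prod_(y <- Y) (c%:R - h y) ^+ (l - k2 y).
have aM1 : aint (M1 : Qb).
  by rewrite /M1 big_seq_cond; apply: (@aint_prod Qb) => y /andP [/Yo yo _]; apply: (@aintX Qb); exact: acy.
have aM2 : aint (M2 : Qb).
  by rewrite /M2 big_seq; apply: (@aint_prod Qb) => y yY; apply: (@aintX Qb); exact/acy/hYo.
have nM1 : ~ Q M1.
  move/(pl_prod plQ) => [y yY _|y yY [/eqP yt]]; first by apply: (@aintX Qb); exact/acy/Yo.
  by move/(pl_exp plQ (acy _ (Yo _ yY)))/oth => /(_ (Yo _ yY)).
(* A factor in Q would mean h y = t for some y in the K-orbit of t, and then h would fix K. *)
have nM2 : ~ Q M2.
  move/(pl_prod plQ) => [y yY _|y yY [_]]; first by apply: (@aintX Qb); exact/acy/hYo.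
  move/(pl_exp plQ (acy _ (hYo _ yY)))/oth => /(_ (hYo _ yY)) hy.
  apply: nh; have fx : fixK (h * w y)%g by apply: tK; rewrite (@gal_mulE Qb) wt.
  by move=> b; have := fx b; rewrite (@gal_mulE Qb) (fixK_toQ (rep t y) b).
have k1t : k1 t = 1%N by apply: kk1; have := @gal_invK Qb (w t) t; rewrite (wt t tY).
have wl y : y \in Y -> (w y al) ^+ l = c%:R - y.
  by move=> yY; rewrite -rmorphXn alE ma wt.
have hl y : y \in Y -> ((h * w y)%g al) ^+ l = c%:R - h y.
  by move=> yY; rewrite -rmorphXn alE ma (@gal_mulE Qb) wt.
have BE : B ^+ l = a * (M1 * M2).
  rewrite /B exprMn -!prodrXl mulrA; congr (_ * _).
    rewrite (bigD1_seq t) //; last exact: Ot_uniq.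
    congr (_ * _); first by rewrite k1t expr1 wl.
    rewrite /M1 big_seq_cond [RHS]big_seq_cond; apply: eq_bigr => y /andP [yY _].
    by rewrite exprAC wl.
  rewrite /M2 big_seq [RHS]big_seq; apply: eq_bigr => y yY.
  by rewrite exprAC hl.
have aal : aint (al : Qb) by apply: (@aint_root Qb l); rewrite ?alE.
have aB : aint (B : Qb).
  by apply: (@aintM Qb); apply: (@aint_prod Qb) => y _; apply: (@aintX Qb); exact: (@aint_gal Qb).
have QB : Q B.
  apply: (@pl_exp Qb q Q plQ B l aB); rewrite BE; apply: (plMr plQ) => //; exact: (@aintM Qb).
have [v [av sv nv vP]] := @pl_unr Qb q Q plQ pq t D at_ DE qD.
have [z az zE] := vP B tB QB.
pose M' : Om := \prod_(y <- orb (Qb := Qb) t | y != t) (c%:R - y).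
have aM' : aint (M' : Qb).
  by rewrite /M' big_seq_cond; apply: (@aint_prod Qb) => y /andP [yo _]; exact: acy.
have FE : (fz.[c%:Z])%:~R = a * M'.
  by rewrite -cprod (bigD1_seq t) ?orb_self ?orb_uniq.
(* Here v B = q z, B^l = a M1 M2 and f(c) = a M'. So v^l M1 M2 f(c) is q^l times an algebraic
   integer, with v^l M1 M2 outside Q. *)
have : (Posz (q ^ l)%N %| fz.[c%:Z])%Z.
  apply: (@pl_symb Qb q Q plQ pq (z ^+ l * M') (v ^+ l * (M1 * M2))).
  - by apply: (@aintM Qb); [exact: (@aintX Qb)|exact: (@aintM Qb)].
  - move/(pl_prime plQ) => [||/(pl_exp plQ av) //|]; first exact: (@aintX Qb).
      exact: (@aintM Qb).
    by move/(pl_prime plQ) => [].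
  - by apply: (@aintM Qb) => //; exact: (@aintX Qb).
  - rewrite FE.
    have -> : v ^+ l * (M1 * M2) * (a * M') = (v ^+ l * (a * (M1 * M2))) * M'.
      by rewrite -!mulrA; congr (_ * _); rewrite [RHS]mulrCA; congr (_ * _); rewrite mulrCA.
    by rewrite -BE -exprMn zE exprMn mulrA.
move=> dvl; move/negP: qf2; apply; apply: dvdz_trans dvl.
by rewrite dvdzE /= dvdn_exp2l.
Qed.

End Kummer.

(** * Evaluating finitely many characters at one Frobenius element *)

Section CommonFrobenius.
Context (R : realType) (K : fieldExtType rat) (Kb : alg_closure K) (l : nat) (l_pr : prime l).
Local Notation Om := (ac_field Kb).
Local Notation Qb := (Qbar Kb).
Local Notation gal := (absgal (Qbar Kb)).
Local Notation emb := (ac_emb Kb).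
Implicit Types (g h : gal) (s : absgal Kb) (Q : set Om) (x : lchar R Kb l).

Lemma lchar_open x : opench x.
Proof. by apply: (@root_open _ _ _ _ l); [exact: prime_gt0|exact: lchar_root]. Qed.

Lemma common_eval (Z : seq (lchar R Kb l)) : exists (P0 : nat) (T : Om), aint (T : Qb) /\
  forall (T' : Om) (D : int), aint (T' : Qb) -> sfix (Qb := Qb) T' T -> orb_disc (T' : Qb) = D%:~R ->
  forall (P : primes_of K) Q g, dg1 P -> (P0 < rchar (val P))%N -> ~~ (rchar (val P) %| D)%Z ->
    place (Qb := Qb) (rchar (val P)) Q -> (forall a, val P a -> Q (emb a)) ->
    Q (g T' - T' ^+ rchar (val P)) ->
    fixK g /\ forall s, toQ s = g -> forall x, x \in Z -> char_at x P = x s.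
Proof.
elim: Z => [|x Z [P1 [T1 [aT1 H1]]]].
  have [P0 [T [aT H]]] := char_at_eval (lchar_open 1%g).
  exists P0, T; split=> // T' D aT' T'T DE P Q g d1 Pp pD plQ PQ Qg.
  by have [s <- _] := H T' D aT' T'T DE P Q g d1 Pp pD plQ PQ Qg; split; [exact: fixK_toQ|].
have [P2 [T2 [aT2 H2]]] := char_at_eval (lchar_open x).
have [T [aT TS _]] := prim_elem (Qb := Qb) [:: T1; T2].
have TT1 : sfix (Qb := Qb) T T1 by apply: TS; rewrite !inE eqxx.
have TT2 : sfix (Qb := Qb) T T2 by apply: TS; rewrite !inE eqxx orbT.
exists (maxn P1 P2), T; split=> // T' D aT' T'T DE P Q g d1 Pp pD plQ PQ Qg.
have tr T0 : sfix (Qb := Qb) T T0 -> sfix (Qb := Qb) T' T0 by move=> TT0 h /T'T /TT0.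
have P1p := leq_ltn_trans (leq_maxl _ _) Pp; have P2p := leq_ltn_trans (leq_maxr _ _) Pp.
have [fg Hg] := H1 T' D aT' (tr _ TT1) DE P Q g d1 P1p pD plQ PQ Qg; split=> // s sE y.
rewrite inE => /orP [/eqP ->|]; last exact: Hg.
have [s' sE' ->] := H2 T' D aT' (tr _ TT2) DE P Q g d1 P2p pD plQ PQ Qg.
by congr (lchar_val x _); apply: toQ_inj; rewrite sE'.
Qed.

Lemma common_frob (Z : seq (lchar R Kb l)) : exists P0 : nat, forall P : primes_of K,
  dg1 P -> (P0 < rchar (val P))%N -> exists s, forall x, x \in Z -> char_at x P = x s.
Proof.
have [P0 [T [aT H]]] := common_eval Z; have [D DE D0] := @orb_disc_int Qb T aT.
exists (maxn P0 (absz D)) => P d1 Pp; have [pp PPp] := rcharP Kb P.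
have [Q0 plQ0] := place_exists Qb pp.
have [g0 g0P] := prime_contr (primes_ofP P) pp PPp plQ0.
have plQ := place_gal plQ0 g0.
have [g Qg] := pl_frob plQ pp aT.
have [||||fg Hg] := H T D aT _ DE P _ g d1 _ _ plQ _ Qg.
- by move=> h.
- exact: leq_ltn_trans (leq_maxl _ _) Pp.
- by rewrite dvdzE /= gtnNdvd ?absz_gt0 //; exact: leq_ltn_trans (leq_maxr _ _) Pp.
- by move=> a /g0P [].
by have [s sE] := toQ_onto fg; exists s; exact: Hg.
Qed.

Lemma char_at_norm x (P : primes_of K) : `|char_at x P| <= 1.
Proof.
rewrite /char_at; case: ifP => _; last by rewrite normr0.
set s := xget _ _; have /(congr1 Num.norm) := lchar_root x s.
rewrite normrX normr1 => /eqP; rewrite pexpr_eq1 ?prime_gt0 // => /eqP ->.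
exact: lexx.
Qed.

Definition gp m (Y : 'I_m -> lchar R Kb l) (k : 'I_m -> nat) : lchar R Kb l :=
  foldr (fun i acc => (Y i ^+ k i * acc)%g) 1%g (enum 'I_m).

Lemma gp_eval m (Y : 'I_m -> lchar R Kb l) (k : 'I_m -> nat) s :
  gp Y k s = \prod_(i < m) Y i s ^+ k i.
Proof.
rewrite /gp -big_enum; elim: (enum _) => [|i r IH]; first by rewrite big_nil.
rewrite big_cons -IH /=; congr (_ * _).
elim: (k i) => [//|n IHn]; by rewrite expgS exprS -IHn.
Qed.

(** At a ramified prime the value 0 breaks multiplicativity in the character; at large primes of
    degree one all these values are taken at a single s. *)
Lemma char_at_gp m (Y : 'I_m -> lchar R Kb l) : exists P0 : nat, forall P : primes_of K,
  dg1 P -> (P0 < rchar (val P))%N ->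
  (forall i, char_at (Y i) P ^+ l = 1) /\ forall k : {ffun 'I_m -> 'I_l},
    char_at (gp Y (fun i => k i : nat)) P = \prod_(i < m) char_at (Y i) P ^+ k i.
Proof.
pose Z := [seq Y i | i <- enum 'I_m] ++
  [seq gp Y (fun i => (k : {ffun 'I_m -> 'I_l}) i : nat) | k : {ffun 'I_m -> 'I_l} <- enum {ffun 'I_m -> 'I_l}].
have [P0 H] := common_frob Z; exists P0 => P d1 Pp; have [s sP] := H P d1 Pp.
have Yi i : char_at (Y i) P = Y i s.
  by apply: sP; rewrite mem_cat map_f // mem_enum.
split=> [i|k]; first by rewrite Yi lchar_root.
rewrite sP ?gp_eval; first by apply: eq_bigr => i _; rewrite Yi.
rewrite mem_cat; apply/orP; right; apply/mapP; exists k => //.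
by rewrite mem_enum.
Qed.

End CommonFrobenius.

Section LcharIso.
Context (R : realType) (K K' : fieldType) (Kb : alg_closure K) (Kb' : alg_closure K')
  (l : nat) (psi : lchar_iso R Kb Kb' l).

Lemma lci1 : psi 1%g = 1%g.
Proof. by apply: (mulgI (psi 1%g)); rewrite -gmulfM !mulg1. Qed.

Lemma lciX (x : lchar R Kb l) k : psi (x ^+ k)%g = (psi x ^+ k)%g.
Proof. by elim: k => [|k IH]; rewrite ?lci1 // !expgS gmulfM IH. Qed.
End LcharIso.

Lemma gp_morph (R : realType) (K K' : fieldExtType rat) (Kb : alg_closure K) (Kb' : alg_closure K')
    (l m : nat) (psi : lchar_iso R Kb Kb' l) (Y : 'I_m -> lchar R Kb l) (k : 'I_m -> nat) :
  psi (gp Y k) = gp (fun i => psi (Y i)) k.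
Proof.
rewrite /gp; elim: (enum _) => [|i r IH] /=; first exact: lci1.
by rewrite gmulfM lciX IH.
Qed.

Section CharacterSums.
Context (C : numClosedFieldType) (l : nat) (l_gt0 : (0 < l)%N).

Lemma unity_sum (u : C) : u ^+ l = 1 -> \sum_(j < l) u ^+ j = if u == 1 then l%:R else 0.
Proof.
move=> ul; case: eqVneq => [->|u1].
  by under eq_bigr do rewrite expr1n; rewrite sumr_const card_ord.
apply/eqP; have := subrX1 u l; rewrite ul subrr => /esym /eqP.
by rewrite mulf_eq0 subr_eq0 (negbTE u1).
Qed.

(* Orthogonality of characters of (Z/l)^m, applied to two families of points of mu_l^m. *)
Lemma unity_match (m : nat) (T T' : eqType) (X : seq T) (X' : seq T')
    (a : T -> 'I_m -> C) (b : T' -> 'I_m -> C) (P0 : T) : P0 \in X ->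
  (forall P i, P \in X -> a P i ^+ l = 1) -> (forall P i, P \in X' -> b P i ^+ l = 1) ->
  (forall k : {ffun 'I_m -> 'I_l}, \sum_(P <- X) \prod_(i < m) a P i ^+ k i =
     \sum_(P <- X') \prod_(i < m) b P i ^+ k i) ->
  exists2 P, P \in X' & forall i, b P i = a P0 i.
Proof.
move=> PX al bl E.
have a0 i : a P0 i != 0.
  by apply/negP => /eqP a0; have := al P0 i PX; rewrite a0 expr0n -[l]prednK //= => /eqP; rewrite eq_sym oner_eq0.
have key (T0 : eqType) (X1 : seq T0) (c : T0 -> 'I_m -> C) : (forall P i, P \in X1 -> c P i ^+ l = 1) ->
    \sum_(k : {ffun 'I_m -> 'I_l}) (\prod_(i < m) (a P0 i)^-1 ^+ k i) *
      (\sum_(P <- X1) \prod_(i < m) c P i ^+ k i) =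
    (l ^ m)%:R * (count (fun P => [forall i, c P i == a P0 i]) X1)%:R.
  move=> cl; under eq_bigr do rewrite mulr_sumr.
  rewrite exchange_big /= -sum1_count natr_sum mulr_sumr.
  rewrite [RHS]big_mkcond /= big_seq [RHS]big_seq; apply: eq_bigr => P PX1.
  under eq_bigr do rewrite -big_split /=.
  rewrite (eq_bigr (fun k : {ffun 'I_m -> 'I_l} => \prod_(i < m) ((a P0 i)^-1 * c P i) ^+ k i)); last first.
    by move=> k _; apply: eq_bigr => i _; rewrite exprMn.
  rewrite -(bigA_distr_bigA (fun i (j : 'I_l) => ((a P0 i)^-1 * c P i) ^+ j)).
  rewrite (eq_bigr (fun i => if c P i == a P0 i then l%:R else 0)); last first.
    move=> i _; rewrite unity_sum; last by rewrite exprMn exprVn al // cl // invr1 mulr1.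
    by rewrite -(inj_eq (mulfI (a0 i))) mulrA mulfV // mul1r mulr1.
  case: ifP => [/forallP H|/negbT /forallPn [i /negbTE ni]].
    by rewrite (eq_bigr (fun=> l%:R)) => [|i _]; rewrite ?H // prodr_const card_ord natrX mulr1.
  by rewrite (bigD1 i) //= ni mul0r.
have := key T X a al; under eq_bigr do rewrite E; rewrite (key T' X' b bl) => /eqP.
have lm : (l ^ m)%:R != 0 :> C by rewrite pnatr_eq0 -lt0n expn_gt0 l_gt0.
rewrite (inj_eq (mulfI lm)) eqr_nat => /eqP cE.
have : has (fun P => [forall i, b P i == a P0 i]) X'.
  by rewrite has_count cE -has_count; apply/hasP; exists P0 => //; apply/forallP.
by move=> /hasP [P PX' /forallP H]; exists P => // i; exact/eqP.
Qed.
End CharacterSums.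

(** * Dirichlet coefficients of L-series *)

Section ComplexModulus.
Context (R : realType).
Implicit Types z w : R[i].

Definition nc z : R := complex.Re `|z|.

Lemma ncE z : `|z| = (nc z)%:C%C.
Proof. by rewrite /nc normc_def. Qed.

Lemma ncM z w : nc (z * w) = nc z * nc w.
Proof. by apply: (@complexI R); rewrite -ncE normrM rmorphM /= !ncE. Qed.

Lemma ncD z w : nc (z + w) <= nc z + nc w.
Proof. by rewrite -lecR rmorphD /= -!ncE ler_normD. Qed.

Lemma ncN z : nc (- z) = nc z. Proof. by rewrite /nc normrN. Qed.
Lemma nc0 : nc 0 = 0. Proof. by rewrite /nc normr0. Qed.
Lemma nc1 : nc 1 = 1. Proof. by rewrite /nc normr1. Qed.
Lemma nc_ge0 z : 0 <= nc z. Proof. by rewrite -lecR -ncE normr_ge0. Qed.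
Lemma nc_eq0 z : (nc z == 0) = (z == 0).
Proof. by rewrite -[RHS]normr_eq0 ncE -(inj_eq (@complexI R)). Qed.

Lemma ncB z w : nc (z - w) = nc (w - z).
Proof. by rewrite -ncN opprB. Qed.

Lemma nc_nat (n : nat) : nc n%:R = n%:R.
Proof. by apply: (@complexI R); rewrite -ncE normr_nat rmorph_nat. Qed.

Lemma ncV z : nc z^-1 = (nc z)^-1.
Proof. by apply: (@complexI R); rewrite -ncE normfV fmorphV /= ncE. Qed.

Lemma ncX z n : nc (z ^+ n) = nc z ^+ n.
Proof. by elim: n => [|n IH]; rewrite ?nc1 // !exprS ncM IH. Qed.

Lemma nc_sum I (r : seq I) (P : pred I) (F : I -> R[i]) :
  nc (\sum_(i <- r | P i) F i) <= \sum_(i <- r | P i) nc (F i).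
Proof.
elim/big_rec2: _ => [|i y x _ le]; first by rewrite nc0.
by apply: (le_trans (ncD _ _)); rewrite lerD2l.
Qed.

Lemma nc_Re z : `|complex.Re z| <= nc z.
Proof. by rewrite /nc normc_def /= -sqrtr_sqr ler_wsqrtr // lerDl sqr_ge0. Qed.

Lemma nc_Im z : `|complex.Im z| <= nc z.
Proof. by rewrite /nc normc_def /= -sqrtr_sqr ler_wsqrtr // lerDr sqr_ge0. Qed.

Lemma nc_ReIm z : nc z <= `|complex.Re z| + `|complex.Im z|.
Proof.
rewrite /nc normc_def /= -[leRHS]ger0_norm ?addr_ge0 // -sqrtr_sqr ler_wsqrtr //.
rewrite -(real_normK (num_real (complex.Re z))) -(real_normK (num_real (complex.Im z))).
by rewrite sqrrD -addrA lerD2l lerDr mulrn_wge0 // mulr_ge0.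
Qed.

Lemma cauchy_real (v : nat -> R) (C : R) :
  (forall M N, (M <= N)%N -> `|v M - v N| <= C * M.+1%:R^-1) -> cvg (v @ \oo).
Proof.
move=> H; apply/cauchy_cvgP/cauchy_exP => e e0.
have [M Me] : exists M : nat, C * M.+1%:R^-1 < e.
  exists (Num.truncn `|C / e|); rewrite ltr_pdivrMr ?ltr0n // mulrC -ltr_pdivrMr //.
  by apply: (le_lt_trans (ler_norm _)); exact: truncnS_gt.
exists (v M); exists M => // N /= MN; rewrite /ball /=.
exact: le_lt_trans (H M N MN) Me.
Qed.

Lemma cauchy_complex (u : nat -> R[i]) (C : R) :
  (forall M N, (M <= N)%N -> nc (u M - u N) <= C * M.+1%:R^-1) ->
  exists a : R[i], (u : nat -> R[i]^o) @ \oo --> (a : R[i]^o).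
Proof.
move=> H.
have /cvg_ex [a aP] : cvg ((fun n => complex.Re (u n)) @ \oo).
  apply: (@cauchy_real _ C) => M N MN; apply: le_trans (H M N MN).
  by have := nc_Re (u M - u N); rewrite raddfB.
have /cvg_ex [b bP] : cvg ((fun n => complex.Im (u n)) @ \oo).
  apply: (@cauchy_real _ C) => M N MN; apply: le_trans (H M N MN).
  by have := nc_Im (u M - u N); rewrite raddfB.
exists (a +i* b)%C; apply/cvgrPdist_lt => e; rewrite ltcE => /andP [/eqP /= Ie Re0].
have e2 : 0 < complex.Re e / 2 by rewrite divr_gt0.
have /cvgrPdist_lt /(_ _ e2) na := aP; have /cvgrPdist_lt /(_ _ e2) nb := bP.
near=> n.
have h1 : `|a - complex.Re (u n)| < complex.Re e / 2 by near: n.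
have h2 : `|b - complex.Im (u n)| < complex.Re e / 2 by near: n.
have h3 : nc ((a +i* b)%C - u n) < complex.Re e.
  apply: (le_lt_trans (nc_ReIm _)); rewrite !raddfB /=; lra.
by rewrite ncE ltcE /= Ie eqxx.
Unshelve. all: by end_near. Qed.

Lemma nc_lim (u : nat -> R[i]) (a : R[i]) (z : R[i]) (d : R) (M : nat) :
  (u : nat -> R[i]^o) @ \oo --> (a : R[i]^o) ->
  (forall N, (M <= N)%N -> nc (z - u N) <= d) -> nc (z - a) <= d.
Proof.
move=> ua H; apply/ler_addgt0Pr => e e0.
have eC : 0 < e%:C%C :> R[i] by rewrite ltcR.
have /cvgrPdist_lt /(_ _ eC) near_a := ua.
have : \forall N \near \oo, (M <= N)%N /\ `|(a : R[i]^o) - u N| < e%:C%C.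
  by near=> N; split; near: N => //; exact: nbhs_infty_ge.
move=> /filter_ex [N [MN aN]].
have -> : z - a = (z - u N) + (u N - a) by ring.
apply: (le_trans (ncD _ _)); apply: lerD; first exact: H.
by rewrite ncB -lecR -ncE ltW.
Unshelve. all: by end_near. Qed.

Lemma geo_zero (e C q : R) (n0 : nat) : 0 <= q < 1 ->
  (forall n, (n0 <= n)%N -> e <= C * q ^+ n) -> e <= 0.
Proof.
move=> /andP [q0 q1] H; rewrite leNgt; apply/negP => e0.
have qn : `|q| < 1 by rewrite ger0_norm.
have cv : (fun n => C * q ^+ n) @ \oo --> C * 0.
  by apply: cvgM; [exact: cvg_cst|exact: cvg_expr].
rewrite mulr0 in cv; have /cvgrPdist_lt /(_ _ e0) nr := cv.
have : \forall n \near \oo, (n0 <= n)%N /\ `|0 - C * q ^+ n| < e.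
  by near=> n; split; near: n => //; exact: nbhs_infty_ge.
move=> /filter_ex [n [nn]]; rewrite sub0r normrN => lt.
have := le_lt_trans (le_trans (H n nn) (ler_norm _)) lt.
by rewrite ltxx.
Unshelve. all: by end_near. Qed.

End ComplexModulus.

(** * Coefficients of finite Dirichlet polynomials *)

Section DirichletPolynomials.
Context (R : realType).
Implicit Types (L X : seq (nat * R[i])).

(* The list of the (k, c) stands for the Dirichlet polynomial sum c k^-n. *)
Definition dpev L (n : nat) : R[i] := \sum_(u <- L) u.2 * (u.1%:R^-1) ^+ n.
Definition dpcoef L (k : nat) : R[i] := \sum_(u <- L | u.1 == k) u.2.

Lemma dpev_coef L (B n : nat) : (forall u, u \in L -> (u.1 < B)%N) ->
  dpev L n = \sum_(k < B) dpcoef L k * (k%:R^-1) ^+ n.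
Proof.
move=> LB; rewrite /dpev big_seq.
transitivity (\sum_(u <- L | u \in L) \sum_(k < B | u.1 == k) u.2 * ((k%:R^-1) ^+ n : R[i])).
  apply: eq_bigr => u uL; rewrite (big_pred1 (Ordinal (LB u uL))) //.
rewrite -big_seq (exchange_big_dep predT) //=; apply: eq_bigr => k _.
by rewrite /dpcoef mulr_suml.
Qed.

(** The first nonzero coefficient, at some k <= M, would make the polynomial decay like k^-n, slower
    than the assumed (M + 1)^-n. *)
Lemma dp_uniq L (M n0 : nat) (C : R) : (forall u, u \in L -> (0 < u.1)%N) ->
  (forall n, (n0 <= n)%N -> nc (dpev L n) <= C * (M.+1%:R^-1) ^+ n) ->
  forall k, (k <= M)%N -> dpcoef L k = 0.
Proof.
move=> Lpos H; elim/ltn_ind => k IH kM.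
have [->|k0] := posnP k.
  rewrite /dpcoef big_seq_cond big1 // => u /andP [/Lpos]; by case: (u.1).
pose B := (M + \sum_(u <- L) u.1).+1.
have LB u : u \in L -> (u.1 < B)%N.
  move=> uL; rewrite /B ltnS; apply: leq_trans (leq_addl _ _).
  by rewrite (big_rem u) //= leq_addr.
have kB : (k < B)%N by rewrite ltnS (leq_trans kM) // leq_addr.
pose S : R := \sum_(j < B) nc (dpcoef L j).
have inv_le (i j n : nat) : (0 < i)%N -> (i <= j)%N -> (j%:R^-1) ^+ n <= (i%:R^-1) ^+ n :> R.
  move=> i0 ij; apply: lerXn2r; rewrite ?nnegrE ?invr_ge0 //.
  by rewrite lef_pV2 ?posrE ?ltr0n ?ler_nat // (leq_trans i0).
have bound n : (n0 <= n)%N -> nc (dpcoef L k) * (k%:R^-1) ^+ n <= (`|C| + S) * (k.+1%:R^-1) ^+ n.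
  move=> nn; have E := dpev_coef n LB.
  rewrite (bigD1 (Ordinal kB)) //= in E.
  have E2 : dpcoef L k * (k%:R^-1) ^+ n = dpev L n -
      \sum_(i < B | i != Ordinal kB) dpcoef L i * (i%:R^-1) ^+ n by rewrite E addrK.
  have -> : nc (dpcoef L k) * (k%:R^-1) ^+ n = nc (dpcoef L k * (k%:R^-1) ^+ n).
    by rewrite ncM ncX ncV nc_nat.
  rewrite E2; apply: (le_trans (ncD _ _)); rewrite ncN mulrDl; apply: lerD.
    apply: (le_trans (H n nn)); apply: (@le_trans _ _ (`|C| * (M.+1%:R^-1) ^+ n)).
      by rewrite ler_wpM2r ?exprn_ge0 ?invr_ge0 // ler_norm.
    by rewrite ler_wpM2l // inv_le.
  apply: (le_trans (nc_sum _ _ _)); rewrite /S mulr_suml big_mkcond; apply: ler_sum => i _.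
  case: ifP => ik; last by rewrite mulr_ge0 ?nc_ge0 ?exprn_ge0 ?invr_ge0.
  rewrite ncM ncX ncV nc_nat; have [lt|] := ltnP i k.
    by rewrite IH ?nc0 ?mul0r // (leq_trans (ltnW lt)).
  rewrite leq_eqVlt => /orP [/eqP kE|lt]; last by rewrite ler_wpM2l ?nc_ge0 // inv_le.
  by move/negP: ik; case; apply/eqP/val_inj.
have kR : 0 < k%:R :> R by rewrite ltr0n.
apply/eqP; rewrite -nc_eq0 eq_le nc_ge0 andbT.
apply: (@geo_zero R _ (`|C| + S) (k%:R / k.+1%:R) n0).
  by rewrite divr_ge0 //= ltr_pdivrMr ?ltr0n // mul1r ltr_nat.
move=> n nn; rewrite exprMn mulrCA [_ ^+ n * _]mulrC.
rewrite -ler_pdivrMr ?exprn_gt0 //; apply: le_trans (bound n nn).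
by rewrite exprVn.
Qed.

(** The expansion of the product of the factors 1 - u.2 * u.1^-n. *)
Fixpoint mk X : seq (nat * R[i]) :=
  if X is u :: X' then mk X' ++ [seq ((u.1 * v.1)%N, - u.2 * v.2) | v <- mk X'] else [:: (1%N, 1)].

Lemma mk_ev X n : dpev (mk X) n = \prod_(u <- X) (1 - u.2 * (u.1%:R^-1) ^+ n).
Proof.
elim: X => [|u X IH]; first by rewrite /dpev big_seq1 big_nil invr1 expr1n mulr1.
rewrite big_cons -IH /dpev /= big_cat big_map /= mulrBl mul1r; congr (_ + _).
rewrite mulr_sumr -sumrN; apply: eq_bigr => v _.
by rewrite natrM invfM exprMn; ring.
Qed.

Lemma mk_pos X : (forall u, u \in X -> (0 < u.1)%N) -> forall u, u \in mk X -> (0 < u.1)%N.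
Proof.
elim: X => [|u X IH] Xp v /=; first by rewrite inE => /eqP ->.
have IH' := IH (fun w wX => Xp w (mem_behead (s := u :: X) wX)).
rewrite mem_cat => /orP [/IH'//|/mapP [w wX ->]] /=.
by rewrite muln_gt0 (IH' w wX) (Xp u (mem_head _ _)).
Qed.

(** All bases exceed 1, so a prime p arises in the expansion only by choosing a single factor with
    base p. *)
Lemma mk_coef X (p : nat) : prime p -> (forall u, u \in X -> (1 < u.1)%N) ->
  dpcoef (mk X) 1 = 1 /\ dpcoef (mk X) p = - \sum_(u <- X | u.1 == p) u.2.
Proof.
move=> pp; elim: X => [|u X IH] X1.
  rewrite /dpcoef /= !big_cons !big_nil eqxx addr0 oppr0; split=> //.
  by case: eqP => // pE; move: pp; rewrite -pE.
have [IH1 IHp] := IH (fun w wX => X1 w (mem_behead (s := u :: X) wX)).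
have u1 := X1 u (mem_head _ _).
have step (k : nat) : dpcoef (mk (u :: X)) k = dpcoef (mk X) k +
    \sum_(v <- mk X | (u.1 * v.1)%N == k) - u.2 * v.2.
  by rewrite /dpcoef /= big_cat big_map.
split; rewrite step.
  rewrite IH1 big_pred0 ?addr0 // => v; apply/negbTE/negP => /eqP uv.
  by have : (u.1 %| 1)%N by [rewrite -uv dvdn_mulr]; rewrite dvdn1 => /eqP uE; rewrite uE in u1.
have -> : \sum_(v <- mk X | (u.1 * v.1)%N == p) - u.2 * v.2 = if u.1 == p then - u.2 else 0.
  case: eqP => [uE|ne].
    rewrite (eq_bigl (fun v : nat * R[i] => v.1 == 1%N)) => [|v].
      by rewrite -mulr_sumr -/(dpcoef (mk X) 1) IH1 mulr1.
    by rewrite uE -{2}[p]muln1 eqn_pmul2l ?prime_gt0.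
  rewrite big_pred0 // => v; apply/negbTE/negP => /eqP uv.
  have : (u.1 %| p)%N by rewrite -uv dvdn_mulr.
  have un1 : u.1 != 1%N by apply: contraTneq u1 => ->.
  by move/(prime_nt_dvdP pp un1).
by rewrite IHp big_cons; case: ifP => _; rewrite ?addr0 // opprD addrC.
Qed.
End DirichletPolynomials.

(** * Truncated Euler products at integers *)

Section LSeries.
Context (R : realType) (K : fieldExtType rat) (Kb : alg_closure K) (l : nat) (l_pr : prime l).
Local Notation prm := (primes_of K).
Implicit Types (P : prm) (X : seq prm).

Definition y_ (k : nat) P : R := ((prime_norm P)%:R^-1) ^+ k.

Lemma norm_gt1 P : (1 < prime_norm P)%N.
Proof. by apply: leq_trans (norm_ge_char Kb P); exact/prime_gt1/(rcharP Kb P).1. Qed.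

Lemma y_ge0 k P : 0 <= y_ k P. Proof. by rewrite exprn_ge0 // invr_ge0. Qed.

Lemma y_sum2 : exists2 C : R, 0 <= C & forall X, uniq X -> \sum_(P <- X) y_ 2 P <= C.
Proof.
have [C CP] := zeta_upper R Kb; exists `|C| => // X uX; apply: le_trans (ler_norm C).
have s2 : 1 < (2 : R) <= 2 by apply/andP; split; lra.
have := CP 2 X s2 uX; rewrite (_ : (2 - 1)^-1 = 1 :> R) ?ln1 ?add0r; last first.
  by rewrite (_ : 2 - 1 = 1 :> R) ?invr1 //; ring.
apply: le_trans; rewrite le_eqVlt; apply/orP; left; apply/eqP; apply: eq_bigr => P _.
by rewrite /y_ powRN exprVn -powR_mulrn.
Qed.

Lemma norm_finite n : finite_set [set P : prm | (prime_norm P <= n)%N].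
Proof.
apply: contrapT => inf; have [C C0 CP] := y_sum2.
pose m := (Num.truncn (C * n%:R ^+ 2)).+1.
have [B BA mB] := @infinite_set_fset _ [set P : prm | (prime_norm P <= n)%N] m inf.
have n0 : (0 < n)%N.
  have [BE|[P PB]] := fset_0Vmem B; first by rewrite BE cardfs0 in mB.
  by have := BA P PB => /=; apply: leq_trans; exact: ltnW (norm_gt1 P).
have := CP (enum_fset B) (fset_uniq B).
have le : (size (enum_fset B))%:R * (n%:R^-1) ^+ 2 <= \sum_(P <- enum_fset B) y_ 2 P.
  rewrite mulr_natl -iter_addr_0 -(count_predT (enum_fset B)) -big_const_seq.
  rewrite big_seq [leRHS]big_seq; apply: ler_sum => P PB.
  have /= Pn := BA P PB; have P1 := norm_gt1 P.
  apply: lerXn2r; rewrite ?nnegrE ?invr_ge0 //.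
  by rewrite lef_pV2 ?posrE ?ltr0n ?ler_nat // ltnW.
move=> /(le_trans le); rewrite exprVn ler_pdivrMr ?exprn_gt0 ?ltr0n //.
apply/negP; rewrite -ltNge; apply: (@lt_le_trans _ _ m%:R); first exact: truncnS_gt.
by rewrite ler_nat.
Qed.

Definition XX n : seq prm := enum_fset (fset_set [set P : prm | (prime_norm P <= n)%N]).

Lemma XXP n P : (P \in XX n) = (prime_norm P <= n)%N.
Proof.
rewrite /XX in_fset_set; last exact: norm_finite.
by apply/idP/idP => [/set_mem|?]; [|apply/mem_set].
Qed.

Lemma XX_uniq n : uniq (XX n). Proof. exact: fset_uniq. Qed.

Lemma XX_split M N : (M <= N)%N ->
  perm_eq (XX N) (XX M ++ [seq P <- XX N | (M < prime_norm P)%N]).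
Proof.
move=> MN; apply: uniq_perm; first exact: XX_uniq.
  rewrite cat_uniq XX_uniq filter_uniq ?XX_uniq // andbT /=.
  by apply/hasPn => P; rewrite mem_filter => /andP [lt _] /=; rewrite XXP -ltnNge.
move=> P; rewrite mem_cat mem_filter !XXP; case: leqP => //= lt.
by rewrite (leq_trans lt).
Qed.

Section Char.
Context (x : lchar R Kb l).
Local Notation v P := (char_at x P).
Definition fac k P : R[i] := 1 - v P * ((prime_norm P)%:R^-1) ^+ k.

Lemma nc_term k P : nc (v P * ((prime_norm P)%:R^-1) ^+ k) <= y_ k P.
Proof.
rewrite ncM ncX ncV nc_nat -[leRHS]mul1r ler_wpM2r ?y_ge0 //.
by rewrite -lecR -ncE; exact: char_at_norm.
Qed.

Lemma y_le k P : (0 < k)%N -> y_ k P <= 2^-1.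
Proof.
move=> k0; have P1 := norm_gt1 P.
have : (prime_norm P)%:R^-1 <= 2^-1 :> R by rewrite lef_pV2 ?posrE ?ltr0n ?ler_nat // ltnW.
move=> h; apply: le_trans h; rewrite /y_ -[leRHS]expr1.
by apply: ler_wiXn2l => //; rewrite ?invr_ge0 // invf_le1 ?ltr0n ?ler1n ltnW.
Qed.

Lemma fac_ub k P : nc (fac k P) <= expR (y_ k P).
Proof.
apply: (le_trans (ncD _ _)); rewrite nc1 ncN; apply: le_trans (expR_ge1Dx _).
by rewrite lerD2l nc_term.
Qed.

Lemma fac_lb k P : (0 < k)%N -> 2^-1 <= nc (fac k P) /\ nc (fac k P)^-1 <= expR (2 * y_ k P).
Proof.
move=> k0; have yl := y_le P k0; have y0 := y_ge0 k P; have tl := nc_term k P.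
have lb : 1 - y_ k P <= nc (fac k P).
  have : nc 1 <= nc (fac k P) + nc (v P * ((prime_norm P)%:R^-1) ^+ k).
    by rewrite -{1}(subrK (v P * ((prime_norm P)%:R^-1) ^+ k) 1); exact: ncD.
  by rewrite nc1; lra.
split; first by lra.
rewrite ncV; have f0 : 0 < nc (fac k P) by lra.
apply: le_trans (expR_ge1Dx _); rewrite -[leLHS]mul1r ler_pdivrMr //.
nra.
Qed.

Lemma fac_neq0 k P : (0 < k)%N -> fac k P != 0.
Proof. by move=> k0; rewrite -nc_eq0 gt_eqF //; have [] := fac_lb P k0; lra. Qed.

Lemma prod_ub (T : Type) (r : seq T) (F : T -> R[i]) (y : T -> R) :
  (forall i, nc (F i) <= expR (y i)) -> nc (\prod_(i <- r) F i) <= expR (\sum_(i <- r) y i).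
Proof.
move=> H; elim: r => [|i r IH]; first by rewrite !big_nil nc1 expR0.
by rewrite !big_cons ncM expRD ler_pM ?nc_ge0.
Qed.

Lemma prod_near k X : nc (\prod_(P <- X) fac k P - 1) <=
  (\sum_(P <- X) y_ k P) * expR (\sum_(P <- X) y_ k P).
Proof.
elim: X => [|P X IH]; first by rewrite !big_nil subrr nc0 mul0r.
rewrite !big_cons; set S := \sum_(_ <- X) _ in IH *; set G := \prod_(_ <- X) _ in IH *.
have S0 : 0 <= S by apply: sumr_ge0 => i _; exact: y_ge0.
have y0 := y_ge0 k P.
have -> : fac k P * G - 1 = fac k P * (G - 1) - v P * ((prime_norm P)%:R^-1) ^+ k.
  by rewrite /fac; ring.
apply: (le_trans (ncD _ _)); rewrite ncM ncN expRD.
have e1 : 1 <= expR (y_ k P) by have := expR_ge1Dx (y_ k P); lra.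
have e2 : 1 <= expR S by have := expR_ge1Dx S; lra.
have h1 : nc (fac k P) * nc (G - 1) <= expR (y_ k P) * (S * expR S).
  by apply: ler_pM; rewrite ?nc_ge0 // fac_ub.
have h2 : y_ k P * 1 <= y_ k P * (expR (y_ k P) * expR S).
  by rewrite ler_wpM2l // -[leLHS]mulr1 ler_pM.
have h3 := nc_term k P.
rewrite mulrDl; have -> : S * (expR (y_ k P) * expR S) = expR (y_ k P) * (S * expR S) by ring.
lra.
Qed.

Definition Gp k n : R[i] := \prod_(P <- XX n) fac k P.
Definition Ap k n : R[i] := \prod_(P <- XX n) (fac k P)^-1.

Lemma GpAp k n : (0 < k)%N -> Gp k n * Ap k n = 1.
Proof. by move=> k0; rewrite -big_split /= big1 // => P _; rewrite mulfV // fac_neq0. Qed.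

Lemma y_tail (C : R) : (forall X, uniq X -> \sum_(P <- X) y_ 2 P <= C) ->
  forall k M X, uniq X -> (forall P, P \in X -> (M < prime_norm P)%N) ->
  \sum_(P <- X) y_ k.+2 P <= C * (M.+1%:R^-1) ^+ k.
Proof.
move=> CP k M X uX XM.
apply: (@le_trans _ _ (\sum_(P <- X) y_ 2 P * (M.+1%:R^-1) ^+ k)).
  rewrite big_seq [leRHS]big_seq; apply: ler_sum => P /XM MP.
  rewrite /y_ -addn2 addnC exprD ler_wpM2l ?exprn_ge0 ?invr_ge0 //.
  apply: lerXn2r; rewrite ?nnegrE ?invr_ge0 //.
  by rewrite lef_pV2 ?posrE ?ltr0n ?ler_nat // (leq_trans _ MP).
by rewrite -mulr_suml ler_wpM2r ?exprn_ge0 ?invr_ge0 // CP.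
Qed.

Lemma cpow_nat (N k : nat) : (0 < N)%N -> nat_cpow_opp N (k%:R : R[i]) = (N%:R^-1) ^+ k.
Proof.
move=> N0; rewrite /nat_cpow_opp.
have -> : - (k%:R : R[i]) * (ln N%:R)%:C%C = (- (k%:R * ln N%:R))%:C%C.
  by rewrite rmorphN rmorphM rmorph_nat mulNr.
rewrite /= cos0 sin0 -[X in _ * X]/(1 : R[i]) mulr1.
rewrite expRN expRM_natl lnK ?posrE ?ltr0n // fmorphV rmorphXn /= exprVn.
by rewrite rmorph_nat.
Qed.

(** The truncation error is governed by the sum of N P^-(k+3) over N P > M, at most (M + 1)^-(k+1)
    times the convergent sum of N P^-2; this is why the integers start at 3. *)
Lemma Lseries_near : exists2 C : R, 0 <= C & forall k M,
  [/\ nc (Ap k.+3 M - Lseries x k.+3%:R) <= C * (M.+1%:R^-1) ^+ k.+1 & nc (Gp k.+3 M) <= C].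
Proof.
have [C2 C20 C2P] := y_sum2.
have E1 : 1 <= expR (2 * C2) by have := expR_ge1Dx (2 * C2); lra.
have E2 : expR C2 <= expR (2 * C2) by rewrite ler_expR; lra.
have tailC k M X : uniq X -> (forall P, P \in X -> (M < prime_norm P)%N) ->
  \sum_(P <- X) y_ k.+2 P <= C2 * (M.+1%:R^-1) ^+ k by move=> ? ?; exact: y_tail.
have allC k X : uniq X -> \sum_(P <- X) y_ k.+2 P <= C2.
  move=> uX; have := @tailC k 0 X uX; rewrite invr1 expr1n mulr1; apply=> P _.
  exact: ltnW (norm_gt1 P).
have Aub k n : nc (Ap k.+2 n) <= expR (2 * C2).
  apply: (@le_trans _ _ (expR (\sum_(P <- XX n) 2 * y_ k.+2 P))).
    by apply: prod_ub => P; have [] := fac_lb (k := k.+2) P isT.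
  by rewrite ler_expR -mulr_sumr ler_wpM2l // allC // XX_uniq.
have diff k M N : (M <= N)%N -> nc (Ap k.+3 M - Ap k.+3 N) <=
    (expR (2 * C2) * expR (2 * C2) * C2) * (M.+1%:R^-1) ^+ k.+1.
  move=> MN; set Z := [seq P <- XX N | (M < prime_norm P)%N].
  have uZ : uniq Z by rewrite filter_uniq ?XX_uniq.
  have ZM P : P \in Z -> (M < prime_norm P)%N by rewrite mem_filter => /andP [].
  have AE : Ap k.+3 N = Ap k.+3 M * \prod_(P <- Z) (fac k.+3 P)^-1.
    by rewrite /Ap (perm_big _ (XX_split MN)) big_cat.
  have ZE : \prod_(P <- Z) (fac k.+3 P)^-1 * \prod_(P <- Z) fac k.+3 P = 1.
    by rewrite -big_split /= big1 // => P _; rewrite mulVf // fac_neq0.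
  have -> : Ap k.+3 M - Ap k.+3 N = Ap k.+3 N * (\prod_(P <- Z) fac k.+3 P - 1).
    by rewrite mulrBr mulr1; congr (_ - _); rewrite AE -mulrA ZE mulr1.
  have h1 := Aub k.+1 N.
  have h2 : nc (\prod_(P <- Z) fac k.+3 P - 1) <= expR (2 * C2) * (C2 * (M.+1%:R^-1) ^+ k.+1).
    apply: (le_trans (prod_near _ _)); rewrite mulrC; apply: ler_pM.
    - exact: expR_ge0.
    - by apply: sumr_ge0 => P _; exact: y_ge0.
    - by apply: le_trans E2; rewrite ler_expR; exact: (allC k.+1).
    - exact: (tailC k.+1).
  by rewrite ncM; apply: (le_trans (ler_pM (nc_ge0 _) (nc_ge0 _) h1 h2)); rewrite !mulrA.
pose CA := expR (2 * C2) * expR (2 * C2) * C2.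
have CA0 : 0 <= CA by rewrite !mulr_ge0 ?expR_ge0.
exists (CA + expR (2 * C2)); first by rewrite addr_ge0 ?expR_ge0.
move=> k M; split; last first.
  apply: (@le_trans _ _ (expR C2)); last by lra.
  apply: (@le_trans _ _ (expR (\sum_(P <- XX M) y_ k.+3 P))); first by apply: prod_ub => P; exact: fac_ub.
  by rewrite ler_expR; apply: (allC k.+1); exact: XX_uniq.
have [a aP] : exists a : R[i], (Ap k.+3 : nat -> R[i]^o) @ \oo --> (a : R[i]^o).
  apply: (@cauchy_complex R _ CA) => M0 N MN; apply: (le_trans (diff k M0 N MN)).
  rewrite ler_wpM2l // -[leRHS]expr1; apply: ler_wiXn2l => //.
  by rewrite invf_le1 ?ltr0n ?ler1n.
have -> : Lseries x k.+3%:R = a.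
  rewrite /Lseries; apply: cvg_lim; first exact: norm_hausdorff.
  suff -> : (fun n : nat => \big[*%R/1]_(p \in [set p : primes_of K | (prime_norm p <= n)%N])
          (1 - char_at x p * nat_cpow_opp (prime_norm p) k.+3%:R)^-1 : R[i]^o) = Ap k.+3 by [].
  apply/funext => n; rewrite fsbig_finite /=; last exact: norm_finite.
  by apply: eq_bigr => P _; rewrite cpow_nat // ltnW // norm_gt1.
apply: (@le_trans _ _ (CA * (M.+1%:R^-1) ^+ k.+1)).
  by apply: (@nc_lim R _ a _ _ M aP) => N MN; exact: diff.
by rewrite ler_wpM2r ?exprn_ge0 ?invr_ge0 // lerDl expR_ge0.
Qed.
End Char.
End LSeries.

(** Truncate the inverse Euler products at norm p. Their difference is a Dirichlet polynomial that
    equals G G' (A' - A), where A and A' approximate the same L-value up to O((p + 1)^-(n-2)); so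
    its coefficients up to p vanish, and the one at p is the difference of the two sums up to
    sign. *)
Lemma Lseries_coef (R : realType) (K K' : fieldExtType rat) (Kb : alg_closure K) (Kb' : alg_closure K')
    (l : nat) (l_pr : prime l) (x : lchar R Kb l) (x' : lchar R Kb' l) :
  (forall s : R[i], 1 < complex.Re s -> Lseries x s = Lseries x' s) ->
  forall p, prime p ->
    \sum_(P <- XX K p | prime_norm P == p) char_at x P =
    \sum_(P <- XX K' p | prime_norm P == p) char_at x' P.
Proof.
move=> Leq p pp.
have [C C0 CP] := Lseries_near l_pr x; have [C' C0' CP'] := Lseries_near l_pr x'.
pose X := [seq (prime_norm P, char_at x P) | P <- XX K p].
pose X' := [seq (prime_norm P, char_at x' P) | P <- XX K' p].
pose L := mk X ++ [seq (u.1, - u.2) | u <- mk X'].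
have X1 u : u \in X -> (1 < u.1)%N by move=> /mapP [P _ ->]; exact: (norm_gt1 Kb P).
have X1' u : u \in X' -> (1 < u.1)%N by move=> /mapP [P _ ->]; exact: (norm_gt1 Kb' P).
have evL n : dpev L n = Gp x n p - Gp x' n p.
  have -> : Gp x n p = dpev (mk X) n by rewrite mk_ev big_map.
  have -> : Gp x' n p = dpev (mk X') n by rewrite mk_ev big_map.
  rewrite /dpev big_cat big_map /=; congr (_ + _); rewrite -sumrN.
  by apply: eq_bigr => u _; rewrite mulNr.
have coefL k : dpcoef L k = dpcoef (mk X) k - dpcoef (mk X') k.
  by rewrite /dpcoef big_cat big_map /= sumrN.
have : dpcoef L p = 0.
  (* The factor (p + 1)^2 absorbs the loss of two in the exponent in [Lseries_near]. *)
  apply: (@dp_uniq R L p 3 (C * C' * (C + C') * p.+1%:R ^+ 2)) => //.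
    move=> u; rewrite mem_cat => /orP [|/mapP [w wX ->]].
      by apply: mk_pos => w /X1 /ltnW.
    by apply: (mk_pos _ wX) => w' /X1' /ltnW.
  move=> [|[|[|k]]] // _; rewrite evL.
  have [h1 h2] := CP k p; have [h1' h2'] := CP' k p.
  have Le : Lseries x k.+3%:R = Lseries x' k.+3%:R.
    apply: Leq; rewrite -(rmorph_nat (@real_complex R)) /= ltr1n //.
  have -> : Gp x k.+3 p - Gp x' k.+3 p =
      Gp x k.+3 p * Gp x' k.+3 p * (Ap x' k.+3 p - Ap x k.+3 p).
    rewrite mulrBr -mulrA (GpAp l_pr) // mulr1 mulrAC (GpAp l_pr) // mul1r.
    by [].
  rewrite !ncM.
  have pe : p.+1%:R ^+ 2 * (p.+1%:R^-1) ^+ k.+3 = (p.+1%:R^-1) ^+ k.+1 :> R.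
    have p0 : p.+1%:R != 0 :> R by rewrite pnatr_eq0.
    by rewrite (_ : k.+3 = (2 + k.+1)%N) // exprD mulrA -exprMn mulfV // expr1n mul1r.
  rewrite -[leRHS]mulrA pe -[leRHS]mulrA; apply: ler_pM; rewrite ?mulr_ge0 ?nc_ge0 //.
    by apply: ler_pM; rewrite ?nc_ge0.
  have -> : Ap x' k.+3 p - Ap x k.+3 p =
      (Ap x' k.+3 p - Lseries x' k.+3%:R) - (Ap x k.+3 p - Lseries x k.+3%:R).
    by rewrite Le; ring.
  by apply: (le_trans (ncD _ _)); rewrite ncN mulrDl addrC lerD.
rewrite coefL; have [_ ->] := mk_coef pp X1; have [_ ->] := mk_coef pp X1'.
by rewrite !big_map => /eqP; rewrite subr_eq0 => /eqP /oppr_inj.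
Qed.

(** The primes of norm p all have degree one, so for large p the values at products of powers are
    products of values. Equality of the sums for all exponents is the hypothesis of
    [unity_match]. *)
Lemma Lseries_match (R : realType) (K K' : fieldExtType rat) (Kb : alg_closure K) (Kb' : alg_closure K')
    (l : nat) (l_pr : prime l) (psi : lchar_iso R Kb Kb' l) :
  (forall (x : lchar R Kb l) (s : R[i]), 1 < complex.Re s -> Lseries x s = Lseries (psi x) s) ->
  forall Z : seq (lchar R Kb l), exists P0 : nat, forall P : primes_of K,
    dg1 P -> (P0 < rchar (val P))%N -> exists P' : primes_of K',
      prime_norm P' = prime_norm P /\ forall x, x \in Z -> char_at x P = char_at (psi x) P'.
Proof.
move=> Leq Z; pose m := size Z; pose Y (i : 'I_m) := nth 1%g Z i.
have [P1 H1] := char_at_gp l_pr Y; have [P2 H2] := char_at_gp l_pr (fun i => psi (Y i)).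
exists (maxn P1 P2) => P d1 Pp; pose p := rchar (val P).
have P1p := leq_ltn_trans (leq_maxl _ _) Pp; have P2p := leq_ltn_trans (leq_maxr _ _) Pp.
have pp : prime p := (rcharP Kb P).1; have NP := norm_dg1 Kb d1.
pose X := [seq P <- XX K p | prime_norm P == p]; pose X' := [seq P <- XX K' p | prime_norm P == p].
have XP P1' : P1' \in X -> dg1 P1' /\ rchar (val P1') = p.
  rewrite mem_filter => /andP [/eqP NE _].
  by have := norm_prime_dg1 Kb (P := P1'); rewrite NE => /(_ pp) [<-].
have XP' P1' : P1' \in X' -> dg1 P1' /\ rchar (val P1') = p.
  rewrite mem_filter => /andP [/eqP NE _].
  by have := norm_prime_dg1 Kb' (P := P1'); rewrite NE => /(_ pp) [<-].
have [|P3 i /XP [d E]|P3 i /XP' [d E]|k|P' PX' P'E] := @unity_match _ l (prime_gt0 l_pr) m _ _ X X'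
   (fun P i => char_at (Y i) P) (fun P i => char_at (psi (Y i)) P) P.
- by rewrite mem_filter NP eqxx XXP //= NP.
- by have [] := H1 P3 d; rewrite ?E.
- by have [] := H2 P3 d; rewrite ?E.
- transitivity (\sum_(P0 <- X) char_at (gp Y (fun i => k i : nat)) P0).
    rewrite big_seq [RHS]big_seq; apply: eq_bigr => P3 /XP [d E].
    by have [|_ ->] := H1 P3 d; rewrite ?E.
  transitivity (\sum_(P0 <- X') char_at (psi (gp Y (fun i => k i : nat))) P0).
    by rewrite !big_filter; apply: (Lseries_coef l_pr) => // s; exact: Leq.
  rewrite gp_morph big_seq [RHS]big_seq; apply: eq_bigr => P3 /XP' [d E].
  by have [|_ ->] := H2 P3 d; rewrite ?E.
exists P'; split.
  by move: PX'; rewrite mem_filter NP => /andP [/eqP].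
move=> x xZ; have iZ : (index x Z < m)%N by rewrite index_mem.
by have := P'E (Ordinal iZ); rewrite /Y /= nth_index // => ->.
Qed.

(** * Inertia and uniqueness of the Frobenius value *)

Lemma pigeon (A B : finType) (f : A -> B) : (#|B| < #|A|)%N ->
  exists a b, a != b /\ f a = f b.
Proof.
move=> lt; have : ~~ injectiveb f.
  by apply/negP => /injectiveP /leq_card; rewrite leqNgt lt.
by move=> /injectivePn [a [b ab E]]; exists a, b.
Qed.

Section Inertia.
Context (Qb : alg_closure rat).
Local Notation Om := (ac_field Qb).
Local Notation gal := (absgal Qb).
Implicit Types (h : gal) (x y z w q : Om).
Context (p : nat) (p_pr : prime p).

Definition dvp x : Prop := exists2 z, aint z & x = p%:R * z.

Lemma dvpD x y : dvp x -> dvp y -> dvp (x + y).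
Proof. by move=> [u au ->] [v av ->]; exists (u + v); [exact: aintD|rewrite mulrDr]. Qed.

Lemma dvpM x y : aint x -> dvp y -> dvp (x * y).
Proof. by move=> ax [v av ->]; exists (x * v); [exact: aintM|rewrite mulrCA]. Qed.

Lemma p_neq0 : p%:R != 0 :> Om.
Proof. by rewrite natr_eq0Q -lt0n prime_gt0. Qed.

Context (t : Om) (at_ : aint t).
Definition OL x : Prop := aint x /\ sfix t x.

Lemma OLD x y : OL x -> OL y -> OL (x + y).
Proof. by move=> [ax sx] [ay sy]; split; [exact: aintD|move=> h ht; rewrite rmorphD sx // sy]. Qed.
Lemma OLB x y : OL x -> OL y -> OL (x - y).
Proof. by move=> [ax sx] [ay sy]; split; [exact: aintB|move=> h ht; rewrite rmorphB sx // sy]. Qed.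
Lemma OLM x y : OL x -> OL y -> OL (x * y).
Proof. by move=> [ax sx] [ay sy]; split; [exact: aintM|move=> h ht; rewrite rmorphM sx // sy]. Qed.
Lemma OL_nat (m : nat) : OL m%:R.
Proof. by split; [exact: aint_nat|move=> h ht; rewrite rmorph_nat]. Qed.
Lemma OLX x n : OL x -> OL (x ^+ n).
Proof. by move=> Ox; elim: n => [|n IH]; [exact: (OL_nat 1)|rewrite exprS; exact: OLM]. Qed.
Lemma OL_sum I (r : seq I) (F : I -> Om) : (forall i, OL (F i)) -> OL (\sum_(i <- r) F i).
Proof. by move=> H; elim/big_ind: _ => //; [exact: (OL_nat 0)|exact: OLD]. Qed.

Lemma OL_divp x z : OL x -> aint z -> x = p%:R * z -> OL z.
Proof.
move=> [ax sx] az E; split=> // h ht; apply: (mulfI p_neq0).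
by rewrite -{1}(rmorph_nat h) -rmorphM -E sx.
Qed.

Lemma OL_class : exists (T : finType) (cls : Om -> T), forall x y, OL x -> OL y ->
  cls x = cls y -> dvp (x - y).
Proof.
have [D DE D0] := orb_disc_int at_; set n := size (orb t).
have exA x : exists A : {poly int}, OL x -> (size A <= n)%N /\ (map_poly intr A).[t] = D%:~R * x.
  have [[ax sx]|nO] := pselect (OL x); last by exists 0.
  by have [A [sA AE _]] := interp_disc at_ ax sx DE; exists A.
have [A AP] := boolp.choice exA.
pose M := (absz D * p).-1; have ME : M.+1 = (absz D * p)%N.
  by rewrite prednK // muln_gt0 absz_gt0 D0 prime_gt0.
pose r x : {ffun 'I_n -> 'I_M.+1} := [ffun i : 'I_n => inord (absz ((A x)`_i %% M.+1)%Z)].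
exists {ffun 'I_n -> 'I_M.+1}, r => a b Oa Ob rE.
have dv i : (M.+1 %| (A a)`_i - (A b)`_i)%Z.
  have [ni|ni] := ltnP i n; last first.
    have [sa _] := AP a Oa; have [sb _] := AP b Ob.
    by rewrite !nth_default ?subrr ?dvdz0 // (leq_trans _ ni).
  have := congr1 (fun f : {ffun 'I_n -> 'I_M.+1} => nat_of_ord (f (Ordinal ni))) rE.
  have modlt (m : int) : (absz (m %% M.+1)%Z < M.+1)%N.
    by rewrite -ltz_nat gez0_abs ?modz_ge0 // ltz_pmod.
  rewrite !ffunE /= !inordK ?modlt // => /eqP.
  by rewrite -eqz_nat !gez0_abs ?modz_ge0 // eqz_mod_dvd.
pose B : {poly int} := \poly_(i < n) (((A a)`_i - (A b)`_i) %/ M.+1)%Z.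
have BE : A a - A b = M.+1%:Z *: B.
  apply/polyP => i; rewrite coefB coefZ coef_poly; case: ltnP => ni.
    by rewrite mulrC divzK.
  have [sa _] := AP a Oa; have [sb _] := AP b Ob.
  by rewrite mulr0 !nth_default ?subrr // (leq_trans _ ni).
have DE' : D%:~R * (a - b) = M.+1%:R * (map_poly intr B).[t].
  have := congr1 (fun q : {poly int} => (map_poly (intr : int -> Om) q).[t]) BE.
  rewrite /= rmorphB /= map_polyZ hornerD hornerN hornerZ (AP b Ob).2 (AP a Oa).2.
  by rewrite -mulrBr => ->.
have sgnE : (absz D)%:R = (Num.sg D)%:~R * D%:~R :> Om.
  by rewrite -intrM -normrEsg -abszE.
exists ((Num.sg D)%:~R * (map_poly intr B).[t]).
  by apply: aintM; [exact: aint_int|exact: aint_horner].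
apply: (mulfI (x := (D%:~R : Om))); first by rewrite intr_eq0Q.
by rewrite DE' ME natrM sgnE; ring.
Qed.

(** O_L modulo p is finite, so every sequence in O_L repeats modulo p; this stands in for chain
    conditions below. *)
Lemma OL_pigeon (f : nat -> Om) : (forall n, OL (f n)) -> exists i d, dvp (f i - f (i + d.+1)%N).
Proof.
move=> Of; have [T [cls clsP]] := OL_class.
have [|i [j [ij E]]] := @pigeon 'I_(#|T|.+1) T (fun i => cls (f i)); first by rewrite card_ord.
wlog lt : i j ij E / (i < j)%N.
  move=> H; have := ij; rewrite -val_eqE neq_ltn => /orP [|lt]; first exact: H.
  by apply: (H j i) => //; rewrite eq_sym.
exists i, (j - i.+1)%N; rewrite -addSnnS subnKC //.
exact: clsP.
Qed.

Section AtPlace.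
Context (Q : set Om) (plQ : place p Q).

Lemma dvpQ x : dvp x -> Q x.
Proof. by move=> [z az ->]; apply: (plMr plQ) => //; exact: (plp plQ). Qed.

(** All conjugates of w lie in Q, so its conjugate polynomial is X^n modulo p; evaluate at w. *)
Lemma nilp w : aint w -> (forall h, Q (h w)) -> exists n, dvp (w ^+ n).
Proof.
move=> aw Qw; have [fz fzE] := orbpoly_int aw.
have key (s : seq Om) : (forall y, y \in s -> Q y) ->
    forall i, Q (\prod_(y <- s) ('X - y%:P) - 'X^(size s))`_i.
  elim: s => [|y s IH] sQ i; first by rewrite big_nil expr0 subrr coef0; exact: (pl0 plQ).
  have sQ' z : z \in s -> Q z by move=> zs; apply: sQ; rewrite inE zs orbT.
  have -> : \prod_(y <- y :: s) ('X - y%:P) - 'X^(size (y :: s)) =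
     'X * (\prod_(y <- s) ('X - y%:P) - 'X^(size s)) - y%:P * \prod_(y <- s) ('X - y%:P).
    by rewrite big_cons /= exprS; ring.
  rewrite coefB coefXM coefCM; apply: (plB plQ).
    by case: ifP => _; [exact: (pl0 plQ)|exact: IH].
  apply: (plMr plQ); last by apply: sQ; rewrite mem_head.
  rewrite big_seq; apply: (@aint_poly_prod Qb) => z zs.
  by apply: aint_poly_XsubC; exact/(pl_aint plQ)/sQ'.
set n := size (orb w); exists n.
pose F := fz - 'X^n.
have FE : orbpoly w - 'X^n = map_poly intr F by rewrite fzE rmorphB /= map_polyXn.
have dv i : (p %| F`_i)%Z.
  apply/(pl_int plQ p_pr); rewrite -(coef_map (intr : {rmorphism int -> Om})) -FE.
  by apply: key => y /orbP [h <-].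
pose B : {poly int} := \poly_(i < size F) (F`_i %/ p)%Z.
have BE : F = p%:Z *: B.
  apply/polyP => i; rewrite coefZ coef_poly; case: ltnP => ni; first by rewrite mulrC divzK.
  by rewrite mulr0 nth_default.
have := congr1 (fun q : {poly Om} => q.[w]) FE.
rewrite /= BE map_polyZ hornerD hornerN hornerXn hornerZ.
have -> : (orbpoly w).[w] = 0.
  by apply/rootP; rewrite /orbpoly root_prod_XsubC orb_self.
rewrite sub0r => E; exists (- (map_poly intr B).[w]); first by apply: aintN; exact: aint_horner.
by rewrite mulrN -[_ * _]E opprK.
Qed.

(* An element of p^-1 O_L mapping the prime below Q into O_L but not into itself. *)
Lemma local_inverse : exists y q z, [/\ OL y, OL q, Q q, OL z /\ y * q = p%:R * z &
  ~ Q z /\ forall q', OL q' -> Q q' -> dvp (y * q')].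
Proof.
have [u [au su nQu uP]] := pl_avoid plQ p_pr at_; have Ou : OL u by split.
have nil q : OL q -> Q q -> exists n, dvp ((u * q) ^+ n).
  by move=> [aq sq] Qq; apply: nilp; [exact: aintM|exact: uP].
(* Powers of u remove the primes above p other than the one below Q, so X means not divisible by p
   locally at Q. *)
pose X x := OL x /\ forall k, ~ dvp (u ^+ k * x).
have X1 : X 1.
  split; first exact: (OL_nat 1).
  by move=> k; rewrite mulr1 => /dvpQ /(pl_exp plQ au).
(* Without a maximal x one could multiply forever by elements of Q and stay in X. A repetition
   modulo p gives x = x r modulo p with r in Q, and nilpotence of u r modulo p makes u^n x divisible
   by p. *)
have [x [Xx xP]] : exists x, X x /\ forall q, OL q -> Q q -> exists k, dvp (u ^+ k * (x * q)).
  apply: contrapT => /forallNP H.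
  have ex x : exists q, X x -> [/\ OL q, Q q & X (x * q)].
    have [Xx|] := pselect (X x); last by exists 0.
    have /not_andP [//|/existsNP [q /not_implyP [Oq /not_implyP [Qq /forallNP nk]]]] := H x.
    by exists q => _; split=> //; split=> //; apply: OLM => //; exact: Xx.1.
  have [qf qfP] := boolp.choice ex.
  pose xs n := iter n (fun x => x * qf x) 1.
  have Xxs n : X (xs n) by elim: n => [//|n IH] /=; have [] := qfP _ IH.
  have [i [d dv]] := OL_pigeon (fun n => (Xxs n).1).
  have [r [Or Qr rE]] : exists r, [/\ OL r, Q r & xs (i + d.+1)%N = xs i * r].
    elim: d {dv} => [|d [r [Or Qr rE]]].
      by rewrite addn1; exists (qf (xs i)); have [Oq Qq _] := qfP _ (Xxs i).
    have [Oq Qq _] := qfP _ (Xxs (i + d.+1)%N).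
    exists (r * qf (xs (i + d.+1)%N)); split; first exact: OLM.
      by apply: (plM plQ) => //; exact: Or.1.
    by rewrite mulrA -rE addnS.
  have [n dvn] := nil r Or Qr.
  have [Oxi nd] := Xxs i; apply: (nd n).
  have -> : u ^+ n * xs i = (u ^+ n * \sum_(k < n) r ^+ k) * (xs i - xs i * r) +
      xs i * (u * r) ^+ n.
    rewrite exprMn; have := subrX1 r n => E.
    have -> : (u ^+ n * \sum_(k < n) r ^+ k) * (xs i - xs i * r) =
       - (u ^+ n * xs i) * ((r - 1) * \sum_(k < n) r ^+ k) by ring.
    by rewrite -E; ring.
  apply: dvpD; last by apply: dvpM => //; exact: Oxi.1.
  rewrite -rE; apply: dvpM => //; apply: aintM; first exact: aintX.
  by apply: aint_sum => k _; apply: aintX; exact: Or.1.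
(* The powers of u are periodic modulo p from u^i on, so multiplying x by u^i removes the auxiliary
   factor u^k. *)
have [i [d dvu]] := OL_pigeon (fun n => OLX n Ou).
have dvuk m : dvp (u ^+ i - u ^+ (i + m * d.+1)).
  elim: m => [|m IH]; first by rewrite addn0 subrr; exists 0; [exact: aint0|rewrite mulr0].
  have -> : u ^+ i - u ^+ (i + m.+1 * d.+1) = (u ^+ i - u ^+ (i + m * d.+1)) +
      u ^+ (m * d.+1) * (u ^+ i - u ^+ (i + d.+1)).
    rewrite mulrBr -!exprD mulSn addrA; congr (_ - u ^+ _); last by lia.
    by rewrite addnC subrK.
  by apply: dvpD => //; apply: dvpM => //; exact: aintX.
pose y := u ^+ i * x.
have Oy : OL y by apply: OLM; [exact: OLX|exact: Xx.1].
have ndy : ~ dvp y by exact: Xx.2.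
have dvy q : OL q -> Q q -> dvp (y * q).
  move=> Oq Qq; have [k dvk] := xP q Oq Qq.
  have -> : y * q = (x * q) * (u ^+ i - u ^+ (i + k * d.+1)) +
      u ^+ (i + k * d) * (u ^+ k * (x * q)).
    have -> : u ^+ (i + k * d.+1) = u ^+ (i + k * d) * u ^+ k.
      by rewrite -exprD; congr (u ^+ _); lia.
    by rewrite /y; ring.
  apply: dvpD; last by apply: dvpM => //; exact: aintX.
  by apply: dvpM => //; apply: aintM; [exact: Xx.1.1|exact: Oq.1].
(* Otherwise w = y/p maps the prime below Q into itself, so every p w^n is integral; this will force
   w to be integral although p does not divide y. *)
have [q [z [Oq Qq Oz yz nQz]]] : exists q z, [/\ OL q, Q q, OL z, y * q = p%:R * z & ~ Q z].
  apply: contrapT => nex.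
  have ex q : exists z, OL q /\ Q q -> [/\ OL z, Q z & y * q = p%:R * z].
    have [[Oq Qq]|] := pselect (OL q /\ Q q); last by exists 0.
    have [z az yz] := dvy q Oq Qq; exists z => _.
    have Oz : OL z by apply: (OL_divp _ az yz); exact: OLM.
    by split=> //; apply: contrapT => nQz; apply: nex; exists q, z.
  have [zf zfP] := boolp.choice ex.
  pose zs n := iter n zf p%:R.
  have zsP n : OL (zs n) /\ Q (zs n).
    elim: n => [|n IH]; first by split; [exact: OL_nat|exact: (plp plQ)].
    by have [] := zfP _ IH.
  pose w := y / p%:R.
  have yw : y = p%:R * w by rewrite /w mulrC divfK // p_neq0.
  have zsE n : zs n = p%:R * w ^+ n.
    elim: n => [|n IH]; first by rewrite expr0 mulr1.
    have [_ _ E] := zfP _ (zsP n); apply: (mulfI p_neq0); rewrite -[zs n.+1]/(zf (zs n)) -E IH yw.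
    by rewrite exprS; ring.
  apply: ndy; exists w => //.
  have [T [cls clsP]] := OL_class.
  (* Two of these 0-1 combinations agree modulo p. Their difference has coefficients -1, 0 or 1, so
     its top coefficient is a unit and yields a monic equation for w over the algebraic integers. *)
  pose S (b : {ffun 'I_(#|T|.+1) -> bool}) := \sum_(j < #|T|.+1) (b j)%:R * zs j.+1.
  have OS b : OL (S b).
    by apply: OL_sum => j; apply: OLM; [exact: OL_nat|exact: (zsP _).1].
  have [|b [b' [bb E]]] := @pigeon {ffun 'I_(#|T|.+1) -> bool} T (fun b => cls (S b)).
    by rewrite card_ffun card_bool card_ord; apply: (ltn_trans (ltnSn _)); exact: ltn_expl.
  have /= [rr ao oE] := clsP _ _ (OS b) (OS b') E; pose o := rr; rewrite -/o in ao oE.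
  pose c (j : nat) : int := if insub j is Some j' then (b j' : nat)%:Z - (b' j' : nat)%:Z else 0.
  have cE (j : 'I_(#|T|.+1)) : c j = (b j : nat)%:Z - (b' j : nat)%:Z.
    by rewrite /c valK.
  have oE' : o = \sum_(j < #|T|.+1) (c j)%:~R * w ^+ j.+1.
    apply: (mulfI p_neq0); rewrite -oE /S -sumrB mulr_sumr; apply: eq_bigr => j _.
    by rewrite cE intrB -!pmulrn zsE; ring.
  have [k0 ck0] : exists j : 'I_(#|T|.+1), c j != 0.
    apply: contrapT => /forallNP H; move/eqP: bb; apply; apply/ffunP => j.
    have := H j; rewrite cE => /negP; rewrite negbK subr_eq0 eqz_nat.
    by case: (b j) (b' j) => [] [].
  have [k /= ck kmax] := @arg_maxnP _ k0 (fun j : 'I_(#|T|.+1) => c j != 0) (fun j => j : nat) ck0.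
  have c1 : (c k)%:~R * (c k)%:~R = 1 :> Om.
    by rewrite -intrM; move: ck; rewrite cE; case: (b k) (b' k) => [] [].
  pose cf (j : nat) : Om := if j is j'.+1 then (c k * c j')%:~R else - (c k)%:~R * o.
  pose F : {poly Om} := 'X^(k.+1) + \poly_(j < k.+1) cf j.
  apply: (@integral_root_monic _ _ (intr : {rmorphism int -> Om}) w F).
  - rewrite monicE lead_coefDl ?lead_coefXn // size_polyXn ltnS; exact: size_poly.
  - rewrite rootE /F hornerD hornerXn horner_poly big_ord_recl expr0 mulr1.
    rewrite (eq_bigr (fun j : 'I_k => (c k)%:~R * ((c j)%:~R * w ^+ j.+1))); last first.
      by move=> j _; rewrite lift0 /cf intrM mulrA.
    rewrite -mulr_sumr /cf.
    have oE2 : o = \sum_(j < k) (c j)%:~R * w ^+ j.+1 + (c k)%:~R * w ^+ k.+1.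
      rewrite oE' (bigID (fun j : 'I_(#|T|.+1) => (j < k.+1)%N)) /= [X in _ + X]big1 ?addr0.
        rewrite -(big_ord_widen_cond _ xpredT (fun j => (c j)%:~R * w ^+ j.+1)) ?big_ord_recr //.
      move=> j; rewrite -leqNgt => kj; have [->|/kmax] := eqVneq (c j) 0; first by rewrite mul0r.
      by rewrite leqNgt kj.
    rewrite mulNr oE2 mulrDr [X in _ + (- (_ + X) + _)]mulrA c1 mul1r; apply/eqP; ring.
  - move=> a /(nthP 0) [j _ <-]; rewrite coefD coefXn coef_poly; apply: aintD; first exact: aint_nat.
    case: ifP => _; last exact: aint0.
    by case: j => [|j]; [apply: aintM => //; apply: aintN; exact: aint_int|exact: aint_int].
by exists y, q, z.
Qed.

(** The square of the prime of O_L below Q. *)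
Definition Qsq x : Prop := exists n (a b : 'I_n -> Om),
  (forall i, [/\ OL (a i), Q (a i), OL (b i) & Q (b i)]) /\ x = \sum_(i < n) a i * b i.

Lemma Q_inverse z : OL z -> ~ Q z -> exists2 z', OL z' & Q (1 - z * z').
Proof.
move=> Oz nQz; have [i [d dv]] := OL_pigeon (fun n => OLX n Oz).
exists (z ^+ d); first exact: OLX.
have : Q (z ^+ i * (1 - z * z ^+ d)).
  by have := dvpQ dv; rewrite exprD exprS mulrBr mulr1.
move=> /(pl_prime plQ) [||/(pl_exp plQ Oz.1) //|//]; first exact/aintX/Oz.1.
by apply: aintB; [exact: aint1|apply: aintM; [|apply: aintX]; exact: Oz.1].
Qed.

(** Multiplication by y/p sends some q0 in Q to z0 outside Q, and sends pi to [zpi]. Were [zpi] in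
    Q, the relation z0 pi = zpi q0 with z0 invertible modulo Q would put pi into the square. So
    [zpi] is outside Q and pi divides Q up to the factor [zpi * z0]. *)
Lemma local_uniformizer pi : OL pi -> Q pi -> ~ Qsq pi ->
  exists v, [/\ OL v, ~ Q v & forall q, OL q -> Q q -> exists2 z, OL z & v * q = pi * z].
Proof.
move=> Opi Qpi nsq; have [y [q0 [z0 [Oy Oq0 Qq0 [Oz0 yz0] [nQz0 dvy]]]]] := local_inverse.
have zq q : OL q -> Q q -> exists2 z, OL z & y * q = p%:R * z.
  move=> Oq Qq; have [z az E] := dvy q Oq Qq; exists z => //.
  by apply: (OL_divp _ az E); exact: OLM.
have swap q z : y * q = p%:R * z -> z0 * q = z * q0.
  move=> E; apply: (mulfI p_neq0); rewrite mulrA -yz0 [RHS]mulrA -E; ring.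
have [zpi Ozpi Epi] := zq pi Opi Qpi; have spi := swap pi zpi Epi.
have nQzpi : ~ Q zpi.
  move=> Qzpi; apply: nsq; have [z' Oz' Qz'] := Q_inverse Oz0 nQz0.
  exists 2%N, (fun i => if i == ord0 then z' * zpi else 1 - z0 * z'),
    (fun i => if i == ord0 then q0 else pi); split.
    move=> i; case: ifP => _; split=> //; first exact: OLM.
    - by apply: (plM plQ) => //; exact: Oz'.1.
    - by apply: OLB; [exact: (OL_nat 1)|exact: OLM].
  rewrite !big_ord_recl big_ord0 /= addr0 -mulrA -spi; ring.
exists (zpi * z0); split; first exact: OLM.
  by move/(pl_prime plQ) => [||//|//]; [exact: Ozpi.1|exact: Oz0.1].
move=> q Oq Qq; have [z Oz E] := zq q Oq Qq; exists (z * z0); first exact: OLM.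
have sq := swap q z E.
by rewrite -mulrA sq mulrCA -spi; ring.
Qed.

(** Up to factors outside Q, z is w + pi z1 with g fixing w and pi, so by induction g z - z is
    divisible by every power of pi. If it were nonzero, a nonzero integer multiple of it would be
    divisible by every power of p. *)
Lemma inertia_trivial (g : gal) pi :
  (forall z, sfix t z -> sfix t (g z)) -> (forall z, OL z -> Q (g z - z)) ->
  (forall z, OL z -> exists w, [/\ OL w, g w = w & Q (z - w)]) ->
  OL pi -> Q pi -> g pi = pi -> ~ Qsq pi -> forall z, OL z -> g z = z.
Proof.
move=> gn triv dec Opi Qpi gpi nsq.
have [v [Ov nQv vP]] := local_uniformizer Opi Qpi nsq.
have Og z : OL z -> OL (g z) by move=> [az sz]; split; [exact: aint_gal|exact: gn].
have nQg z : OL z -> ~ Q z -> ~ Q (g z).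
  by move=> Oz nz Qgz; apply: nz; have := plB plQ Qgz (triv z Oz); rewrite subKr.
have nQM y z : OL y -> OL z -> ~ Q y -> ~ Q z -> ~ Q (y * z).
  by move=> [ay _] [az _] ny nz /(pl_prime plQ) [].
have S n : forall z, OL z -> exists V o, [/\ OL V, ~ Q V, aint o & V * (g z - z) = pi ^+ n * o].
  elim: n => [|n IH] z Oz.
    exists 1, (g z - z); split; [exact: (OL_nat 1)|exact: (pl1 plQ)| |by rewrite expr0 !mul1r].
    by apply: aintB; [exact: (Og z Oz).1|exact: Oz.1].
  have [w [Ow gw Qw]] := dec z Oz; have Ozw := OLB Oz Ow.
  have [z1 Oz1 E] := vP _ Ozw Qw.
  have [V1 [r1 [OV1 nV1 ar1 E1]]] := IH z1 Oz1; have [V2 [r2 [OV2 nV2 ar2 E2]]] := IH v Ov.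
  have gE : g v * (g z - w) = pi * g z1.
    by rewrite -{1}gw -rmorphB -rmorphM E rmorphM gpi.
  exists (V1 * V2 * (v * g v)), (V2 * v * r1 - V1 * z1 * r2); split.
  - by apply: OLM; [exact: OLM|apply: OLM => //; exact: Og].
  - have Ogv := Og v Ov; have n1 := nQM _ _ OV1 OV2 nV1 nV2.
    have n2 := nQM _ _ Ov Ogv nQv (nQg v Ov nQv).
    exact: (nQM _ _ (OLM OV1 OV2) (OLM Ov Ogv) n1 n2).
  - by apply: aintB; apply: aintM => //; apply: aintM; [exact: OV2.1|exact: Ov.1|exact: OV1.1|exact: Oz1.1].
  have -> : g z - z = (g z - w) - (z - w) by ring.
  have -> : V1 * V2 * (v * g v) * (g z - w - (z - w)) =
     V1 * V2 * (v * (g v * (g z - w)) - g v * (v * (z - w))) by ring.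
  rewrite gE E exprS.
  have -> : V1 * V2 * (v * (pi * g z1) - g v * (pi * z1)) =
     pi * (V2 * v * (V1 * (g z1 - z1)) - V1 * z1 * (V2 * (g v - v))) by ring.
  by rewrite E1 E2; ring.
move=> z Oz; apply/eqP; rewrite -subr_eq0; apply/negPn/negP => d0.
have [u [au su nQu uP]] := pl_avoid plQ p_pr at_.
have [m [r ar rE]] : exists m, dvp ((u * pi) ^+ m).
  by apply: nilp; [apply: aintM => //; exact: Opi.1|exact: (uP _ Opi.2)].
set d := g z - z in d0; have ad : aint d by apply: aintB; [exact: (Og z Oz).1|exact: Oz.1].
have [N [d' [ad' NE N0]]] : exists (N : int) d', [/\ aint d', N%:~R = d * d' & N != 0].
  have [N NE] : exists N : int, \prod_(y <- orb d) y = N%:~R.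
    apply: gal_fixed_aint.
      by rewrite big_seq; apply: aint_prod => y yo; exact: aint_orb yo.
    move=> h; rewrite rmorph_prod -[LHS](big_map h predT id).
    by rewrite (perm_big _ (orb_perm d h)).
  exists N, (\prod_(y <- rem d (orb d)) y); split.
  - by rewrite big_seq; apply: aint_prod => y /mem_rem yo; exact: aint_orb yo.
  - by rewrite -NE (big_rem d) ?orb_self.
  - rewrite -(intr_eq0Q Qb) -NE prodf_seq_neq0; apply/allP => y /orbP [h <-] /=.
    by rewrite fmorph_eq0.
have dvN k : (Posz (p ^ k)%N %| N)%Z.
  have [V [r' [OV nV ar' E]]] := S (m * k)%N z Oz.
  apply: (@pl_symb Qb p Q plQ p_pr (r ^+ k * (r' * d')) (u ^+ (m * k) * V)).
  - by apply: aintM; [exact: aintX|exact: OV.1].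
  - move/(pl_prime plQ) => [||/(pl_exp plQ au) //|//]; [exact: aintX|exact: OV.1].
  - by apply: aintM; [exact: aintX|exact: aintM].
  have -> : u ^+ (m * k) * V * N%:~R = u ^+ (m * k) * (V * d) * d' by rewrite NE; ring.
  rewrite E mulrA -exprMn exprM rE exprMn; ring.
have : (p ^ absz N <= absz N)%N by apply: dvdn_leq; [rewrite absz_gt0|have := dvN (absz N); rewrite dvdzE].
by rewrite leqNgt ltn_expl // prime_gt1.
Qed.
End AtPlace.
End Inertia.

Section IdealSums.
Context (F : fieldType).
Implicit Types (I J : set F).

Lemma ideal_mul0 I J : ideal_mul I J 0.
Proof. by exists 0%N, (fun=> 0), (fun=> 0); split; [case|rewrite big_ord0]. Qed.

Lemma ideal_mul_add I J x y : ideal_mul I J x -> ideal_mul I J y -> ideal_mul I J (x + y).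
Proof.
move=> [n [a [b [ab ->]]]] [m [a' [b' [ab' ->]]]].
exists (n + m)%N, (fun i => match fintype.split i with inl j => a j | inr k => a' k end),
  (fun i => match fintype.split i with inl j => b j | inr k => b' k end); split.
  by move=> i; case: (fintype.split i).
rewrite big_split_ord /=; congr (_ + _); apply: eq_bigr => i _.
  by rewrite (unsplitK (inl i : 'I_n + 'I_m)).
by rewrite (unsplitK (inr i : 'I_n + 'I_m)).
Qed.

Lemma ideal_mul_prod I J x y : I x -> J y -> ideal_mul I J (x * y).
Proof. by move=> Ix Jy; exists 1%N, (fun=> x), (fun=> y); rewrite big_ord1. Qed.
End IdealSums.

(** * Independence of the chosen Frobenius element at every unramified prime *)

Section FrobeniusUnique.
Context (R : realType) (K : fieldExtType rat) (Kb : alg_closure K) (l : nat) (l_pr : prime l).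
Local Notation Om := (ac_field Kb).
Local Notation Qb := (Qbar Kb).
Local Notation gal := (absgal (Qbar Kb)).
Local Notation emb := (ac_emb Kb).
Local Notation O := (int_ring [set: K]).
Context (x : dirichlet_char R Kb) (xl : forall s, x s ^+ l = 1)
  (t : Om) (at_ : aint (t : Qb)) (tP : forall g : gal, g t = t <-> exists2 s, toQ s = g & x s = 1).
Local Notation L := (char_field x).
Local Notation OL := (@OL Qb t).
Local Notation sfixt z := (sfix (Qb := Qb) t z).
Implicit Types (s g : absgal Kb) (z w : Om).

Lemma OL_int z : OL z <-> int_ring L z.
Proof.
by split=> [[az sz]|[Lz az]]; split=> //; apply/(char_fieldE tP).
Qed.

Lemma OL_act s z : OL z -> OL (s z).
Proof. by move=> [az sz]; split; [exact: (@aint_gal Qb (toQ s))|exact: (sfix_conj tP)]. Qed.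

Lemma ker_fix s z : x s = 1 -> sfixt z -> s z = z.
Proof. by move=> xs sz; apply: (sz (toQ s)); apply/tP; exists s. Qed.

Lemma dchar_expgs s k : x (s ^+ k)%g = x s ^+ k.
Proof. by elim: k => [|k IH]; rewrite ?dchar1 // expgS exprS dc_mulM IH. Qed.

(** Averaging over the powers of g, whose l-th power is trivial on L: for p different from l divide
    the trace by l modulo p. For p = l the norm is congruent to z^p, and a further power p^d brings
    z^p back to z modulo Q. *)
Lemma inertia_dec (p : nat) (Q : set Om) g z : prime p -> place (Qb := Qb) p Q ->
  (forall z, OL z -> Q (g z - z)) -> OL z -> exists w, [/\ OL w, g w = w & Q (z - w)].
Proof.
move=> pp plQ triv Oz; have l0 := prime_gt0 l_pr.
pose gi i := (g ^+ i)%g z.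
have giS i : g (gi i) = gi i.+1 by rewrite /gi expgS.
have Ogi i : OL (gi i) by exact: OL_act.
have gil : gi l = z by apply: ker_fix Oz.2; rewrite dchar_expgs xl.
have gi0 : gi 0%N = z by [].
have Qgi i : Q (gi i - z).
  elim: i => [|i IH]; first by rewrite gi0 subrr; exact: (pl0 plQ).
  by have := plD plQ (triv _ (Ogi i)) IH; rewrite subrKA giS.
have lS : l = l.-1.+1 by rewrite prednK.
have [plE|pl] := eqVneq p l; last first.
  pose Tr : Om := \sum_(i < l) gi i.
  have OTr : OL Tr by apply: (@OL_sum Qb).
  have gTr : g Tr = Tr.
    rewrite /Tr rmorph_sum; under eq_bigr do rewrite giS.
    rewrite lS big_ord_recr [RHS]big_ord_recl /= -lS gil -gi0 addrC.
    by congr (_ + _); apply: eq_bigr => i _.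
  have : coprimez p l.
    rewrite coprimezE /= prime_coprime // dvdn_prime2 //.
  move=> /coprimezP [[u v] /= uv].
  have uvK : u%:~R * p%:R + v%:~R * l%:R = 1 :> Om.
    by have := congr1 (fun k : int => k%:~R : Om) uv; rewrite intrD !intrM.
  have QTr : Q (Tr - l%:R * z).
    rewrite mulr_natl -[X in z *+ X]card_ord -sumr_const /Tr -sumrB.
    by apply: (pl_sum plQ) => i _.
  have Oint (k : int) : OL (k%:~R : Om).
    by split; [exact: (@aint_int Qb)|move=> h ht; rewrite rmorph_int].
  exists (v%:~R * Tr); split; first exact: (@OLM Qb).
    by rewrite rmorphM /= rmorph_int gTr.
  have -> : z - v%:~R * Tr = (u%:~R * z) * p%:R - v%:~R * (Tr - l%:R * z).
    have zE : z = (u%:~R * p%:R + v%:~R * l%:R) * z by rewrite uvK mul1r.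
    by rewrite {1}zE; ring.
  apply: (plB plQ); last by apply: (plM plQ) => //; exact: (@aint_int Qb).
  apply: (plM plQ); last exact: (plp plQ).
  by apply: (@aintM Qb); [exact: (@aint_int Qb)|exact: Oz.1].
pose Nz : Om := \prod_(i < l) gi i.
have ONz : OL Nz.
  rewrite /Nz; elim/big_ind: _ => //; first exact: (OL_nat (Qb := Qb) t 1).
  by move=> a b; exact: (@OLM Qb).
have gNz : g Nz = Nz.
  rewrite /Nz rmorph_prod; under eq_bigr do rewrite giS.
  rewrite lS big_ord_recr [RHS]big_ord_recl /= -lS gil -gi0 mulrC.
  by congr (_ * _); apply: eq_bigr => i _.
have QX (a b : Om) n : aint (a : Qb) -> aint (b : Qb) -> Q (a - b) -> Q (a ^+ n - b ^+ n).
  move=> aa ab Qab; rewrite subrXX; apply: (plMr plQ) => //; apply: (@aint_sum Qb) => i _.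
  by apply: (@aintM Qb); exact: (@aintX Qb).
have QN : Q (Nz - z ^+ l).
  rewrite -[X in z ^+ X]card_ord -prodr_const /Nz.
  have : forall r : seq 'I_l, Q (\prod_(i <- r) gi i - \prod_(i <- r) z) /\
      aint (\prod_(i <- r) z : Qb).
    elim=> [|i r [IH ar]]; first by rewrite !big_nil subrr; split; [exact: (pl0 plQ)|exact: (@aint1 Qb)].
    rewrite !big_cons; split; last by apply: (@aintM Qb) => //; exact: Oz.1.
    have -> : gi i * \prod_(j <- r) gi j - z * \prod_(j <- r) z =
      gi i * (\prod_(j <- r) gi j - \prod_(j <- r) z) + (\prod_(j <- r) z) * (gi i - z) by ring.
    by apply: (plD plQ); apply: (plM plQ) => //; exact: (Ogi i).1.
  by move=> /(_ (index_enum _)) [].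
have [i [d dv]] := @OL_pigeon Qb p pp t at_ _ (fun n => @OLX Qb t z (p ^ n)%N Oz).
have desc : forall (n : nat) (a b : Om), aint (a : Qb) -> aint (b : Qb) -> Q (a ^+ (p ^ n)%N - b ^+ (p ^ n)%N) -> Q (a - b).
  elim=> [|n IH] a b aa ab; first by rewrite expn0.
  rewrite expnS !exprM => Qab.
  have : Q (a ^+ p - b ^+ p) by apply: (IH _ _ _ _ Qab); exact: (@aintX Qb).
  move=> Qp; have [r ar E] := bin_div (Qb := Qb) pp (@aintB Qb _ _ aa ab) ab.
  apply: (@pl_exp Qb p Q plQ _ p); first exact: (@aintB Qb).
  have -> : (a - b) ^+ p = (a ^+ p - b ^+ p) - p%:R * r.
    by move: E; rewrite subrK => ->; ring.
  by apply: (plB plQ) => //; apply: (plMr plQ) => //; exact: (plp plQ).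
have Qz : Q (z - z ^+ (p ^ d.+1)%N).
  apply: (desc i); [exact: Oz.1|by apply: (@aintX Qb); exact: Oz.1|].
  by rewrite -exprM -expnD addnC; exact: (dvpQ plQ dv).
exists (Nz ^+ (p ^ d)%N); split; first exact: (@OLX Qb).
  by rewrite rmorphXn /= gNz.
have Qw : Q (Nz ^+ (p ^ d)%N - z ^+ (p ^ d.+1)%N).
  rewrite expnS exprM {2}plE; apply: QX => //; [exact: ONz.1|by apply: (@aintX Qb); exact: Oz.1].
by have := plB plQ Qz Qw; rewrite opprB subrKA.
Qed.

(** Conjugate both elements to one place Q. Their quotient g acts trivially modulo Q, so it is
    trivial on L by [inertia_trivial], which also covers primes above l. *)
Lemma frob_unique (P : primes_of K) s1 s2 : unramified L P ->
  is_frobenius L P s1 -> is_frobenius L P s2 -> x s1 = x s2.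
Proof.
move=> unr [Q1 ab1 fr1] [Q2 ab2 fr2]; have [pp PPp] := rcharP Kb P.
set p := rchar (val P) in pp PPp; have PP := primes_ofP P.
have [Q0 plQ0] := place_exists Qb pp.
have [g0 g0P] := prime_contr PP pp PPp plQ0.
have plQ := place_gal plQ0 g0; set Q := [set z | _] in plQ.
have PQ a : val P a -> Q (emb a) by move=> /g0P [].
have contr a : O a -> Q (emb a) -> val P a by move=> Oa Qa; apply/g0P.
have [h1 hP1] := above_conj at_ tP plQ PQ ab1; have [h2 hP2] := above_conj at_ tP plQ PQ ab2.
have conj (Q' : set Om) s (h : absgal Kb) : (forall z, Q' z -> Q (h z)) ->
    (forall z, int_ring L z -> Q' (s z - z ^+ prime_norm P)) ->
    forall z, OL z -> Q ((h * s * h^-1)%g z - z ^+ prime_norm P).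
  move=> hP fr z Oz.
  have Ohz : int_ring L (h^-1%g z) by apply/OL_int; exact: OL_act.
  have := hP _ (fr _ Ohz); rewrite rmorphB rmorphXn.
  by have -> : h (h^-1%g z) = z by exact: absgal_invfK.
have f1 := conj _ _ _ hP1 fr1; have f2 := conj _ _ _ hP2 fr2.
set s1' := (h1 * s1 * h1^-1)%g in f1; set s2' := (h2 * s2 * h2^-1)%g in f2.
pose g := (s2' * s1'^-1)%g.
have triv z : OL z -> Q (g z - z).
  move=> Oz; have Oz' : OL (s1'^-1%g z) by exact: OL_act.
  have := plB plQ (f2 _ Oz') (f1 _ Oz').
  have -> : s1' (s1'^-1%g z) = z by exact: absgal_invfK.
  by rewrite opprB subrKA.
have xg : x g = x s2 / x s1.
  have n1 := dc_neq0 x h1; have n2 := dc_neq0 x h2; have n3 := dc_neq0 x s1.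
  by rewrite /g /s1' /s2' !dc_mulM !dcharV !dc_mulM !dcharV; field; rewrite n1 n2 n3.
suff xg1 : x g = 1.
  by have := congr1 (fun u => u * x s1) xg; rewrite xg1 mul1r divfK ?dc_neq0.
pose QL := [set z | sfixt z /\ Q z].
have abQ : lies_above L P QL by exact: (above_prime tP plQ PQ contr).
(* Ramification index 1 provides a local uniformizer in K, which g fixes: if every element of P were
   in the square, P O_L would be contained in the square of the prime below Q. *)
have [a Pa nsq] : exists2 a, val P a & ~ @Qsq Qb t Q (emb a).
  apply: contrapT => H.
  have all a : val P a -> @Qsq Qb t Q (emb a).
    by move=> Pa; apply: contrapT => nsq; apply: H; exists a.
  have : (2 <= 1)%N; last by [].
  apply/(unr QL abQ) => z [n [a [b [ab ->]]]].
  elim/big_ind: _ => [|u v|i _]; [exact: ideal_mul0|exact: ideal_mul_add|].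
  have [[c Pc <-] Ob] := ab i; have [m [a' [b' [ab' ->]]]] := all c Pc.
  rewrite mulr_suml; elim/big_ind: _ => [|u v|j _]; [exact: ideal_mul0|exact: ideal_mul_add|].
  have [Oa' Qa' Ob' Qb'] := ab' j; rewrite -mulrA; apply: ideal_mul_prod; first by split; [exact: Oa'.2|].
  by apply: ideal_mul_prod => //; split; [exact: Ob'.2|].
have OLt : OL t by split=> // h.
have gt : g t = t.
  apply: (@inertia_trivial Qb p pp t at_ Q plQ (toQ g) (emb a)) => //.
  - by move=> z sz; exact: (sfix_conj tP).
  - by move=> z Oz; exact: (inertia_dec pp plQ triv Oz).
  - split; first by apply/(intK Kb); exact: (kp_int PP).
    by move=> h /tP [s <- _]; exact: fixK_toQ.
  - exact: PQ.
  - exact: fixK_toQ.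
by have /tP [s /toQ_inj <-] : toQ g t = t by exact: gt.
Qed.
End FrobeniusUnique.

(** * Transport along field isomorphisms *)

Section FieldTransport.
Context (F F' : fieldType) (f : {rmorphism F -> F'}) (f' : {rmorphism F' -> F})
  (fK : cancel f f') (fK' : cancel f' f).
Implicit Types (A L I J : set F).

(** The image of A under f, written as a preimage under the inverse so that membership computes. *)
Definition tset A : set F' := [set z | A (f' z)].

Lemma tset_int L : int_ring (tset L) = tset (int_ring L).
Proof.
apply/seteqP; split=> z [Lz az]; split=> //; first exact: aint_rmorph.
by rewrite -[z]fK'; exact: aint_rmorph.
Qed.

Lemma tset_prime L I : is_prime L I -> is_prime (tset L) (tset I).
Proof.
move=> [[Ii I0 ID IM] I1 [x Ix x0] Ip]; split; first split.
- by move=> z /Ii; rewrite tset_int.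
- by rewrite /tset /= rmorph0.
- by move=> y z; rewrite /tset /= rmorphD; exact: ID.
- by move=> y z; rewrite tset_int /tset /= rmorphM; exact: IM.
- by rewrite /tset /= rmorph1.
- by exists (f x); rewrite ?fmorph_eq0 // /tset /= fK.
- by move=> y z; rewrite tset_int /tset /= rmorphM; exact: Ip.
Qed.

Lemma tset_mul I J : ideal_mul (tset I) (tset J) = tset (ideal_mul I J).
Proof.
apply/seteqP; split=> [z [n [a [b [ab ->]]]]|z [n [a [b [ab zE]]]]].
  exists n, (f' \o a), (f' \o b); split=> //.
  by rewrite rmorph_sum; apply: eq_bigr => i _; rewrite rmorphM.
exists n, (f \o a), (f \o b); split.
  by move=> i; rewrite /tset /= !fK; exact: ab.
rewrite -[z]fK' zE rmorph_sum; apply: eq_bigr => i _.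
by rewrite rmorphM.
Qed.

Lemma tset_exp L I n : ideal_exp (tset L) (tset I) n = tset (ideal_exp L I n).
Proof.
by elim: n => [|n IH]; [exact: tset_int|rewrite /ideal_exp !iterS -tset_mul -IH].
Qed.

Lemma tset_inj : injective tset.
Proof.
move=> A B E; apply/seteqP; split=> z Az.
  by have : tset A (f z) by [rewrite /tset /= fK]; rewrite E /tset /= fK.
by have : tset B (f z) by [rewrite /tset /= fK]; rewrite -E /tset /= fK.
Qed.
End FieldTransport.

Record closure_iso (K K' : fieldType) (Kb : alg_closure K) (Kb' : alg_closure K') := ClosureIso {
  ci_sg : {rmorphism K -> K'}; ci_sg' : {rmorphism K' -> K};
  ci_S : {rmorphism Kb -> Kb'}; ci_S' : {rmorphism Kb' -> Kb};
  ci_sgK : cancel ci_sg ci_sg'; ci_sgK' : cancel ci_sg' ci_sg;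
  ci_SK : cancel ci_S ci_S'; ci_SK' : cancel ci_S' ci_S;
  ci_SE : forall a, ci_S (ac_emb Kb a) = ac_emb Kb' (ci_sg a) }.

Section Inverse.
Context (K K' : fieldType) (Kb : alg_closure K) (Kb' : alg_closure K').

Lemma ci_SE' (i : closure_iso Kb Kb') a : ci_S' i (ac_emb Kb' a) = ac_emb Kb (ci_sg' i a).
Proof. by rewrite -{1}(ci_sgK' i a) -ci_SE ci_SK. Qed.

Definition ci_inv (i : closure_iso Kb Kb') : closure_iso Kb' Kb :=
  ClosureIso (ci_sgK' i) (ci_sgK i) (ci_SK' i) (ci_SK i) (ci_SE' i).

Section Trg.
Context (i : closure_iso Kb Kb') (s : absgal Kb).

Lemma trg_bij : bijective (ci_S i \o s \o ci_S' i).
Proof.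
apply: bij_comp; last exact: Bijective (ci_SK' i) (ci_SK i).
by apply: bij_comp; [exact: Bijective (ci_SK i) (ci_SK' i)|exact: gal_bij].
Qed.

Lemma trg_fix a : (ci_S i \o s \o ci_S' i) (ac_emb Kb' a) = ac_emb Kb' a.
Proof. by rewrite /= ci_SE' gal_fix ci_SE ci_sgK'. Qed.

Definition trg : absgal Kb' := @AbsGal K' Kb' (ci_S i \o s \o ci_S' i) trg_bij trg_fix.
End Trg.

Lemma trgM i s s' : trg i (s * s')%g = (trg i s * trg i s')%g.
Proof. by apply: absgal_eq => z; rewrite /= ci_SK. Qed.
End Inverse.

Section Transport.
Context (R : realType) (l : nat) (l_pr : prime l).

Section Chars.
Context (K K' : fieldExtType rat) (Kb : alg_closure K) (Kb' : alg_closure K').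
Implicit Types (i : closure_iso Kb Kb').

Lemma trgK i (s : absgal Kb) : trg (ci_inv i) (trg i s) = s.
Proof. by apply: absgal_eq => z; rewrite /= !ci_SK. Qed.

Section Trc.
Context (i : closure_iso Kb Kb') (x : dirichlet_char R Kb).
Let fx (s : absgal Kb') := x (trg (ci_inv i) s).

Lemma trc_neq0 s : fx s != 0. Proof. exact: dc_neq0. Qed.
Lemma trc_mulM s s' : fx (s * s')%g = fx s * fx s'.
Proof. by rewrite /fx trgM dc_mulM. Qed.
Lemma trc_cont (s : absgal Kb') (e : R[i]) : 0 < e -> exists S : seq Kb', forall s' : absgal Kb',
  {in S, s' =1 s} -> `|fx s' - fx s| < e.
Proof.
move=> e0; have [S SP] := dc_cont x (trg (ci_inv i) s) e0.
exists [seq ci_S i z | z <- S] => s' sS; apply: SP => z zS /=.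
by rewrite sS // map_f.
Qed.
Definition trc : dirichlet_char R Kb' := DirichletChar trc_neq0 trc_mulM trc_cont.
End Trc.

Lemma trc_root i (x : lchar R Kb l) s : trc i x s ^+ l = 1.
Proof. exact: lchar_root. Qed.

Definition trl i (x : lchar R Kb l) : lchar R Kb' l := LChar (root_lchar l_pr (trc_root i x)).

Lemma trlE i x s : trl i x s = x (trg (ci_inv i) s). Proof. by []. Qed.

Lemma trlM i : {morph trl i : x y / (x * y)%g}.
Proof. by move=> x y; apply: val_inj; apply: dchar_eq. Qed.

HB.instance Definition _ i := isMultiplicative.Build (lchar R Kb l) (lchar R Kb' l) (trl i) (trlM i).

Definition trp i (P : primes_of K) : primes_of K' :=
  exist _ (tset (ci_sg' i) (val P))
    (mem_set (tset_prime (ci_sgK i) (ci_sgK' i) (primes_ofP P) : is_prime [set: K'] _)).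

Lemma trp_norm i P : prime_norm (trp i P) = prime_norm P.
Proof.
rewrite /prime_norm.
set A := [set [set x + y | y in val P] | x in int_ring [set: K]].
have fA : finite_set A by exact: (@cosets_finite K Kb P).
have -> : [set [set x + y | y in val (trp i P)] | x in int_ring [set: K']] = tset (ci_sg' i) @` A.
  have TI := tset_int (ci_sgK' i) [set: K].
  have cos a : [set ci_sg i a + y | y in tset (ci_sg' i) (val P)] =
      tset (ci_sg' i) [set a + y | y in val P].
    apply/seteqP; split=> [z [y Py <-]|z [y Py E]].
      by exists (ci_sg' i y) => //; rewrite rmorphD ci_sgK.
    by exists (ci_sg i y); [rewrite /tset /= ci_sgK|rewrite -rmorphD E ci_sgK'].
  apply/seteqP; split=> [_ [a Oa <-]|_ [_ [a Oa <-] <-]].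
    exists [set ci_sg' i a + y | y in val P].
      by exists (ci_sg' i a) => //; move: Oa; rewrite -[X in int_ring X]/(tset (ci_sg' i) [set: K]) TI.
    by rewrite -cos ci_sgK'.
  exists (ci_sg i a); last exact: cos.
  by rewrite -[X in int_ring X]/(tset (ci_sg' i) [set: K]) TI /tset /= ci_sgK.
rewrite fset_set_image // card_imfset //=.
exact: (tset_inj (ci_sgK i)).
Qed.
End Chars.

Lemma trpK (K K' : fieldExtType rat) (Kb : alg_closure K) (Kb' : alg_closure K')
  (i : closure_iso Kb Kb') : cancel (trp i) (trp (ci_inv i)).
Proof. by move=> P; apply/val_inj/seteqP; split=> a; rewrite /= /tset /= ci_sgK. Qed.

Lemma trcK (K K' : fieldExtType rat) (Kb : alg_closure K) (Kb' : alg_closure K')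
  (i : closure_iso Kb Kb') (x : dirichlet_char R Kb) : trc (ci_inv i) (trc i x) = x.
Proof. by apply: dchar_eq => s; rewrite /=; congr (dc_fun x _); apply: absgal_eq => z; rewrite /= !ci_SK. Qed.

Lemma trlK (K K' : fieldExtType rat) (Kb : alg_closure K) (Kb' : alg_closure K')
  (i : closure_iso Kb Kb') : cancel (trl i) (trl (ci_inv i)).
Proof. by move=> x; apply: val_inj; exact: trcK. Qed.

Lemma trpK' (K K' : fieldExtType rat) (Kb : alg_closure K) (Kb' : alg_closure K')
  (i : closure_iso Kb Kb') : cancel (trp (ci_inv i)) (trp i).
Proof. by move=> P; apply/val_inj/seteqP; split=> a; rewrite /= /tset /= ci_sgK'. Qed.

Lemma trlK' (K K' : fieldExtType rat) (Kb : alg_closure K) (Kb' : alg_closure K')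
  (i : closure_iso Kb Kb') : cancel (trl (ci_inv i)) (trl i).
Proof.
move=> x; apply: val_inj; apply: dchar_eq => s; rewrite /=; congr (dc_fun x _).
by apply: absgal_eq => z; rewrite /= !ci_SK'.
Qed.

Section CharAt.
Context (K K' : fieldExtType rat) (Kb : alg_closure K) (Kb' : alg_closure K').

Lemma trc_field (i : closure_iso Kb Kb') (x : dirichlet_char R Kb) :
  char_field (trc i x) = tset (ci_S' i) (char_field x).
Proof.
apply/seteqP; split=> z Lz s xs.
  have : trg i s z = z by apply: Lz; rewrite -[LHS]/(x (trg (ci_inv i) (trg i s))) trgK.
  by move=> /(congr1 (ci_S' i)); rewrite /= ci_SK.
have : trg (ci_inv i) s (ci_S' i z) = ci_S' i z by exact: Lz.
by move=> /(congr1 (ci_S i)); rewrite /= !ci_SK'.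
Qed.

Lemma tr_above (i : closure_iso Kb Kb') L P Q : lies_above L P Q ->
  lies_above (tset (ci_S' i) L) (trp i P) (tset (ci_S' i) Q).
Proof.
move=> [Qp QP]; split; first exact: (tset_prime (ci_SK i) (ci_SK' i) Qp).
by apply/seteqP; split=> a; rewrite /= /tset /= ci_SE' -QP.
Qed.
End CharAt.

Section CharAt2.
Context (K K' : fieldExtType rat) (Kb : alg_closure K) (Kb' : alg_closure K').
Context (i : closure_iso Kb Kb').
Local Notation T := (tset (ci_S' i)).
Local Notation T' := (tset (ci_S i)).

Lemma tsetK A : T (T' A) = A.
Proof. by apply/seteqP; split=> z; rewrite /tset /= ci_SK'. Qed.
Lemma tsetK' A : T' (T A) = A.
Proof. by apply/seteqP; split=> z; rewrite /tset /= ci_SK. Qed.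

Lemma tr_unramified (x : dirichlet_char R Kb) P : unramified (char_field x) P ->
  unramified (char_field (trc i x)) (trp i P).
Proof.
move=> unr Q' /(tr_above (ci_inv i)); rewrite trpK trc_field -[tset _ (T _)]/(T' (T _)) tsetK'.
move=> /unr ram n; rewrite -[Q']tsetK (tset_exp (ci_SK i) (ci_SK' i)) -ram.
have -> : ideal_mul (ac_emb Kb' @` val (trp i P)) (int_ring (T (char_field x))) =
    T (ideal_mul (ac_emb Kb @` val P) (int_ring (char_field x))).
  rewrite -(tset_mul (ci_SK i) (ci_SK' i)) (tset_int (ci_SK' i)); congr ideal_mul.
  apply/seteqP; split=> [_ [a Pa <-]|z [a Pa E]].
    by exists (ci_sg' i a) => //; rewrite /= ci_SE'.
  exists (ci_sg i a); first by rewrite /= /tset /= ci_sgK.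
  by rewrite -ci_SE E ci_SK'.
by split=> sub z Tz; [have := sub (ci_S i z); rewrite /tset /= ci_SK; apply|exact: sub].
Qed.

Lemma tr_frobenius (x : dirichlet_char R Kb) P s : is_frobenius (char_field x) P s ->
  is_frobenius (char_field (trc i x)) (trp i P) (trg i s).
Proof.
move=> [Q ab fr]; exists (T Q); first by rewrite trc_field; exact: tr_above.
move=> z; rewrite trc_field (tset_int (ci_SK' i)) => /fr.
by rewrite /tset /= trp_norm rmorphB rmorphXn /= ci_SK.
Qed.
End CharAt2.

(** The Frobenius elements selected on the two sides are unrelated, so [frob_unique] has to compare
    them. If neither side has one, both defaults are 1, where every character is 1. *)
Lemma tr_char_at (K K' : fieldExtType rat) (Kb : alg_closure K) (Kb' : alg_closure K')
    (i : closure_iso Kb Kb') (x : lchar R Kb l) P :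
  char_at (trl i x) (trp i P) = char_at x P.
Proof.
rewrite /char_at.
have uE : unramified (char_field (trc i x)) (trp i P) <-> unramified (char_field x) P.
  split; last exact: (tr_unramified (i := i)).
  by move=> /(tr_unramified (i := ci_inv i)); rewrite trcK trpK.
rewrite (asbool_equiv_eq uE : `[< unramified (char_field (trl i x)) (trp i P) >] = _).
case: asboolP => [unr|//].
have opn := char_gen (root_open (prime_gt0 l_pr) (lchar_root (trl i x))).
have [t at_ tP] := opn.
case: xgetP => [s' _ fr'|none]; case: xgetP => [s _ fr|none'].
- have fr2 := tr_frobenius i fr.
  have -> : x s = trl i x (trg i s) by rewrite trlE trgK.
  by apply: (@frob_unique R K' Kb' l l_pr (trl i x) (lchar_root (trl i x)) t at_ tP (trp i P)) => //; apply/uE.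
- by have := tr_frobenius (ci_inv i) fr'; rewrite trcK trpK => /none'.
- by have := tr_frobenius i fr => /none.
- by rewrite !dchar1.
Qed.

Definition tr_iso (K K' : fieldExtType rat) (Kb : alg_closure K) (Kb' : alg_closure K')
    (i : closure_iso Kb Kb') : lchar_iso R Kb Kb' l :=
  @LCharIso R K K' Kb Kb' l (trl i) (Bijective (trlK i) (trlK' i)).

Lemma closure_iso_ext (K K' : fieldExtType rat) (Kb : alg_closure K) (Kb' : alg_closure K')
    (sg : {rmorphism K -> K'}) : bijective sg ->
  exists i : closure_iso Kb Kb', forall a, ci_sg i a = sg a.
Proof.
move=> bsg; have [sg' sgK sgK'] := bsg.
have [sg1 sg1E] : exists sg1 : {rmorphism K' -> K}, sg1 =1 sg'.
  have zm : zmod_morphism sg' by exact: (can2_zmod_morphism sgK sgK').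
  have mm : monoid_morphism sg' by exact: (can2_monoid_morphism sgK sgK').
  pose A := GRing.isZmodMorphism.Build K' K sg' zm; pose B := GRing.isMonoidMorphism.Build K' K sg' mm.
  pose m : {rmorphism K' -> K} := HB.pack sg' A B.
  by exists m.
pose i2 : {rmorphism K -> Kb'} := ac_emb Kb' \o sg.
have [S SE] := @closure_hom K Kb Kb' (ac_emb Kb) i2 (@ac_alg _ Kb).
have alg2 y : algebraicOver i2 y.
  have [q q0 rq] := ac_alg y; exists (map_poly sg1 q); first by rewrite map_poly_eq0.
  rewrite -map_poly_comp; rewrite (eq_map_poly (g := ac_emb Kb')) // => a /=.
  by rewrite sg1E sgK'.
have [S' SK SK'] := closure_hom_bij SE alg2.
have [S1 S1E] : exists S1 : {rmorphism Kb' -> Kb}, S1 =1 S'.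
  have zm : zmod_morphism S' by exact: (can2_zmod_morphism SK SK').
  have mm : monoid_morphism S' by exact: (can2_monoid_morphism SK SK').
  pose A := GRing.isZmodMorphism.Build Kb' Kb S' zm; pose B := GRing.isMonoidMorphism.Build Kb' Kb S' mm.
  pose m : {rmorphism Kb' -> Kb} := HB.pack S' A B.
  by exists m.
have c1 : cancel sg sg1 by move=> a; rewrite sg1E sgK.
have c2 : cancel sg1 sg by move=> a; rewrite sg1E sgK'.
have c3 : cancel S S1 by move=> a; rewrite S1E SK.
have c4 : cancel S1 S by move=> a; rewrite S1E SK'.
by exists (ClosureIso c1 c2 c3 c4 SE).
Qed.

End Transport.

(** * From matching primes to a field isomorphism *)

Lemma rat_morph_uniq (F : fieldType) (e1 e2 : {rmorphism rat -> F}) q : e1 q = e2 q.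
Proof. by rewrite -(divq_num_den q) !fmorph_div /= !rmorph_int. Qed.

Section MakeGal.
Context (Qb : alg_closure rat) (h : {rmorphism Qb -> Qb}) (bh : bijective h).
Lemma mkgal_fix q : h (ac_emb Qb q) = ac_emb Qb q.
Proof. exact: (rat_morph_uniq (h \o ac_emb Qb)). Qed.
Definition mkgal : absgal Qb := @AbsGal rat Qb h bh mkgal_fix.
End MakeGal.

(** * Matching primes with K and K' inside one algebraic closure *)

Section SameField.
Context (R : realType) (l : nat) (l_pr : prime l) (K K' : fieldExtType rat) (Kb : alg_closure K)
  (e2 : {rmorphism K' -> ac_field Kb}) (alg2 : forall x, algebraicOver e2 x).
Local Notation Kc := (AlgClosure alg2).
Local Notation Om := (ac_field Kb).
Local Notation Qb := (Qbar Kb).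
Local Notation Qc := (Qbar Kc).
Local Notation gal := (absgal (Qbar Kb)).
Local Notation emb := (ac_emb Kb).
Implicit Types (g h k : gal) (T z : Om) (Q : set Om).

Definition fix2 g := forall a, g (e2 a) = e2 a.
Definition to2 (s : absgal Kc) : gal := @mkgal Qb s (gal_bij s).
(** [Qbar Kb] and [Qbar Kc] share their field but are different closures of Q as terms; [vc] and
    [cv] pass between their Galois groups without changing the function. *)
Definition vc (g : gal) : absgal Qc := @mkgal Qc g (gal_bij g).
Definition cv (g : absgal Qc) : gal := @mkgal Qb g (gal_bij g).

Lemma fix2_to2 s : fix2 (to2 s). Proof. by move=> a; exact: (gal_fix s a). Qed.
Lemma to2_onto g : fix2 g -> exists s, to2 s = g.
Proof. by move=> fg; exists (@AbsGal K' Kc g (gal_bij g) fg); apply: absgal_eq. Qed.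
Lemma to2M s s' : to2 (s * s')%g = (to2 s * to2 s')%g. Proof. exact: absgal_eq. Qed.
Lemma to2V s : to2 s^-1%g = (to2 s)^-1%g.
Proof. by apply: (mulgI (to2 s)); rewrite -to2M !mulgV; exact: absgal_eq. Qed.
Lemma to2_inj s s' : to2 s = to2 s' -> s = s'.
Proof. by move=> E; apply: absgal_eq => z; rewrite -[s z]/(to2 s z) E. Qed.
Lemma vcM g h : vc (g * h)%g = (vc g * vc h)%g. Proof. exact: absgal_eq. Qed.
Lemma vcV g : vc g^-1%g = (vc g)^-1%g.
Proof. by apply: (mulgI (vc g)); rewrite -vcM !mulgV; exact: absgal_eq. Qed.
Lemma vc_to2 s : vc (to2 s) = toQ s. Proof. exact: absgal_eq. Qed.
Lemma vc_inj : injective vc.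
Proof. by move=> g h E; apply: absgal_eq => z; rewrite -[g z]/(vc g z) E. Qed.
Lemma sfix_c T z : sfix (Qb := Qb) T z -> sfix (Qb := Qc) T z.
Proof. by move=> H g gT; exact: (H (cv g) gT). Qed.

Lemma orb_c z : orb (Qb := Qc) z = orb (Qb := Qb) z.
Proof.
rewrite /orb; congr (enum_fset (fset_set _)); apply/seteqP; split=> _ [g _ <-].
  by exists (cv g).
by exists (vc g).
Qed.

Lemma orb_disc_c z : orb_disc (Qb := Qc) z = orb_disc (Qb := Qb) z.
Proof. by rewrite /orb_disc /orb_diff orb_c. Qed.

Lemma K_gen2 : exists2 e : Om, aint (e : Qb) & forall g, g e = e <-> fix2 g.
Proof. by have [e ae eP] := K_gen Kc; exists e => // g; exact: (eP (vc g)). Qed.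

Lemma kummer2 h T : ~ fix2 h -> exists (x : lchar R Kc l) (s s' : absgal Kc),
  [/\ s T = T, to2 s' = (h^-1 * to2 s * h)%g & x s <> x s'].
Proof.
move=> nh; have [x [s [s' [sT sE ne]]]] := @kummer_sep R K' Kc l l_pr (vc h) T nh.
by exists x, s, s'; split=> //; apply: vc_inj; rewrite !vcM vcV !vc_to2.
Qed.

Lemma contr2 (P : primes_of K') Q : place (Qb := Qb) (rchar (val P)) Q ->
  exists g, forall a, val P a -> Q (g (e2 a)).
Proof.
move=> plQ; have [pp PPp] := rcharP Kc P.
have [g gP] := @prime_contr K' Kc (val P) (primes_ofP P) _ pp PPp Q plQ.
by exists (cv g) => a /gP [].
Qed.

Context (psi : lchar_iso R Kb Kc l).
Implicit Types (Z : seq (lchar R Kb l)).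

Definition Ug g Z h := exists (s : absgal Kb) (s' : absgal Kc),
  [/\ toQ s = h, to2 s' = (g^-1 * h * g)%g & forall x, x \in Z -> x s = psi x s'].
Definition Vg g h := fixK h /\ fix2 (g^-1 * h * g)%g.

Lemma UV g Z h : Ug g Z h -> Vg g h.
Proof. by move=> [s [s' [<- E _]]]; split; [exact: fixK_toQ|rewrite -E; exact: fix2_to2]. Qed.

Lemma conjMg g h k : (g^-1 * (h * k) * g = (g^-1 * h * g) * (g^-1 * k * g))%g.
Proof. by rewrite !mulgA mulgK. Qed.

Lemma conjVg g h : (g^-1 * h^-1 * g = (g^-1 * h * g)^-1)%g.
Proof. by rewrite !invgM invgK !mulgA. Qed.

Lemma U1 g Z : Ug g Z 1%g.
Proof.
exists 1%g, 1%g; split; [exact: absgal_eq| |by move=> x _; rewrite !dchar1].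
by rewrite mulg1 mulVg; exact: absgal_eq.
Qed.

Lemma UM g Z h k : Ug g Z h -> Ug g Z k -> Ug g Z (h * k)%g.
Proof.
move=> [s [s' [<- E H]]] [r [r' [<- E' H']]]; exists (s * r)%g, (s' * r')%g; split.
- by rewrite toQM.
- by rewrite conjMg to2M E E'.
- by move=> x xZ; rewrite !dc_mulM H // H'.
Qed.

Lemma UI g Z h : Ug g Z h -> Ug g Z h^-1%g.
Proof.
move=> [s [s' [<- E H]]]; exists s^-1%g, s'^-1%g; split.
- by rewrite toQV.
- by rewrite conjVg to2V E.
- by move=> x xZ; rewrite !dcharV H.
Qed.

Lemma VP g h : Vg g h -> exists (s : absgal Kb) (s' : absgal Kc),
  toQ s = h /\ to2 s' = (g^-1 * h * g)%g.
Proof. by move=> [/toQ_onto [s sE] /to2_onto [s' sE']]; exists s, s'. Qed.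

Lemma V1 g : Vg g 1%g. Proof. exact: (UV (U1 g [::])). Qed.

Lemma VM g h k : Vg g h -> Vg g k -> Vg g (h * k)%g.
Proof.
by move=> /VP [s [s' [<- E]]] /VP [r [r' [<- E']]]; split; [rewrite -toQM; exact: fixK_toQ|
  rewrite conjMg -E -E' -to2M; exact: fix2_to2].
Qed.

(* Ug is the kernel of a homomorphism from Vg to an abelian group. *)
Lemma UJ g Z h k : Vg g h -> Ug g Z k -> Ug g Z (h^-1 * k * h)%g.
Proof.
move=> /VP [r [r' [<- E']]] [s [s' [<- E H]]].
exists (r^-1 * s * r)%g, (r'^-1 * s' * r')%g; split.
- by rewrite !toQM toQV.
- by rewrite !conjMg conjVg !to2M to2V E E'.
- move=> x xZ; rewrite !dc_mulM !dcharV H //.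
  have n1 := dc_neq0 x r; have n2 := dc_neq0 (psi x) r'.
  by field; rewrite n1 n2.
Qed.

Lemma Usub g Z Z' h : {subset Z <= Z'} -> Ug g Z' h -> Ug g Z h.
Proof. by move=> ZZ [s [s' [E E' H]]]; exists s, s'; split=> // x /ZZ; exact: H. Qed.

Lemma char_trivial_on (F : fieldExtType rat) (Fb : alg_closure F) (Y : seq (lchar R Fb l)) :
  exists2 T : Fb, aint (T : Qbar Fb) & forall g : absgal (Qbar Fb), g T = T ->
    exists2 s, toQ s = g & forall x, x \in Y -> x s = 1.
Proof.
elim: Y => [|x Y [T1 aT1 H1]].
  have [e ae eP] := K_gen Fb; exists e => // g /eP /toQ_onto [s sE]; by exists s.
have [T2 aT2 H2] := lchar_open l_pr x.
have [T [aT TS _]] := prim_elem (Qb := Qbar Fb) [:: T1; T2].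
exists T => // g gT.
have /H1 [s sE sY] : g T1 = T1 by apply: (TS T1) => //; rewrite !inE eqxx.
have /H2 [s' sE' sx] : g T2 = T2 by apply: (TS T2) => //; rewrite !inE eqxx orbT.
exists s => // y; rewrite inE => /orP [/eqP ->|]; last exact: sY.
by rewrite -sx; congr (lchar_val x _); apply: toQ_inj; rewrite sE'.
Qed.

Lemma U_open Z : exists T, [/\ aint (T : Qb), (forall h, sfix (Qb := Qb) T (h T)) &
  forall g h, h T = T -> Ug g Z h].
Proof.
have [T1 aT1 H1] := char_trivial_on Z; have [T2 aT2 H2] := char_trivial_on (map psi Z).
have [T [aT TS Tn]] := @normal_gen Qb [:: T1; T2].
exists T; split=> // g h hT.
have /H1 [s sE sZ] : h T1 = T1 by apply: (TS T1) => //; rewrite !inE eqxx.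
have : (g^-1 * h * g)%g T2 = T2.
  apply: (TS T2); first by rewrite !inE eqxx orbT.
  by rewrite !(@gal_mulE Qb) (Tn g h hT) (@gal_invK Qb).
move=> /(H2 (vc (g^-1 * h * g)%g)) [s' sE' sZ'].
exists s, s'; split=> //; first by apply: vc_inj; rewrite vc_to2.
by move=> x xZ; rewrite sZ // sZ' // map_f.
Qed.

(** Only the coset of g modulo the Galois group of K' matters; such cosets are labelled below by the
    conjugates of a generator e' of K'. *)
Lemma U_coset g k Z h : Ug (g * k)%g Z h -> fix2 k -> Ug g Z h.
Proof.
move=> [s [s' [<- E H]]] /to2_onto [r rE]; exists s, (r * s' * r^-1)%g; split=> //.
  by rewrite !to2M to2V E rE invgM !mulgA mulgV mul1g mulgK.
move=> x xZ; rewrite H // !dc_mulM dcharV mulrAC mulfV ?mul1r //; exact: dc_neq0.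
Qed.

(* The elements of hs lie in distinct cosets of Ug in Vg. *)
Definition fam g Z (hs : seq gal) := (forall h, h \in hs -> Vg g h) /\
  forall i j, (i < j < size hs)%N -> ~ Ug g Z ((nth 1 hs i)^-1 * nth 1 hs j)%g.

Lemma fam_sub g Z Z' hs : {subset Z <= Z'} -> fam g Z hs -> fam g Z' hs.
Proof. by move=> ZZ [H1 H2]; split=> // i j ij /(Usub ZZ); exact: H2. Qed.

Section Count.
Context (e' : Om) (e'P : forall g, g e' = e' <-> fix2 g)
  (gc : Om -> gal) (gcP : forall c, c \in orb (Qb := Qb) e' -> gc c e' = c)
  (S : set (primes_of K)) (dS : dirichlet_density S (1 : R))
  (W : forall Z, exists P0 : nat, forall P : primes_of K, S P -> dg1 P -> (P0 < rchar (val P))%N ->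
     exists P' : primes_of K', prime_norm P' = prime_norm P /\
       forall x, x \in Z -> char_at x P = char_at (psi x) P').
Local Notation orb := (orb (Qb := Qb)).

(** The partner P' is the contraction of Q along some g', so conjugating the Frobenius h at Q by g'
    gives a Frobenius at P'. Equality of the character values then places h in U_g' (Z). *)
Lemma prime_coset Z : exists (P0 : nat) (T : Om) (D : int), [/\ aint (T : Qb),
  (forall h, sfix (Qb := Qb) T (h T)), (forall g h, h T = T -> Ug g Z h),
  orb_disc (T : Qb) = D%:~R &
  forall P : primes_of K, S P -> dg1 P -> (P0 < rchar (val P))%N -> ~~ (rchar (val P) %| D)%Z /\
    exists c Q h, [/\ c \in orb e', place (Qb := Qb) (rchar (val P)) Q,
      (forall a, val P a -> Q (emb a)), Q (h T - T ^+ rchar (val P)) & Ug (gc c) Z h]].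
Proof.
have [T0 [aT0 T0n T0U]] := U_open Z.
have [P1 [T1 [aT1 H1]]] := common_eval l_pr Z; have [P2 [T2 [aT2 H2]]] := common_eval l_pr (map psi Z).
have [P3 H3] := W Z.
have [T [aT TS Tn]] := @normal_gen Qb [:: T0; T1; T2].
have TT0 : sfix (Qb := Qb) T T0 by apply: TS; rewrite !inE eqxx.
have TT1 : sfix (Qb := Qb) T T1 by apply: TS; rewrite !inE eqxx !orbT.
have TT2 : sfix (Qb := Qb) T T2 by apply: TS; rewrite !inE eqxx !orbT.
have [D DE D0] := @orb_disc_int Qb T aT.
exists (maxn (maxn P1 P2) (maxn P3 (absz D))), T, D; split=> //; first by move=> g h /TT0; exact: T0U.
move=> P SP d1 Pp; rewrite !gtn_max in Pp; have /andP [/andP [P1p P2p] /andP [P3p Dp]] := Pp.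
have pD : ~~ (rchar (val P) %| D)%Z by rewrite dvdzE /= gtnNdvd ?absz_gt0.
split=> //; have [pp PPp] := rcharP Kb P.
have [Q0 plQ0] := place_exists Qb pp.
have [g0 g0P] := prime_contr (primes_ofP P) pp PPp plQ0.
have plQ := place_gal plQ0 g0; set Q := [set z | _] in plQ.
have PQ a : val P a -> Q (emb a) by move=> /g0P [].
have [h Qh] := pl_frob plQ pp aT.
have [fh Hh] := H1 T D aT TT1 DE P Q h d1 P1p pD plQ PQ Qh.
have [P' [NE PE]] := H3 P SP d1 P3p.
have [pE d1'] : rchar (val P') = rchar (val P) /\ dg1 P'.
  have := norm_prime_dg1 Kc (P := P'); rewrite NE (norm_dg1 Kb d1) => /(_ pp) [<-]; by split.
have plQ' : place (Qb := Qb) (rchar (val P')) Q by rewrite pE.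
have [g' g'P] := contr2 plQ'.
have plg := place_gal plQ' g'; set Q' := [set z | _] in plg.
have [||||fk Hk] := H2 T D aT (sfix_c TT2) _ P' Q' (vc (g'^-1 * h * g')%g) d1' _ _ plg g'P.
- by rewrite orb_disc_c.
- by rewrite pE.
- by rewrite pE.
- rewrite /Q' /= rmorphB rmorphXn /= pE -[g' (absgal_invf _ _)]/(g' (g'^-1%g (h (g' T)))).
  rewrite (@gal_Kinv Qb); apply: (@pl_frob_ext Qb _ Q plQ pp T D) => //; exact: (@aint_gal Qb).
have [s sE] := toQ_onto fh.
have [s' sE'] : exists s', to2 s' = (g'^-1 * h * g')%g by exact: (to2_onto fk).
have Uh : Ug g' Z h.
  exists s, s'; split=> // x xZ; rewrite -(Hh s sE) // PE //.
  by apply: Hk; [rewrite -sE' vc_to2|exact: map_f].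
exists (g' e'), Q, h; split=> //; first by apply/orbP; exists g'.
have co : g' e' \in orb e' by apply/orbP; exists g'.
apply: (@U_coset _ ((gc (g' e'))^-1 * g')%g); first by rewrite mulgA mulgV mul1g.
by apply/e'P; rewrite (@gal_mulE Qb) -{2}(gcP co) (@gal_invK Qb).
Qed.

(** Let [ee c] generate the fixed field of U for the coset c. For a prime P sorted under c the
    elements of [hs c] send it to distinct conjugates congruent to integers above P, so [inj_pairs]
    bounds the primes under c by 1 / |hs c| of [pzeta]. Together these primes have density one. *)
Lemma count_bound Z (hs : Om -> seq gal) (ep : R) : 0 < ep < 1 ->
  (forall c, c \in orb e' -> fam (gc c) Z (hs c) /\ (0 < size (hs c))%N) ->
  1 - ep <= \sum_(c <- orb e') (size (hs c))%:R^-1.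
Proof.
move=> ep01 Hhs; have [P1 [T [D [aT Tn TU DE HP]]]] := prime_coset Z.
have ex1 c : exists e : Om, aint (e : Qb) /\ forall g, g e = e <-> Ug (gc c) Z g.
  have [||||e ae eP] := @prim_subgroup Qb T (Ug (gc c) Z).
  - exact: U1.
  - by move=> g h; exact: UM.
  - by move=> g; exact: UI.
  - by move=> g; exact: TU.
  - by exists e.
have [ee eeP] := boolp.choice ex1.
have ex2 c : exists DF : int * {poly int}, [/\ orb_disc (ee c : Qb) = DF.1%:~R, DF.1 != 0 &
    orbpoly (ee c : Qb) = map_poly intr DF.2].
  have [D' DE' D0'] := @orb_disc_int Qb (ee c) (eeP c).1.
  by have [fz fzE] := @orbpoly_int Qb (ee c) (eeP c).1; exists (D', fz).
have [DF DFP] := boolp.choice ex2.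
pose P0 := (maxn P1 (\max_(c <- orb e') absz (DF c).1)).+1.
have P0D c : c \in orb e' -> (absz (DF c).1 <= P0)%N.
  move=> co; apply: leqW; apply: leq_trans (leq_maxr _ _).
  by rewrite (big_rem c) //= leq_maxl.
have ex3 c : exists C : R, c \in orb e' -> forall Y s, 1 < s <= 2 ->
    pzeta (DF c).2 P0 Y s <= ln (s - 1)^-1 + C.
  have [co|] := boolP (c \in orb e'); last by exists 0.
  have [E D0 F] := DFP c.
  by have [C CP] := @pzeta_upper R Qb (ee c) (eeP c).1 _ E D0 _ F P0 (P0D c co); exists C.
have [CC CCP] := boolp.choice ex3.
have [C [d [d0 d1 dP]]] := density_lower Kb ep01 (ltn0Sn _ : (0 < P0)%N) dS.
pose A : R := \sum_(c <- orb e') (size (hs c))%:R^-1.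
pose B : R := \sum_(c <- orb e') (size (hs c))%:R^-1 * CC c.
have ineq s : 1 < s < 1 + d -> (1 - ep) * ln (s - 1)^-1 - C <= A * ln (s - 1)^-1 + B.
  move=> s1; have [X [uX XP XS]] := dP s s1; apply: (le_trans XS).
  have s12 : 1 < s <= 2 by case/andP: s1 => -> ?; lra.
  have ex4 (P : primes_of K) : exists cQh : Om * (set Om * gal), P \in X ->
      [/\ cQh.1 \in orb e', place (Qb := Qb) (rchar (val P)) cQh.2.1,
      (forall a, val P a -> cQh.2.1 (emb a)), cQh.2.1 (cQh.2.2 T - T ^+ rchar (val P)) &
      Ug (gc cQh.1) Z cQh.2.2].
    have [PX|] := boolP (P \in X); last by exists (0, (set0, 1%g)).
    have [SP d1P Pp] := XP P PX.
    have P1p : (P1 < rchar (val P))%N by apply: leq_ltn_trans Pp; apply: leqW; exact: leq_maxl.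
    by have [_ [c [Q [h H]]]] := HP P SP d1P P1p; exists (c, (Q, h)).
  have [cc ccP] := boolp.choice ex4.
  pose Xc c := [seq P <- X | (cc P).1 == c].
  have -> : zsum X s = \sum_(c <- orb e') zsum (Xc c) s.
    rewrite /zsum; under [RHS]eq_bigr do rewrite big_filter.
    rewrite (exchange_big_dep predT) //= big_seq [RHS]big_seq; apply: eq_bigr => P PX.
    have [co _ _ _ _] := ccP P PX.
    rewrite -big_filter (_ : [seq i <- orb e' | (cc P).1 == i] = [:: (cc P).1]) ?big_seq1 //.
    rewrite -[RHS](filter_pred1_uniq (orb_uniq (Qb := Qb) e') co).
    by apply: eq_filter => c; rewrite /= eq_sym.
  rewrite /A /B mulr_suml -big_split /= big_seq [leRHS]big_seq; apply: ler_sum => c co.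
  have [fm sz] := Hhs c co; have [E D0 F] := DFP c; have [aec ecP] := eeP c.
  have kpos : 0 < (size (hs c))%:R :> R by rewrite ltr0n.
  rewrite -mulrDr mulrC ler_pdivlMr // mulrC.
  have [|||Y YP] := @inj_pairs R K Kb (ee c) aec (DF c).1 E (DF c).2 F P0 (P0D c co) D0 _ (size (hs c)) (Xc c).
  - by move=> g /ecP /UV [].
  - exact: filter_uniq.
  - move=> P; rewrite mem_filter => /andP [/eqP ccE PX].
    have [SP d1P Pp] := XP P PX; have [co' plQ PQ Qh Uh] := ccP P PX; rewrite ccE in Uh.
    have pp := (rcharP Kb P).1.
    have P1p : (P1 < rchar (val P))%N by apply: leq_ltn_trans Pp; apply: leqW; exact: leq_maxl.
    have [pD _] := HP P SP d1P P1p.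
    split=> //; first exact: (norm_dg1 Kb d1P).
    exists (cc P).2.1, [seq h (ee c) | h : gal <- hs c]; split=> //; last first.
    + move=> y /mapP [h hh yE]; have Vh := fm.1 h hh; split; first by exists h => //; exact: Vh.1.
      have yo : y \in orb (ee c) by rewrite yE; apply/orbP; exists h.
      (* U is normal in V, so the Frobenius fixes the whole V-orbit of [ee c]; hence y is congruent
         to its p-th power, and to an integer. *)
      have hy : (cc P).2.2 y = y.
        have /ecP : Ug (gc c) Z (h^-1 * (cc P).2.2 * h)%g by exact: UJ.
        rewrite !(@gal_mulE Qb) => /(congr1 (h : Om -> Om)); rewrite (@gal_Kinv Qb) yE.
        by [].
      have Ty : sfix (Qb := Qb) T y.
        move=> g gT; have /TU -/(_ (gc c)) /ecP : (h^-1 * g * h)%g T = T.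
          by rewrite !(@gal_mulE Qb) (Tn h g gT) (@gal_invK Qb).
        by rewrite !(@gal_mulE Qb) => /(congr1 (h : Om -> Om)); rewrite (@gal_Kinv Qb) yE.
      have ay : aint (y : Qb) by exact: (@aint_orb Qb (ee c) y aec yo).
      have := @pl_frob_ext Qb _ _ plQ pp T D (cc P).2.2 y aT DE pD Qh ay Ty.
      rewrite hy => /(plN plQ); rewrite opprB => Qy.
      have [r _ Qr] := @frob_fix_root Qb (ee c) aec (DF c).2 F _ _ plQ pp y yo Qy.
      by exists r.
    + by rewrite size_map.
    + apply/(uniqP 0) => i j; rewrite !inE size_map => ii jj; rewrite !(nth_map 1%g) // => eij.
      wlog lt : i j ii jj eij / (i < j)%N.
        move=> H; case: (ltngtP i j) => [|lt|//]; first exact: H.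
        by apply/esym/(H j i).
      exfalso; apply: (fm.2 i j); first by rewrite lt.
      by apply/ecP; rewrite (@gal_mulE Qb) -eij (@gal_invK Qb).
  - apply: le_trans (CCP c co Y s s12); exact: YP.
rewrite -/A leNgt; apply/negP => lt.
(* Chosen so that ln (s - 1)^-1 >= M contradicts [ineq]. *)
pose M := (B + C + 1) / (1 - ep - A).
have [d2 /andP [d20 d21] d2P] := ln_inv_near M.
pose s := 1 + Num.min d d2 / 2.
have m0 : 0 < Num.min d d2 by rewrite lt_min d0.
have m1 : Num.min d d2 <= d by rewrite ge_min lexx.
have m2 : Num.min d d2 <= d2 by rewrite ge_min lexx orbT.
have sd : 1 < s < 1 + d by rewrite /s; apply/andP; split; lra.
have sd2 : 1 < s < 1 + d2 by rewrite /s; apply/andP; split; lra.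
have h1 := ineq s sd; have h2 := d2P s sd2.
have p0 : 0 < 1 - ep - A by lra.
rewrite /M ler_pdivrMr // in h2.
have : (1 - ep) * ln (s - 1)^-1 - A * ln (s - 1)^-1 = ln (s - 1)^-1 * (1 - ep - A) by ring.
lra.
Qed.
End Count.

(** One open subgroup, the stabilizer of T, lies in U_g(Z) for all Z at once. *)
Definition univ g T := forall h, h T = T -> exists (s : absgal Kb) (s' : absgal Kc),
  [/\ toQ s = h, to2 s' = (g^-1 * h * g)%g & forall x : lchar R Kb l, x s = psi x s'].

Lemma fam1 g Z : fam g Z [:: 1%g].
Proof.
split=> [h|i j /andP [ij]]; first by rewrite inE => /eqP ->; exact: V1.
by rewrite /= ltnS leqn0 => /eqP j0; rewrite j0 in ij.
Qed.

(** Take Z with a longest family. If a further character x cut some h out of U_g(Z), then [h0 * h],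
    for the first member [h0], would extend the family for [x :: Z]. *)
Lemma bounded_univ g (M : nat) : (forall Z hs, fam g Z hs -> (size hs < M)%N) -> exists T, univ g T.
Proof.
move=> bd; pose pr (k : nat) := `[< exists Z hs, fam g Z hs /\ size hs = k >].
have ex : exists k : nat, pr k by exists 1%N; apply/asboolP; exists [::], [:: 1%g]; split=> //; exact: fam1.
have ub (k : nat) : pr k -> (k <= M)%N by move=> /asboolP [Z [hs [/bd lt <-]]]; exact: ltnW.
case: (ex_maxnP ex ub) => k /asboolP [Z [hs [fm szk]]] kmax.
have k1 : (1 <= k)%N by apply: kmax; apply/asboolP; exists [::], [:: 1%g]; split=> //; exact: fam1.
have [T [_ _ TU]] := U_open Z; exists T => h hT; have Uh := TU g h hT.
have [s [s' [sE sE' _]]] := Uh; exists s, s'; split=> // x.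
have : Ug g (x :: Z) h.
  apply: contrapT => nU; pose h0 := nth 1%g hs 0.
  have ZZ : {subset Z <= x :: Z} by move=> y yZ; rewrite inE yZ orbT.
  have V0 : Vg g h0 by apply: fm.1; rewrite mem_nth // szk.
  suff /kmax : pr k.+1 by rewrite ltnn.
  apply/asboolP; exists (x :: Z), (rcons hs (h0 * h)%g); split; last by rewrite size_rcons szk.
  split.
    move=> k0; rewrite mem_rcons inE => /orP [/eqP ->|]; last exact: fm.1.
    by apply: VM => //; exact: (UV Uh).
  move=> i j; rewrite size_rcons szk !nth_rcons szk => /andP [ij]; rewrite ltnS leq_eqVlt.
  move=> /orP [/eqP jk|jk]; last first.
    by rewrite (ltn_trans ij jk) jk => /(Usub ZZ); apply: fm.2; rewrite ij szk.
  rewrite jk ltnn eqxx -jk ij; case: (posnP i) => [->|i0] UU.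
    by apply: nU; move: UU; rewrite -/h0 mulgA mulVg mul1g.
  apply: (fm.2 0%N i); first by rewrite i0 szk -jk.
  have := UM (Usub ZZ UU) (UI Uh); rewrite mulgA mulgK => /UI.
  by rewrite invgM invgK.
move=> [r [r' [rE rE' rx]]].
have -> : s = r by apply: toQ_inj; rewrite sE.
have -> : s' = r' by apply: to2_inj; rewrite sE'.
by apply: rx; rewrite mem_head.
Qed.

(** If h fixes K but its conjugate does not fix K', a Kummer character of K' distinguishes two
    elements conjugate under it. The corresponding character of K sees only conjugation inside the
    Galois group of K and takes equal values. The converse is symmetric. *)
Lemma univ_conj g T : univ g T -> forall h, fixK h <-> fix2 (g^-1 * h * g)%g.
Proof.
move=> un h; have [T1 [aT1 T1S T1n]] := @normal_gen Qb [:: T].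
have T1T k : k T1 = T1 -> k T = T by apply: T1S; rewrite inE.
have cj k m : k T1 = T1 -> (m^-1 * k * m)%g T1 = T1.
  by move=> kT; rewrite !(@gal_mulE Qb) (T1n m k kT) (@gal_invK Qb).
split=> [fh|f2]; apply: contrapT => nf.
  have [x' [s [s' [sT sE ne]]]] := kummer2 T1 nf.
  have [psi' _ psiK] := lci_bij psi.
  have c1 : (g * to2 s * g^-1)%g T1 = T1.
    by have := cj (to2 s) g^-1%g sT; rewrite invgK.
  have c2 : (g * to2 s' * g^-1)%g T1 = T1.
    have : to2 s' T1 = T1 by rewrite sE; apply: cj.
    by move=> /(cj _ g^-1%g); rewrite invgK.
  have [r [r' [rE rE' rx]]] := un _ (T1T _ c1).
  have [q [q' [qE qE' qx]]] := un _ (T1T _ c2).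
  apply: ne; rewrite -(psiK x').
  have -> : s = r' by apply: to2_inj; rewrite rE' !mulgA mulVg mul1g mulgVK.
  have -> : s' = q' by apply: to2_inj; rewrite qE' !mulgA mulVg mul1g mulgVK.
  rewrite -rx -qx; have [m mE] := toQ_onto fh.
  have -> : q = (m^-1 * r * m)%g.
    apply: toQ_inj; rewrite qE !toQM toQV mE rE sE !invgM !invgK !mulgA.
    by rewrite mulgK mulgV mul1g.
  rewrite !dc_mulM dcharV; have n1 := dc_neq0 (psi' x') m.
  by rewrite mulrAC mulVf // mul1r.
have [x [s [s' [sT sE ne]]]] := @kummer_sep R K Kb l l_pr h T1 nf.
have c2 : toQ s' T1 = T1 by rewrite sE; apply: cj.
have [r [r' [rE rE' rx]]] := un _ (T1T (toQ s) sT).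
have [q [q' [qE qE' qx]]] := un _ (T1T _ c2).
apply: ne; rewrite -(toQ_inj rE) -(toQ_inj qE) rx qx.
have [m mE] := to2_onto f2.
have -> : q' = (m^-1 * r' * m)%g.
  apply: to2_inj; rewrite qE' !to2M to2V mE rE' sE !invgM !invgK !mulgA.
  by rewrite mulgK mulgK.
rewrite !dc_mulM dcharV; have n1 := dc_neq0 (psi x) m.
by rewrite mulrAC mulVf // mul1r.
Qed.

(** On a small open subgroup both conjugations carry psi x to x, so conjugation by g1^-1 g2 is
    invisible to all characters of K' there, against [kummer2]. *)
Lemma univ_uniq g1 g2 T1 T2 : univ g1 T1 -> univ g2 T2 -> fix2 (g1^-1 * g2)%g.
Proof.
move=> un1 un2; apply: contrapT => nf.
have [T [aT TS Tn]] := @normal_gen Qb [:: T1; T2].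
have [x' [s [s' [sT sE ne]]]] := kummer2 T nf.
have [psi' _ psiK] := lci_bij psi.
have c1 : (g1 * to2 s * g1^-1)%g T = T.
  by rewrite !(@gal_mulE Qb) (Tn g1^-1%g (to2 s) sT) (@gal_Kinv Qb).
have [|r [r' [rE rE' rx]]] := un1 (g1 * to2 s * g1^-1)%g.
  by apply: (TS T1) => //; rewrite !inE eqxx.
have [|q [q' [qE qE' qx]]] := un2 (g1 * to2 s * g1^-1)%g.
  by apply: (TS T2) => //; rewrite !inE eqxx orbT.
apply: ne; rewrite -(psiK x').
have -> : s = r' by apply: to2_inj; rewrite rE' !mulgA mulVg mul1g mulgVK.
have -> : s' = q' by apply: to2_inj; rewrite qE' sE !invgM !invgK !mulgA.
by rewrite -rx -qx; congr (lchar_val _ _); apply: toQ_inj; rewrite rE qE.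
Qed.

Lemma core (S : set (primes_of K)) : dirichlet_density S (1 : R) ->
  (forall Z, exists P0 : nat, forall P : primes_of K, S P -> dg1 P -> (P0 < rchar (val P))%N ->
     exists P' : primes_of K', prime_norm P' = prime_norm P /\
       forall x, x \in Z -> char_at x P = char_at (psi x) P') ->
  exists g, (forall h, fixK h <-> fix2 (g^-1 * h * g)%g) /\
    forall s s', to2 s' = (g^-1 * toQ s * g)%g -> forall x : lchar R Kb l, x s = psi x s'.
Proof.
move=> dS W; have [e' ae' e'P] := K_gen2; pose ob := orb (Qb := Qb) e'; pose n := size ob.
have n0 : (0 < n)%N by have := orb_self (Qb := Qb) e'; rewrite /n /ob; case: (orb _).
have exg c : exists g : gal, c \in ob -> g e' = c.
  have [/orbP [g gE]|] := boolP (c \in ob); last by exists 1%g.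
  by exists g.
have [gc gcP] := boolp.choice exg.
have cnt := count_bound e'P gcP dS W.
have nR : 0 < n%:R :> R by rewrite ltr0n.
pose bounded c := exists M : nat, forall Z hs, fam (gc c) Z hs -> (size hs < M)%N.
have unb c (M : nat) : ~ bounded c -> exists Zh : seq (lchar R Kb l) * seq gal,
    fam (gc c) Zh.1 Zh.2 /\ (M <= size Zh.2)%N.
  move=> /forallNP /(_ M) /existsNP [Z /existsNP [hs /not_implyP [fm /negP]]].
  by rewrite -leqNgt => le; exists (Z, hs).
(* [count_bound] with the given family at [c0] and families of length at least M at all other
   cosets. A [c0] outside [ob] treats the case in which no coset is exceptional. *)
have big (M : nat) (c0 : Om) (Z0 : seq (lchar R Kb l)) (hs0 : seq gal) : (0 < M)%N ->
    (c0 \in ob -> fam (gc c0) Z0 hs0 /\ (0 < size hs0)%N) ->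
    (forall c, c \in ob -> c != c0 -> ~ bounded c) -> forall ep : R, 0 < ep < 1 ->
    1 - ep <= (if c0 \in ob then (size hs0)%:R^-1 else 0) + n%:R / M%:R.
  move=> M0 H0 Hu ep ep01.
  have ex c : exists Zh : seq (lchar R Kb l) * seq gal, c \in ob -> c != c0 ->
      fam (gc c) Zh.1 Zh.2 /\ (M <= size Zh.2)%N.
    have [co|] := boolP (c \in ob); last by exists ([::], [::]).
    have [->|nc0] := eqVneq c c0; first by exists ([::], [::]).
    by have [Zh H] := unb c M (Hu c co nc0); exists Zh.
  have [ZH ZHP] := boolp.choice ex.
  pose Z := Z0 ++ flatten [seq (ZH c).1 | c <- ob].
  pose hs c := if c == c0 then hs0 else (ZH c).2.
  have MR : 0 < M%:R :> R by rewrite ltr0n.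
  apply: (le_trans (cnt Z hs ep ep01 _)).
    move=> c co; rewrite /hs; case: eqVneq => [cE|nc0].
      rewrite cE in co *; have [fm sz] := H0 co; split=> //; apply: fam_sub fm.
      by move=> x xZ; rewrite mem_cat xZ.
    have [fm sz] := ZHP c co nc0; split; last exact: leq_trans sz.
    apply: fam_sub fm => x xZ; rewrite mem_cat; apply/orP; right.
    by apply/flattenP; exists (ZH c).1 => //; exact: map_f.
  apply: (@le_trans _ _ (\sum_(c <- ob) ((if c == c0 then (size hs0)%:R^-1 else 0) + M%:R^-1))).
    rewrite /ob big_seq [leRHS]big_seq; apply: ler_sum => c co; rewrite /hs; case: eqVneq => [_|nc0].
      by rewrite lerDl invr_ge0.
    have [_ sz] := ZHP c co nc0; rewrite add0r lef_pV2 ?posrE ?ler_nat //.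
    by rewrite ltr0n (leq_trans M0).
  rewrite big_split /=; apply: lerD; last first.
    by rewrite big_const_seq count_predT iter_addr_0 -/n mulr_natl.
  rewrite -big_mkcond /= -big_filter.
  rewrite (eq_filter (a2 := pred1 c0)) //.
  case: ifP => co.
    have -> : [seq c <- ob | pred1 c0 c] = [:: c0] by exact: (filter_pred1_uniq (orb_uniq (Qb := Qb) e') co).
    by rewrite big_seq1.
  rewrite big_filter big_seq_cond big_pred0 // => c; apply/negbTE/negP => /andP [cob /eqP cE].
  by rewrite -cE cob in co.
have half : 0 < (2^-1 : R) < 1 by rewrite invr_gt0 ltr0n /= invf_lt1 ?ltr0n // ltr1n.
have [c [co [M bM]]] : exists c, c \in ob /\ bounded c.
  apply: contrapT => /forallNP H.
  (* A label outside [ob]; with M = 4 n the bound would read 1/2 <= 1/4. *)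
  have [w wo] : exists w : Om, w \notin ob by have [m mo] := @nat_notin Qb ob; exists m%:R.
  have := big (4 * n)%N w [::] [::]; rewrite muln_gt0 /= n0 => /(_ isT).
  move=> /(_ (fun wob => False_ind _ (negP wo wob))) /(_ _ _ half).
  rewrite (negbTE wo) add0r natrM => H'; have : 1 - 2^-1 <= n%:R / (4 * n%:R) :> R.
    by apply: H' => c co _ bc; apply: (H c).
  rewrite invfM mulrCA mulfV ?gt_eqF // mulr1; lra.
have [T un] := bounded_univ bM.
exists (gc c); split; first exact: (univ_conj un).
move=> s s' sE x; apply: contrapT => ne.
have b1 : c \in ob -> fam (gc c) [:: x] [:: 1%g; toQ s] /\ (0 < size [:: 1%g; toQ s])%N.
  move=> _; split=> //; split.
    move=> h; rewrite !inE => /orP [/eqP ->|/eqP ->]; first exact: V1.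
    by split; [exact: fixK_toQ|rewrite -sE; exact: fix2_to2].
  move=> [|i] [|[|j]] //=; rewrite ?andbF // => _; rewrite invg1 mul1g => -[r [r' [rE rE' rx]]].
  apply: ne; rewrite -(toQ_inj rE) rx ?inE //; congr (lchar_val _ _); apply: to2_inj.
  by rewrite rE'.
have b2 c' : c' \in ob -> c' != c -> ~ bounded c'.
  move=> co' nc' [M' bM']; have [T' un'] := bounded_univ bM'.
  move/eqP: nc'; apply; have /e'P := univ_uniq un un'.
  rewrite (@gal_mulE Qb) (gcP c' co') => /(congr1 (gc c : Om -> Om)).
  by rewrite (@gal_Kinv Qb) (gcP c co).
(* If x(s) differed from (psi x)(s'), the family 1, s would have length 2 at c, and the bound would
   read 3/4 <= 1/2 + 1/8. *)
have b0 : (0 < 8 * n)%N by rewrite muln_gt0.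
have b3 : 0 < (4^-1 : R) < 1 by rewrite invr_gt0 ltr0n /= invf_lt1 ?ltr0n // ltr1n.
have := big (8 * n)%N c [:: x] [:: 1%g; toQ s] b0 b1 b2 4^-1 b3.
rewrite co /= natrM invfM mulrCA mulfV ?gt_eqF // mulr1; lra.
Qed.

End SameField.

Lemma rmorph_pack (F F' : fieldType) (f : F -> F') : zmod_morphism f -> monoid_morphism f ->
  exists g : {rmorphism F -> F'}, g =1 f.
Proof.
move=> zm mm; pose A := GRing.isZmodMorphism.Build F F' f zm.
pose B := GRing.isMonoidMorphism.Build F F' f mm.
by pose m : {rmorphism F -> F'} := HB.pack f A B; exists m.
Qed.

Section ComposeIso.
Context (K1 K2 K3 : fieldType) (Kb1 : alg_closure K1) (Kb2 : alg_closure K2) (Kb3 : alg_closure K3)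
  (i : closure_iso Kb1 Kb2) (j : closure_iso Kb2 Kb3).
Lemma ci_comp_SE a : (ci_S j \o ci_S i) (ac_emb Kb1 a) = ac_emb Kb3 ((ci_sg j \o ci_sg i) a).
Proof. by rewrite /= !ci_SE. Qed.
Definition ci_comp : closure_iso Kb1 Kb3 :=
  ClosureIso (can_comp (ci_sgK j) (ci_sgK i)) (can_comp (ci_sgK' i) (ci_sgK' j))
    (can_comp (ci_SK j) (ci_SK i)) (can_comp (ci_SK' i) (ci_SK' j)) ci_comp_SE.
End ComposeIso.

(** * Character isomorphisms induced by field isomorphisms *)

Section Classification.
Context (R : realType) (l : nat) (l_pr : prime l) (K K' : fieldExtType rat)
  (Kb : alg_closure K) (Kb' : alg_closure K').
Local Notation ctrl := (@trl R l l_pr K K' Kb Kb').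

(** Two extensions of the same field isomorphism differ by an element k of the Galois group of K,
    and characters do not see conjugation by k. *)
Lemma trl_sg (i1 i2 : closure_iso Kb Kb') x : ci_sg i1 =1 ci_sg i2 -> ctrl i1 x = ctrl i2 x.
Proof.
move=> E; apply: val_inj; apply: dchar_eq => u.
rewrite -[LHS]/(x (trg (ci_inv i1) u)) -[RHS]/(x (trg (ci_inv i2) u)).
have b : bijective (ci_S' i2 \o ci_S i1).
  by exists (ci_S' i1 \o ci_S i2) => z; rewrite /= ?ci_SK' ?ci_SK // ci_SK' ci_SK.
have f a : (ci_S' i2 \o ci_S i1) (ac_emb Kb a) = ac_emb Kb a.
  by rewrite /= ci_SE ci_SE' E ci_sgK.
pose k : absgal Kb := @AbsGal K Kb (ci_S' i2 \o ci_S i1) b f.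
have -> : trg (ci_inv i1) u = (k^-1 * trg (ci_inv i2) u * k)%g.
  apply: (mulgI k); rewrite !mulgA mulgV mul1g; apply: absgal_eq => z.
  by rewrite /= !ci_SK'.
rewrite !dc_mulM dcharV mulrAC mulVf ?mul1r //; exact: dc_neq0.
Qed.

(** The two extensions differ by an automorphism h of the closure. If h moved K, [kummer_sep] would
    give a character on which the two transports differ. *)
Lemma trl_inj (i1 i2 : closure_iso Kb Kb') : (forall x, ctrl i1 x = ctrl i2 x) ->
  ci_sg i1 =1 ci_sg i2.
Proof.
move=> E.
have b : bijective (ci_S' i2 \o ci_S i1).
  by exists (ci_S' i1 \o ci_S i2) => z; rewrite /= ?ci_SK' ?ci_SK // ci_SK' ci_SK.
pose h : absgal (Qbar Kb) := @mkgal (Qbar Kb) (ci_S' i2 \o ci_S i1) b.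
have fh : fixK h.
  apply: contrapT => nf; have [x [s [s' [_ sE]]]] := @kummer_sep R K Kb l l_pr h 0 nf; apply.
  have E1 : x (trg (ci_inv i1) (trg i2 s)) = x (trg (ci_inv i2) (trg i2 s)) :=
    congr1 (fun y : lchar R Kb' l => y (trg i2 s)) (E x).
  rewrite trgK in E1; rewrite -E1.
  congr (lchar_val x _); apply: toQ_inj; rewrite sE; apply: (mulgI h).
  by rewrite !mulgA mulgV mul1g; apply: absgal_eq => z; rewrite /= ci_SK' ci_SK.
move=> a; apply: (fmorph_inj (ac_emb Kb')); rewrite -!ci_SE.
by have /(congr1 (ci_S i2)) := fh a; rewrite /= ci_SK'.
Qed.

Lemma iso_of_density (psi : lchar_iso R Kb Kb' l) (S : set (primes_of K)) :
  dirichlet_density S (1 : R) ->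
  (forall Z : seq (lchar R Kb l), exists P0 : nat, forall P : primes_of K,
     S P -> dg1 P -> (P0 < rchar (val P))%N ->
     exists P' : primes_of K', prime_norm P' = prime_norm P /\
       forall x, x \in Z -> char_at x P = char_at (psi x) P') ->
  exists i : closure_iso Kb Kb', forall x, psi x = ctrl i x.
Proof.
move=> dS W.
(* An isomorphism of the two closures over Q moves K' into [Kb], and psi is composed with the
   transport along it so that [core] applies. *)
have [f fE] := @closure_hom rat Kb' Kb (ac_emb (Qbar Kb')) (ac_emb (Qbar Kb)) (@ac_alg _ (Qbar Kb')).
have [f0 fK fK'] := closure_hom_bij fE (@ac_alg _ (Qbar Kb)).
have [f' f'E] := rmorph_pack (can2_zmod_morphism fK fK') (can2_monoid_morphism fK fK').
have c1 : cancel f f' by move=> z; rewrite f'E fK.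
have c2 : cancel f' f by move=> z; rewrite f'E fK'.
have [e2 e2E] : exists e2 : {rmorphism K' -> ac_field Kb}, forall a, f (ac_emb Kb' a) = e2 a.
  by exists (f \o ac_emb Kb').
have alg2 z : algebraicOver e2 z.
  have [q q0 rq] := ac_alg (f' z); exists q => //.
  have -> : map_poly e2 q = map_poly f (map_poly (ac_emb Kb') q).
    by rewrite -map_poly_comp; apply: eq_map_poly => a /=; rewrite e2E.
  by rewrite -[z]c2; exact: rmorph_root.
pose Kc := AlgClosure alg2.
pose j : closure_iso Kb' Kc := @ClosureIso K' K' Kb' Kc idfun idfun f f'
  (fun=> erefl) (fun=> erefl) c1 c2 e2E.
pose p2 (x : lchar R Kb l) : lchar R Kc l := trl l_pr j (psi x).
have p2M : {morph p2 : x y / (x * y)%g} by move=> x y; rewrite /p2 gmulfM trlM.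
pose A := isMultiplicative.Build (lchar R Kb l) (lchar R Kc l) p2 p2M.
pose p2m : {multiplicative lchar R Kb l -> lchar R Kc l} := HB.pack p2 A.
have p2b : bijective p2m.
  by apply: (bij_comp (f := trl l_pr j)); [exact: Bijective (trlK l_pr j) (trlK' l_pr j)|exact: lci_bij].
pose psi2 : lchar_iso R Kb Kc l := @LCharIso R K K' Kb Kc l p2m p2b.
have [|g [gK gx]] := @core R l l_pr K K' Kb e2 alg2 psi2 S dS.
  move=> Z; have [P0 H] := W Z; exists P0 => P SP d1 Pp.
  have [P' [NE PE]] := H P SP d1 Pp; exists (trp j P'); split; first by rewrite trp_norm.
  by move=> x xZ; rewrite PE // -(tr_char_at l_pr j).
(* By [gK] and Galois theory g^-1 maps K onto the copy of K'; its restriction is the field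
   isomorphism. *)
have exs a : exists a', (g^-1)%g (ac_emb Kb a) = e2 a'.
  apply: (@fixK_rel K' Kc) => k fk.
  have : fixK (g * cv k * g^-1)%g.
    apply/gK; rewrite !mulgA mulVg mul1g mulgVK; exact: fk.
  move=> /(_ a) /(congr1 (g^-1)%g).
  have -> : (g * cv k * g^-1)%g (ac_emb Kb a) = g (k ((g^-1)%g (ac_emb Kb a))) by [].
  by rewrite (@gal_invK (Qbar Kb)).
have exs' a' : exists a, g (e2 a') = ac_emb Kb a.
  apply: fixK_rel => h fh; have /gK := fh => /(_ a') /(congr1 (g : Kb -> Kb)).
  have -> : (g^-1 * h * g)%g (e2 a') = (g^-1)%g (h (g (e2 a'))) by [].
  by rewrite (@gal_Kinv (Qbar Kb)).
have [sg sgP] := boolp.choice exs; have [sg' sgP'] := boolp.choice exs'.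
have i2 := fmorph_inj e2; have i1 := fmorph_inj (ac_emb Kb).
have [gi giE] : exists gi : {rmorphism Kb -> Kb}, forall a, gi (ac_emb Kb a) = e2 (sg a).
  by exists (gal_fun (g^-1)%g).
have [gg ggE] : exists gg : {rmorphism Kb -> Kb}, forall a, gg (e2 a) = ac_emb Kb (sg' a).
  by exists (gal_fun g).
have zm : zmod_morphism sg.
  by move=> a b; apply: i2; rewrite -giE rmorphB (rmorphB gi) !giE rmorphB.
have mm : monoid_morphism sg.
  split=> [|a b]; apply: i2; rewrite -giE; first by rewrite !rmorph1.
  by rewrite rmorphM (rmorphM gi) !giE rmorphM.
have zm' : zmod_morphism sg'.
  by move=> a b; apply: i1; rewrite -ggE rmorphB (rmorphB gg) !ggE rmorphB.
have mm' : monoid_morphism sg'.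
  split=> [|a b]; apply: i1; rewrite -ggE; first by rewrite !rmorph1.
  by rewrite rmorphM (rmorphM gg) !ggE rmorphM.
have [s1 s1E] := rmorph_pack zm mm; have [s2 s2E] := rmorph_pack zm' mm'.
have k1 : cancel s1 s2.
  by move=> a; apply: i1; rewrite s2E -sgP' s1E -sgP (@gal_Kinv (Qbar Kb)).
have k2 : cancel s2 s1.
  by move=> a; apply: i2; rewrite s1E -sgP s2E -sgP' (@gal_invK (Qbar Kb)).
have k3 : cancel (g^-1)%g g by exact: (@gal_Kinv (Qbar Kb)).
have k4 : cancel g (g^-1)%g by exact: (@gal_invK (Qbar Kb)).
have SE a : (g^-1)%g (ac_emb Kb a) = ac_emb Kc (s1 a) by rewrite s1E sgP.
pose i0 : closure_iso Kb Kc := @ClosureIso K K' Kb Kc s1 s2 (gal_fun (g^-1)%g) (gal_fun g) k1 k2 k3 k4 SE.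
have E0 x : psi2 x = trl l_pr i0 x.
  apply: val_inj; apply: dchar_eq => u; rewrite -[RHS]/(x (trg (ci_inv i0) u)); apply/esym/gx.
  apply: absgal_eq => z.
  rewrite -[RHS]/((g^-1)%g (g (u ((g^-1)%g (g z))))).
  by rewrite !(@gal_invK (Qbar Kb)).
exists (ci_comp i0 (ci_inv j)) => x.
rewrite -[psi x](trlK l_pr j) -[trl l_pr j (psi x)]/(psi2 x) E0.
by apply: val_inj; apply: dchar_eq => u; rewrite /=; congr (dc_fun x _); apply: absgal_eq.
Qed.

Lemma lchar_iso_eq (psi1 psi2 : lchar_iso R Kb Kb' l) : psi1 =1 psi2 -> psi1 = psi2.
Proof.
case: psi1 psi2 => [[f [[cf]]] bf] [[g [[cg]]] bg] /= /funext efg.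
case: g / efg cg bg => cg bg; rewrite (Prop_irrelevance cf cg) in bf *.
by congr LCharIso; exact: Prop_irrelevance.
Qed.

Lemma field_iso_eq (f1 f2 : field_iso K K') : sval f1 =1 sval f2 -> f1 = f2.
Proof.
case: f1 f2 => [[f [[a] [b]]] bf] [[g [[a'] [b']]] bg] /= /funext efg.
case: g / efg a' b' bg => a' b' bg.
rewrite (Prop_irrelevance a a') (Prop_irrelevance b b') in bf *.
by congr exist; exact: Prop_irrelevance.
Qed.

Definition pL (psi : lchar_iso R Kb Kb' l) := forall (x : lchar R Kb l) (s : R[i]),
  1 < complex.Re s -> Lseries x s = Lseries (psi x) s.
Definition pP (psi : lchar_iso R Kb Kb' l) := exists phi : primes_of K -> primes_of K',
      [/\ bijective phi, (forall p, prime_norm (phi p) = prime_norm p) &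
          forall (x : lchar R Kb l) p, char_at x p = char_at (psi x) (phi p)].
Definition pD (psi : lchar_iso R Kb Kb' l) := exists (S : set (primes_of K)) (phi : S -> primes_of K'),
      [/\ dirichlet_density S (1 : R), injective phi,
          (forall p : S, prime_norm (phi p) = prime_norm (val p)) &
          forall (p : S) (x : lchar R Kb l), char_at x (val p) = char_at (psi x) (phi p)].

Lemma pPL psi : pP psi -> pL psi.
Proof.
move=> [phi [bphi nE cE]] x s s1; rewrite /Lseries; congr (lim (_ @ \oo)).
apply/funext => n; have [phi' phiK phiK'] := bphi.
rewrite [RHS](@reindex_fsbig _ _ _ _ _ phi [set p : primes_of K | (prime_norm p <= n)%N]).
  by apply: eq_fsbigr => p _; rewrite cE nE.
split.
- by move=> p /=; rewrite nE.
- by move=> p q _ _; exact: (can_inj phiK).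
- by move=> p /= pn; exists (phi' p); rewrite /= ?phiK' // -nE phiK'.
Qed.

Lemma pPD psi : pP psi -> pD psi.
Proof.
move=> [phi [bphi nE cE]]; exists [set: primes_of K], (fun p => phi (val p)); split=> //.
- exact: (@density_setT R K Kb).
- by move=> p q /(bij_inj bphi) /val_inj.
Qed.

Lemma pL_iso psi : pL psi -> exists i : closure_iso Kb Kb', forall x, psi x = ctrl i x.
Proof.
move=> Leq; apply: (@iso_of_density psi [set: primes_of K] (@density_setT R K Kb)) => Z.
by have [P0 H] := Lseries_match l_pr Leq Z; exists P0 => P _; exact: H.
Qed.

Lemma pD_iso psi : pD psi -> exists i : closure_iso Kb Kb', forall x, psi x = ctrl i x.
Proof.
move=> [S [phi [dS _ nE cE]]]; apply: (iso_of_density dS) => Z; exists 0%N => P SP _ _.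
pose p : S := exist _ P (mem_set SP); exists (phi p); split; first exact: nE.
by move=> x _; exact: (cE p).
Qed.

Lemma iso_pP (psi : lchar_iso R Kb Kb' l) (i : closure_iso Kb Kb') : (forall x, psi x = ctrl i x) -> pP psi.
Proof.
move=> E; exists (trp i); split; first exact: Bijective (trpK i) (trpK' i).
  exact: trp_norm.
by move=> x p; rewrite E tr_char_at.
Qed.
End Classification.

Lemma sig_eq (T : Type) (P : T -> Prop) (u v : {x | P x}) : sval u = sval v -> u = v.
Proof. by case: u v => [x px] [y py] /= E; case: y / E py => py; congr exist; exact: Prop_irrelevance. Qed.

Theorem theorem3p2 (R : realType) (K K' : fieldExtType rat)
    (Kbar : alg_closure K) (Kbar' : alg_closure K') (l : nat)
    (l_prime : prime l) :
  exists (Theta3 : iso_Lseries R Kbar Kbar' l -> iso_primes R Kbar Kbar' l)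
         (Theta2 : iso_primes R Kbar Kbar' l -> iso_Lseries R Kbar Kbar' l)
         (Theta1 : iso_primes R Kbar Kbar' l ->
                   iso_primes_density R Kbar Kbar' l)
         (Theta4 : field_iso K K' -> iso_primes R Kbar Kbar' l)
         (Theta5 : iso_primes_density R Kbar Kbar' l -> field_iso K K'),
    [/\ injective Theta1, injective Theta2, injective Theta3,
        injective Theta4 & injective Theta5] /\
    (cancel Theta3 Theta2 /\ cancel Theta2 Theta3) /\
    (cancel (Theta1 \o Theta4) Theta5 /\ cancel Theta5 (Theta1 \o Theta4)) /\
    [/\ exists f : iso_Lseries R Kbar Kbar' l -> iso_primes R Kbar Kbar' l,
          bijective f,
        exists f : iso_primes R Kbar Kbar' l ->
                   iso_primes_density R Kbar Kbar' l, bijective f &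
        exists f : iso_primes_density R Kbar Kbar' l -> field_iso K K',
          bijective f].
Proof.
(* The maps among the three sets of psi keep psi and change only the proof of membership, which
   passes through a field isomorphism where needed; their mutual inverses then hold by [sig_eq]. *)
pose T3 (u : iso_Lseries R Kbar Kbar' l) : iso_primes R Kbar Kbar' l :=
  exist _ (sval u) (let: ex_intro i E := pL_iso l_prime (svalP u) in iso_pP E).
pose T2 (u : iso_primes R Kbar Kbar' l) : iso_Lseries R Kbar Kbar' l :=
  exist _ (sval u) (pPL (svalP u)).
pose T1 (u : iso_primes R Kbar Kbar' l) : iso_primes_density R Kbar Kbar' l :=
  exist _ (sval u) (pPD (svalP u)).
pose T1' (u : iso_primes_density R Kbar Kbar' l) : iso_primes R Kbar Kbar' l :=
  exist _ (sval u) (let: ex_intro i E := pD_iso l_prime (svalP u) in iso_pP E).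
(* An extension to the closures is chosen; by [trl_sg] the induced map on characters depends on f
   alone. *)
pose ext (f : field_iso K K') := sval (cid (closure_iso_ext Kbar Kbar' (svalP f))).
have extP f a : ci_sg (ext f) a = sval f a by exact: (svalP (cid (closure_iso_ext Kbar Kbar' (svalP f)))).
have trE f x : tr_iso R l_prime (ext f) x = trl l_prime (ext f) x by [].
pose T4 (f : field_iso K K') : iso_primes R Kbar Kbar' l :=
  exist _ (tr_iso R l_prime (ext f)) (iso_pP (trE f)).
pose rel (u : iso_primes_density R Kbar Kbar' l) := sval (cid (pD_iso l_prime (svalP u))).
have relP (u : iso_primes_density R Kbar Kbar' l) (x : lchar R Kbar l) : sval u x = trl l_prime (rel u) x by exact: (svalP (cid (pD_iso l_prime (svalP u)))).
pose T5 (u : iso_primes_density R Kbar Kbar' l) : field_iso K K' :=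
  exist _ (ci_sg (rel u)) (Bijective (ci_sgK (rel u)) (ci_sgK' (rel u))).
have c32 : cancel T3 T2 by move=> u; exact: sig_eq.
have c23 : cancel T2 T3 by move=> u; exact: sig_eq.
have c1 : cancel T1 T1' by move=> u; exact: sig_eq.
have c1' : cancel T1' T1 by move=> u; exact: sig_eq.
have c45 : cancel (T1 \o T4) T5.
  move=> f; apply: field_iso_eq => a; rewrite -[RHS]extP /=.
  by apply: (@trl_inj R l l_prime K K' Kbar Kbar') => x; rewrite -relP.
have c54 : cancel T5 (T1 \o T4).
  move=> u; apply/sig_eq/lchar_iso_eq => x.
  rewrite [RHS]relP -[LHS]/(trl l_prime (ext (T5 u)) x).
  by apply: trl_sg => a; rewrite extP.
exists T3, T2, T1, T4, T5; split; first split.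
- exact: can_inj c1.
- exact: can_inj c23.
- exact: can_inj c32.
- by move=> f g E; apply: (can_inj c45); rewrite /= E.
- exact: can_inj c54.
split=> //; split=> //; split.
- by exists T3; exact: Bijective c32 c23.
- by exists T1; exact: Bijective c1 c1'.
- by exists T5; exact: Bijective c54 c45.
Qed.
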